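(* For every $w\in\pi_1=\pi_1(\mathbb{C}\setminus\{-1,1\},0)$ the following inequalities hold: $$\frac{1}{2\pi}\mathcal{L}(w)\le\Lambda({}_{tr}(w)_{pb})\le 300\cdot\mathcal{L}(w),\qquad \frac{1}{2\pi}\mathcal{L}(w)\le\Lambda({}_{pb}(w)_{tr})\le 300\cdot\mathcal{L}(w).$$
   Context: $\pi_1=\pi_1(\mathbb{C}\setminus\{-1,1\},0)$ is free on $a_1$, the class of a loop based at $0$ surrounding $-1$ once in the positive direction, and $a_2$, the class of a loop based at $0$ surrounding $1$ once in the positive direction. Since $(-1,1)$ and $i\mathbb{R}$ are connected, simply connected and contain $0$, each $w\in\pi_1$ determines canonically a homotopy class ${}_{tr}(w)_{pb}$ of curves in $\mathbb{C}\setminus\{-1,1\}$ with initial point in $(-1,1)$ and terminating point in $i\mathbb{R}$ (homotopies keep the endpoints in these sets), and likewise ${}_{pb}(w)_{tr}$ (initial point in $i\mathbb{R}$, terminating point in $(-1,1)$). For a homotopy class $\mathsf h$ of curves with initial point in $E_1$ and terminating point in $E_2$, a map $f$ from an open rectangle $R$ (sides parallel to the axes) continuous on $\bar R$ represents $\mathsf h$ if it maps the open lower side into $E_1$, the open upper side into $E_2$, and its restriction to the closure of every maximal vertical segment of $R$ represents $\mathsf h$. $\Lambda(\mathsf h)$ is the infimum of $\lambda(R)=\mathsf a/\mathsf b$ (vertical side length over horizontal side length) over all rectangles admitting a holomorphic map into $\mathbb{C}\setminus\{-1,1\}$ representing $\mathsf h$. Syllables of a nontrivial reduced word $w=w_1^{n_1}w_2^{n_2}\cdots$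 ($n_j\ne0$, $w_j$ alternately $a_1,a_2$; the $w_j^{n_j}$ are the terms): (1) every term with $|n_j|\ge2$ is a syllable; (2) every maximal sequence of at least two consecutive terms all having the same exponent, equal to $+1$ or to $-1$, is a syllable; (3) every remaining term is a syllable (a singleton). The degree $d_j$ of a syllable is the sum of the absolute values of the exponents of its terms. $\mathcal{L}(w)=\sum_j\log(4d_j-1)$ over all syllables; $\mathcal{L}(\text{identity})=0$. *)

(* Defs.v *)
From Stdlib Require Import Reals ZArith List.
From Coquelicot Require Import Coquelicot.
Import ListNotations.
Local Open Scope R_scope.

Notation CC := Complex.C.

Definition Xdom (z : CC) : Prop := z <> (-1, 0) /\ z <> (1, 0).

Definition E_tr (z : CC) : Prop := -1 < fst z < 1 /\ snd z = 0.

Definition E_pb (z : CC) : Prop := fst z = 0.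

Definition cont_on (D : CC -> Prop) (f : CC -> CC) : Prop :=
  forall z, D z -> forall eps, 0 < eps -> exists delta, 0 < delta /\
    forall z', D z' -> Cmod (Cminus z' z) < delta -> Cmod (Cminus (f z') (f z)) < eps.

Definition C_differentiable_at (f : CC -> CC) (z : CC) : Prop :=
  exists l : CC, forall eps, 0 < eps -> exists delta, 0 < delta /\
    forall h : CC, 0 < Cmod h < delta ->
      Cmod (Cminus (Cminus (f (Cplus z h)) (f z)) (Cmult l h)) <= eps * Cmod h.

Definition unit_square (p : CC) : Prop := 0 <= fst p <= 1 /\ 0 <= snd p <= 1.

(* curves are maps [0,1] -> C (values outside [0,1] are irrelevant).
   g1 and g2 are homotopic in C\{-1,1} through curves with initial point
   in E1 and terminating point in E2. *)
Definition homotopic_rel (E1 E2 : CC -> Prop) (g1 g2 : R -> CC) : Prop :=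
  exists H : CC -> CC,
    cont_on unit_square H /\
    (forall p, unit_square p -> Xdom (H p)) /\
    (forall s, 0 <= s <= 1 -> H (0, s) = g1 s /\ H (1, s) = g2 s) /\
    (forall u, 0 <= u <= 1 -> E1 (H (u, 0)) /\ E2 (H (u, 1))).

Record hclass := HClass { hc_E1 : CC -> Prop; hc_E2 : CC -> Prop; hc_ref : R -> CC }.

Definition in_class (h : hclass) (g : R -> CC) : Prop :=
  homotopic_rel (hc_E1 h) (hc_E2 h) g (hc_ref h).

(* A word is a list of terms (generator, exponent); generator false = a1,
   true = a2.  Elements of pi_1 correspond bijectively to reduced words. *)
Definition word := list (bool * Z).

Fixpoint alternating (w : word) : Prop :=
  match w with
  | [] => True
  | (g, _) :: r =>
      match r with
      | [] => True
      | (g', _) :: _ => g <> g' /\ alternating r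
      end
  end.

Definition reduced (w : word) : Prop :=
  (forall t, In t w -> snd t <> 0%Z) /\ alternating w.

(* the loop representing the term g^n, parametrized by [0,1]:
   a1^n : t |-> -1 + e^{2 pi i n t}      (circle around -1 through 0, positive direction)
   a2^n : t |->  1 - e^{2 pi i n t}      (circle around  1 through 0, positive direction) *)
Definition term_loop (t : bool * Z) (s : R) : CC :=
  let n := IZR (snd t) in
  if fst t
  then (1 - cos (2 * PI * n * s), - sin (2 * PI * n * s))
  else (-1 + cos (2 * PI * n * s), sin (2 * PI * n * s)).

Fixpoint word_loop (w : word) : R -> CC :=
  match w with
  | [] => fun _ => (0, 0)
  | t :: r => fun s => if Rle_dec s (/2) then term_loop t (2 * s)
                       else word_loop r (2 * s - 1)
  end.

Definition tr_pb (w : word) : hclass := HClass E_tr E_pb (word_loop w).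
Definition pb_tr (w : word) : hclass := HClass E_pb E_tr (word_loop w).

Definition holo_represents (h : hclass) (x0 x1 y0 y1 : R) (f : CC -> CC) : Prop :=
  let Ropen := fun z : CC => x0 < fst z < x1 /\ y0 < snd z < y1 in
  let Rclosed := fun z : CC => x0 <= fst z <= x1 /\ y0 <= snd z <= y1 in
  (forall z, Ropen z -> C_differentiable_at f z) /\
  (forall z, Ropen z -> Xdom (f z)) /\
  cont_on Rclosed f /\
  (forall x, x0 < x < x1 -> hc_E1 h (f (x, y0))) /\
  (forall x, x0 < x < x1 -> hc_E2 h (f (x, y1))) /\
  (forall x, x0 < x < x1 ->
     in_class h (fun s => f (x, y0 + s * (y1 - y0)))).

(* Lambda(h) = inf of (vertical side)/(horizontal side) over admissible rectangles
   (inf of the empty set is +oo). *)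
Definition Lambda (h : hclass) : Rbar :=
  Glb_Rbar (fun l => exists x0 x1 y0 y1 (f : CC -> CC),
     x0 < x1 /\ y0 < y1 /\ holo_represents h x0 x1 y0 y1 f /\
     l = (y1 - y0) / (x1 - x0)).

Fixpoint runs (l : list Z) : list (Z * nat) :=
  match l with
  | [] => []
  | n :: r =>
      match runs r with
      | (m, k) :: rs => if Z.eqb n m then (m, S k) :: rs else (n, 1%nat) :: (m, k) :: rs
      | [] => [(n, 1%nat)]
      end
  end.

(* Contribution of a block of k consecutive terms all with exponent n:
   - if |n| >= 2, each of the k terms is a syllable of degree |n|;
   - if n = +-1, the block is one syllable of degree k (a run of rule (2) if
     k >= 2, a singleton of rule (3) if k = 1). *)
Definition run_contribution (p : Z * nat) : R :=
  let (n, k) := p in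
  if Z.leb 2 (Z.abs n)
  then INR k * ln (4 * IZR (Z.abs n) - 1)
  else ln (4 * INR k - 1).

Definition Lw (w : word) : R :=
  fold_right Rplus 0 (map run_contribution (runs (map snd w))).

(* Main.v *)
(* The modular function F = 1 - 2 lambda realizes C \ {-1, 1} as the quotient of the upper
   half-plane by Gamma(2). It maps the geodesic I = i R+ into (-1, 1) and the unit semicircle J
   into i R, and a word w corresponds to a matrix W = [[p, q], [r, s]] in Gamma(2). A map
   representing tr(w)pb lifts through F to a map of the rectangle into the half-plane that sends
   the horizontal sides into I and W J. These geodesics have distance d = arccosh |N| with
   N = q s - p r, and in the logarithmic coordinate along their common perpendicular the
   half-plane becomes a strip of height PI in which I and W J lie on vertical lines at distance
   d. Integrating the derivative of the lift over the rectangle gives d / PI as a lower bound of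
   the extremal length; composing F with an affine map onto a rectangle of height 2 in the strip
   gives d / 2 as an upper bound. A recursion over the exponents of w shows
   L(w) <= 2 ln |N| and ln (2 |N|) <= 5 L(w). For pb(w)tr one uses the inverse word.
   The lift in the lower bound comes from quotients of elliptic periods; for the upper bound, F is
   built from Eisenstein series of weight 4. *)
Require Import Defs.
From Stdlib Require Import Reals ZArith List Lra Lia ClassicalEpsilon.
From Coquelicot Require Import Coquelicot.
Import ListNotations.
Local Open Scope R_scope.

(** * Continuity and complex differentiability *)

(** The two bounds use the modular covering in opposite directions, and the two constructions are
    never identified with each other. The lower bound needs only a branch of the inverse that
    continues along every map of a rectangle, is determined up to Gamma(2), and is known on (-1, 1)
    and on the imaginary axis: discreteness of Gamma(2) makes the continuation unique, and a local
    section at every point makes it exist. The upper bound needs only that F is holomorphic on the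
    half-plane, omits -1 and 1, has the right invariance and symmetries, and maps a path from i to W
    i to the loop of w up to homotopy. The main obstacle there is that F has no poles, that is, the
    non-vanishing of [s01 + s10]; it is carried over from the half-plane Im t >= 5/6 by the modular
    group. The constants: the lower bound is ln |N| / PI >= L / (2 PI); the upper one is d / 2 <= ln
    (2 |N|) / 2 <= 5 L / 2, well inside 300 L. *)

Ltac Ceq := apply injective_projections; simpl; try ring.

Lemma Cmod_sq (z : C) : Cmod z * Cmod z = fst z * fst z + snd z * snd z.
Proof. pose proof (Cmod2_alt z) as E. unfold Re, Im in E. nra. Qed.

Lemma Cmod_le_sq (z : C) (r : R) :
  0 <= r -> fst z * fst z + snd z * snd z <= r * r -> Cmod z <= r.
Proof. intros Hr E. rewrite <- Cmod_sq in E. pose proof (Cmod_ge_0 z). nra. Qed.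

Lemma Cmod_ge_sq (z : C) (r : R) :
  r * r <= fst z * fst z + snd z * snd z -> r <= Cmod z.
Proof. intros E. rewrite <- Cmod_sq in E. pose proof (Cmod_ge_0 z). nra. Qed.

Lemma Cmod_Ci : Cmod Ci = 1.
Proof. apply Rle_antisym; [apply Cmod_le_sq; simpl; lra|apply Cmod_ge_sq; simpl; lra]. Qed.

Lemma fst_le_Cmod (z : C) : Rabs (fst z) <= Cmod z.
Proof. apply (re_le_Cmod z). Qed.

Lemma snd_le_Cmod (z : C) : Rabs (snd z) <= Cmod z.
Proof. eapply Rle_trans; [apply Rmax_r|apply (Rmax_Cmod z)]. Qed.

Lemma Cmod_le_abs (z : C) : Cmod z <= Rabs (fst z) + Rabs (snd z).
Proof.
  pose proof (Rabs_pos (fst z)); pose proof (Rabs_pos (snd z)).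
  apply Cmod_le_sq; [lra|].
  pose proof (Rsqr_abs (fst z)); pose proof (Rsqr_abs (snd z)).
  unfold Rsqr in *. nra.
Qed.

Lemma Cmod_swap (x y : C) : Cmod (x - y) = Cmod (y - x).
Proof. rewrite <- Cmod_opp. f_equal. ring. Qed.

Lemma Cmod_tri (x y z : C) : Cmod (x - z) <= Cmod (x - y) + Cmod (y - z).
Proof. replace (x - z)%C with ((x - y) + (y - z))%C by ring. apply Cmod_triangle. Qed.

Lemma Cmod_rev (x y : C) : Cmod x - Cmod y <= Cmod (x - y).
Proof.
  pose proof (Cmod_triangle (x - y) y). replace (x - y + y)%C with x in H by ring. lra.
Qed.

Lemma Cmod_minus_le (x y : C) : Cmod (x - y) <= Cmod x + Cmod y.
Proof. unfold Cminus. rewrite <- (Cmod_opp y). apply Cmod_triangle. Qed.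

Lemma Cmod_RtoC_mult (a : R) (z : C) : Cmod (RtoC a * z) = Rabs a * Cmod z.
Proof. rewrite Cmod_mult, Cmod_R. reflexivity. Qed.

Definition dC (z w : C) : R := Cmod (z - w).
Definition dR (x y : R) : R := Rabs (x - y).

(** The distance and the domain are parameters, so that one set of rules serves curves on R,
    functions on C and functions restricted to a rectangle. For [dC] and a point of [D] this unfolds
    to the condition in [cont_on]. *)
Definition ctat {X : Type} (d : X -> X -> R) (D : X -> Prop) (f : X -> C) (x : X) : Prop :=
  forall eps, 0 < eps -> exists delta, 0 < delta /\
    forall x', D x' -> d x' x < delta -> Cmod (f x' - f x) < eps.

Section Ctat.
Context {X : Type} (d : X -> X -> R) (D : X -> Prop).

Lemma ctat_const (c : C) (x : X) : ctat d D (fun _ => c) x.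
Proof.
  intros e He. exists 1. split; [lra|]. intros.
  replace (c - c)%C with (RtoC 0) by ring. now rewrite Cmod_0.
Qed.

Lemma ctat_plus (f g : X -> C) (x : X) :
  ctat d D f x -> ctat d D g x -> ctat d D (fun y => f y + g y)%C x.
Proof.
  intros F G e He.
  destruct (F (e/2)) as (d1 & H1 & F1); [lra|]. destruct (G (e/2)) as (d2 & H2 & G2); [lra|].
  exists (Rmin d1 d2). split; [now apply Rmin_glb_lt|]. intros y Dy L.
  assert (L1 := Rlt_le_trans _ _ _ L (Rmin_l _ _)).
  assert (L2 := Rlt_le_trans _ _ _ L (Rmin_r _ _)).
  replace (f y + g y - (f x + g x))%C with ((f y - f x) + (g y - g x))%C by ring.
  pose proof (Cmod_triangle (f y - f x) (g y - g x)).
  specialize (F1 y Dy L1). specialize (G2 y Dy L2). lra.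
Qed.

Lemma ctat_bounded (f : X -> C) (x : X) :
  ctat d D f x -> exists delta, 0 < delta /\
    forall y, D y -> d y x < delta -> Cmod (f y) <= Cmod (f x) + 1.
Proof.
  intros F. destruct (F 1) as (dl & H & F1); [lra|]. exists dl. split; [easy|].
  intros y Dy L. specialize (F1 y Dy L). pose proof (Cmod_rev (f y) (f x)). lra.
Qed.

Lemma ctat_mult (f g : X -> C) (x : X) :
  ctat d D f x -> ctat d D g x -> ctat d D (fun y => f y * g y)%C x.
Proof.
  intros F G e He.
  destruct (ctat_bounded f x F) as (d0 & H0 & F0).
  pose proof (Cmod_ge_0 (f x)) as Pf. pose proof (Cmod_ge_0 (g x)) as Pg.
  set (M := Cmod (f x) + Cmod (g x) + 1). assert (HM : 0 < M) by (unfold M; lra).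
  assert (HE : 0 < e / (2 * M)) by (apply Rdiv_lt_0_compat; lra).
  destruct (F _ HE) as (d1 & H1 & F1). destruct (G _ HE) as (d2 & H2 & G2).
  exists (Rmin d0 (Rmin d1 d2)). split; [now repeat apply Rmin_glb_lt|]. intros y Dy L.
  assert (L0 := Rlt_le_trans _ _ _ L (Rmin_l _ _)).
  assert (L' := Rlt_le_trans _ _ _ L (Rmin_r _ _)).
  assert (L1 := Rlt_le_trans _ _ _ L' (Rmin_l _ _)).
  assert (L2 := Rlt_le_trans _ _ _ L' (Rmin_r _ _)).
  specialize (F0 y Dy L0). specialize (F1 y Dy L1). specialize (G2 y Dy L2).
  replace (f y * g y - f x * g x)%C with (f y * (g y - g x) + g x * (f y - f x))%C by ring.
  eapply Rle_lt_trans; [apply Cmod_triangle|]. rewrite !Cmod_mult.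
  assert (Cmod (f y) * Cmod (g y - g x) <= M * Cmod (g y - g x))
    by (apply Rmult_le_compat_r; [apply Cmod_ge_0|unfold M; lra]).
  assert (Cmod (g x) * Cmod (f y - f x) <= M * Cmod (f y - f x))
    by (apply Rmult_le_compat_r; [apply Cmod_ge_0|unfold M; lra]).
  assert (M * Cmod (g y - g x) < M * (e / (2 * M))) by (apply Rmult_lt_compat_l; lra).
  assert (M * Cmod (f y - f x) < M * (e / (2 * M))) by (apply Rmult_lt_compat_l; lra).
  replace (M * (e / (2 * M))) with (e / 2) in * by (field; lra). lra.
Qed.

Lemma ctat_opp (f : X -> C) (x : X) :
  ctat d D f x -> ctat d D (fun y => - f y)%C x.
Proof.
  intros F e He. destruct (F e He) as (dl & H & F1). exists dl. split; [easy|].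
  intros y Dy L. specialize (F1 y Dy L).
  replace (- f y - - f x)%C with (- (f y - f x))%C by ring. now rewrite Cmod_opp.
Qed.

Lemma ctat_minus (f g : X -> C) (x : X) :
  ctat d D f x -> ctat d D g x -> ctat d D (fun y => f y - g y)%C x.
Proof. intros F G. apply ctat_plus; [easy|now apply ctat_opp]. Qed.

Lemma ctat_nonzero (f : X -> C) (x : X) :
  ctat d D f x -> f x <> RtoC 0 -> exists delta, 0 < delta /\
    forall y, D y -> d y x < delta -> Cmod (f x) / 2 < Cmod (f y).
Proof.
  intros F Hx. apply Cmod_gt_0 in Hx.
  destruct (F (Cmod (f x) / 2)) as (dl & H & F1); [lra|]. exists dl. split; [easy|].
  intros y Dy L. specialize (F1 y Dy L). rewrite Cmod_swap in F1.
  pose proof (Cmod_rev (f x) (f y)). lra.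
Qed.

Lemma ctat_inv (f : X -> C) (x : X) :
  ctat d D f x -> f x <> RtoC 0 -> ctat d D (fun y => / f y)%C x.
Proof.
  intros F Hx e He. destruct (ctat_nonzero f x F Hx) as (d0 & H0 & F0).
  assert (Hm := proj1 (Cmod_gt_0 _) Hx). set (m := Cmod (f x)) in *.
  destruct (F (e * (m * m) / 2)) as (d1 & H1 & F1); [apply Rdiv_lt_0_compat; [repeat apply Rmult_lt_0_compat; easy|lra]|].
  exists (Rmin d0 d1). split; [now apply Rmin_glb_lt|]. intros y Dy L.
  assert (L0 := Rlt_le_trans _ _ _ L (Rmin_l _ _)).
  assert (L1 := Rlt_le_trans _ _ _ L (Rmin_r _ _)).
  specialize (F0 y Dy L0). specialize (F1 y Dy L1). fold m in F0.
  assert (Hy : f y <> RtoC 0) by (apply Cmod_gt_0; lra).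
  replace (/ f y - / f x)%C with (- (f y - f x) * / (f y * f x))%C by (field; repeat split; auto).
  rewrite Cmod_mult, Cmod_opp, Cmod_inv, Cmod_mult by (now apply Cmult_neq_0). fold m.
  assert (HP : 0 < Cmod (f y) * m) by (apply Rmult_lt_0_compat; lra).
  apply Rmult_lt_reg_r with (Cmod (f y) * m); [easy|].
  rewrite Rmult_assoc, Rinv_l by lra.
  assert (e * m * (m / 2) <= e * m * Cmod (f y)) by (apply Rmult_le_compat_l; nra). nra.
Qed.

Lemma ctat_div (f g : X -> C) (x : X) :
  ctat d D f x -> ctat d D g x -> g x <> RtoC 0 -> ctat d D (fun y => f y / g y)%C x.
Proof. intros F G H. apply ctat_mult; [easy|now apply ctat_inv]. Qed.

Lemma ctat_comp (E : C -> Prop) (f : X -> C) (g : C -> C) (x : X) :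
  ctat d D f x -> ctat dC E g (f x) -> (forall y, D y -> E (f y)) ->
  ctat d D (fun y => g (f y)) x.
Proof.
  intros F G H e He. destruct (G e He) as (d1 & H1 & G1). destruct (F d1 H1) as (d2 & H2 & F2).
  exists d2. split; [easy|]. intros y Dy L. apply G1; [auto|now apply F2].
Qed.

Lemma ctat_comp_T (f : X -> C) (g : C -> C) (x : X) :
  ctat d D f x -> ctat dC (fun _ => True) g (f x) -> ctat d D (fun y => g (f y)) x.
Proof. intros F G. now apply (ctat_comp (fun _ => True)). Qed.

Lemma ctat_subset (D' : X -> Prop) (f : X -> C) (x : X) :
  ctat d D f x -> (forall y, D' y -> D y) -> ctat d D' f x.
Proof.
  intros F H e He. destruct (F e He) as (dl & H1 & F1). exists dl. split; auto.
Qed.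

Lemma ctat_ext (f g : X -> C) (x : X) :
  (forall y, D y -> f y = g y) -> D x -> ctat d D f x -> ctat d D g x.
Proof.
  intros E Dx F e He. destruct (F e He) as (dl & H & F1). exists dl. split; [easy|].
  intros y Dy L. rewrite <- !E; auto.
Qed.

Lemma ctat_ext_loc (f g : X -> C) (x : X) (r : R) :
  0 < r -> (forall y, D y -> d y x < r -> f y = g y) -> f x = g x -> ctat d D f x -> ctat d D g x.
Proof.
  intros Hr E Ex F e He. destruct (F e He) as (dl & H & F1). exists (Rmin r dl).
  split; [now apply Rmin_glb_lt|].
  intros y Dy L. rewrite <- Ex, <- E; auto. 2: exact (Rlt_le_trans _ _ _ L (Rmin_l _ _)).
  apply F1; auto. exact (Rlt_le_trans _ _ _ L (Rmin_r _ _)).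
Qed.
End Ctat.

Lemma ctat_id (D : C -> Prop) (z : C) : ctat dC D (fun w => w) z.
Proof. intros e He. now exists e. Qed.

Lemma ctat_pre {X Y : Type} (d : X -> X -> R) (d' : Y -> Y -> R) (D : X -> Prop) (E : Y -> Prop)
  (k : X -> Y) (f : Y -> C) (x : X) (K : R) :
  0 < K -> (forall y, D y -> d' (k y) (k x) <= K * d y x) -> (forall y, D y -> E (k y)) ->
  ctat d' E f (k x) -> ctat d D (fun y => f (k y)) x.
Proof.
  intros HK L H F e He. destruct (F e He) as (dl & H1 & F1).
  exists (dl / K). split; [now apply Rdiv_lt_0_compat|].
  intros y Dy Ly. apply F1; auto. eapply Rle_lt_trans; [now apply L|].
  apply Rmult_lt_compat_l with (r := K) in Ly; [|easy].
  replace (K * (dl / K)) with dl in Ly by (field; lra). easy.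
Qed.

(* Holomorphy at a point in Caratheodory form, which makes the calculus rules
   consequences of those for continuity. *)
Definition hol (f : C -> C) (z : C) : Prop :=
  exists phi r, 0 < r /\ ctat dC (fun _ => True) phi z /\
    forall w, Cmod (w - z) < r -> (f w - f z = phi w * (w - z))%C.

Lemma hol_iff (f : C -> C) (z : C) : C_differentiable_at f z <-> hol f z.
Proof.
  split.
  - intros (l & Hl).
    exists (fun w => if excluded_middle_informative (w = z) then l else (f w - f z) / (w - z))%C, 1.
    split; [lra|]. split.
    + intros e He. destruct (Hl (e / 2)) as (dl & Hd & Hb); [lra|]. exists dl. split; [easy|].
      intros w _ L. unfold dC in L. destruct (excluded_middle_informative (z = z)); [|easy].
      destruct (excluded_middle_informative (w = z)) as [E|E].
      * replace (l - l)%C with (RtoC 0) by ring. now rewrite Cmod_0.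
      * assert (N : (w - z <> RtoC 0)%C) by now apply Cminus_eq_contra.
        assert (P := proj1 (Cmod_gt_0 _) N).
        specialize (Hb (w - z)%C (conj P L)).
        replace (z + (w - z))%C with w in Hb by ring.
        replace ((f w - f z) / (w - z) - l)%C with ((f w - f z - l * (w - z)) / (w - z))%C
          by (field; easy).
        rewrite Cmod_div by easy. apply Rlt_div_l; [easy|]. nra.
    + intros w _. destruct (excluded_middle_informative (w = z)) as [->|E]; [ring|].
      field. now apply Cminus_eq_contra.
  - intros (phi & r & Hr & Hc & He). exists (phi z). intros eps Heps.
    destruct (Hc eps Heps) as (dl & Hd & Hb). exists (Rmin r dl).
    split; [now apply Rmin_glb_lt|]. intros h [H0 H1].
    assert (L0 := Rlt_le_trans _ _ _ H1 (Rmin_l _ _)).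
    assert (L1 := Rlt_le_trans _ _ _ H1 (Rmin_r _ _)).
    assert (Eh : (z + h - z = h)%C) by ring.
    rewrite (He (z + h)%C) by now rewrite Eh. rewrite Eh.
    replace (phi (z + h) * h - phi z * h)%C with ((phi (z + h) - phi z) * h)%C by ring.
    rewrite Cmod_mult. apply Rmult_le_compat_r; [lra|]. left. apply Hb; [easy|].
    unfold dC. now rewrite Eh.
Qed.

Lemma hol_ct (f : C -> C) (z : C) : hol f z -> ctat dC (fun _ => True) f z.
Proof.
  intros (phi & r & Hr & Hc & He).
  apply ctat_ext_loc with (f := fun w => (f z + phi w * (w - z))%C) (r := r); [easy| | |].
  - intros y _ L. rewrite <- He by easy. ring.
  - ring.
  - apply ctat_plus; [apply ctat_const|]. apply ctat_mult; [easy|].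
    apply ctat_minus; [apply ctat_id|apply ctat_const].
Qed.

Lemma hol_ext (f g : C -> C) (z : C) (r : R) :
  0 < r -> (forall w, Cmod (w - z) < r -> f w = g w) -> hol f z -> hol g z.
Proof.
  intros Hr E (phi & r' & Hr' & Hc & He). exists phi, (Rmin r r').
  split; [now apply Rmin_glb_lt|]. split; [easy|]. intros w L.
  assert (L0 := Rlt_le_trans _ _ _ L (Rmin_l _ _)).
  assert (L1 := Rlt_le_trans _ _ _ L (Rmin_r _ _)).
  rewrite <- !E; auto. replace (z - z)%C with (RtoC 0) by ring. now rewrite Cmod_0.
Qed.

Lemma hol_const (c z : C) : hol (fun _ => c) z.
Proof.
  exists (fun _ => RtoC 0), 1. split; [lra|]. split; [apply ctat_const|]. intros. ring.
Qed.

Lemma hol_id (z : C) : hol (fun w => w) z.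
Proof.
  exists (fun _ => RtoC 1), 1. split; [lra|]. split; [apply ctat_const|]. intros. ring.
Qed.

Lemma hol_plus (f g : C -> C) (z : C) : hol f z -> hol g z -> hol (fun w => f w + g w)%C z.
Proof.
  intros (p & r & Hr & Hc & He) (p' & r' & Hr' & Hc' & He').
  exists (fun w => p w + p' w)%C, (Rmin r r'). split; [now apply Rmin_glb_lt|].
  split; [now apply ctat_plus|]. intros w L.
  assert (L0 := Rlt_le_trans _ _ _ L (Rmin_l _ _)).
  assert (L1 := Rlt_le_trans _ _ _ L (Rmin_r _ _)).
  specialize (He w L0). specialize (He' w L1).
  transitivity ((f w - f z) + (g w - g z))%C; [ring|]. rewrite He, He'. ring.
Qed.

Lemma hol_mult (f g : C -> C) (z : C) : hol f z -> hol g z -> hol (fun w => f w * g w)%C z.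
Proof.
  intros F G. assert (Gc := hol_ct _ _ G).
  destruct F as (p & r & Hr & Hc & He). destruct G as (p' & r' & Hr' & Hc' & He').
  exists (fun w => p w * g w + f z * p' w)%C, (Rmin r r'). split; [now apply Rmin_glb_lt|].
  split; [apply ctat_plus; apply ctat_mult; auto; apply ctat_const|]. intros w L.
  assert (L0 := Rlt_le_trans _ _ _ L (Rmin_l _ _)).
  assert (L1 := Rlt_le_trans _ _ _ L (Rmin_r _ _)).
  specialize (He w L0). specialize (He' w L1).
  transitivity ((f w - f z) * g w + f z * (g w - g z))%C; [ring|]. rewrite He, He'. ring.
Qed.

Lemma hol_opp (f : C -> C) (z : C) : hol f z -> hol (fun w => - f w)%C z.
Proof.
  intros F. apply hol_ext with (f := fun w => (RtoC (-1) * f w)%C) (r := 1); [lra| |].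
  - intros. Ceq.
  - apply hol_mult; [apply hol_const|easy].
Qed.

Lemma hol_minus (f g : C -> C) (z : C) : hol f z -> hol g z -> hol (fun w => f w - g w)%C z.
Proof. intros F G. apply hol_plus; [easy|now apply hol_opp]. Qed.

Lemma hol_inv (f : C -> C) (z : C) : hol f z -> f z <> RtoC 0 -> hol (fun w => / f w)%C z.
Proof.
  intros F Hz. assert (Fc := hol_ct _ _ F).
  destruct (ctat_nonzero _ _ _ _ Fc Hz) as (d0 & H0 & F0).
  destruct F as (p & r & Hr & Hc & He).
  exists (fun w => - p w * / (f w * f z))%C, (Rmin r d0). split; [now apply Rmin_glb_lt|].
  split.
  - apply ctat_mult; [now apply ctat_opp|]. apply ctat_inv.
    + apply ctat_mult; [easy|apply ctat_const].
    + now apply Cmult_neq_0.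
  - intros w L.
    assert (L0 := Rlt_le_trans _ _ _ L (Rmin_l _ _)).
    assert (L1 := Rlt_le_trans _ _ _ L (Rmin_r _ _)).
    specialize (He w L0). specialize (F0 w I L1).
    assert (Nw : f w <> RtoC 0) by (apply Cmod_gt_0; pose proof (Cmod_ge_0 (f z)); lra).
    transitivity (- (f w - f z) * / (f w * f z))%C; [field; repeat split; auto|]. rewrite He. ring.
Qed.

Lemma hol_div (f g : C -> C) (z : C) :
  hol f z -> hol g z -> g z <> RtoC 0 -> hol (fun w => f w / g w)%C z.
Proof. intros F G H. apply hol_mult; [easy|now apply hol_inv]. Qed.

Lemma hol_comp (f g : C -> C) (z : C) : hol f z -> hol g (f z) -> hol (fun w => g (f w)) z.
Proof.
  intros F G. assert (Fc := hol_ct _ _ F).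
  destruct F as (p & r & Hr & Hc & He). destruct G as (p' & r' & Hr' & Hc' & He').
  destruct (Fc r' Hr') as (d0 & H0 & F0).
  exists (fun w => p' (f w) * p w)%C, (Rmin r d0). split; [now apply Rmin_glb_lt|].
  split; [apply ctat_mult; [now apply ctat_comp_T|easy]|]. intros w L.
  assert (L0 := Rlt_le_trans _ _ _ L (Rmin_l _ _)).
  assert (L1 := Rlt_le_trans _ _ _ L (Rmin_r _ _)).
  rewrite He' by now apply F0. rewrite He by easy. ring.
Qed.

(** A quadratic remainder with explicit constants survives integration and summation. Holomorphy of
    the exponential, of inverse roots, of parameter integrals and of series is obtained through this
    criterion. *)
Lemma hol_quad (f : C -> C) (z l : C) (r K : R) :
  0 < r -> (forall w, Cmod (w - z) < r ->
     Cmod (f w - f z - l * (w - z)) <= K * (Cmod (w - z) * Cmod (w - z))) -> hol f z.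
Proof.
  intros Hr H. apply hol_iff. exists l. intros e He.
  assert (HK : 0 < Rabs K + 1) by (pose proof (Rabs_pos K); lra).
  exists (Rmin r (e / (Rabs K + 1))).
  split; [apply Rmin_glb_lt; [easy|now apply Rdiv_lt_0_compat]|].
  intros h [H0 H1].
  assert (L0 := Rlt_le_trans _ _ _ H1 (Rmin_l _ _)).
  assert (L1 := Rlt_le_trans _ _ _ H1 (Rmin_r _ _)).
  assert (Eh : (z + h - z = h)%C) by ring.
  specialize (H (z + h)%C). rewrite Eh in H. specialize (H L0).
  eapply Rle_trans; [exact H|]. rewrite <- Rmult_assoc. apply Rmult_le_compat_r; [lra|].
  apply Rlt_div_r in L1; [|easy]. pose proof (Rle_abs K). nra.
Qed.

(** * Goursat's theorem *)

Lemma continuous_eps (f : R -> R) (x : R) :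
  (forall eps, 0 < eps -> exists delta, 0 < delta /\
     forall y, Rabs (y - x) < delta -> Rabs (f y - f x) < eps) -> continuous f x.
Proof.
  intros H. apply filterlim_locally. intros e. destruct (H e (cond_pos e)) as (dl & Hd & Hb).
  exists (mkposreal dl Hd). intros y Hy. apply Hb. exact Hy.
Qed.

Lemma ctat_continuous_fst (g : R -> C) (x : R) :
  ctat dR (fun _ => True) g x -> continuous (fun t => fst (g t)) x.
Proof.
  intros H. apply continuous_eps. intros e He. destruct (H e He) as (dl & Hd & Hb).
  exists dl. split; [easy|]. intros y Hy. eapply Rle_lt_trans; [|apply (Hb y I Hy)].
  apply (fst_le_Cmod (g y - g x)).
Qed.

Lemma ctat_continuous_snd (g : R -> C) (x : R) :
  ctat dR (fun _ => True) g x -> continuous (fun t => snd (g t)) x.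
Proof.
  intros H. apply continuous_eps. intros e He. destruct (H e He) as (dl & Hd & Hb).
  exists dl. split; [easy|]. intros y Hy. eapply Rle_lt_trans; [|apply (Hb y I Hy)].
  apply (snd_le_Cmod (g y - g x)).
Qed.

Lemma dC_hor (x x' y : R) : dC (x', y) (x, y) <= 1 * dR x' x.
Proof.
  unfold dC, dR. eapply Rle_trans; [apply Cmod_le_abs|]. simpl.
  replace (y + - y) with 0 by ring. rewrite Rabs_R0. unfold Rminus. lra.
Qed.

Lemma dC_ver (x y y' : R) : dC (x, y') (x, y) <= 1 * dR y' y.
Proof.
  unfold dC, dR. eapply Rle_trans; [apply Cmod_le_abs|]. simpl.
  replace (x + - x) with 0 by ring. rewrite Rabs_R0. unfold Rminus. lra.
Qed.

Lemma ctat_hor (f : C -> C) (x y : R) :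
  ctat dC (fun _ => True) f (x, y) -> ctat dR (fun _ => True) (fun t => f (t, y)) x.
Proof.
  intros H. apply (ctat_pre dR dC (fun _ => True) (fun _ => True) (fun t => (t, y)) f x 1);
    auto; [lra|]. intros. apply dC_hor.
Qed.

Lemma ctat_ver (f : C -> C) (x y : R) :
  ctat dC (fun _ => True) f (x, y) -> ctat dR (fun _ => True) (fun t => f (x, t)) y.
Proof.
  intros H. apply (ctat_pre dR dC (fun _ => True) (fun _ => True) (fun t => (x, t)) f y 1);
    auto; [lra|]. intros. apply dC_ver.
Qed.

Lemma ex_RInt_cont (f : R -> R) (a b : R) :
  a <= b -> (forall x, a <= x <= b -> continuous f x) -> ex_RInt f a b.
Proof.
  intros Hab H. apply (ex_RInt_continuous (V := R_CompleteNormedModule)).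
  intros z Hz. rewrite Rmin_left, Rmax_right in Hz by easy. auto.
Qed.

Lemma RInt_close (f g : R -> R) (a b K : R) :
  a <= b -> ex_RInt f a b -> ex_RInt g a b ->
  (forall x, a <= x <= b -> Rabs (f x - g x) <= K) ->
  Rabs (RInt f a b - RInt g a b) <= K * (b - a).
Proof.
  intros Hab Ef Eg H.
  rewrite <- (RInt_minus f g a b Ef Eg : RInt (fun y => f y - g y) a b = RInt f a b - RInt g a b).
  apply (norm_RInt_le (V := R_NormedModule) (fun y => f y - g y) (fun _ => K) a b _ (K * (b - a)) Hab).
  - exact H.
  - apply (RInt_correct (V := R_CompleteNormedModule)). now apply (ex_RInt_minus (V := R_NormedModule)).
  - replace (K * (b - a)) with (scal (b - a) K) by (unfold scal; simpl; unfold mult; simpl; ring).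
    apply (is_RInt_const (V := R_NormedModule)).
Qed.

Lemma RInt_lin (A B a b : R) : is_RInt (fun x => A + B * x) a b (A * (b - a) + B * (b * b - a * a) / 2).
Proof.
  replace (A * (b - a) + B * (b * b - a * a) / 2)
    with (minus (A * b + B * b * b / 2) (A * a + B * a * a / 2))
    by (unfold minus, plus, opp; simpl; field).
  apply (is_RInt_derive (V := R_CompleteNormedModule) (fun x => A * x + B * x * x / 2)).
  - intros x _. auto_derive; [easy|]. field.
  - intros x _. apply (continuous_plus (V := R_NormedModule)); [apply continuous_const|].
    apply (continuous_scal_r (K := R_AbsRing) (V := R_NormedModule) B (fun t => t)).
    apply continuous_id.
Qed.

(** Bisection as an induction principle: a failing rectangle has a failing quarter, and the nested
    quarters shrink to a point where the local hypothesis contradicts the failure. It serves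
    Goursat's theorem, the existence and uniqueness of lifts and a uniform continuity statement;
    with [c = d] it is bisection of an interval. *)
Lemma nested_rectangles (P : R -> R -> R -> R -> Prop) (a b c d : R) :
  a <= b -> c <= d ->
  (forall a' b' c' d', a <= a' -> a' <= b' -> b' <= b -> c <= c' -> c' <= d' -> d' <= d ->
     P a' ((a' + b') / 2) c' ((c' + d') / 2) -> P ((a' + b') / 2) b' c' ((c' + d') / 2) ->
     P a' ((a' + b') / 2) ((c' + d') / 2) d' -> P ((a' + b') / 2) b' ((c' + d') / 2) d' ->
     P a' b' c' d') ->
  (forall x y, a <= x <= b -> c <= y <= d -> exists delta, 0 < delta /\
     forall a' b' c' d', a <= a' <= x -> x <= b' <= b -> c <= c' <= y -> y <= d' <= d ->
       b' - a' < delta -> d' - c' < delta -> P a' b' c' d') ->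
  P a b c d.
Proof.
  intros Hab Hcd Hq Hl. apply NNPP. intros HN.
  set (Bad := fun q : (R * R) * (R * R) =>
    a <= fst (fst q) /\ fst (fst q) <= snd (fst q) /\ snd (fst q) <= b /\
    c <= fst (snd q) /\ fst (snd q) <= snd (snd q) /\ snd (snd q) <= d /\
    ~ P (fst (fst q)) (snd (fst q)) (fst (snd q)) (snd (snd q))).
  set (Sub := fun p q : (R * R) * (R * R) =>
    fst (fst p) <= fst (fst q) /\ snd (fst q) <= snd (fst p) /\
    fst (snd p) <= fst (snd q) /\ snd (snd q) <= snd (snd p) /\
    snd (fst q) - fst (fst q) = (snd (fst p) - fst (fst p)) / 2 /\
    snd (snd q) - fst (snd q) = (snd (snd p) - fst (snd p)) / 2).
  (* The implication stands inside the existential, so that choice yields a total successor function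
     [nxt]. *)
  assert (step : forall p, exists q, Bad p -> Bad q /\ Sub p q).
  { intros [[a' b'] [c' d']]. apply NNPP. intros HE.
    assert (HB : forall q, ~ Bad q \/ ~ Sub ((a', b'), (c', d')) q).
    { intros q. apply not_and_or. intros HH. apply HE. exists q. easy. }
    assert (HB0 : Bad ((a', b'), (c', d'))).
    { apply NNPP. intros N. apply HE. now exists ((a', b'), (c', d')). }
    unfold Bad, Sub in *. simpl in *. destruct HB0 as (H1 & H2 & H3 & H4 & H5 & H6 & H7).
    apply H7. set (m := (a' + b') / 2) in *. set (n := (c' + d') / 2) in *.
    assert (a' <= m <= b') by (unfold m; lra). assert (c' <= n <= d') by (unfold n; lra).
    apply Hq; auto; apply NNPP; intros N.
    - destruct (HB ((a', m), (c', n))) as [X|X]; apply X; simpl; repeat split; unfold m, n in *; lra || easy.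
    - destruct (HB ((m, b'), (c', n))) as [X|X]; apply X; simpl; repeat split; unfold m, n in *; lra || easy.
    - destruct (HB ((a', m), (n, d'))) as [X|X]; apply X; simpl; repeat split; unfold m, n in *; lra || easy.
    - destruct (HB ((m, b'), (n, d'))) as [X|X]; apply X; simpl; repeat split; unfold m, n in *; lra || easy. }
  set (nxt := fun p => proj1_sig (constructive_indefinite_description _ (step p))).
  assert (Hn : forall p, Bad p -> Bad (nxt p) /\ Sub p (nxt p)).
  { intros p. unfold nxt. destruct (constructive_indefinite_description _ (step p)). easy. }
  set (q := fix q (n : nat) := match n with O => ((a, b), (c, d)) | S n => nxt (q n) end).
  assert (HBad : forall n, Bad (q n)).
  { induction n; [unfold Bad; simpl; repeat split; lra || easy|]. now apply Hn. }
  assert (Hmono : forall n k,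
    fst (fst (q n)) <= fst (fst (q (n + k)%nat)) /\ snd (fst (q (n + k)%nat)) <= snd (fst (q n)) /\
    fst (snd (q n)) <= fst (snd (q (n + k)%nat)) /\ snd (snd (q (n + k)%nat)) <= snd (snd (q n))).
  { intros n k. induction k as [|k IH]; [rewrite Nat.add_0_r; lra|].
    rewrite Nat.add_succ_r. destruct (Hn _ (HBad (n + k)%nat)) as [_ S1]. unfold Sub in S1.
    simpl. destruct IH as (?&?&?&?). destruct S1 as (?&?&?&?&_). repeat split; lra. }
  assert (Hwid : forall n, snd (fst (q n)) - fst (fst (q n)) = (b - a) * (/ 2) ^ n /\
                           snd (snd (q n)) - fst (snd (q n)) = (d - c) * (/ 2) ^ n).
  { induction n as [|n [I1 I2]]; [simpl; lra|].
    destruct (Hn _ (HBad n)) as [_ (_&_&_&_&S1&S2)]. simpl. rewrite S1, S2, I1, I2. lra. }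
  assert (Hle : forall n m, fst (fst (q n)) <= snd (fst (q m)) /\ fst (snd (q n)) <= snd (snd (q m))).
  { intros n m. destruct (Hmono n m) as (A1&A2&A3&A4). destruct (Hmono m n) as (B1&B2&B3&B4).
    rewrite (Nat.add_comm m n) in *. destruct (HBad (n + m)%nat) as (_&C1&_&_&C2&_). lra. }
  destruct (completeness (fun x => exists n, x = fst (fst (q n)))) as (x & Hx1 & Hx2).
  { exists (snd (fst (q 0%nat))). intros x [n ->]. apply Hle. }
  { now exists (fst (fst (q 0%nat))), 0%nat. }
  destruct (completeness (fun x => exists n, x = fst (snd (q n)))) as (y & Hy1 & Hy2).
  { exists (snd (snd (q 0%nat))). intros y [n ->]. apply Hle. }
  { now exists (fst (snd (q 0%nat))), 0%nat. }
  assert (Hx : forall n, fst (fst (q n)) <= x <= snd (fst (q n))).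
  { intros n. split; [apply Hx1; now exists n|]. apply Hx2. intros t [m ->]. apply Hle. }
  assert (Hy : forall n, fst (snd (q n)) <= y <= snd (snd (q n))).
  { intros n. split; [apply Hy1; now exists n|]. apply Hy2. intros t [m ->]. apply Hle. }
  destruct (Hl x y (Hx 0%nat) (Hy 0%nat)) as (dl & Hd & Hb).
  destruct (pow_lt_1_zero (/ 2) ltac:(rewrite Rabs_right; lra) (dl / (b - a + (d - c) + 1)))
    as (N & HN1); [apply Rdiv_lt_0_compat; lra|].
  specialize (HN1 N (le_n N)). rewrite Rabs_right in HN1 by (apply Rle_ge, pow_le; lra).
  apply Rlt_div_r in HN1; [|lra].
  assert (Hp : 0 < (/ 2) ^ N) by (apply pow_lt; lra).
  destruct (HBad N) as (B1&B2&B3&B4&B5&B6&B7). destruct (Hwid N) as [W1 W2].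
  destruct (Hx N); destruct (Hy N). apply B7. apply Hb; try lra; nra.
Qed.

(** The real part of the integral of f dz around the rectangle, counterclockwise. The imaginary part
    is the same expression for -i f. *)
Definition circ (f : C -> C) (a b c d : R) : R :=
  RInt (fun x => fst (f (x, c))) a b - RInt (fun y => snd (f (b, y))) c d
  - RInt (fun x => fst (f (x, d))) a b + RInt (fun y => snd (f (a, y))) c d.

Theorem goursat (f : C -> C) (a b c d : R) :
  a <= b -> c <= d ->
  (forall z : C, a <= fst z <= b -> c <= snd z <= d -> hol f z) ->
  circ f a b c d = 0.
Proof.
  intros Hab Hcd Hf.
  assert (Eh : forall a' b' y, a <= a' -> a' <= b' -> b' <= b -> c <= y <= d ->
    ex_RInt (fun x => fst (f (x, y))) a' b').
  { intros. apply ex_RInt_cont; [easy|]. intros x Hx. apply ctat_continuous_fst.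
    apply (ctat_hor f x y). apply hol_ct, Hf; simpl; lra. }
  assert (Ev : forall c' d' x, c <= c' -> c' <= d' -> d' <= d -> a <= x <= b ->
    ex_RInt (fun y => snd (f (x, y))) c' d').
  { intros. apply ex_RInt_cont; [easy|]. intros y Hy. apply ctat_continuous_snd.
    apply (ctat_ver f x y). apply hol_ct, Hf; simpl; lra. }
  (* The bound is proportional to the square of the half-perimeter, hence additive under division
     into four equal quarters and therefore provable by bisection. *)
  assert (Main : forall e, 0 < e -> Rabs (circ f a b c d) <= e * ((b - a + (d - c)) * (b - a + (d - c)))).
  2:{ destruct (Req_dec (circ f a b c d) 0) as [|N]; [easy|exfalso].
      apply Rabs_pos_lt in N. set (K := (b - a + (d - c)) * (b - a + (d - c))) in *.
      assert (HK : 0 <= K) by (unfold K; nra).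
      specialize (Main (Rabs (circ f a b c d) / (2 * (K + 1)))).
      assert (H0 : 0 < Rabs (circ f a b c d) / (2 * (K + 1))) by (apply Rdiv_lt_0_compat; lra).
      specialize (Main H0). revert Main. apply Rlt_not_le.
      set (X := Rabs (circ f a b c d)) in *.
      replace (X / (2 * (K + 1)) * K) with (X * (K / (2 * (K + 1)))) by (field; lra).
      rewrite <- (Rmult_1_r X) at 2. apply Rmult_lt_compat_l; [easy|].
      apply Rlt_div_l; lra. }
  intros e He.
  apply (nested_rectangles (fun a b c d =>
    Rabs (circ f a b c d) <= e * ((b - a + (d - c)) * (b - a + (d - c)))) a b c d Hab Hcd).
  - intros a' b' c' d' H1 H2 H3 H4 H5 H6 Q1 Q2 Q3 Q4.
    set (m := (a' + b') / 2) in *. set (n := (c' + d') / 2) in *.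
    assert (Hm : a' <= m <= b') by (unfold m; lra). assert (Hn : c' <= n <= d') by (unfold n; lra).
    assert (E : circ f a' b' c' d' = circ f a' m c' n + circ f m b' c' n + circ f a' m n d' + circ f m b' n d').
    { unfold circ.
      rewrite <- (RInt_Chasles (V := R_CompleteNormedModule) (fun x => fst (f (x, c'))) a' m b') by (apply Eh; lra).
      rewrite <- (RInt_Chasles (V := R_CompleteNormedModule) (fun x => fst (f (x, d'))) a' m b') by (apply Eh; lra).
      rewrite <- (RInt_Chasles (V := R_CompleteNormedModule) (fun y => snd (f (a', y))) c' n d') by (apply Ev; lra).
      rewrite <- (RInt_Chasles (V := R_CompleteNormedModule) (fun y => snd (f (b', y))) c' n d') by (apply Ev; lra).
      unfold plus; simpl. ring. }
    rewrite E. eapply Rle_trans; [apply Rabs_triang|].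
    eapply Rle_trans; [apply Rplus_le_compat_r, Rabs_triang|].
    eapply Rle_trans; [apply Rplus_le_compat_r, Rplus_le_compat_r, Rabs_triang|].
    replace (m - a') with ((b' - a') / 2) in * by (unfold m; field).
    replace (b' - m) with ((b' - a') / 2) in * by (unfold m; field).
    replace (n - c') with ((d' - c') / 2) in * by (unfold n; field).
    replace (d' - n) with ((d' - c') / 2) in * by (unfold n; field).
    replace ((b' - a' + (d' - c')) * (b' - a' + (d' - c'))) with
      (4 * (((b' - a') / 2 + (d' - c') / 2) * ((b' - a') / 2 + (d' - c') / 2))) by field.
    lra.
  - intros x y Hx Hy. destruct (Hf (x, y) Hx Hy) as (phi & r & Hr & Hc & Hphi).
    destruct (Hc (e / 2)) as (dl & Hd & Hb); [lra|]. set (l := phi (x, y)) in *.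
    set (c0 := f (x, y)) in *.
    exists (Rmin r dl / 2). assert (HM : 0 < Rmin r dl) by now apply Rmin_glb_lt.
    split; [lra|]. intros a' b' c' d' H1 H2 H3 H4 H5 H6.
    set (W := b' - a' + (d' - c')).
    assert (Hcl : forall s t, a' <= s <= b' -> c' <= t <= d' ->
      Cmod (f (s, t) - (c0 + l * ((s, t) - (x, y)))) <= e / 2 * W).
    { intros s t Hs Ht. assert (Lz : Cmod ((s, t) - (x, y)) <= W).
      { eapply Rle_trans; [apply Cmod_le_abs|]. simpl.
        apply Rplus_le_compat; apply Rabs_le; lra. }
      assert (LW : W < Rmin r dl) by (unfold W; lra).
      pose proof (Rmin_l r dl); pose proof (Rmin_r r dl).
      replace (f (s, t) - (c0 + l * ((s, t) - (x, y))))%C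
        with ((f (s, t) - c0) - l * ((s, t) - (x, y)))%C by ring.
      unfold c0. rewrite Hphi by lra.
      replace (phi (s, t) * ((s, t) - (x, y)) - l * ((s, t) - (x, y)))%C
        with ((phi (s, t) - l) * ((s, t) - (x, y)))%C by ring.
      rewrite Cmod_mult. apply Rmult_le_compat; [apply Cmod_ge_0..| |easy].
      left. apply Hb; [easy|]. unfold dC. lra. }
    (* [A t + fst l * s] and [B s + fst l * t] are the real and imaginary parts of the affine
       approximation of [f] at (s, t). Their boundary integrals cancel, and only the errors of the
       approximation remain. *)
    set (A := fun t => fst c0 - fst l * x - snd l * (t - y)).
    set (B := fun s => snd c0 - snd l * (- (s - x)) - fst l * y).
    assert (Jh : forall t, c' <= t <= d' ->
      Rabs (RInt (fun s => fst (f (s, t))) a' b' - (A t * (b' - a') + fst l * (b' * b' - a' * a') / 2))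
        <= e / 2 * W * (b' - a')).
    { intros t Ht. rewrite <- (is_RInt_unique _ _ _ _ (RInt_lin (A t) (fst l) a' b')).
      apply RInt_close; [lra|apply Eh; lra|eexists; apply RInt_lin|].
      intros s Hs. eapply Rle_trans; [|apply (Hcl s t Hs Ht)].
      eapply Rle_trans; [|apply fst_le_Cmod]. apply Req_le. f_equal. simpl. unfold A. ring. }
    assert (Jv : forall s, a' <= s <= b' ->
      Rabs (RInt (fun t => snd (f (s, t))) c' d' - (B s * (d' - c') + fst l * (d' * d' - c' * c') / 2))
        <= e / 2 * W * (d' - c')).
    { intros s Hs. rewrite <- (is_RInt_unique _ _ _ _ (RInt_lin (B s) (fst l) c' d')).
      apply RInt_close; [lra|apply Ev; lra|eexists; apply RInt_lin|].
      intros t Ht. eapply Rle_trans; [|apply (Hcl s t Hs Ht)].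
      eapply Rle_trans; [|apply snd_le_Cmod]. apply Req_le. f_equal. simpl. unfold B. ring. }
    pose proof (Jh c' ltac:(lra)) as J1. pose proof (Jh d' ltac:(lra)) as J2.
    pose proof (Jv a' ltac:(lra)) as J3. pose proof (Jv b' ltac:(lra)) as J4.
    unfold circ. unfold A, B in *.
    apply Rabs_le_between in J1; apply Rabs_le_between in J2;
    apply Rabs_le_between in J3; apply Rabs_le_between in J4.
    assert (EW : e * (W * W) = 2 * (e / 2 * W * (b' - a')) + 2 * (e / 2 * W * (d' - c')))
      by (unfold W; field).
    rewrite EW. apply Rabs_le. split; nra.
Qed.

(** * Exponential, square root, integrals with a parameter *)

Definition cexp (z : C) : C := (exp (fst z) * cos (snd z), exp (fst z) * sin (snd z)).

Lemma cexp_plus (z w : C) : cexp (z + w) = (cexp z * cexp w)%C.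
Proof.
  unfold cexp. Ceq; rewrite exp_plus, ?cos_plus, ?sin_plus; ring.
Qed.

Lemma cexp_0 : cexp (RtoC 0) = RtoC 1.
Proof. unfold cexp. Ceq; rewrite exp_0, ?cos_0, ?sin_0; ring. Qed.

Lemma Cmod_cexp (z : C) : Cmod (cexp z) = exp (fst z).
Proof.
  pose proof (exp_pos (fst z)). apply Rle_antisym.
  - apply Cmod_le_sq; [lra|]. simpl. pose proof (sin2_cos2 (snd z)) as S. unfold Rsqr in S. nra.
  - apply Cmod_ge_sq. simpl. pose proof (sin2_cos2 (snd z)) as S. unfold Rsqr in S. nra.
Qed.

Lemma cexp_neq_0 (z : C) : cexp z <> RtoC 0.
Proof. apply Cmod_gt_0. rewrite Cmod_cexp. apply exp_pos. Qed.

Lemma cexp_opp (z : C) : cexp (- z) = (/ cexp z)%C.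
Proof.
  assert (E : (cexp (- z) * cexp z)%C = RtoC 1).
  { rewrite <- cexp_plus. replace (- z + z)%C with (RtoC 0) by ring. apply cexp_0. }
  pose proof (cexp_neq_0 z).
  transitivity (cexp (- z) * cexp z * / cexp z)%C; [field; easy|]. rewrite E. ring.
Qed.

Lemma exp_quad (x : R) : Rabs x <= / 2 -> Rabs (exp x - 1 - x) <= 2 * (x * x).
Proof.
  intros H. apply Rabs_le_between in H. pose proof (exp_ineq1_le x).
  pose proof (exp_ineq1_le (- x)) as H2. rewrite exp_Ropp in H2. pose proof (exp_pos x) as Hp.
  assert (E : exp x * (1 + - x) <= 1).
  { apply Rmult_le_compat_l with (r := exp x) in H2; [|lra]. rewrite Rinv_r in H2; lra. }
  rewrite Rabs_right by lra. nra.
Qed.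

Lemma one_minus_cos (y : R) : 0 <= 1 - cos y <= y * y / 2.
Proof.
  pose proof (COS_bound y). split; [lra|].
  replace y with (2 * (y / 2)) at 1 by field. rewrite cos_2a_sin.
  assert (Rabs (sin (y / 2)) <= Rabs (y / 2)).
  { destruct (Rle_dec 0 (y / 2)) as [P|P].
    - destruct (Req_dec (y / 2) 0) as [->|N]; [rewrite sin_0; lra|].
      assert (sin (y / 2) < y / 2) by (apply sin_lt_x; lra).
      assert (- (y / 2) < sin (y / 2)).
      { destruct (Rle_dec (y / 2) PI); [pose proof (sin_ge_0 (y / 2) ltac:(lra) ltac:(lra)); lra|].
        pose proof (SIN_bound (y / 2)). pose proof PI2_3_2. lra. }
      rewrite (Rabs_right (y / 2)) by lra. apply Rabs_le; lra.
    - assert (- sin (y / 2) < - (y / 2)) by (rewrite <- sin_neg; apply sin_lt_x; lra).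
      assert (y / 2 < - sin (y / 2)).
      { rewrite <- sin_neg.
        destruct (Rle_dec (- (y / 2)) PI); [pose proof (sin_ge_0 (- (y / 2)) ltac:(lra) ltac:(lra)); lra|].
        pose proof (SIN_bound (- (y / 2))). pose proof PI2_3_2. lra. }
      rewrite (Rabs_left (y / 2)) by lra. apply Rabs_le; lra. }
  assert (sin (y / 2) * sin (y / 2) <= y / 2 * (y / 2)).
  { pose proof (Rsqr_le_abs_1 _ _ H0) as Q. unfold Rsqr in Q. exact Q. }
  lra.
Qed.

Lemma sin_quad (y : R) : Rabs y <= / 2 -> Rabs (sin y - y) <= y * y.
Proof.
  intros H.
  destruct (MVT_gen (fun t => sin t - t) 0 y (fun t => cos t - 1)) as (c & Hc & E).
  - intros. auto_derive; [easy|]. ring.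
  - intros. apply continuity_pt_minus; [apply continuity_sin|apply continuity_pt_id].
  - rewrite sin_0 in E. replace (sin y - y) with ((cos c - 1) * (y - 0)) by lra.
    rewrite Rabs_mult. pose proof (one_minus_cos c) as O.
    assert (Rabs c <= Rabs y).
    { unfold Rmin, Rmax in Hc. destruct (Rle_dec 0 y); unfold Rabs; repeat destruct Rcase_abs; lra. }
    rewrite (Rabs_left1 (cos c - 1)) by lra. rewrite Rminus_0_r.
    assert (c * c <= y * y).
    { pose proof (Rsqr_le_abs_1 _ _ H0) as Q. unfold Rsqr in Q. exact Q. }
    pose proof (Rabs_pos y). assert (y * y = Rabs y * Rabs y) by (pose proof (Rsqr_abs y); easy). nra.
Qed.

Lemma cexp_quad (h : C) : Cmod h <= / 2 -> Cmod (cexp h - RtoC 1 - h) <= 8 * (Cmod h * Cmod h).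
Proof.
  destruct h as [x y]. intros H. pose proof (Cmod_sq (x, y)) as E. simpl in E. rewrite E.
  pose proof (fst_le_Cmod (x, y)) as Hx. pose proof (snd_le_Cmod (x, y)) as Hy. simpl in Hx, Hy.
  eapply Rle_trans; [apply Cmod_le_abs|]. unfold cexp. simpl.
  assert (X := exp_quad x ltac:(lra)). assert (Y := sin_quad y ltac:(lra)).
  assert (O := one_minus_cos y). pose proof (COS_bound y). pose proof (SIN_bound y).
  apply Rabs_le_between in X, Y.
  assert (Bx : -(1/2) <= x <= 1/2) by (apply Rabs_le_between; lra).
  assert (By : -(1/2) <= y <= 1/2) by (apply Rabs_le_between; lra).
  assert (P1 : Rabs (exp x * cos y + -(1) + - x) <= 2 * (x * x) + y * y).
  { replace (exp x * cos y + -(1) + - x) with ((exp x - 1 - x) * cos y - (1 + x) * (1 - cos y)) by ring.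
    eapply Rle_trans; [apply Rabs_triang|]. rewrite Rabs_Ropp, !Rabs_mult.
    rewrite (Rabs_right (1 + x)), (Rabs_right (1 - cos y)) by lra.
    assert (Rabs (cos y) <= 1) by (apply Rabs_le; lra).
    assert (Rabs (exp x - 1 - x) <= 2 * (x * x)) by (apply Rabs_le; lra).
    pose proof (Rabs_pos (cos y)); pose proof (Rabs_pos (exp x - 1 - x)). nra. }
  assert (P2 : Rabs (exp x * sin y + - 0 + - y) <= 3 * (x * x) + 3 * (y * y)).
  { replace (exp x * sin y + - 0 + - y) with ((exp x - 1 - x) * sin y + x * sin y + (sin y - y)) by ring.
    assert (S : - (2 * (x * x)) <= (exp x - 1 - x) * sin y <= 2 * (x * x)).
    { apply Rabs_le_between. rewrite Rabs_mult, <- (Rmult_1_r (2 * (x * x))).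
      apply Rmult_le_compat; try apply Rabs_pos; apply Rabs_le; lra. }
    assert (S2 : - (x * x + y * y) <= x * sin y <= x * x + y * y).
    { assert (T : sin y * sin y <= 4 * (y * y)).
      { assert (L : Rabs (sin y) <= Rabs (2 * y)).
        { replace (sin y) with ((sin y - y) + y) by ring. eapply Rle_trans; [apply Rabs_triang|].
          rewrite (Rabs_mult 2), (Rabs_right 2) by lra.
          assert (Rabs (sin y - y) <= Rabs y).
          { eapply Rle_trans; [apply Rabs_le, Y|].
            pose proof (Rsqr_abs y) as Q. unfold Rsqr in Q. rewrite Q. pose proof (Rabs_pos y). nra. }
          lra. }
        apply Rsqr_le_abs_1 in L. unfold Rsqr in L. lra. }
      pose proof (Rle_0_sqr (2 * x + sin y)) as Z1. pose proof (Rle_0_sqr (2 * x - sin y)) as Z2.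
      unfold Rsqr in Z1, Z2. lra. }
    pose proof (Rle_0_sqr x) as Z1. pose proof (Rle_0_sqr y) as Z2. unfold Rsqr in Z1, Z2.
    apply Rabs_le. lra. }
  pose proof (Rle_0_sqr x) as Z1. pose proof (Rle_0_sqr y) as Z2. unfold Rsqr in Z1, Z2. lra.
Qed.

Lemma hol_cexp (z : C) : hol cexp z.
Proof.
  apply (hol_quad cexp z (cexp z) (/ 2) (8 * Cmod (cexp z))); [lra|].
  intros w H. replace (cexp w) with (cexp z * cexp (w - z))%C.
  2:{ rewrite <- cexp_plus. f_equal. ring. }
  replace (cexp z * cexp (w - z) - cexp z - cexp z * (w - z))%C
    with (cexp z * (cexp (w - z) - RtoC 1 - (w - z)))%C by ring.
  rewrite Cmod_mult, (Rmult_comm 8), Rmult_assoc.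
  apply Rmult_le_compat_l; [apply Cmod_ge_0|]. apply cexp_quad. lra.
Qed.

(** * The principal square root *)

(** The plane cut along the non-positive reals. In this form the quantity is also twice the squared
    real part of the principal root, so a lower bound for it keeps the root away from 0. *)
Definition slit (w : C) : Prop := 0 < Cmod w + fst w.

Definition csqrt (w : C) : C :=
  (sqrt ((Cmod w + fst w) / 2), snd w / (2 * sqrt ((Cmod w + fst w) / 2))).

Lemma slit_iff (w : C) : slit w <-> snd w <> 0 \/ 0 < fst w.
Proof.
  unfold slit. pose proof (Cmod_sq w). pose proof (Cmod_ge_0 w). split.
  - intros P. destruct (Req_dec (snd w) 0) as [E|E]; [right|now left]. rewrite E in H.
    destruct (Rle_dec (fst w) 0); nra.
  - intros [P|P]; [|lra]. assert (0 < snd w * snd w) by nra. nra.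
Qed.

Lemma csqrt_re_pos (w : C) : slit w -> 0 < fst (csqrt w).
Proof. intros H. unfold slit in H. simpl. apply sqrt_lt_R0. lra. Qed.

Lemma csqrt_sq (w : C) : slit w -> (csqrt w * csqrt w)%C = w.
Proof.
  intros H. assert (Hr := csqrt_re_pos w H). unfold slit in H. simpl in Hr.
  assert (E := sqrt_sqrt ((Cmod w + fst w) / 2) ltac:(lra)).
  pose proof (Cmod_sq w) as Q. unfold csqrt. set (r := sqrt ((Cmod w + fst w) / 2)) in *.
  apply injective_projections; simpl; [|field; lra].
  apply Rmult_eq_reg_r with (4 * (r * r)); [|nra].
  transitivity (4 * (r * r) * (r * r) - snd w * snd w); [field; lra|]. rewrite E. nra.
Qed.

(** The principal root is the only root with positive real part. Its behaviour under scaling,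
    negation and conjugation follows from this alone. *)
Lemma csqrt_unique (w s : C) : (s * s)%C = w -> 0 < fst s -> slit w /\ csqrt w = s.
Proof.
  intros E Hs. assert (Hw : slit w).
  { unfold slit. rewrite <- E, Cmod_mult, Cmod_sq. simpl. nra. }
  split; [easy|]. assert (Q := csqrt_sq w Hw). assert (Hp := csqrt_re_pos w Hw).
  assert (Z : ((csqrt w - s) * (csqrt w + s))%C = RtoC 0).
  { transitivity (csqrt w * csqrt w - s * s)%C; [ring|]. rewrite Q, E. ring. }
  apply Ceq_minus. destruct (Ceq_dec (csqrt w - s) (RtoC 0)) as [|N]; [easy|exfalso].
  apply (Cmult_neq_0 _ (csqrt w + s)%C) in N; [easy|].
  intros Z2. apply (f_equal fst) in Z2. simpl in Z2, Hp. lra.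
Qed.

Lemma csqrt_scal (c : R) (w : C) :
  0 < c -> slit w -> slit (RtoC c * w) /\ csqrt (RtoC c * w) = (RtoC (sqrt c) * csqrt w)%C.
Proof.
  intros Hc Hw. apply csqrt_unique.
  - transitivity (RtoC (sqrt c * sqrt c) * (csqrt w * csqrt w))%C; [rewrite RtoC_mult; ring|].
    rewrite sqrt_sqrt by lra. now rewrite csqrt_sq.
  - assert (H := csqrt_re_pos w Hw). assert (0 < sqrt c) by now apply sqrt_lt_R0.
    rewrite (re_scal_l (sqrt c) (csqrt w) : fst _ = _). unfold Re. nra.
Qed.

Lemma csqrt_opp (w : C) : snd w < 0 -> slit (- w) /\ csqrt (- w) = (Ci * csqrt w)%C.
Proof.
  intros H. assert (Hw : slit w) by (apply slit_iff; left; lra).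
  assert (Q := csqrt_sq w Hw). assert (P := csqrt_re_pos w Hw).
  apply csqrt_unique.
  - transitivity (Ci * Ci * (csqrt w * csqrt w))%C; [ring|]. rewrite Q. Ceq.
  - apply (f_equal snd) in Q. simpl in Q, P |- *.
    destruct (Rlt_le_dec (snd w / (2 * sqrt ((Cmod w + fst w) / 2))) 0) as [L|L]; [lra|nra].
Qed.

Lemma csqrt_conj (w : C) : slit w -> slit (Cconj w) /\ csqrt (Cconj w) = Cconj (csqrt w).
Proof.
  intros Hw. apply csqrt_unique.
  - rewrite <- Cmult_conj. now rewrite csqrt_sq.
  - apply (csqrt_re_pos w Hw).
Qed.

Definition rsq (w : C) : C := (/ csqrt w)%C.

Lemma csqrt_neq_0 (w : C) : slit w -> csqrt w <> RtoC 0.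
Proof. intros H E. apply csqrt_re_pos in H. rewrite E in H. simpl in H. lra. Qed.

Lemma re_bound_Cmod (m : R) (p : C) : 0 < m -> m <= fst p -> m <= Cmod p /\ p <> RtoC 0.
Proof.
  intros Hm H. pose proof (fst_le_Cmod p). rewrite Rabs_right in H0 by lra.
  split; [lra|]. intros ->. simpl in H. lra.
Qed.

(** In terms of the two roots p and q the remainder is a rational expression with the factor (q^2 -
    p^2)^2, and its denominators are bounded below by powers of [sqrt mu / 2]. The constants depend
    on [mu] only, which makes the estimate uniform under an integral sign. *)
Lemma rsq_quad (w0 w1 : C) (mu : R) :
  0 < mu -> mu <= Cmod w0 + fst w0 -> Cmod (w1 - w0) <= mu / 4 ->
  slit w1 /\ Cmod (rsq w1) <= 2 / sqrt mu /\
  Cmod (rsq w1 - rsq w0 + (w1 - w0) * (rsq w0 * rsq w0 * rsq w0) / RtoC 2)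
   <= / ((sqrt mu / 2) ^ 5) * (Cmod (w1 - w0) * Cmod (w1 - w0)).
Proof.
  intros Hmu H0 Hk.
  assert (H1 : mu / 2 <= Cmod w1 + fst w1).
  { pose proof (Cmod_rev w0 w1) as A. rewrite Cmod_swap in A.
    pose proof (fst_le_Cmod (w1 - w0)) as B. simpl in B. apply Rabs_le_between in B. lra. }
  assert (S0 : slit w0) by (unfold slit; lra). assert (S1 : slit w1) by (unfold slit; lra).
  assert (Hm : 0 < sqrt mu / 2) by (pose proof (sqrt_lt_R0 mu Hmu); lra).
  assert (Em : sqrt mu / 2 = sqrt (mu / 4)).
  { rewrite sqrt_div_alt by lra. replace 4 with (2 * 2) by ring. now rewrite sqrt_square by lra. }
  set (m := sqrt mu / 2) in *. set (p := csqrt w0). set (q := csqrt w1).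
  assert (Hp : m <= fst p) by (rewrite Em; simpl; apply sqrt_le_1_alt; lra).
  assert (Hq : m <= fst q) by (rewrite Em; simpl; apply sqrt_le_1_alt; lra).
  destruct (re_bound_Cmod m p Hm Hp) as [Mp Np]. destruct (re_bound_Cmod m q Hm Hq) as [Mq Nq].
  assert (Hs : 2 * m <= fst (p + q)%C) by (change (2 * m <= fst p + fst q); lra).
  destruct (re_bound_Cmod (2 * m) (p + q)%C ltac:(lra) Hs) as [Ms Ns].
  split; [easy|]. split.
  - unfold rsq. fold q. rewrite Cmod_inv by easy.
    replace (2 / sqrt mu) with (/ m) by (unfold m; field; unfold m in Hm; lra).
    apply Rinv_le_contravar; lra.
  - assert (E0 : w0 = (p * p)%C) by (symmetry; now apply csqrt_sq).
    assert (E1 : w1 = (q * q)%C) by (symmetry; now apply csqrt_sq).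
    unfold rsq. fold p q.
    assert (E : (/ q - / p + (w1 - w0) * (/ p * / p * / p) / RtoC 2)%C
      = ((w1 - w0) * (w1 - w0) * (/ (p * p * q * (p + q) * (p + q)) + / (p * p * p * q * (p + q))) / RtoC 2)%C).
    { rewrite E0, E1. field. repeat split; auto. }
    rewrite E. unfold Cdiv. rewrite !Cmod_mult.
    assert (I2 : Cmod (/ RtoC 2) = / 2).
    { rewrite <- RtoC_inv by lra. rewrite Cmod_R. apply Rabs_right. lra. }
    rewrite I2.
    assert (0 < m ^ 5) by now apply pow_lt.
    assert (T : Cmod (/ (p * p * q * (p + q) * (p + q)) + / (p * p * p * q * (p + q))) <= 2 * / m ^ 5).
    { eapply Rle_trans; [apply Cmod_triangle|].
      rewrite !Cmod_inv by (repeat apply Cmult_neq_0; auto). rewrite !Cmod_mult.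
      assert (/ (Cmod p * Cmod p * Cmod q * Cmod (p + q) * Cmod (p + q)) <= / m ^ 5).
      { apply Rinv_le_contravar; [easy|]. replace (m ^ 5) with (m * m * m * m * m) by ring.
        repeat apply Rmult_le_compat; repeat apply Rmult_le_pos; try lra; apply sqrt_pos. }
      assert (/ (Cmod p * Cmod p * Cmod p * Cmod q * Cmod (p + q)) <= / m ^ 5).
      { apply Rinv_le_contravar; [easy|]. replace (m ^ 5) with (m * m * m * m * m) by ring.
        repeat apply Rmult_le_compat; repeat apply Rmult_le_pos; try lra; apply sqrt_pos. }
      lra. }
    pose proof (Cmod_ge_0 (w1 - w0)). nra.
Qed.

Lemma hol_rsq (w : C) : slit w -> hol rsq w.
Proof.
  intros H. unfold slit in H. set (mu := Cmod w + fst w) in *.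
  apply (hol_quad rsq w (- (rsq w * rsq w * rsq w) / RtoC 2)%C (mu / 4)
    (/ ((sqrt mu / 2) ^ 5))); [lra|].
  intros w1 L. destruct (rsq_quad w w1 mu H ltac:(unfold mu; lra) ltac:(lra)) as (_ & _ & Q).
  eapply Rle_trans; [|exact Q]. apply Req_le. f_equal. unfold Cdiv. ring.
Qed.

(** * Complex-valued integrals and their dependence on a parameter *)

Definition CI (f : R -> C) (a b : R) : C :=
  (RInt (fun t => fst (f t)) a b, RInt (fun t => snd (f t)) a b).

Definition rcont (f : R -> C) (a b : R) : Prop :=
  forall t, a <= t <= b -> ctat dR (fun _ => True) f t.

Lemma rcont_ex (f : R -> C) (a b : R) :
  a <= b -> rcont f a b ->
  ex_RInt (fun t => fst (f t)) a b /\ ex_RInt (fun t => snd (f t)) a b.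
Proof.
  intros Hab H. split; (apply ex_RInt_cont; [easy|]); intros x Hx.
  - now apply ctat_continuous_fst, H.
  - now apply ctat_continuous_snd, H.
Qed.

Lemma CI_ext (f g : R -> C) (a b : R) :
  a <= b -> (forall t, a < t < b -> f t = g t) -> CI f a b = CI g a b.
Proof.
  intros Hab H. unfold CI. f_equal; apply RInt_ext; intros t Ht;
    rewrite Rmin_left, Rmax_right in Ht by easy; now rewrite H.
Qed.

Lemma CI_minus (f g : R -> C) (a b : R) :
  a <= b -> rcont f a b -> rcont g a b -> (CI (fun t => f t - g t) a b = CI f a b - CI g a b)%C.
Proof.
  intros Hab F G. destruct (rcont_ex f a b Hab F). destruct (rcont_ex g a b Hab G).
  apply injective_projections; simpl.
  - apply (RInt_minus (V := R_CompleteNormedModule)); easy.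
  - apply (RInt_minus (V := R_CompleteNormedModule)); easy.
Qed.

Lemma CI_scal (f : R -> C) (c : C) (a b : R) :
  a <= b -> rcont f a b -> (CI (fun t => f t * c) a b = CI f a b * c)%C.
Proof.
  intros Hab F. destruct (rcont_ex f a b Hab F) as [E1 E2].
  assert (S : forall (g : R -> R) k, ex_RInt g a b -> is_RInt (fun t => g t * k) a b (RInt g a b * k)).
  { intros g k Eg. apply is_RInt_ext with (f := fun t => scal k (g t)).
    - intros. unfold scal; simpl; unfold mult; simpl. ring.
    - replace (RInt g a b * k) with (scal k (RInt g a b)) by (unfold scal; simpl; unfold mult; simpl; ring).
      apply (is_RInt_scal (V := R_NormedModule)). now apply (RInt_correct (V := R_CompleteNormedModule)). }
  apply injective_projections; simpl; apply is_RInt_unique.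
  - apply (is_RInt_minus (V := R_NormedModule)); now apply S.
  - apply (is_RInt_plus (V := R_NormedModule)); now apply S.
Qed.

(** The factor 2 comes from estimating the real and imaginary parts separately. *)
Lemma CI_bound (f : R -> C) (a b K : R) :
  a <= b -> rcont f a b -> (forall t, a <= t <= b -> Cmod (f t) <= K) ->
  Cmod (CI f a b) <= 2 * K * (b - a).
Proof.
  intros Hab F H. destruct (rcont_ex f a b Hab F) as [E1 E2].
  eapply Rle_trans; [apply Cmod_le_abs|]. simpl.
  assert (Z : RInt (fun _ => 0) a b = 0).
  { rewrite RInt_const. unfold scal; simpl; unfold mult; simpl. ring. }
  assert (Ez : ex_RInt (fun _ : R => 0) a b) by (apply ex_RInt_const).
  pose proof (RInt_close _ _ a b K Hab E1 Ez) as C1. pose proof (RInt_close _ _ a b K Hab E2 Ez) as C2.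
  rewrite Z, Rminus_0_r in C1, C2.
  assert (X1 : Rabs (RInt (fun t => fst (f t)) a b) <= K * (b - a)).
  { apply C1. intros. rewrite Rminus_0_r. eapply Rle_trans; [apply fst_le_Cmod|auto]. }
  assert (X2 : Rabs (RInt (fun t => snd (f t)) a b) <= K * (b - a)).
  { apply C2. intros. rewrite Rminus_0_r. eapply Rle_trans; [apply snd_le_Cmod|auto]. }
  lra.
Qed.

Lemma CI_re_pos (f : R -> C) (c : C) (a b : R) :
  a < b -> rcont f a b -> (forall t, a < t < b -> 0 < fst (f t * c)%C) ->
  0 < fst (CI f a b * c)%C.
Proof.
  intros Hab F H. rewrite <- CI_scal by (auto; lra). simpl. apply RInt_gt_0; [easy|exact H|].
  intros t Ht. apply (ctat_continuous_fst (fun t => f t * c)%C).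
  apply ctat_mult; [now apply F|apply ctat_const].
Qed.

Theorem goursat_C (f : C -> C) (a b c d : R) :
  a <= b -> c <= d ->
  (forall z : C, a <= fst z <= b -> c <= snd z <= d -> hol f z) ->
  (CI (fun x => f (x, c)) a b + Ci * CI (fun y => f (b, y)) c d
   - CI (fun x => f (x, d)) a b - Ci * CI (fun y => f (a, y)) c d = RtoC 0)%C.
Proof.
  intros Hab Hcd Hf. assert (G1 := goursat f a b c d Hab Hcd Hf).
  assert (G2 := goursat (fun z => - Ci * f z)%C a b c d Hab Hcd).
  assert (Hf' : forall z : C, a <= fst z <= b -> c <= snd z <= d -> hol (fun z => - Ci * f z)%C z).
  { intros. apply hol_mult; [apply hol_const|now apply Hf]. }
  specialize (G2 Hf').
  assert (V : forall y a b, RInt (fun x => fst (- Ci * f (x, y))%C) a b = RInt (fun x => snd (f (x, y))) a b).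
  { intros. apply RInt_ext. intros. simpl. ring. }
  assert (U : forall x, a <= x <= b ->
    RInt (fun y => snd (- Ci * f (x, y))%C) c d = - RInt (fun y => fst (f (x, y))) c d).
  { intros x H2.
    rewrite <- (RInt_opp (V := R_CompleteNormedModule) (fun y => fst (f (x, y)))).
    - apply RInt_ext. intros. unfold opp. simpl. ring.
    - apply ex_RInt_cont; [easy|]. intros y Hy.
      apply ctat_continuous_fst, (ctat_ver f x y), hol_ct, Hf; simpl; lra. }
  unfold circ in G1, G2. rewrite !V, !U in G2 by lra.
  apply injective_projections; simpl.
  - etransitivity; [|exact G1]. ring.
  - etransitivity; [|exact G2]. ring.
Qed.

Lemma ctat_RtoC (f : R -> R) (x : R) : continuous f x -> ctat dR (fun _ => True) (fun t => RtoC (f t)) x.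
Proof.
  intros H e He. apply filterlim_locally with (eps := mkposreal e He) in H.
  destruct H as [dl Hd]. exists dl. split; [apply cond_pos|]. intros y _ L.
  rewrite <- RtoC_minus, Cmod_R. apply (Hd y L).
Qed.

Definition PInt (alpha beta : R -> R) (a b : R) (z : C) : C :=
  CI (fun t => rsq (RtoC (alpha t) + RtoC (beta t) * z)) a b.

Section ParamInt.
Variables (alpha beta : R -> R) (a b : R).
Hypothesis Hab : a < b.
Hypothesis Ca : forall t, a <= t <= b -> continuous alpha t.
Hypothesis Cb : forall t, a <= t <= b -> continuous beta t.
Let w (z : C) (t : R) : C := (RtoC (alpha t) + RtoC (beta t) * z)%C.

Lemma PInt_w_cont (z : C) (t : R) : a <= t <= b -> ctat dR (fun _ => True) (w z) t.
Proof.
  intros Ht. unfold w. apply ctat_plus; [now apply ctat_RtoC, Ca|].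
  apply ctat_mult; [now apply ctat_RtoC, Cb|apply ctat_const].
Qed.

Lemma PInt_rcont (z : C) : (forall t, a <= t <= b -> slit (w z t)) -> rcont (fun t => rsq (w z t)) a b.
Proof.
  intros H t Ht. apply (ctat_comp_T dR (fun _ => True) (w z) rsq); [now apply PInt_w_cont|].
  now apply hol_ct, hol_rsq, H.
Qed.

Lemma PInt_min (z : C) : (forall t, a <= t <= b -> slit (w z t)) ->
  exists mu, 0 < mu /\ forall t, a <= t <= b -> mu <= Cmod (w z t) + fst (w z t).
Proof.
  intros H. destruct (continuity_ab_min (fun t => Cmod (w z t) + fst (w z t)) a b) as (t0 & H1 & H2).
  - lra.
  - intros t Ht. apply (proj2 (continuity_pt_filterlim (fun t => Cmod (w z t) + fst (w z t)) t)).
    apply (continuous_eps (fun t => Cmod (w z t) + fst (w z t))). intros e He.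
    destruct (PInt_w_cont z t Ht (e / 2)) as (dl & Hd & Hc); [lra|]. exists dl. split; [easy|].
    intros y Hy. specialize (Hc y I Hy).
    pose proof (Cmod_rev (w z y) (w z t)) as H2. pose proof (Cmod_rev (w z t) (w z y)) as H3.
    rewrite (Cmod_swap (w z t)) in H3. pose proof (fst_le_Cmod (w z y - w z t)) as Q. simpl in Q.
    apply Rabs_le_between in Q. apply Rabs_lt_between. simpl in *. lra.
  - exists (Cmod (w z t0) + fst (w z t0)). split; [now apply H|]. easy.
Qed.

(** Differentiation under the integral sign: compactness of the interval gives one [mu] for
    [rsq_quad], and the integrated remainder is still quadratic in the increment of z. *)
Lemma hol_PInt (z : C) : (forall t, a <= t <= b -> slit (w z t)) -> hol (PInt alpha beta a b) z.
Proof.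
  intros H. destruct (PInt_min z H) as (mu & Hmu & Hm).
  destruct (continuity_ab_maj (fun t => Rabs (beta t)) a b) as (t1 & HM & _).
  { lra. }
  { intros t Ht. apply (proj2 (continuity_pt_filterlim (fun t => Rabs (beta t)) t)).
    apply (continuous_comp beta Rabs); [now apply Cb|].
    apply continuous_Rabs. }
  set (M := Rabs (beta t1) + 1) in *. assert (PM : 0 < M) by (unfold M; pose proof (Rabs_pos (beta t1)); lra).
  set (D := fun t => (- RtoC (beta t) * (rsq (w z t) * rsq (w z t) * rsq (w z t)) / RtoC 2)%C).
  assert (CD : rcont D a b).
  { intros t Ht. assert (R1 := PInt_rcont z H t Ht). unfold D, Cdiv.
    repeat apply ctat_mult; auto; try apply ctat_const.
    apply ctat_opp. now apply ctat_RtoC, Cb. }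
  set (K := 2 * (/ ((sqrt mu / 2) ^ 5) * (M * M)) * (b - a)).
  apply (hol_quad _ z (CI D a b) (mu / (4 * M)) K); [apply Rdiv_lt_0_compat; lra|].
  intros z1 Hz1. assert (Hz2 : M * Cmod (z1 - z) < mu / 4).
  { apply Rmult_lt_compat_l with (r := M) in Hz1; [|easy].
    replace (M * (mu / (4 * M))) with (mu / 4) in Hz1 by (field; lra). easy. }
  assert (Ew : forall t, (w z1 t - w z t = RtoC (beta t) * (z1 - z))%C) by (intros; unfold w; ring).
  assert (Lw : forall t, a <= t <= b -> Cmod (w z1 t - w z t) <= M * Cmod (z1 - z)).
  { intros t Ht. rewrite Ew, Cmod_RtoC_mult. apply Rmult_le_compat_r; [apply Cmod_ge_0|].
    unfold M. specialize (HM t Ht). simpl in HM. lra. }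
  assert (Q : forall t, a <= t <= b -> slit (w z1 t) /\
    Cmod (rsq (w z1 t) - rsq (w z t) - D t * (z1 - z)) <=
    / ((sqrt mu / 2) ^ 5) * (M * M) * (Cmod (z1 - z) * Cmod (z1 - z))).
  { intros t Ht. specialize (Lw t Ht).
    destruct (rsq_quad (w z t) (w z1 t) mu Hmu (Hm t Ht) ltac:(lra)) as (Q1 & _ & Q3).
    split; [easy|].
    replace (rsq (w z1 t) - rsq (w z t) - D t * (z1 - z))%C with
     (rsq (w z1 t) - rsq (w z t) + (w z1 t - w z t) * (rsq (w z t) * rsq (w z t) * rsq (w z t)) / RtoC 2)%C
     by (rewrite Ew; unfold D, Cdiv; ring).
    eapply Rle_trans; [exact Q3|]. rewrite Rmult_assoc. apply Rmult_le_compat_l.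
    - left. apply Rinv_0_lt_compat, pow_lt. pose proof (sqrt_lt_R0 mu Hmu). lra.
    - replace (M * M * (Cmod (z1 - z) * Cmod (z1 - z))) with ((M * Cmod (z1 - z)) * (M * Cmod (z1 - z))) by ring.
      apply Rmult_le_compat; auto; apply Cmod_ge_0. }
  assert (R0 := PInt_rcont z H). assert (R1 := PInt_rcont z1 (fun t Ht => proj1 (Q t Ht))).
  assert (RD : rcont (fun t => D t * (z1 - z))%C a b).
  { intros t Ht. apply ctat_mult; [now apply CD|apply ctat_const]. }
  assert (R01 : rcont (fun t => rsq (w z1 t) - rsq (w z t))%C a b).
  { intros t Ht. apply ctat_minus; [now apply R1|now apply R0]. }
  unfold PInt. fold (w z) (w z1).
  change (CI (fun t => rsq (RtoC (alpha t) + RtoC (beta t) * z1)%C) a b) with (CI (fun t => rsq (w z1 t)) a b).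
  change (CI (fun t => rsq (RtoC (alpha t) + RtoC (beta t) * z)%C) a b) with (CI (fun t => rsq (w z t)) a b).
  assert (Hab' : a <= b) by lra.
  rewrite <- CI_scal, <- CI_minus, <- CI_minus by easy.
  eapply Rle_trans.
  - apply CI_bound with (K := / ((sqrt mu / 2) ^ 5) * (M * M) * (Cmod (z1 - z) * Cmod (z1 - z))); [easy| |].
    + intros t Ht. apply ctat_minus; [now apply R01|now apply RD].
    + intros t Ht. now apply Q.
  - apply Req_le. unfold K. ring.
Qed.
End ParamInt.

(** * Elliptic periods *)

(* Half-periods of the elliptic curve branched at -1, 1, z and infinity. The substitution
   u = exp (-t/2) turns [Bper] into a multiple of the integral of (cosh t - z)^(-1/2) over
   t > 0, and Cauchy's theorem on 0 < Im t < PI expresses it by [Cper] and [Aper]. *)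
Definition Bper : C -> C := PInt (fun u => 1 + u ^ 4) (fun u => - 2 * u ^ 2) 0 1.
Definition Aper (z : C) : C := Bper (- z).
(** The division matches the factor that [substitution_B] puts before [Bper], so that the relation
    between the three periods has coefficients 1 and i. *)
Definition Cper (z : C) : C := (PInt (fun t => (- cos t)%R) (fun _ => 1%R) 0 PI z / RtoC (2 * sqrt 2))%C.

Ltac cont_d := let t := fresh in intros t _; apply (ex_derive_continuous (K := R_AbsRing) (V := R_NormedModule)); auto_derive; easy.

Lemma slit_B (z : C) (u : R) : snd z <> 0 \/ fst z < 1 -> 0 <= u <= 1 ->
  slit (RtoC (1 + u ^ 4) + RtoC (- 2 * u ^ 2) * z).
Proof.
  intros H Hu. apply slit_iff. destruct z as [x y]. simpl in H.
  assert (E1 : fst (RtoC (1 + u ^ 4) + RtoC (- 2 * u ^ 2) * (x, y))%C = 1 + u * u * (u * u) - 2 * (u * u) * x)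
    by (simpl; ring).
  assert (E2 : snd (RtoC (1 + u ^ 4) + RtoC (- 2 * u ^ 2) * (x, y))%C = - 2 * (u * u) * y)
    by (simpl; ring).
  rewrite E1, E2.
  destruct (Req_dec u 0) as [->|N]; [right; lra|].
  assert (0 < u * u) by nra. destruct H as [H|H].
  - left. intros E. apply H. assert (Z : u * u * y = 0) by lra.
    apply Rmult_integral in Z. destruct Z; [lra|easy].
  - right. pose proof (Rle_0_sqr (1 - u * u)) as S. unfold Rsqr in S.
    assert (0 < u * u * (1 - x)) by (apply Rmult_lt_0_compat; lra). lra.
Qed.

Lemma slit_C (z : C) (t : R) : snd z <> 0 \/ 1 < fst z -> slit (RtoC (- cos t) + RtoC 1 * z).
Proof.
  intros H. apply slit_iff. destruct z as [x y]. simpl in *. pose proof (COS_bound t).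
  destruct H; [left|right]; lra.
Qed.

Lemma hol_B (z : C) : snd z <> 0 \/ fst z < 1 -> hol Bper z.
Proof.
  intros H. apply hol_PInt; [lra|cont_d|cont_d|]. intros. now apply slit_B.
Qed.

Lemma hol_A (z : C) : snd z <> 0 \/ -1 < fst z -> hol Aper z.
Proof.
  intros H. apply (hol_comp Copp Bper); [apply (hol_opp (fun w => w)), hol_id|]. apply hol_B. simpl.
  destruct H; [left|right]; lra.
Qed.

Lemma hol_C (z : C) : snd z <> 0 \/ 1 < fst z -> hol Cper z.
Proof.
  intros H. apply hol_mult; [|apply hol_const]. apply hol_PInt; [apply PI_RGT_0|cont_d|cont_d|].
  intros. now apply slit_C.
Qed.

Lemma PInt_conj (alpha beta : R -> R) (a b : R) (z : C) : a < b ->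
  (forall t, a <= t <= b -> slit (RtoC (alpha t) + RtoC (beta t) * z)) ->
  (forall t, a <= t <= b -> continuous alpha t) -> (forall t, a <= t <= b -> continuous beta t) ->
  PInt alpha beta a b (Cconj z) = Cconj (PInt alpha beta a b z).
Proof.
  intros Hab H Ca Cb. unfold PInt.
  assert (R0 := PInt_rcont alpha beta a b Ca Cb z H).
  destruct (rcont_ex _ a b (Rlt_le _ _ Hab) R0) as [E1 E2].
  rewrite (CI_ext _ (fun t => Cconj (rsq (RtoC (alpha t) + RtoC (beta t) * z))) a b (Rlt_le _ _ Hab)).
  - unfold CI, Cconj at 3. simpl. f_equal.
    apply (RInt_opp (V := R_CompleteNormedModule) (fun t => snd (rsq (RtoC (alpha t) + RtoC (beta t) * z))%C)).
    exact E2.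
  - intros t Ht. unfold rsq. assert (St := H t ltac:(lra)).
    rewrite Cinv_conj by now apply csqrt_neq_0.
    rewrite <- (proj2 (csqrt_conj _ St)). do 2 f_equal. Ceq.
Qed.

Lemma B_conj (z : C) : snd z <> 0 \/ fst z < 1 -> Bper (Cconj z) = Cconj (Bper z).
Proof.
  intros H. apply PInt_conj; [lra| |cont_d|cont_d]. intros. now apply slit_B.
Qed.

Lemma A_conj (z : C) : snd z <> 0 \/ -1 < fst z -> Aper (Cconj z) = Cconj (Aper z).
Proof.
  intros H. unfold Aper. rewrite <- Copp_conj. apply B_conj. simpl. destruct H; [left|right]; lra.
Qed.

Lemma C_conj (z : C) : snd z <> 0 \/ 1 < fst z -> Cper (Cconj z) = Cconj (Cper z).
Proof.
  intros H. unfold Cper. assert (0 < sqrt 2) by (apply sqrt_lt_R0; lra).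
  rewrite Cdiv_conj by (intros E; apply RtoC_inj in E; lra).
  f_equal; [|Ceq]. apply PInt_conj; [apply PI_RGT_0| |cont_d|cont_d]. intros. now apply slit_C.
Qed.

(* With a, b positive multiples of c1 - z and c2 + z: the two square roots make an acute angle. *)
Lemma rsq_pair_pos (a b : C) (k l : R) : slit a -> slit b -> 0 < k -> 0 < l ->
  k * snd a + l * snd b = 0 -> 0 < k * fst a + l * fst b -> 0 < fst (rsq a * Cconj (rsq b))%C.
Proof.
  intros Sa Sb Hk Hl E1 E2. unfold rsq.
  assert (Qa := csqrt_sq a Sa). assert (Qb := csqrt_sq b Sb).
  assert (Pa := csqrt_re_pos a Sa). assert (Pb := csqrt_re_pos b Sb).
  rewrite <- Qa, <- Qb in E1, E2. clear Qa Qb.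
  destruct (csqrt a) as [p1 p2]. destruct (csqrt b) as [q1 q2]. simpl in *.
  assert (T : 0 < p1 * q1 + p2 * q2).
  { apply Rnot_le_lt. intros N.
    assert (Eq : l * q1 * q2 = - (k * p1 * p2)) by lra.
    assert (Hkp : 0 < k * p1) by now apply Rmult_lt_0_compat.
    assert (Hlq : 0 < l * q1) by now apply Rmult_lt_0_compat.
    assert (Npq : p2 * q2 <= - (p1 * q1)) by lra.
    assert (H1 : k * (p1 * p1) <= l * (q2 * q2)).
    { apply Rmult_le_reg_r with q1; [easy|].
      apply (Rmult_le_compat_l (k * p1)) in Npq; [|lra].
      replace (l * (q2 * q2) * q1) with (l * q1 * q2 * q2) by ring. rewrite Eq. lra. }
    assert (H2 : l * (q1 * q1) <= k * (p2 * p2)).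
    { apply Rmult_le_reg_r with p1; [easy|].
      apply (Rmult_le_compat_l (l * q1)) in Npq; [|lra].
      replace (k * (p2 * p2) * p1) with (- (- (k * p1 * p2)) * p2) by ring. rewrite <- Eq. lra. }
    lra. }
  assert (0 < p1 * (p1 * 1) + p2 * (p2 * 1)) by nra. assert (0 < q1 * (q1 * 1) + q2 * (q2 * 1)) by nra.
  match goal with |- 0 < ?X => replace X with
    ((p1 * q1 + p2 * q2) / ((p1 * (p1 * 1) + p2 * (p2 * 1)) * (q1 * (q1 * 1) + q2 * (q2 * 1)))) by (field; lra) end.
  apply Rdiv_lt_0_compat; [easy|]. now apply Rmult_lt_0_compat.
Qed.

Lemma rcont_B (z : C) : snd z <> 0 \/ fst z < 1 ->
  rcont (fun u => rsq (RtoC (1 + u ^ 4) + RtoC (- 2 * u ^ 2) * z)) 0 1.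
Proof.
  intros H. apply (PInt_rcont (fun u => 1 + u ^ 4) (fun u => - 2 * u ^ 2) 0 1); [cont_d|cont_d|].
  intros. now apply slit_B.
Qed.

(** Pairwise positivity integrated twice: the radicands at u and s are positive multiples of c1 - z
    and c2 + z, whose sum c1 + c2 is positive. This is the inequality that puts [tau1] into the
    upper half-plane. *)
Lemma BA_pos (z : C) : snd z <> 0 \/ -1 < fst z < 1 -> 0 < fst (Bper z * Cconj (Aper z))%C.
Proof.
  intros H.
  assert (HB : snd z <> 0 \/ fst z < 1) by (destruct H; [left|right]; lra).
  assert (HA : snd (- z)%C <> 0 \/ fst (- z)%C < 1) by (simpl; destruct H; [left|right]; lra).
  set (b := fun u => rsq (RtoC (1 + u ^ 4) + RtoC (- 2 * u ^ 2) * z)%C).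
  set (a := fun u => rsq (RtoC (1 + u ^ 4) + RtoC (- 2 * u ^ 2) * - z)%C).
  assert (S1 : forall s, 0 < s < 1 -> 0 < fst (Bper z * Cconj (a s))%C).
  { intros s Hs. unfold Bper, PInt. apply CI_re_pos; [lra|now apply rcont_B|].
    (* The weights bring the coefficients of z in the two radicands to -1 and 1. *)
    intros u Hu. apply (rsq_pair_pos _ _ (/ (2 * u ^ 2)) (/ (2 * s ^ 2))).
    - apply slit_B; lra.
    - apply slit_B; [easy|lra].
    - apply Rinv_0_lt_compat. nra.
    - apply Rinv_0_lt_compat. nra.
    - simpl. field. lra.
    - simpl. match goal with |- 0 < ?X => replace X with
       ((1 + u ^ 4) / (2 * u ^ 2) + (1 + s ^ 4) / (2 * s ^ 2)) by (field; lra) end.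
      apply Rplus_lt_0_compat; apply Rdiv_lt_0_compat; try nra.
 }
  assert (0 < fst (Aper z * Cconj (Bper z))%C).
  { unfold Aper. unfold Bper at 1, PInt. apply CI_re_pos; [lra|now apply rcont_B|].
    intros s Hs. specialize (S1 s Hs). fold (a s). simpl in S1 |- *. lra. }
  simpl in H0 |- *. lra.
Qed.

Lemma A_neq_0 (z : C) : snd z <> 0 \/ -1 < fst z < 1 -> Aper z <> RtoC 0.
Proof. intros H E. apply BA_pos in H. rewrite E in H. simpl in H. lra. Qed.

Definition ccosh (t : C) : C := ((cexp t + cexp (- t)) / RtoC 2)%C.

Lemma substitution_B (z : C) (T : R) : snd z <> 0 -> 0 <= T ->
  CI (fun x => rsq (ccosh (RtoC x) - z)) 0 T =
  (RtoC (2 * sqrt 2) * CI (fun u => rsq (RtoC (1 + u ^ 4) + RtoC (- 2 * u ^ 2) * z)) (exp (- T / 2)) 1)%C.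
Proof.
  intros Hz HT.
  assert (S2 : 0 < sqrt 2) by (apply sqrt_lt_R0; lra).
  assert (He : 0 < exp (- T / 2) <= 1).
  { split; [apply exp_pos|]. rewrite <- exp_0. destruct (Req_dec T 0) as [->|]; [right; f_equal; lra|].
    left. apply exp_increasing. lra. }
  set (k := fun u => rsq (RtoC (1 + u ^ 4) + RtoC (- 2 * u ^ 2) * z)%C).
  assert (Pt : forall x, 0 <= x -> rsq (ccosh (RtoC x) - z) = (RtoC (sqrt 2 * exp (- x / 2)) * k (exp (- x / 2)))%C).
  { intros x Hx. set (u := exp (- x / 2)). assert (Hu : 0 < u) by apply exp_pos.
    assert (Eu : u * u = exp (- x)) by (unfold u; rewrite <- exp_plus; f_equal; field).
    assert (Ei : exp (- x) * exp x = 1) by (rewrite <- exp_plus, <- exp_0; f_equal; ring).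
    assert (Hsl : slit (ccosh (RtoC x) - z)).
    { apply slit_iff. left. unfold ccosh, cexp. simpl. rewrite Ropp_0, sin_0. lra. }
    assert (Ew : (RtoC (1 + u ^ 4) + RtoC (- 2 * u ^ 2) * z = RtoC (2 * (u * u)) * (ccosh (RtoC x) - z))%C).
    { replace (u ^ 4) with (u * u * (u * u)) by ring. replace (u ^ 2) with (u * u) by ring. rewrite Eu.
      unfold ccosh, cexp. simpl. rewrite Ropp_0, sin_0, cos_0.
      apply injective_projections; simpl; [|field]. 
      assert (E2 : exp (- x) * exp (- x) - 2 * exp (- x) * fst z =
        exp (- x) * exp (- x) - 2 * exp (- x) * fst z) by easy.
      field_simplify. nra. }
    unfold k. rewrite Ew. unfold rsq at 2.
    destruct (csqrt_scal (2 * (u * u)) (ccosh (RtoC x) - z) ltac:(nra) Hsl) as [_ ->].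
    rewrite sqrt_mult, sqrt_square by nra. unfold rsq.
    assert (RtoC (sqrt 2 * u) <> RtoC 0) by (intros Z; apply RtoC_inj in Z; nra).
    pose proof (csqrt_neq_0 _ Hsl). field. easy. }
  assert (Key : forall pr : C -> R, (pr = fst \/ pr = snd) ->
    RInt (fun x => pr (rsq (ccosh (RtoC x) - z))) 0 T = 2 * sqrt 2 * RInt (fun u => pr (k u)) (exp (- T / 2)) 1).
  { intros pr Hpr.
    assert (Hc : forall x, 0 <= x <= 1 -> continuous (fun u => pr (k u)) x).
    { intros x Hx. destruct Hpr as [-> | ->].
      - apply ctat_continuous_fst. apply rcont_B; auto.
      - apply ctat_continuous_snd. apply rcont_B; auto. }
    assert (Hs : forall r w, pr (RtoC r * w)%C = r * pr w) by (intros; destruct Hpr as [-> | ->]; simpl; ring).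
    assert (I := is_RInt_comp (V := R_CompleteNormedModule) (fun u => pr (k u)) (fun x => exp (- x / 2))
      (fun x => - exp (- x / 2) / 2) 0 T).
    rewrite Rmin_left, Rmax_right in I by easy.
    assert (I1 : forall x, 0 <= x <= T -> continuous (fun u => pr (k u)) (exp (- x / 2))).
    { intros x Hx. apply Hc. split; [left; apply exp_pos|]. rewrite <- exp_0.
      destruct (Req_dec x 0) as [->|]; [right; f_equal; lra|]. left. apply exp_increasing. lra. }
    assert (I2 : forall x, 0 <= x <= T -> is_derive (fun x => exp (- x / 2)) x (- exp (- x / 2) / 2) /\
      continuous (fun x => - exp (- x / 2) / 2) x).
    { intros x Hx. split; [auto_derive; [easy|unfold Rdiv; ring]|].
      apply (ex_derive_continuous (K := R_AbsRing) (V := R_NormedModule)). auto_derive. easy. }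
    specialize (I I1 I2). replace (exp (- 0 / 2)) with 1 in I by (rewrite <- exp_0; f_equal; lra).
    apply (is_RInt_scal (V := R_NormedModule) _ _ _ (- (2 * sqrt 2))) in I.
    rewrite <- (opp_RInt_swap (V := R_CompleteNormedModule)) in I.
    2:{ apply ex_RInt_cont; [easy|]. intros x Hx. apply Hc. lra. }
    apply is_RInt_unique.
    replace (2 * sqrt 2 * RInt (fun u => pr (k u)) (exp (- T / 2)) 1) with
      (scal (- (2 * sqrt 2)) (opp (RInt (fun u => pr (k u)) (exp (- T / 2)) 1)))
      by (unfold scal, opp; simpl; unfold mult; simpl; ring).
    eapply is_RInt_ext; [|exact I]. intros x Hx. rewrite Rmin_left, Rmax_right in Hx by easy.
    rewrite Pt, Hs by lra. unfold scal; simpl; unfold mult; simpl. field. }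
  apply injective_projections.
  - transitivity (2 * sqrt 2 * RInt (fun u => fst (k u)) (exp (- T / 2)) 1); [exact (Key fst (or_introl eq_refl))|].
    unfold CI. simpl. unfold k. ring.
  - transitivity (2 * sqrt 2 * RInt (fun u => snd (k u)) (exp (- T / 2)) 1); [exact (Key snd (or_intror eq_refl))|].
    unfold CI. simpl. unfold k. ring.
Qed.

(** After the substitution, truncation at T omits just the part of [Bper] over [0, exp (-T/2)],
    where the integrand is bounded. *)
Lemma tail_B (z : C) : snd z <> 0 -> exists K, 0 <= K /\ forall T, 0 <= T ->
  Cmod (CI (fun x => rsq (ccosh (RtoC x) - z)) 0 T - RtoC (2 * sqrt 2) * Bper z) <= K * exp (- T / 2).
Proof.
  intros Hz.
  set (k := fun u => rsq (RtoC (1 + u ^ 4) + RtoC (- 2 * u ^ 2) * z)%C).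
  destruct (PInt_min (fun u => 1 + u ^ 4) (fun u => - 2 * u ^ 2) 0 1) with (z := z) as (mu & Hmu & Hm);
    [lra|cont_d|cont_d|intros; apply slit_B; auto|].
  assert (Hk : forall u, 0 <= u <= 1 -> Cmod (k u) <= 2 / sqrt mu).
  { intros u Hu. destruct (rsq_quad (RtoC (1 + u ^ 4) + RtoC (- 2 * u ^ 2) * z)
      (RtoC (1 + u ^ 4) + RtoC (- 2 * u ^ 2) * z) mu Hmu (Hm u Hu)) as (_ & Q & _); [|exact Q].
    unfold Cminus. rewrite Cplus_opp_r, Cmod_0. lra. }
  assert (Hs := sqrt_lt_R0 mu Hmu). assert (S2 : 0 < sqrt 2) by (apply sqrt_lt_R0; lra).
  exists (2 * sqrt 2 * (2 * (2 / sqrt mu))). split.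
  { apply Rmult_le_pos; [lra|]. apply Rmult_le_pos; [lra|]. left. apply Rdiv_lt_0_compat; lra. }
  intros T HT. rewrite substitution_B by easy. fold k.
  assert (He : 0 < exp (- T / 2) <= 1).
  { split; [apply exp_pos|]. rewrite <- exp_0. destruct (Req_dec T 0) as [->|]; [right; f_equal; lra|].
    left. apply exp_increasing. lra. }
  set (e := exp (- T / 2)) in *.
  assert (Rk : rcont k 0 1) by (apply rcont_B; auto).
  assert (E : (CI k e 1 - Bper z = - CI k 0 e)%C).
  { change (Bper z) with (CI k 0 1). destruct (rcont_ex k 0 e) as [A1 A2]; [lra|intros t Ht; apply Rk; lra|].
    destruct (rcont_ex k e 1) as [B1 B2]; [lra|intros t Ht; apply Rk; lra|].
    pose proof (RInt_Chasles (V := R_CompleteNormedModule) _ _ _ _ A1 B1) as C1.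
    pose proof (RInt_Chasles (V := R_CompleteNormedModule) _ _ _ _ A2 B2) as C2.
    apply injective_projections.
    - change (RInt (fun t => fst (k t)) e 1 + - RInt (fun t => fst (k t)) 0 1 = - RInt (fun t => fst (k t)) 0 e).
      rewrite <- C1. unfold plus. simpl. ring.
    - change (RInt (fun t => snd (k t)) e 1 + - RInt (fun t => snd (k t)) 0 1 = - RInt (fun t => snd (k t)) 0 e).
      rewrite <- C2. unfold plus. simpl. ring. }
  replace (RtoC (2 * sqrt 2) * CI k e 1 - RtoC (2 * sqrt 2) * Bper z)%C
    with (RtoC (2 * sqrt 2) * (CI k e 1 - Bper z))%C by ring.
  rewrite E, Cmod_RtoC_mult, Cmod_opp, Rabs_right by lra.
  rewrite (Rmult_assoc (2 * sqrt 2) _ e). apply Rmult_le_compat_l; [lra|].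
  eapply Rle_trans; [apply (CI_bound k 0 e (2 / sqrt mu))|right; ring]; [lra| |].
  - intros t Ht. apply Rk. lra.
  - intros t Ht. apply Hk. lra.
Qed.

Lemma rsq_opp (w : C) : snd w < 0 -> rsq (- w) = (- Ci * rsq w)%C.
Proof.
  intros H. unfold rsq. rewrite (proj2 (csqrt_opp w H)).
  assert (N := csqrt_neq_0 w ltac:(apply slit_iff; lra)).
  assert (Ci <> RtoC 0) by (intros E; apply (f_equal snd) in E; simpl in E; lra).
  transitivity (/ Ci * / csqrt w)%C; [field; easy|]. now rewrite Ci_inv.
Qed.

Lemma Cmod_rsq (w : C) (eta : R) : slit w -> 0 < eta -> / (eta * eta) <= Cmod w -> Cmod (rsq w) <= eta.
Proof.
  intros S He H. unfold rsq. assert (N := csqrt_neq_0 w S). rewrite Cmod_inv by easy.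
  assert (Q := f_equal Cmod (csqrt_sq w S)). rewrite Cmod_mult in Q.
  apply Cmod_gt_0 in N. set (r := Cmod (csqrt w)) in *. rewrite <- Q in H.
  rewrite <- (Rinv_inv eta). apply Rinv_le_contravar; [now apply Rinv_0_lt_compat|].
  rewrite Rinv_mult in H. assert (0 < / eta) by now apply Rinv_0_lt_compat. nra.
Qed.

(** Goursat's theorem for (cosh t - z)^(-1/2) on [0, T] x [0, PI]. The lower side gives B; the upper
    one gives A, since cosh (x + i PI) = - cosh x; the left one gives C, since cosh (i y) = cos y;
    the right one vanishes as T grows. Since Im z < 0 and Im cosh >= 0 on this rectangle, the
    radicand stays in the upper half-plane and one branch of the root suffices. *)
Theorem B_lower (z : C) : snd z < 0 -> (Bper z = Cper z - Ci * Aper z)%C.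
Proof.
  intros Hz. assert (S2 : 0 < sqrt 2) by (apply sqrt_lt_R0; lra). pose proof PI_RGT_0 as HPI.
  destruct (tail_B z) as (K1 & P1 & T1); [lra|].
  destruct (tail_B (- z)) as (K2 & P2 & T2); [simpl; lra|].
  set (F := fun t => rsq (ccosh t - z)).
  assert (Him : forall x y, 0 <= x -> 0 <= y <= PI -> 0 <= snd (ccosh (x, y))).
  { intros x y Hx Hy. unfold ccosh, cexp. simpl.
    assert (0 <= sin y) by (apply sin_ge_0; lra).
    assert (exp (- x) <= exp x).
    { destruct (Req_dec x 0) as [->|]; [rewrite Ropp_0; lra|]. left. apply exp_increasing. lra. }
    rewrite sin_neg. match goal with |- 0 <= ?X => replace X with ((exp x - exp (- x)) * sin y / 2) by field end.
    nra. }
  assert (G : forall T, 0 <= T ->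
    (CI (fun x => rsq (ccosh (RtoC x) - z)) 0 T + Ci * CI (fun y => F (T, y)) 0 PI
     + Ci * CI (fun x => rsq (ccosh (RtoC x) - - z)) 0 T - RtoC (2 * sqrt 2) * Cper z = RtoC 0)%C).
  { intros T HT. assert (Gf := goursat_C F 0 T 0 PI HT (Rlt_le _ _ HPI)).
    rewrite <- Gf.
    2:{ intros [x y] Hx Hy. simpl in Hx, Hy. unfold F. apply hol_comp.
        - apply hol_minus; [|apply hol_const]. unfold ccosh. apply hol_mult; [|apply hol_const].
          apply hol_plus; [apply hol_cexp|]. apply (hol_comp Copp cexp); [apply (hol_opp (fun w => w)), hol_id|apply hol_cexp].
        - apply hol_rsq, slit_iff. left. specialize (Him x y ltac:(lra) Hy). simpl in Him |- *. lra. }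
    assert (E1 : CI (fun x => F (x, PI)) 0 T = (CI (fun x => rsq (ccosh (RtoC x) - - z)) 0 T * - Ci)%C).
    { rewrite <- CI_scal; [|easy|].
      - apply CI_ext; [easy|]. intros x Hx. unfold F.
        replace (ccosh (x, PI) - z)%C with (- (ccosh (RtoC x) - - z))%C.
        2:{ unfold ccosh, cexp. simpl. rewrite Ropp_0, sin_neg, cos_neg, sin_PI, cos_PI, sin_0, cos_0. Ceq; field. }
        rewrite rsq_opp; [ring|]. unfold ccosh, cexp. simpl. rewrite Ropp_0, sin_0. lra.
      - intros x Hx. apply (ctat_comp_T dR (fun _ => True) (fun x => ccosh (RtoC x) - - z)%C rsq).
        + apply ctat_minus; [|apply ctat_const].
          apply (ctat_comp_T dR (fun _ => True) RtoC ccosh).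
          * apply ctat_RtoC, continuous_id.
          * apply hol_ct. unfold ccosh. apply hol_mult; [|apply hol_const].
            apply hol_plus; [apply hol_cexp|]. apply (hol_comp Copp cexp); [apply (hol_opp (fun w => w)), hol_id|apply hol_cexp].
        + apply hol_ct, hol_rsq, slit_iff. left. unfold ccosh, cexp. simpl. rewrite Ropp_0, sin_0. lra. }
    assert (E2 : CI (fun y => F (0, y)) 0 PI = (RtoC (2 * sqrt 2) * Cper z * - Ci)%C).
    { assert (E3 : (RtoC (2 * sqrt 2) * Cper z)%C = PInt (fun t => - cos t) (fun _ => 1) 0 PI z).
      { unfold Cper. field. intros E. apply RtoC_inj in E. lra. }
      rewrite E3. unfold PInt. rewrite <- CI_scal; [|lra|].
      - apply CI_ext; [lra|]. intros y Hy. unfold F.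
        replace (ccosh (0, y) - z)%C with (- (RtoC (- cos y) + RtoC 1 * z))%C.
        2:{ unfold ccosh, cexp. simpl. rewrite sin_neg, cos_neg, Ropp_0, exp_0. Ceq; field. }
        rewrite rsq_opp; [ring|]. simpl. lra.
      - apply (PInt_rcont (fun t => - cos t) (fun _ => 1) 0 PI); [cont_d|cont_d|].
        intros. apply slit_C. left. lra. }
    rewrite E1, E2. 
    change (fun x => F (x, 0)) with (fun x : R => rsq (ccosh (RtoC x) - z)).
    set (X := CI (fun x : R => rsq (ccosh (RtoC x) - z)) 0 T). set (Y := CI (fun y : R => F (T, y)) 0 PI).
    set (Z := CI (fun x : R => rsq (ccosh (RtoC x) - - z)) 0 T). set (V := (RtoC (2 * sqrt 2) * Cper z)%C).
    apply injective_projections; simpl; ring. }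
  assert (Est : forall e, 0 < e -> Cmod (RtoC (2 * sqrt 2) * (Bper z + Ci * Aper z - Cper z)) <= e).
  { intros e He.
    set (eta := e / (4 * PI)). assert (Heta : 0 < eta) by (apply Rdiv_lt_0_compat; lra).
    assert (Hi : 0 < / (eta * eta)) by (apply Rinv_0_lt_compat; nra).
    (* The first summand makes |cosh - z| at least 1 / eta^2 on the right side, which bounds its
       integral by e / 2; the second brings the two tails below e / 2. *)
    set (T := 2 * (/ (eta * eta) + Cmod z) + 4 * (K1 + K2) / e + 1).
    pose proof (Cmod_ge_0 z) as Hz0.
    assert (H4 : 0 <= 4 * (K1 + K2) / e) by (apply Rmult_le_pos; [lra|left; now apply Rinv_0_lt_compat]).
    assert (HT : 0 <= T) by (unfold T; lra).
    assert (Hright : Cmod (CI (fun y => F (T, y)) 0 PI) <= e / 2).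
    { replace (e / 2) with (2 * eta * (PI - 0)) by (unfold eta; field; lra).
      apply CI_bound; [lra| |].
      - intros y Hy. unfold F. apply (ctat_comp_T dR (fun _ => True) (fun y => ccosh (T, y) - z)%C rsq).
        + apply ctat_minus; [|apply ctat_const]. apply (ctat_ver ccosh T y). apply hol_ct.
          unfold ccosh. apply hol_mult; [|apply hol_const].
          apply hol_plus; [apply hol_cexp|]. apply (hol_comp Copp cexp); [apply (hol_opp (fun w => w)), hol_id|apply hol_cexp].
        + apply hol_ct, hol_rsq, slit_iff. left. specialize (Him T y HT Hy). simpl in Him |- *. lra.
      - intros y Hy. apply Cmod_rsq; [|easy|].
        + apply slit_iff. left. specialize (Him T y HT Hy). simpl in Him |- *. lra.
        + pose proof (Cmod_rev (ccosh (T, y)) z) as L1.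
          assert (L2 : T / 2 <= Cmod (ccosh (T, y))).
          { unfold ccosh, Cdiv. rewrite Cmod_mult, <- RtoC_inv, Cmod_R by lra.
            rewrite (Rabs_right (/ 2)) by lra.
            pose proof (Cmod_rev (cexp (T, y)) (- cexp (- (T, y)))) as L.
            replace (cexp (T, y) - - cexp (- (T, y)))%C with (cexp (T, y) + cexp (- (T, y)))%C in L by ring.
            rewrite Cmod_opp, !Cmod_cexp in L. simpl in L.
            pose proof (exp_ineq1_le T).
            assert (exp (- T) <= 1).
            { rewrite <- exp_0. destruct (Req_dec T 0) as [->|]; [right; f_equal; lra|].
              left. apply exp_increasing. lra. }
            lra. }
          assert (/ (eta * eta) + Cmod z <= T / 2) by (unfold T; lra). lra. }
    specialize (G T HT). specialize (T1 T HT). specialize (T2 T HT).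
    set (X := CI (fun x : R => rsq (ccosh (RtoC x) - z)) 0 T) in *. set (Y := CI (fun y : R => F (T, y)) 0 PI) in *.
    set (Z := CI (fun x : R => rsq (ccosh (RtoC x) - - z)) 0 T) in *. fold (Aper z) in T2.
    replace (RtoC (2 * sqrt 2) * (Bper z + Ci * Aper z - Cper z))%C with
      (- (X - RtoC (2 * sqrt 2) * Bper z) - Ci * (Z - RtoC (2 * sqrt 2) * Aper z) - Ci * Y)%C.
    2:{ transitivity (- (X + Ci * Y + Ci * Z - RtoC (2 * sqrt 2) * Cper z)
          + RtoC (2 * sqrt 2) * (Bper z + Ci * Aper z - Cper z))%C; [ring|]. rewrite G. ring. }
    pose proof Cmod_Ci as CiM.
    eapply Rle_trans; [apply Cmod_minus_le|]. eapply Rle_trans; [apply Rplus_le_compat_r, Cmod_minus_le|].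
    rewrite Cmod_opp, !Cmod_mult, CiM, !Rmult_1_l.
    assert (L : (K1 + K2) * exp (- T / 2) <= e / 2).
    { pose proof (exp_ineq1_le (T / 2)) as L. pose proof (exp_pos (T / 2)).
      replace (- T / 2) with (- (T / 2)) by field. rewrite exp_Ropp.
      apply Rle_div_l; [easy|].
      assert (2 * (K1 + K2) / e <= T / 2) by (unfold T; lra).
      apply (proj1 (Rle_div_l _ _ e He)) in H0.
      apply (Rmult_le_compat_l e) in L; lra. }
    nra. }
  assert (Z : (RtoC (2 * sqrt 2) * (Bper z + Ci * Aper z - Cper z))%C = RtoC 0).
  { apply Cmod_eq_0. apply Rle_antisym; [|apply Cmod_ge_0]. apply Rnot_lt_le. intros N.
    specialize (Est _ (Rdiv_lt_0_compat _ 2 N ltac:(lra))). lra. }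
  destruct (Ceq_dec (Bper z + Ci * Aper z - Cper z) (RtoC 0)) as [E|N].
  - transitivity ((Bper z + Ci * Aper z - Cper z) + (Cper z - Ci * Aper z))%C; [ring|]. rewrite E. ring.
  - exfalso. revert Z. apply Cmult_neq_0; [|easy]. intros E. apply RtoC_inj in E. lra.
Qed.

Theorem B_upper (z : C) : 0 < snd z -> (Bper z = Cper z + Ci * Aper z)%C.
Proof.
  intros Hz. rewrite <- (Cconj_conj z). assert (Hz' : snd (Cconj z) < 0) by (simpl; lra).
  set (w := Cconj z) in *. rewrite B_conj, C_conj, A_conj by (left; lra).
  rewrite B_lower by easy. apply injective_projections; simpl; ring.
Qed.

(** * The group Gamma(2) and the inverse of the modular function *)

Definition uhp (h : C) : Prop := 0 < snd h.

Record mat := Mat { mp : Z; mq : Z; mr : Z; ms : Z }.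

Definition mid : mat := Mat 1 0 0 1.
Definition mmul (M N : mat) : mat :=
  Mat (mp M * mp N + mq M * mr N) (mp M * mq N + mq M * ms N)
      (mr M * mp N + ms M * mr N) (mr M * mq N + ms M * ms N).
Definition minv (M : mat) : mat := Mat (ms M) (- mq M) (- mr M) (mp M).
Definition SL2 (M : mat) : Prop := (mp M * ms M - mq M * mr M = 1)%Z.

Definition Gam (M : mat) : Prop :=
  SL2 M /\ Z.Odd (mp M) /\ Z.Even (mq M) /\ Z.Even (mr M) /\ Z.Odd (ms M).

Definition ZtoC (n : Z) : C := RtoC (IZR n).
Definition mob (M : mat) (h : C) : C :=
  ((ZtoC (mp M) * h + ZtoC (mq M)) / (ZtoC (mr M) * h + ZtoC (ms M)))%C.

Lemma uhp_neq_0 (h : C) : uhp h -> h <> RtoC 0.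
Proof. intros H E. rewrite E in H. unfold uhp in H. simpl in H. lra. Qed.

Lemma SL2_R (M : mat) : SL2 M -> IZR (mp M) * IZR (ms M) - IZR (mq M) * IZR (mr M) = 1.
Proof. intros H. rewrite <- !mult_IZR, <- minus_IZR. f_equal. exact H. Qed.

Lemma mob_den (M : mat) (h : C) : SL2 M -> uhp h -> (ZtoC (mr M) * h + ZtoC (ms M) <> RtoC 0)%C.
Proof.
  intros HM Hh E. apply SL2_R in HM. unfold uhp in Hh.
  assert (E1 := f_equal fst E). assert (E2 := f_equal snd E). simpl in E1, E2.
  assert (Z : IZR (mr M) * snd h = 0) by lra. apply Rmult_integral in Z. destruct Z as [Z|Z]; [|lra].
  rewrite Z in *. assert (IZR (ms M) = 0) by lra. rewrite H in HM. lra.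
Qed.

Lemma mob_im (M : mat) (h : C) : SL2 M -> uhp h ->
  snd (mob M h) = snd h / (Cmod (ZtoC (mr M) * h + ZtoC (ms M)) * Cmod (ZtoC (mr M) * h + ZtoC (ms M))).
Proof.
  intros HM Hh. assert (N := mob_den M h HM Hh). apply SL2_R in HM.
  apply Cmod_gt_0 in N. rewrite Cmod_sq.
  assert (P : 0 < fst (ZtoC (mr M) * h + ZtoC (ms M))%C * fst (ZtoC (mr M) * h + ZtoC (ms M))%C
    + snd (ZtoC (mr M) * h + ZtoC (ms M))%C * snd (ZtoC (mr M) * h + ZtoC (ms M))%C)
    by (rewrite <- Cmod_sq; nra).
  unfold mob. destruct h as [x y]. simpl in *.
  transitivity ((IZR (mp M) * IZR (ms M) - IZR (mq M) * IZR (mr M)) * y /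
   ((IZR (mr M) * x - 0 * y + IZR (ms M)) * (IZR (mr M) * x - 0 * y + IZR (ms M)) +
    (IZR (mr M) * y + 0 * x + 0) * (IZR (mr M) * y + 0 * x + 0))).
  - field. nra.
  - rewrite HM. f_equal. ring.
Qed.

Lemma mob_uhp (M : mat) (h : C) : SL2 M -> uhp h -> uhp (mob M h).
Proof.
  intros HM Hh. unfold uhp. rewrite mob_im by easy.
  assert (N := mob_den M h HM Hh). apply Cmod_gt_0 in N. apply Rdiv_lt_0_compat; [easy|nra].
Qed.

Lemma ZtoC_plus (a b : Z) : ZtoC (a + b) = (ZtoC a + ZtoC b)%C.
Proof. unfold ZtoC. now rewrite plus_IZR, RtoC_plus. Qed.
Lemma ZtoC_mult (a b : Z) : ZtoC (a * b) = (ZtoC a * ZtoC b)%C.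
Proof. unfold ZtoC. now rewrite mult_IZR, RtoC_mult. Qed.
Lemma ZtoC_opp (a : Z) : ZtoC (- a) = (- ZtoC a)%C.
Proof. unfold ZtoC. now rewrite opp_IZR, RtoC_opp. Qed.

Lemma SL2_mul (M N : mat) : SL2 M -> SL2 N -> SL2 (mmul M N).
Proof.
  unfold SL2, mmul. simpl. intros H1 H2.
  transitivity ((mp M * ms M - mq M * mr M) * (mp N * ms N - mq N * mr N))%Z; [ring|].
  rewrite H1, H2. ring.
Qed.

Lemma mob_mul (M N : mat) (h : C) : SL2 M -> SL2 N -> uhp h -> mob (mmul M N) h = mob M (mob N h).
Proof.
  intros HM HN Hh. assert (D1 := mob_den N h HN Hh).
  assert (D2 := mob_den M _ HM (mob_uhp N h HN Hh)).
  assert (D3 := mob_den _ h (SL2_mul M N HM HN) Hh).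
  unfold mob in *. simpl in *. rewrite !ZtoC_plus, !ZtoC_mult in *.
  field. repeat split; auto.
  intros E. apply D3. rewrite <- E. ring.
Qed.

Lemma SL2_inv (M : mat) : SL2 M -> SL2 (minv M).
Proof. unfold SL2, minv. simpl. lia. Qed.

Lemma mob_id (h : C) : mob mid h = h.
Proof. unfold mob, mid, ZtoC. simpl. field. Qed.

Lemma mob_inv_l (M : mat) (h : C) : SL2 M -> uhp h -> mob (minv M) (mob M h) = h.
Proof.
  intros HM Hh. rewrite <- mob_mul; auto using SL2_inv.
  rewrite <- (mob_id h) at 2. f_equal. unfold SL2 in HM. unfold mmul, minv, mid. simpl. f_equal; lia.
Qed.

Lemma Gam_SL2 (M : mat) : Gam M -> SL2 M.
Proof. now intros [H _]. Qed.

Lemma Gam_id : Gam mid.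
Proof. unfold Gam, SL2, mid; simpl. repeat split; [now exists 0%Z|now exists 0%Z|now exists 0%Z|now exists 0%Z]. Qed.

Lemma Gam_inv (M : mat) : Gam M -> Gam (minv M).
Proof.
  intros (H1&H2&[q Hq]&[r Hr]&H5). split; [now apply SL2_inv|]. unfold minv. simpl.
  repeat split; auto; [exists (- q)%Z|exists (- r)%Z]; lia.
Qed.

Lemma Gam_mul (M N : mat) : Gam M -> Gam N -> Gam (mmul M N).
Proof.
  intros (H1&[p Hp]&[q Hq]&[r Hr]&[s Hs]) (H1'&[p' Hp']&[q' Hq']&[r' Hr']&[s' Hs']).
  split; [now apply SL2_mul|]. unfold mmul. simpl. rewrite Hp, Hq, Hr, Hs, Hp', Hq', Hr', Hs'. repeat split.
  - exists (2 * p * p' + p + p' + 2 * q * r')%Z. ring.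
  - exists ((2 * p + 1) * q' + q * (2 * s' + 1))%Z. ring.
  - exists (r * (2 * p' + 1) + (2 * s + 1) * r')%Z. ring.
  - exists (2 * r * q' + 2 * s * s' + s + s')%Z. ring.
Qed.

Definition gequiv (h1 h2 : C) : Prop := exists M, Gam M /\ h2 = mob M h1.

Lemma gequiv_refl (h : C) : gequiv h h.
Proof. exists mid. split; [apply Gam_id|now rewrite mob_id]. Qed.

Lemma gequiv_sym (h1 h2 : C) : uhp h1 -> gequiv h1 h2 -> gequiv h2 h1.
Proof.
  intros Hh (M & HM & ->). exists (minv M). split; [now apply Gam_inv|].
  now rewrite mob_inv_l by (auto; now apply Gam_SL2).
Qed.

Lemma gequiv_trans (h1 h2 h3 : C) : uhp h1 -> gequiv h1 h2 -> gequiv h2 h3 -> gequiv h1 h3.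
Proof.
  intros Hh (M & HM & ->) (N & HN & ->). exists (mmul N M). split; [now apply Gam_mul|].
  rewrite mob_mul; auto using Gam_SL2.
Qed.

Lemma gequiv_uhp (h1 h2 : C) : uhp h1 -> gequiv h1 h2 -> uhp h2.
Proof. intros Hh (M & HM & ->). apply mob_uhp; [now apply Gam_SL2|easy]. Qed.

(* Elements of the group have real fixed points, so that the quadratic form of a
   non-trivial one is bounded below on the upper half plane. *)
Lemma Gam_discrete (M : mat) (h : C) : Gam M -> uhp h ->
  Cmod (mob M h - h) < Rmin 1 (Rmin (snd h / 2) (snd h * snd h / 2)) -> forall k, mob M k = k.
Proof.
  intros HG Hh HL. assert (HM := Gam_SL2 _ HG).
  assert (L1 := Rlt_le_trans _ _ _ HL (Rmin_l _ _)).
  assert (L' := Rlt_le_trans _ _ _ HL (Rmin_r _ _)).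
  assert (L2 := Rlt_le_trans _ _ _ L' (Rmin_l _ _)).
  assert (L3 := Rlt_le_trans _ _ _ L' (Rmin_r _ _)). clear HL L'.
  assert (D := mob_den M h HM Hh). assert (EI := mob_im M h HM Hh).
  set (den := (ZtoC (mr M) * h + ZtoC (ms M))%C) in *. assert (Dp := proj1 (Cmod_gt_0 _) D).
  assert (HD2 : Cmod den * Cmod den < 2).
  { pose proof (snd_le_Cmod (mob M h - h)) as Q.
    change (snd (mob M h - h)%C) with (snd (mob M h) - snd h) in Q. apply Rabs_le_between in Q.
    unfold uhp in Hh. assert (snd h / 2 < snd (mob M h)) by lra. rewrite EI in H.
    apply (Rlt_div_r (snd h / 2) (snd h) (Cmod den * Cmod den)) in H; [|nra]. nra. }
  assert (HDen : Cmod den < 3 / 2) by nra.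
  assert (EQ : (ZtoC (mr M) * (h * h) + (ZtoC (ms M) - ZtoC (mp M)) * h - ZtoC (mq M) = - (mob M h - h) * den)%C).
  { unfold mob. fold den. transitivity (- (ZtoC (mp M) * h + ZtoC (mq M)) + h * den)%C.
    - unfold den. ring.
    - field. easy. }
  destruct HG as (Hdet & [p Hp] & [q Hq] & [r Hr] & [s Hs]). unfold SL2 in Hdet.
  destruct (Z.eq_dec (mr M) 0) as [R0|R0].
  - assert (Eps : mp M = ms M /\ (mp M = 1 \/ mp M = -1)%Z).
    { rewrite R0, Z.mul_0_r, Z.sub_0_r in Hdet. destruct (Z.mul_eq_1 _ _ Hdet) as [E|E]; rewrite E in Hdet; lia. }
    destruct Eps as [Eps E1].
    assert (Q0 : mq M = 0%Z).
    { assert (EC : Cmod (mob M h - h) = IZR (Z.abs (mq M))).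
      { unfold mob. rewrite <- Eps, R0. replace ((ZtoC (mp M) * h + ZtoC (mq M)) / (ZtoC 0 * h + ZtoC (mp M)) - h)%C
          with (ZtoC (mq M) / ZtoC (mp M))%C.
        - unfold ZtoC. rewrite Cmod_div, !Cmod_R, <- !abs_IZR.
          + destruct E1 as [-> | ->]; simpl; field.
          + intros E. apply RtoC_inj in E. destruct E1 as [X|X]; rewrite X in E; lra.
        - unfold ZtoC. field. intros E. apply RtoC_inj in E. destruct E1 as [X|X]; rewrite X in E; lra. }
      rewrite EC in L1. apply lt_IZR in L1. lia. }
    intros k. unfold mob. rewrite <- Eps, R0, Q0. unfold ZtoC. field.
    intros E. apply RtoC_inj in E. destruct E1 as [X|X]; rewrite X in E; lra.
  - exfalso.
    (* The trace is even, and it is not 0: otherwise minus an odd square would be 1 modulo 4. So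
       there are no elliptic elements. *)
    assert (Ht : (4 <= (mp M + ms M) * (mp M + ms M))%Z).
    { assert (T2 : (mp M + ms M = 2 * (p + s + 1))%Z) by lia.
      assert (p + s + 1 <> 0)%Z.
      { intros X. assert (Ep : (mp M = - ms M)%Z) by lia. rewrite Ep, Hq, Hr, Hs in Hdet.
        assert (4 * (s * s + s) + 4 * (q * r) = -2)%Z by lia. lia. }
      rewrite T2. nia. }
    apply IZR_le in Ht. rewrite mult_IZR, plus_IZR in Ht.
    assert (HdR : IZR (mp M) * IZR (ms M) - IZR (mq M) * IZR (mr M) = 1) by now apply SL2_R.
    assert (Hr2 : 1 <= IZR (mr M) * IZR (mr M)).
    { rewrite <- mult_IZR. apply (IZR_le 1). nia. }
    set (P := IZR (mp M)) in *. set (Q := IZR (mq M)) in *. set (Rr := IZR (mr M)) in *. set (S := IZR (ms M)) in *.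
    set (y := snd h) in *. set (x := fst h).
    (* Completing the square: 4 r times the quadratic form of the fixed points is (u + i b)^2 - k
       with discriminant k >= 0, and such a number has modulus at least b^2. *)
    set (u := (2 * Rr * x + S - P)). set (b := 2 * Rr * y). set (k := (P + S) * (P + S) - 4).
    assert (EF : (RtoC (4 * Rr) * (RtoC Rr * (h * h) + (RtoC S - RtoC P) * h - RtoC Q))%C =
      (u * u - b * b - k, 2 * u * b)).
    { unfold u, b, k, x, y. apply injective_projections; simpl; [|ring].
      replace 4 with (4 * 1) at 2 by ring. rewrite <- HdR. ring. }
    assert (Low : b * b <= Cmod (RtoC (4 * Rr) * (RtoC Rr * (h * h) + (RtoC S - RtoC P) * h - RtoC Q))).
    { rewrite EF. apply Cmod_ge_sq. simpl. assert (0 <= k) by (unfold k; lra).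
      assert (0 <= (u * u - k) * (u * u - k)) by apply Rle_0_sqr.
      assert (0 <= u * u) by apply Rle_0_sqr. assert (0 <= b * b) by apply Rle_0_sqr.
      assert (0 <= u * u * (b * b)) by now apply Rmult_le_pos. assert (0 <= k * (b * b)) by now apply Rmult_le_pos.
      lra. }
    change (RtoC Rr) with (ZtoC (mr M)) in Low. change (RtoC S) with (ZtoC (ms M)) in Low.
    change (RtoC P) with (ZtoC (mp M)) in Low. change (RtoC Q) with (ZtoC (mq M)) in Low.
    rewrite EQ, Cmod_RtoC_mult, Cmod_mult, Cmod_opp in Low.
    assert (Hab : Rabs (4 * Rr) <= 4 * (Rr * Rr)).
    { pose proof (Rsqr_abs Rr) as A. unfold Rsqr in A. rewrite Rabs_mult, (Rabs_right 4), A by lra.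
      assert (1 <= Rabs Rr) by (pose proof (Rabs_pos Rr); nra). pose proof (Rabs_pos Rr). nra. }
    pose proof (Cmod_ge_0 (mob M h - h)).
    assert (Hprod : Cmod (mob M h - h) * Cmod den < y * y).
    { assert (0 < y * y) by (unfold uhp in Hh; fold y in Hh; nra). nra. }
    assert (Rabs (4 * Rr) * (Cmod (mob M h - h) * Cmod den) <= 4 * (Rr * Rr) * (Cmod (mob M h - h) * Cmod den)).
    { apply Rmult_le_compat_r; [|easy]. apply Rmult_le_pos; lra. }
    assert (4 * (Rr * Rr) * (Cmod (mob M h - h) * Cmod den) < 4 * (Rr * Rr) * (y * y)).
    { apply Rmult_lt_compat_l; lra. }
    unfold b in Low. lra.
Qed.

(** * Period ratios as branches of the inverse *)

(** [tau1] is the branch on the plane without the rays (-infinity, -1] and [1, infinity). [tau2] is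
    holomorphic across (1, infinity) and differs from [tau1] by 1 above the ray and by -1 below it,
    so it describes the continuation of [tau1] through the ray. *)
Definition tau1 (z : C) : C := (Ci * Bper z / Aper z)%C.
Definition tau2 (z : C) : C := (Ci * Cper z / Aper z)%C.
Definition Smat : mat := Mat 0 (-1) 1 0.
Definition sm (h : C) : C := (- / h)%C.

(* One value of the multivalued inverse of the modular function at each point of C \ {-1, 1}. *)
Definition Tm (x : C) : C :=
  if excluded_middle_informative (snd x <> 0 \/ -1 < fst x < 1) then tau1 x
  else if Rlt_dec 1 (fst x) then (tau2 x + RtoC 1)%C else sm (tau2 (- x) + RtoC 1)%C.

Lemma sm_mob (h : C) : uhp h -> sm h = mob Smat h.
Proof.
  intros H. apply uhp_neq_0 in H. unfold sm, mob, Smat, ZtoC. simpl. field. easy.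
Qed.

Lemma SL2_S : SL2 Smat.
Proof. reflexivity. Qed.

Lemma sm_uhp (h : C) : uhp h -> uhp (sm h).
Proof. intros H. rewrite sm_mob by easy. now apply mob_uhp. Qed.

Lemma sm_sm (h : C) : uhp h -> sm (sm h) = h.
Proof.
  intros H. apply uhp_neq_0 in H. unfold sm. field. 
  repeat split; auto. 
Qed.

Lemma tau1_uhp (z : C) : snd z <> 0 \/ -1 < fst z < 1 -> uhp (tau1 z).
Proof.
  intros H. assert (P := BA_pos z H). assert (N := A_neq_0 z H). unfold uhp, tau1.
  apply Cmod_gt_0 in N. assert (Q : 0 < Cmod (Aper z) * Cmod (Aper z)) by nra. rewrite Cmod_sq in Q.
  destruct (Aper z) as [a1 a2]. destruct (Bper z) as [b1 b2]. simpl in *.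
  match goal with |- 0 < ?X => replace X with ((b1 * a1 - b2 * - a2) / (a1 * a1 + a2 * a2)) by (field; lra) end.
  now apply Rdiv_lt_0_compat.
Qed.

(** Negating z exchanges the periods A and B, and i A / B is the negative inverse of i B / A. *)
Lemma tau1_opp (z : C) : snd z <> 0 \/ -1 < fst z < 1 -> tau1 (- z) = sm (tau1 z).
Proof.
  intros H. assert (H' : snd (- z)%C <> 0 \/ -1 < fst (- z)%C < 1) by (simpl; destruct H; [left|right]; lra).
  assert (N := A_neq_0 z H). assert (N' := A_neq_0 _ H').
  unfold tau1, sm. unfold Aper in *. replace (- - z)%C with z in * by ring.
  assert (NC : Ci <> RtoC 0) by (intros E; apply (f_equal snd) in E; simpl in E; lra).
  transitivity (- / Ci * (Bper (- z) / Bper z))%C; [rewrite Ci_inv|]; field; repeat split; auto.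
Qed.

Lemma tau2_upper (z : C) : 0 < snd z -> (tau1 z = tau2 z - RtoC 1)%C.
Proof.
  intros H. assert (N := A_neq_0 z ltac:(left; lra)). unfold tau1, tau2. rewrite B_upper by easy.
  assert (CC1 : (Ci * Ci = - RtoC 1)%C) by Ceq.
  transitivity (Ci * Cper z / Aper z + (Ci * Ci))%C; [field; easy|]. rewrite CC1. ring.
Qed.

Lemma tau2_lower (z : C) : snd z < 0 -> (tau1 z = tau2 z + RtoC 1)%C.
Proof.
  intros H. assert (N := A_neq_0 z ltac:(left; lra)). unfold tau1, tau2. rewrite B_lower by easy.
  assert (CC1 : (Ci * Ci = - RtoC 1)%C) by Ceq.
  transitivity (Ci * Cper z / Aper z - (Ci * Ci))%C; [field; easy|]. rewrite CC1. ring.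
Qed.

Lemma rsq_re_pos (w : C) : slit w -> 0 < fst (rsq w).
Proof.
  intros H. assert (P := csqrt_re_pos w H). unfold rsq. destruct (csqrt w) as [a b]. simpl in *.
  apply Rdiv_lt_0_compat; nra.
Qed.

Lemma PInt_re_pos (alpha beta : R -> R) (a b : R) (z : C) : a < b ->
  (forall t, a <= t <= b -> slit (RtoC (alpha t) + RtoC (beta t) * z)) ->
  (forall t, a <= t <= b -> continuous alpha t) -> (forall t, a <= t <= b -> continuous beta t) ->
  0 < fst (PInt alpha beta a b z).
Proof.
  intros Hab H Ca Cb. replace (PInt alpha beta a b z) with (PInt alpha beta a b z * RtoC 1)%C by ring.
  apply CI_re_pos; [easy|now apply PInt_rcont|]. intros t Ht.
  replace (rsq (RtoC (alpha t) + RtoC (beta t) * z) * RtoC 1)%C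
    with (rsq (RtoC (alpha t) + RtoC (beta t) * z)) by ring.
  apply rsq_re_pos, H. lra.
Qed.

Lemma A_re_pos (z : C) : snd z <> 0 \/ -1 < fst z -> 0 < fst (Aper z).
Proof.
  intros H. apply (PInt_re_pos (fun u => 1 + u ^ 4) (fun u => - 2 * u ^ 2) 0 1 (- z)%C); [lra| |cont_d|cont_d].
  intros. apply slit_B; [|easy].
  simpl. destruct H; [left|right]; lra.
Qed.

Lemma C_re_pos (z : C) : snd z <> 0 \/ 1 < fst z -> 0 < fst (Cper z).
Proof.
  intros H. unfold Cper.
  assert (P : 0 < fst (PInt (fun t => - cos t) (fun _ => 1) 0 PI z)).
  { apply (PInt_re_pos (fun t => - cos t) (fun _ => 1) 0 PI z); [apply PI_RGT_0| |cont_d|cont_d]. intros. now apply slit_C. }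
  unfold Cdiv. assert (S2 : 0 < sqrt 2) by (apply sqrt_lt_R0; lra).
  rewrite <- RtoC_inv by lra.
  rewrite (re_scal_r (PInt (fun t => - cos t) (fun _ => 1) 0 PI z) (/ (2 * sqrt 2)) : fst _ = _).
  apply Rmult_lt_0_compat; [easy|]. apply Rinv_0_lt_compat. lra.
Qed.

Lemma real_conj (z : C) : snd z = 0 -> Cconj z = z.
Proof. intros H. unfold Cconj. rewrite H. Ceq. lra. Qed.

Lemma conj_real (z : C) : z = Cconj z -> snd z = 0.
Proof. intros H. apply (f_equal snd) in H. simpl in H. lra. Qed.

Lemma A_real (z : C) : snd z = 0 -> -1 < fst z -> snd (Aper z) = 0.
Proof. intros H1 H2. apply conj_real. rewrite <- A_conj by (right; lra). now rewrite real_conj. Qed.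

Lemma B_real (z : C) : snd z = 0 -> fst z < 1 -> snd (Bper z) = 0.
Proof. intros H1 H2. apply conj_real. rewrite <- B_conj by (right; lra). now rewrite real_conj. Qed.

Lemma C_real (z : C) : snd z = 0 -> 1 < fst z -> snd (Cper z) = 0.
Proof. intros H1 H2. apply conj_real. rewrite <- C_conj by (right; lra). now rewrite real_conj. Qed.

Lemma tau1_real (z : C) : snd z = 0 -> -1 < fst z < 1 -> fst (tau1 z) = 0.
Proof.
  intros H1 H2. assert (EA := A_real z H1 ltac:(lra)). assert (EB := B_real z H1 ltac:(lra)).
  unfold tau1. destruct (Aper z) as [a1 a2]. destruct (Bper z) as [b1 b2]. simpl in *. subst. 
  unfold Rdiv. ring.
Qed.

(** On the imaginary axis -z is the conjugate of z, so the two periods are conjugate and their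
    quotient has modulus 1. *)
Lemma tau1_imag (z : C) : fst z = 0 -> Cmod (tau1 z) = 1.
Proof.
  intros H. assert (N := A_neq_0 z ltac:(right; lra)).
  assert (E : Aper z = Cconj (Bper z)).
  { unfold Aper. rewrite <- B_conj by (right; lra). f_equal. Ceq. lra. }
  pose proof Cmod_Ci as CiM.
  unfold tau1. rewrite Cmod_div, Cmod_mult, CiM by easy. rewrite E in N |- *. rewrite Cmod_conj.
  apply Cmod_gt_0 in N. rewrite Cmod_conj in N. field. lra.
Qed.

Lemma tau1_0 : tau1 (RtoC 0) = Ci.
Proof.
  assert (N := A_neq_0 (RtoC 0) ltac:(right; simpl; lra)). unfold tau1, Aper in *.
  replace (- RtoC 0)%C with (RtoC 0) in * by ring. field. easy.
Qed.

(** The continuation of [tau1] from the lower half-plane across (1, infinity). Above the ray it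
    exceeds [tau1] by 2, the parabolic generator attached to the puncture 1. *)
Definition sig2 (z : C) : C := (tau2 z + RtoC 1)%C.

Lemma Gam_shift (n : Z) : Gam (Mat 1 (2 * n) 0 1).
Proof.
  split; [unfold SL2; cbv [mp mq mr ms]; ring|].
  split; [now exists 0%Z|split; [now exists n|split; [now exists 0%Z|now exists 0%Z]]].
Qed.

Lemma mob_shift (n : Z) (h : C) : (mob (Mat 1 (2 * n) 0 1) h = h + RtoC 2 * ZtoC n)%C.
Proof. unfold mob. cbv [mp mq mr ms]. rewrite ZtoC_mult. unfold ZtoC. field. Qed.

Lemma sig2_spec (z : C) : 1 < fst z -> uhp (sig2 z) /\ hol sig2 z /\
  (snd z = 0 -> Tm z = sig2 z) /\ (snd z < 0 -> tau1 z = sig2 z) /\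
  (0 < snd z -> sig2 z = tau1 z + RtoC 2)%C.
Proof.
  intros Hz.
  assert (NA : Aper z <> RtoC 0).
  { intros E. assert (P := A_re_pos z ltac:(right; lra)). rewrite E in P. simpl in P. lra. }
  assert (P4 : snd z < 0 -> tau1 z = sig2 z) by (intros; now apply tau2_lower).
  assert (P5 : (0 < snd z -> sig2 z = tau1 z + RtoC 2)%C).
  { intros. rewrite tau2_upper by easy. unfold sig2. Ceq. }
  split; [|split; [|split; [|split]]]; auto.
  - destruct (Rtotal_order (snd z) 0) as [L|[E|L]].
    + rewrite <- P4 by easy. apply tau1_uhp. left. lra.
    + unfold sig2, tau2. assert (EA := A_real z E ltac:(lra)). assert (EC := C_real z E Hz).
      assert (PA := A_re_pos z ltac:(right; lra)). assert (PC := C_re_pos z ltac:(right; lra)).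
      unfold uhp. destruct (Aper z) as [a1 a2]. destruct (Cper z) as [c1 c2]. simpl in *. subst.
      match goal with |- 0 < ?X => replace X with (c1 / a1) by (field; lra) end.
      now apply Rdiv_lt_0_compat.
    + rewrite P5 by easy. assert (U := tau1_uhp z ltac:(left; lra)). unfold uhp in *. change (0 < snd (tau1 z) + 0). lra.
  - unfold sig2, tau2. apply hol_plus; [|apply hol_const]. apply hol_div; [|apply hol_A; right; lra|easy].
    apply hol_mult; [apply hol_const|]. apply hol_C. right. lra.
  - intros E. unfold Tm. destruct (excluded_middle_informative (snd z <> 0 \/ -1 < fst z < 1)) as [X|X]; [destruct X; lra|].
    destruct (Rlt_dec 1 (fst z)); [easy|lra].
Qed.

Lemma Tm_tau1 (x : C) : snd x <> 0 \/ -1 < fst x < 1 -> Tm x = tau1 x.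
Proof.
  intros H. unfold Tm. destruct (excluded_middle_informative (snd x <> 0 \/ -1 < fst x < 1)); easy.
Qed.

Lemma X_cases (x : C) : Xdom x -> (snd x <> 0 \/ -1 < fst x < 1) \/ (snd x = 0 /\ 1 < fst x) \/ (snd x = 0 /\ fst x < -1).
Proof.
  intros [H1 H2]. destruct (Req_dec (snd x) 0) as [E|E]; [|auto].
  assert (fst x <> -1) by (intros F; apply H1; destruct x; simpl in *; now subst).
  assert (fst x <> 1) by (intros F; apply H2; destruct x; simpl in *; now subst).
  destruct (Rlt_dec 1 (fst x)); [auto|]. destruct (Rlt_dec (fst x) (-1)); [auto|].
  left. right. lra.
Qed.

Lemma Tm_left (x : C) : snd x = 0 -> fst x < -1 -> Tm x = sm (sig2 (- x)).
Proof.
  intros H1 H2. unfold Tm. destruct (excluded_middle_informative (snd x <> 0 \/ -1 < fst x < 1)) as [X|X]; [destruct X; lra|].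
  destruct (Rlt_dec 1 (fst x)); [lra|easy].
Qed.

Lemma Tm_uhp (x : C) : Xdom x -> uhp (Tm x).
Proof.
  intros H. destruct (X_cases x H) as [H1|[[H1 H2]|[H1 H2]]].
  - rewrite Tm_tau1 by easy. now apply tau1_uhp.
  - destruct (sig2_spec x H2) as (U&_&E&_). rewrite E; auto.
  - rewrite Tm_left by easy. apply sm_uhp, sig2_spec. simpl. lra.
Qed.

Lemma Tm_opp (x : C) : Xdom x -> Tm (- x) = sm (Tm x).
Proof.
  intros H. destruct (X_cases x H) as [H1|[[H1 H2]|[H1 H2]]].
  - rewrite !Tm_tau1; [now apply tau1_opp|easy|simpl; destruct H1; [left|right]; lra].
  - rewrite Tm_left by (simpl; lra). replace (- - x)%C with x by ring.
    destruct (sig2_spec x H2) as (_&_&E&_). now rewrite E.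
  - rewrite (Tm_left x) by easy. destruct (sig2_spec (- x)%C ltac:(simpl; lra)) as (U&_&E&_).
    rewrite E by (simpl; lra). now rewrite sm_sm.
Qed.

Lemma Xdom_intro (x : C) : snd x <> 0 \/ fst x <> 1 /\ fst x <> -1 -> Xdom x.
Proof. intros H. split; intros E; rewrite E in H; simpl in H; lra. Qed.

(** The branches are [tau1] off the two rays, [sig2] across (1, infinity), and, by the symmetry z ->
    -z, [sm] of [sig2] across (-infinity, -1). Equivalence to [Tm] on both sides of a ray is the
    only compatibility that later arguments use. *)
Theorem section (x0 : C) : Xdom x0 -> exists r sigma, 0 < r /\ forall x, Cmod (x - x0) < r ->
  Xdom x /\ uhp (sigma x) /\ gequiv (Tm x) (sigma x) /\ hol sigma x.
Proof.
  assert (Loc : forall x x0 : C, -(Cmod (x - x0)) <= fst x - fst x0 <= Cmod (x - x0) /\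
    -(Cmod (x - x0)) <= snd x - snd x0 <= Cmod (x - x0)).
  { intros x y. pose proof (fst_le_Cmod (x - y)) as Q1. pose proof (snd_le_Cmod (x - y)) as Q2. simpl in Q1, Q2.
    apply Rabs_le_between in Q1, Q2. lra. }
  assert (T1 : forall x, snd x <> 0 \/ -1 < fst x < 1 ->
    Xdom x /\ uhp (tau1 x) /\ gequiv (Tm x) (tau1 x) /\ hol tau1 x).
  { intros x Hx. split; [apply Xdom_intro; lra|]. split; [now apply tau1_uhp|].
    split; [rewrite Tm_tau1 by easy; apply gequiv_refl|].
    unfold tau1. apply hol_div; [|apply hol_A; lra|now apply A_neq_0].
    apply hol_mult; [apply hol_const|apply hol_B; lra]. }
  intros H. destruct (X_cases x0 H) as [[H1|H1]|[[H1 H2]|[H1 H2]]].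
  - exists (Rabs (snd x0)), tau1. split; [now apply Rabs_pos_lt|]. intros x Hx. apply T1. left.
    destruct (Loc x x0) as [_ L]. intros E. rewrite E in L. revert Hx. apply Rle_not_lt.
    apply Rabs_le. lra.
  - exists (Rmin (1 - fst x0) (fst x0 + 1)), tau1. split; [apply Rmin_glb_lt; lra|]. intros x Hx.
    apply T1. right. destruct (Loc x x0) as [L _].
    pose proof (Rmin_l (1 - fst x0) (fst x0 + 1)). pose proof (Rmin_r (1 - fst x0) (fst x0 + 1)). lra.
  - exists (fst x0 - 1), sig2. split; [lra|]. intros x Hx. destruct (Loc x x0) as [L _].
    assert (Hf : 1 < fst x) by lra. destruct (sig2_spec x Hf) as (U & Hh & E1 & E2 & E3).
    split; [apply Xdom_intro; lra|]. split; [easy|]. split; [|easy].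
    destruct (Rtotal_order (snd x) 0) as [N|[N|N]].
    + rewrite Tm_tau1, E2 by lra. apply gequiv_refl.
    + rewrite E1 by easy. apply gequiv_refl.
    + rewrite Tm_tau1, E3 by lra. exists (Mat 1 (2 * 1) 0 1). split; [apply Gam_shift|].
      rewrite mob_shift. unfold ZtoC. Ceq.
  - exists (- 1 - fst x0), (fun x => sm (sig2 (- x))). split; [lra|]. intros x Hx. destruct (Loc x x0) as [L _].
    assert (Hf : 1 < fst (- x)%C) by (simpl; lra). destruct (sig2_spec (- x)%C Hf) as (U & Hh & E1 & E2 & E3).
    split; [apply Xdom_intro; simpl in Hf; lra|]. split; [now apply sm_uhp|]. split.
    + destruct (Rtotal_order (snd x) 0) as [N|[N|N]].
      * rewrite Tm_tau1 by lra. assert (U1 := tau1_uhp x ltac:(lra)).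
        rewrite E3 by (simpl; lra). rewrite tau1_opp by lra.
        (* The translation by 2 conjugated by S, up to sign. *)
        exists (Mat (-1) 0 2 (-1)). split.
        { split; [easy|]. split; [now exists (-1)%Z|split; [now exists 0%Z|split; [now exists 1%Z|now exists (-1)%Z]]]. }
        assert (D := mob_den (Mat (-1) 0 2 (-1)) (tau1 x) eq_refl U1). simpl in D.
        assert (N0 := uhp_neq_0 _ U1). unfold sm, mob, ZtoC in *. simpl in *.
        field. split; [exact D|exact N0].
      * rewrite Tm_left by (simpl in Hf; lra). apply gequiv_refl.
      * rewrite Tm_tau1 by lra. rewrite <- E2 by (simpl; lra). rewrite tau1_opp by lra.
        rewrite sm_sm by (apply tau1_uhp; lra). apply gequiv_refl.
    + unfold sm. apply hol_opp, hol_inv; [|now apply uhp_neq_0].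
      apply (hol_comp Copp sig2); [apply (hol_opp (fun w => w)), hol_id|easy].
Qed.

(** * Lifting to the upper half-plane *)

Definition seg (a b t : R) : Prop := a <= t <= b.
Definition rect (a b c d : R) (z : C) : Prop := a <= fst z <= b /\ c <= snd z <= d.
Definition pcont (a b : R) (g : R -> C) : Prop := forall t, seg a b t -> ctat dR (seg a b) g t.

Lemma cont_at (D : C -> Prop) (f : C -> C) (z : C) : cont_on D f -> D z -> ctat dC D f z.
Proof. intros H Dz. exact (H z Dz). Qed.

(** If the functions agree at s, then by continuity [f2 t] is close to [f1 t]; but it is also M (f1
    t) with M in the group, and [Gam_discrete] forces M to act trivially. *)
Lemma equal_near (X : Type) (d : X -> X -> R) (D : X -> Prop) (f1 f2 : X -> C) (m : X) :
  D m -> ctat d D f1 m -> ctat d D f2 m ->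
  (forall t, D t -> uhp (f1 t) /\ gequiv (f1 t) (f2 t)) ->
  exists delta, 0 < delta /\ forall s t, D s -> D t -> d s m < delta -> d t m < delta ->
    f1 s = f2 s -> f1 t = f2 t.
Proof.
  intros Dm C1 C2 H. destruct (H m Dm) as [U _]. unfold uhp in U. set (y := snd (f1 m)) in *.
  (* Four differences of size [e] add up, and the imaginary part of [f1 t] is at least y / 2; so
     [4 * e] lies below the threshold of [Gam_discrete] at [f1 t]. *)
  set (e := Rmin 1 (Rmin (y / 4) (y * y / 8)) / 4).
  assert (Hy2 : 0 < y * y) by nra.
  assert (He : 0 < e) by (unfold e; assert (0 < Rmin 1 (Rmin (y / 4) (y * y / 8)))
    by (repeat apply Rmin_glb_lt; lra); lra).
  assert (He1 : 4 * e <= 1 /\ 4 * e <= y / 4 /\ 4 * e <= y * y / 8).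
  { unfold e. pose proof (Rmin_l 1 (Rmin (y / 4) (y * y / 8))). pose proof (Rmin_r 1 (Rmin (y / 4) (y * y / 8))).
    pose proof (Rmin_l (y / 4) (y * y / 8)). pose proof (Rmin_r (y / 4) (y * y / 8)). lra. }
  destruct (C1 e He) as (d1 & P1 & Q1). destruct (C2 e He) as (d2 & P2 & Q2).
  exists (Rmin d1 d2). split; [now apply Rmin_glb_lt|].
  intros s t Ds Dt Ls Lt E. pose proof (Rmin_l d1 d2). pose proof (Rmin_r d1 d2).
  destruct (H t Dt) as [Ut (M & HM & E2)]. 
  assert (X1 := Q1 s Ds ltac:(lra)). assert (X2 := Q1 t Dt ltac:(lra)).
  assert (X3 := Q2 s Ds ltac:(lra)). assert (X4 := Q2 t Dt ltac:(lra)).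
  assert (B : Cmod (f2 t - f1 t) < 4 * e).
  { replace (f2 t - f1 t)%C with ((f2 t - f2 m) - (f2 s - f2 m) + ((f1 s - f1 m) - (f1 t - f1 m)))%C
      by (rewrite E; ring).
    eapply Rle_lt_trans; [apply Cmod_triangle|].
    pose proof (Cmod_minus_le (f2 t - f2 m) (f2 s - f2 m)).
    pose proof (Cmod_minus_le (f1 s - f1 m) (f1 t - f1 m)). lra. }
  rewrite E2 in B. rewrite E2. symmetry. apply Gam_discrete with (h := f1 t); [easy|easy|].
  pose proof (snd_le_Cmod (f1 t - f1 m)) as Z.
  change (snd (f1 t - f1 m)%C) with (snd (f1 t) - y) in Z. apply Rabs_le_between in Z.
  set (yt := snd (f1 t)) in *.
  assert (y / 2 <= yt) by lra.
  assert (y * y / 4 <= yt * yt) by nra.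
  repeat apply Rmin_glb_lt; lra.
Qed.

Lemma unique_01 (f1 f2 : R -> C) : pcont 0 1 f1 -> pcont 0 1 f2 ->
  (forall t, seg 0 1 t -> uhp (f1 t) /\ gequiv (f1 t) (f2 t)) -> f1 0 = f2 0 -> f1 1 = f2 1.
Proof.
  intros C1 C2 H E0.
  assert (K : f1 0 = f2 0 -> forall t, 0 <= t <= 1 -> f1 t = f2 t); [|apply K; [easy|lra]].
  (* The second side is degenerate, so this is bisection of [0, 1]. *)
  apply (nested_rectangles (fun a b _ _ => f1 a = f2 a -> forall t, a <= t <= b -> f1 t = f2 t) 0 1 0 0);
    [lra|lra| |].
  - intros a b c d H1 H2 H3 _ _ _ I1 I2 _ _ E t Ht. 
    destruct (Rle_dec t ((a + b) / 2)); [apply I1; auto; lra|]. apply I2; [|lra]. apply I1; [easy|lra].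
  - intros x y Hx _. destruct (equal_near R dR (seg 0 1) f1 f2 x Hx (C1 x Hx) (C2 x Hx) H) as (dl & Hd & Hn).
    exists dl. split; [easy|]. intros a b _ _ Ha Hb _ _ L _ E t Ht.
    apply (Hn a t); auto; unfold seg, dR; try lra; apply Rabs_def1; lra.
Qed.

Definition convex (D : C -> Prop) : Prop :=
  forall z w s, D z -> D w -> 0 <= s <= 1 -> D (z + RtoC s * (w - z))%C.

Lemma segment_lip (z w : C) (s t : R) :
  dC (z + RtoC s * (w - z)) (z + RtoC t * (w - z)) <= (Cmod (w - z) + 1) * dR s t.
Proof.
  unfold dC, dR. replace (z + RtoC s * (w - z) - (z + RtoC t * (w - z)))%C with (RtoC (s - t) * (w - z))%C.
  - rewrite Cmod_RtoC_mult. pose proof (Rabs_pos (s - t)). lra.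
  - rewrite RtoC_minus. ring.
Qed.

Lemma segment_pcont (D : C -> Prop) (f : C -> C) (z w : C) :
  convex D -> cont_on D f -> D z -> D w -> pcont 0 1 (fun s => f (z + RtoC s * (w - z))%C).
Proof.
  intros HD Hf Dz Dw t Ht.
  apply (ctat_pre dR dC (seg 0 1) D (fun s => (z + RtoC s * (w - z))%C) f t (Cmod (w - z) + 1)).
  - pose proof (Cmod_ge_0 (w - z)). lra.
  - intros s _. apply segment_lip.
  - intros s Hs. now apply HD.
  - apply cont_at; [easy|now apply HD].
Qed.

Lemma lift_unique (D : C -> Prop) (f1 f2 : C -> C) (z0 : C) :
  convex D -> cont_on D f1 -> cont_on D f2 ->
  (forall z, D z -> uhp (f1 z) /\ gequiv (f1 z) (f2 z)) -> D z0 -> f1 z0 = f2 z0 ->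
  forall z, D z -> f1 z = f2 z.
Proof.
  intros HD C1 C2 H D0 E0 z Dz.
  assert (K := unique_01 (fun s => f1 (z0 + RtoC s * (z - z0))%C) (fun s => f2 (z0 + RtoC s * (z - z0))%C)
    (segment_pcont D f1 z0 z HD C1 D0 Dz) (segment_pcont D f2 z0 z HD C2 D0 Dz)
    ltac:(intros t Ht; apply H; now apply HD)).
  simpl in K. replace (z0 + RtoC 0 * (z - z0))%C with z0 in K by ring.
  replace (z0 + RtoC 1 * (z - z0))%C with z in K by ring. auto.
Qed.

(* A continuous branch over D of the inverse of the modular function, along x. *)
Definition lift (D : C -> Prop) (x phi : C -> C) : Prop :=
  cont_on D phi /\ forall z, D z -> gequiv (Tm (x z)) (phi z).

Lemma lift_gequiv (x : C) (h1 h2 : C) : Xdom x -> gequiv (Tm x) h1 -> gequiv (Tm x) h2 -> uhp h1 /\ gequiv h1 h2.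
Proof.
  intros Hx E1 E2. assert (U := Tm_uhp x Hx). split; [now apply (gequiv_uhp (Tm x))|].
  apply (gequiv_trans h1 (Tm x) h2); auto. now apply (gequiv_uhp (Tm x)). now apply gequiv_sym.
Qed.

Lemma lift_eq (D : C -> Prop) (x f1 f2 : C -> C) (z0 : C) :
  convex D -> (forall z, D z -> Xdom (x z)) -> lift D x f1 -> lift D x f2 -> D z0 -> f1 z0 = f2 z0 ->
  forall z, D z -> f1 z = f2 z.
Proof.
  intros HD HX [C1 L1] [C2 L2] D0 E0. apply (lift_unique D f1 f2 z0); auto.
  intros z Dz. apply (lift_gequiv (x z)); auto.
Qed.

Lemma hol_mob (M : mat) (h : C) : SL2 M -> uhp h -> hol (mob M) h.
Proof.
  intros HM Hh. unfold mob. apply hol_div.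
  - apply hol_plus; [apply hol_mult; [apply hol_const|apply hol_id]|apply hol_const].
  - apply hol_plus; [apply hol_mult; [apply hol_const|apply hol_id]|apply hol_const].
  - now apply mob_den.
Qed.

(** The starting point and the starting value are arbitrary: a lift over one piece has to be
    continued into the next one from whatever value it takes at a common point. *)
Definition liftable (x : C -> C) (D : C -> Prop) : Prop :=
  forall z0 h0, D z0 -> gequiv (Tm (x z0)) h0 -> exists phi, lift D x phi /\ phi z0 = h0.

Lemma cont_glue (D : C -> Prop) (g : C -> R) (m : R) (f1 f2 : C -> C) :
  (forall z w, Rabs (g z - g w) <= dC z w) ->
  cont_on (fun z => D z /\ g z <= m) f1 -> cont_on (fun z => D z /\ m <= g z) f2 ->
  (forall z, D z -> g z = m -> f1 z = f2 z) ->
  cont_on D (fun z => if Rle_dec (g z) m then f1 z else f2 z).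
Proof.
  intros Hg C1 C2 E z Dz e He.
  destruct (Rtotal_order (g z) m) as [L|[L|L]].
  - destruct (C1 z (conj Dz (Rlt_le _ _ L)) e He) as (dl & Hd & H).
    exists (Rmin dl (m - g z)). split; [apply Rmin_glb_lt; lra|]. intros w Dw Lw.
    pose proof (Rmin_l dl (m - g z)). pose proof (Rmin_r dl (m - g z)).
    specialize (Hg w z). unfold dC in Hg. apply Rabs_le_between in Hg.
    destruct (Rle_dec (g w) m); [|lra]. destruct (Rle_dec (g z) m); [|lra].
    apply H; [easy|lra].
  - destruct (C1 z (conj Dz (Req_le _ _ L)) e He) as (d1 & Hd1 & H1).
    destruct (C2 z (conj Dz (Req_le _ _ (eq_sym L))) e He) as (d2 & Hd2 & H2).
    exists (Rmin d1 d2). split; [now apply Rmin_glb_lt|]. intros w Dw Lw.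
    pose proof (Rmin_l d1 d2). pose proof (Rmin_r d1 d2).
    destruct (Rle_dec (g z) m); [|lra].
    destruct (Rle_dec (g w) m); [apply H1; [easy|lra]|].
    rewrite E by easy. apply H2; [split; [easy|lra]|lra].
  - destruct (C2 z (conj Dz (Rlt_le _ _ L)) e He) as (dl & Hd & H).
    exists (Rmin dl (g z - m)). split; [apply Rmin_glb_lt; lra|]. intros w Dw Lw.
    pose proof (Rmin_l dl (g z - m)). pose proof (Rmin_r dl (g z - m)).
    specialize (Hg w z). unfold dC in Hg. apply Rabs_le_between in Hg.
    destruct (Rle_dec (g w) m); [lra|]. destruct (Rle_dec (g z) m); [lra|].
    apply H; [split; [easy|lra]|lra].
Qed.

Lemma cont_on_subset (D D' : C -> Prop) (f : C -> C) :
  (forall z, D' z -> D z) -> cont_on D f -> cont_on D' f.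
Proof. intros H Hf z Dz. apply (ctat_subset dC D D'); auto. apply cont_at; auto. Qed.

(** The lift over one piece prescribes the value at [z1] for the other. The common line is convex,
    so uniqueness makes the two lifts agree on all of it, and they join continuously. *)
Lemma liftable_glue (x : C -> C) (D : C -> Prop) (g : C -> R) (m : R) (z1 : C) :
  (forall z w, Rabs (g z - g w) <= dC z w) ->
  (forall z, D z -> Xdom (x z)) -> convex (fun z => D z /\ g z = m) -> D z1 -> g z1 = m ->
  liftable x (fun z => D z /\ g z <= m) -> liftable x (fun z => D z /\ m <= g z) -> liftable x D.
Proof.
  intros Hg HX HC D1 G1 L1 L2 z0 h0 D0 E0.
  assert (K : forall p1 p2, lift (fun z => D z /\ g z <= m) x p1 -> lift (fun z => D z /\ m <= g z) x p2 ->
    p1 z1 = p2 z1 -> lift D x (fun z => if Rle_dec (g z) m then p1 z else p2 z)).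
  { intros p1 p2 [C1 Q1] [C2 Q2] E.
    assert (Ag : forall z, D z -> g z = m -> p1 z = p2 z).
    { intros z Dz Gz. apply (lift_eq (fun z => D z /\ g z = m) x p1 p2 z1); auto.
      - intros w [Dw _]. auto.
      - split; [|intros w [Dw Gw]; apply Q1; split; [easy|lra]].
        apply (cont_on_subset (fun z => D z /\ g z <= m)); [|easy]. intros w [Dw Gw]; split; [easy|lra].
      - split; [|intros w [Dw Gw]; apply Q2; split; [easy|lra]].
        apply (cont_on_subset (fun z => D z /\ m <= g z)); [|easy]. intros w [Dw Gw]; split; [easy|lra]. }
    split; [now apply cont_glue|]. intros z Dz. destruct (Rle_dec (g z) m); [now apply Q1|].
    apply Q2. split; [easy|lra]. }
  destruct (Rle_dec (g z0) m) as [G0|G0].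
  - destruct (L1 z0 h0 (conj D0 G0) E0) as (p1 & Lp1 & Ep1).
    destruct (L2 z1 (p1 z1)) as (p2 & Lp2 & Ep2); [split; [easy|lra]|apply Lp1; split; [easy|lra]|].
    exists (fun z => if Rle_dec (g z) m then p1 z else p2 z). split; [now apply K|].
    destruct (Rle_dec (g z0) m); easy.
  - destruct (L2 z0 h0) as (p2 & Lp2 & Ep2); [split; [easy|lra]|easy|].
    destruct (L1 z1 (p2 z1)) as (p1 & Lp1 & Ep1); [split; [easy|lra]|apply Lp2; split; [easy|lra]|].
    exists (fun z => if Rle_dec (g z) m then p1 z else p2 z). split; [now apply K|].
    destruct (Rle_dec (g z0) m); easy.
Qed.

Lemma liftable_ext (x : C -> C) (D D' : C -> Prop) :
  (forall z, D z <-> D' z) -> liftable x D -> liftable x D'.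
Proof.
  intros E L z0 h0 D0 E0. destruct (L z0 h0) as (p & [C1 Q] & Ep); [now apply E|easy|].
  exists p. repeat split; auto.
  - apply (cont_on_subset D); [apply E|easy].
  - intros z Dz. apply Q. now apply E.
Qed.

Lemma segment_between (a b u v s : R) : 0 <= s <= 1 -> a <= u <= b -> a <= v <= b -> a <= u + s * (v - u) <= b.
Proof.
  intros Hs Hu Hv. replace (u + s * (v - u)) with ((1 - s) * u + s * v) by ring.
  assert ((1 - s) * a <= (1 - s) * u) by (apply Rmult_le_compat_l; lra).
  assert ((1 - s) * u <= (1 - s) * b) by (apply Rmult_le_compat_l; lra).
  assert (s * a <= s * v) by (apply Rmult_le_compat_l; lra).
  assert (s * v <= s * b) by (apply Rmult_le_compat_l; lra). lra.
Qed.

Lemma convex_rect (a b c d : R) : convex (rect a b c d).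
Proof.
  intros z w s [H1 H2] [H3 H4] Hs. 
  assert (E1 : fst (z + RtoC s * (w - z))%C = fst z + s * (fst w - fst z)) by (simpl; ring).
  assert (E2 : snd (z + RtoC s * (w - z))%C = snd z + s * (snd w - snd z)) by (simpl; ring).
  unfold rect. rewrite E1, E2. split; now apply segment_between.
Qed.

Lemma convex_ext (D D' : C -> Prop) : (forall z, D z <-> D' z) -> convex D -> convex D'.
Proof. intros E H z w s Dz Dw Hs. apply E. apply H; auto; now apply E. Qed.

(** Bisection: a small rectangle is mapped by [x] into the domain of one local section, which is
    adjusted by a group element to the prescribed value; the four quarters are joined along their
    common edges. *)
Theorem lift_exists (x : C -> C) (a b c d : R) : a <= b -> c <= d ->
  cont_on (rect a b c d) x -> (forall z, rect a b c d z -> Xdom (x z)) -> liftable x (rect a b c d).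
Proof.
  intros Hab Hcd Cx HX.
  apply (nested_rectangles (fun a b c d => liftable x (rect a b c d)) a b c d Hab Hcd).
  - intros a' b' c' d' H1 H2 H3 H4 H5 H6 Q1 Q2 Q3 Q4.
    set (m := (a' + b') / 2) in *. set (n := (c' + d') / 2) in *.
    assert (Hm : a' <= m <= b') by (unfold m; lra). assert (Hn : c' <= n <= d') by (unfold n; lra).
    assert (HX' : forall z, rect a' b' c' d' z -> Xdom (x z)).
    { intros z [Hz1 Hz2]. apply HX. split; lra. }
    assert (V : forall u v, a <= u -> u <= v -> v <= b -> liftable x (rect u v c' n) -> liftable x (rect u v n d') ->
      liftable x (rect u v c' d')).
    { intros u v Hu Huv Hv P1 P2. apply (liftable_glue x _ snd n (u, n)).
      - intros z w. apply (snd_le_Cmod (z - w)).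
      - intros z [Hz1 Hz2]. apply HX. split; lra.
      - apply (convex_ext (rect u v n n)); [|apply convex_rect]. intros z. unfold rect. split; intros; lra.
      - split; simpl; lra.
      - easy.
      - apply (liftable_ext x (rect u v c' n)); [|easy]. intros z. unfold rect. split; intros; lra.
      - apply (liftable_ext x (rect u v n d')); [|easy]. intros z. unfold rect. split; intros; lra. }
    apply (liftable_glue x _ fst m (m, c')).
    + intros z w. apply (fst_le_Cmod (z - w)).
    + easy.
    + apply (convex_ext (rect m m c' d')); [|apply convex_rect]. intros z. unfold rect. split; intros; lra.
    + split; simpl; lra.
    + easy.
    + apply (liftable_ext x (rect a' m c' d')); [intros z; unfold rect; split; intros; lra|]. apply V; auto; lra.
    + apply (liftable_ext x (rect m b' c' d')); [intros z; unfold rect; split; intros; lra|]. apply V; auto; lra.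
  - intros u v Hu Hv. assert (Dp : rect a b c d (u, v)) by easy.
    destruct (section _ (HX _ Dp)) as (r & sigma & Hr & Hs).
    destruct (Cx (u, v) Dp r Hr) as (dl & Hd & Hc).
    exists (dl / 2). split; [lra|]. intros a' b' c' d' Ha Hb Hc' Hd' L1 L2 z0 h0 D0 E0.
    assert (Near : forall z, rect a' b' c' d' z -> rect a b c d z /\ Cmod (x z - x (u, v)) < r).
    { intros z [Z1 Z2]. assert (rect a b c d z) by (split; lra). split; [easy|]. apply Hc; [easy|].
      eapply Rle_lt_trans; [apply Cmod_le_abs|]. simpl.
      assert (Rabs (fst z + - u) < dl / 2) by (apply Rabs_def1; lra).
      assert (Rabs (snd z + - v) < dl / 2) by (apply Rabs_def1; lra). lra. }
    destruct (Hs _ (proj2 (Near z0 D0))) as (X0 & U0 & T0 & _).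
    assert (E1 : gequiv (sigma (x z0)) h0).
    { apply (lift_gequiv (x z0)); auto. }
    destruct E1 as (M & HM & ->). exists (fun z => mob M (sigma (x z))). split; [|easy]. split.
    + intros z Dz. destruct (Near z Dz) as [Rz Nz]. destruct (Hs _ Nz) as (_ & Uz & _ & Hz).
      apply (ctat_comp_T dC _ (fun z => sigma (x z)) (mob M)).
      * apply (ctat_comp_T dC _ x sigma); [|now apply hol_ct].
        apply (ctat_subset dC (rect a b c d)); [now apply cont_at|]. intros w Dw. apply (Near w Dw).
      * apply hol_ct, hol_mob; [now apply Gam_SL2|easy].
    + intros z Dz. destruct (Near z Dz) as [Rz Nz]. destruct (Hs _ Nz) as (Xz & Uz & Tz & _).
      apply (gequiv_trans _ (sigma (x z))); [now apply Tm_uhp|easy|]. now exists M.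
Qed.

Lemma convex_ball (p : C) (r : R) : convex (fun z => Cmod (z - p) < r).
Proof.
  intros z w s Hz Hw Hs.
  replace (z + RtoC s * (w - z) - p)%C with (RtoC (1 - s) * (z - p) + RtoC s * (w - p))%C
    by (rewrite RtoC_minus; ring).
  eapply Rle_lt_trans; [apply Cmod_triangle|]. rewrite !Cmod_RtoC_mult, !Rabs_right by lra.
  destruct (Req_dec s 0) as [->|]; [lra|].
  assert (s * Cmod (w - p) < s * r) by (apply Rmult_lt_compat_l; lra).
  assert ((1 - s) * Cmod (z - p) <= (1 - s) * r) by (apply Rmult_le_compat_l; lra). lra.
Qed.

(** By uniqueness on a small disc the lift equals M o sigma o x for a local section sigma and a
    group element M. *)
Lemma lift_hol (D : C -> Prop) (x phi : C -> C) (z : C) (rho : R) :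
  0 < rho -> (forall w, Cmod (w - z) < rho -> D w) -> cont_on D x -> (forall w, D w -> Xdom (x w)) ->
  lift D x phi -> hol x z -> hol phi z.
Proof.
  intros Hrho HD Cx HX [Cp Lp] Hh.
  assert (Z0 : Cmod (z - z) = 0) by (unfold Cminus; rewrite Cplus_opp_r; apply Cmod_0).
  assert (Dz : D z) by (apply HD; lra).
  destruct (section _ (HX _ Dz)) as (r & sigma & Hr & Hs).
  destruct (Cx z Dz r Hr) as (dl & Hd & Hc).
  set (r' := Rmin rho dl). assert (Hr' : 0 < r') by now apply Rmin_glb_lt.
  assert (Near : forall w, Cmod (w - z) < r' -> D w /\ Cmod (x w - x z) < r).
  { intros w Hw. pose proof (Rmin_l rho dl). pose proof (Rmin_r rho dl). unfold r' in Hw.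
    assert (D w) by (apply HD; lra). split; [easy|]. apply Hc; [easy|lra]. }
  destruct (Near z ltac:(lra)) as [_ Nz]. destruct (Hs _ Nz) as (Xz & Uz & Tz & Sz).
  destruct (lift_gequiv (x z) (sigma (x z)) (phi z)) as [_ (M & HM & EM)]; auto.
  assert (Hpsi : hol (fun w => mob M (sigma (x w))) z).
  { apply (hol_comp (fun w => sigma (x w)) (mob M)); [now apply hol_comp|].
    apply hol_mob; [now apply Gam_SL2|easy]. }
  apply (hol_ext (fun w => mob M (sigma (x w))) phi z r' Hr'); [|easy].
  apply (lift_eq (fun w => Cmod (w - z) < r') x _ _ z); auto.
  - apply convex_ball.
  - intros w Hw. apply HX, (Near w Hw).
  - split.
    + intros w Hw. destruct (Near w Hw) as [Dw Nw]. destruct (Hs _ Nw) as (_ & Uw & _ & Sw).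
      apply (ctat_comp_T dC _ (fun w => sigma (x w)) (mob M)).
      * apply (ctat_comp_T dC _ x sigma); [|now apply hol_ct].
        apply (ctat_subset dC D); [now apply cont_at|]. intros v Hv. apply (Near v Hv).
      * apply hol_ct, hol_mob; [now apply Gam_SL2|easy].
    + intros w Hw. destruct (Near w Hw) as [Dw Nw]. destruct (Hs _ Nw) as (Xw & Uw & Tw & _).
      apply (gequiv_trans _ (sigma (x w))); [now apply Tm_uhp|easy|]. now exists M.
  - split; [apply (cont_on_subset D); [intros w Hw; apply (Near w Hw)|easy]|].
    intros w Hw. apply Lp, (Near w Hw).
  - lra.
Qed.

Definition plift (a b : R) (g phi : R -> C) : Prop :=
  pcont a b phi /\ forall t, seg a b t -> gequiv (Tm (g t)) (phi t).

Lemma pcont_cont_on (a b : R) (g : R -> C) : pcont a b g -> cont_on (rect a b 0 0) (fun z => g (fst z)).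
Proof.
  intros H z [Hz _]. apply (ctat_pre dC dR _ (seg a b) fst g z 1); auto; [lra| |].
  - intros y _. unfold dC, dR. rewrite Rmult_1_l. apply (fst_le_Cmod (y - z)).
  - intros y [Hy _]. easy.
Qed.

Lemma cont_on_hor (D : C -> Prop) (a b y : R) (f : C -> C) :
  (forall t, seg a b t -> D (t, y)) -> cont_on D f -> pcont a b (fun t => f (t, y)).
Proof.
  intros H Hf t Ht. apply (ctat_pre dR dC (seg a b) D (fun t => (t, y)) f t 1); auto; [lra| |].
  - intros. apply dC_hor.
  - apply cont_at; auto.
Qed.

Lemma cont_on_ver (D : C -> Prop) (a b x : R) (f : C -> C) :
  (forall t, seg a b t -> D (x, t)) -> cont_on D f -> pcont a b (fun t => f (x, t)).
Proof.
  intros H Hf t Ht. apply (ctat_pre dR dC (seg a b) D (fun t => (x, t)) f t 1); auto; [lra| |].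
  - intros. apply dC_ver.
  - apply cont_at; auto.
Qed.

(** A path is treated as a function of the first coordinate on the degenerate rectangle
    [rect a b 0 0]. *)
Lemma plift_exists (a b : R) (g : R -> C) (t0 : R) (h0 : C) : a <= b -> pcont a b g ->
  (forall t, seg a b t -> Xdom (g t)) -> seg a b t0 -> gequiv (Tm (g t0)) h0 ->
  exists phi, plift a b g phi /\ phi t0 = h0.
Proof.
  intros Hab Cg HX H0 E0.
  destruct (lift_exists (fun z => g (fst z)) a b 0 0 Hab (Rle_refl 0) (pcont_cont_on a b g Cg)
    ltac:(intros z [Hz _]; now apply HX) (t0, 0) h0) as (p & [Cp Lp] & Ep); [split; simpl; [easy|lra]|easy|].
  exists (fun t => p (t, 0)). split; [|easy]. split.
  - apply (cont_on_hor (rect a b 0 0)); [|easy]. intros t Ht. split; simpl; [easy|lra].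
  - intros t Ht. apply (Lp (t, 0)). split; simpl; [easy|lra].
Qed.

Lemma plift_unique (a b : R) (g f1 f2 : R -> C) (t0 : R) :
  (forall t, seg a b t -> Xdom (g t)) -> plift a b g f1 -> plift a b g f2 -> seg a b t0 -> f1 t0 = f2 t0 ->
  forall t, seg a b t -> f1 t = f2 t.
Proof.
  intros HX [C1 L1] [C2 L2] H0 E0 t Ht.
  apply (lift_eq (rect a b 0 0) (fun z => g (fst z)) (fun z => f1 (fst z)) (fun z => f2 (fst z)) (t0, 0)
    (convex_rect a b 0 0)) with (z := (t, 0)).
  - intros z [Hz _]. now apply HX.
  - split; [now apply pcont_cont_on|]. intros z [Hz _]. now apply L1.
  - split; [now apply pcont_cont_on|]. intros z [Hz _]. now apply L2.
  - split; simpl; [easy|lra].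
  - easy.
  - split; simpl; [easy|lra].
Qed.

Lemma plift_tau1 (a b : R) (g : R -> C) : pcont a b g ->
  (forall t, seg a b t -> snd (g t) <> 0 \/ -1 < fst (g t) < 1) -> plift a b g (fun t => tau1 (g t)).
Proof.
  intros Cg H. split.
  - intros t Ht. apply (ctat_comp_T dR (seg a b) g tau1); [now apply Cg|]. apply hol_ct.
    specialize (H t Ht). unfold tau1. apply hol_div; [|apply hol_A; lra|now apply A_neq_0].
    apply hol_mult; [apply hol_const|apply hol_B; lra].
  - intros t Ht. rewrite Tm_tau1 by auto. apply gequiv_refl.
Qed.

Lemma plift_mob (a b : R) (g phi : R -> C) (M : mat) : Gam M -> (forall t, seg a b t -> Xdom (g t)) ->
  plift a b g phi -> plift a b g (fun t => mob M (phi t)).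
Proof.
  intros HM HX [Cp Lp].
  assert (U : forall t, seg a b t -> uhp (phi t)).
  { intros t Ht. apply (gequiv_uhp (Tm (g t))); [now apply Tm_uhp, HX|now apply Lp]. }
  split.
  - intros t Ht. apply (ctat_comp_T dR (seg a b) phi (mob M)); [now apply Cp|].
    apply hol_ct, hol_mob; [now apply Gam_SL2|auto].
  - intros t Ht. apply (gequiv_trans _ (phi t)); [now apply Tm_uhp, HX|now apply Lp|]. now exists M.
Qed.

Lemma plift_restrict (a b a' b' : R) (g phi : R -> C) : a <= a' -> b' <= b -> plift a b g phi -> plift a' b' g phi.
Proof.
  intros Ha Hb [Cp Lp]. split.
  - intros t Ht. apply (ctat_subset dR (seg a b)); [apply Cp|]; unfold seg in *; intros; lra.
  - intros t Ht. apply Lp. unfold seg in *. lra.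
Qed.

(** S normalizes Gamma(2). This carries lifts of a loop around 1 over to lifts of the negated loop
    around -1. *)
Lemma gequiv_sm (h1 h2 : C) : uhp h1 -> gequiv h1 h2 -> gequiv (sm h1) (sm h2).
Proof.
  intros Hh (M & HM & ->). exists (mmul (mmul Smat M) (minv Smat)). split.
  - destruct HM as (H1&[p Hp]&[q Hq]&[r Hr]&[s Hs]). split.
    + repeat apply SL2_mul; try easy.
    + destruct M as [mp1 mq1 mr1 ms1]. unfold mmul, minv, Smat. cbn [mp mq mr ms] in *.
      split; [exists s|split; [exists (- r)%Z|split; [exists (- q)%Z|exists p]]]; lia.
  - assert (HS := Gam_SL2 _ HM). assert (U := sm_uhp h1 Hh). assert (U2 := mob_uhp M h1 HS Hh).
    rewrite mob_mul; [|now apply SL2_mul|apply SL2_inv, SL2_S|easy].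
    rewrite (sm_mob h1) by easy. rewrite mob_inv_l by easy. rewrite mob_mul by easy.
    now apply sm_mob.
Qed.

Lemma plift_sm (a b : R) (g phi : R -> C) : (forall t, seg a b t -> Xdom (g t)) ->
  plift a b g phi -> plift a b (fun t => - g t)%C (fun t => sm (phi t)).
Proof.
  intros HX [Cp Lp].
  assert (U : forall t, seg a b t -> uhp (phi t)).
  { intros t Ht. apply (gequiv_uhp (Tm (g t))); [now apply Tm_uhp, HX|now apply Lp]. }
  split.
  - intros t Ht. apply ctat_opp, ctat_inv; [now apply Cp|]. now apply uhp_neq_0, U.
  - intros t Ht. rewrite Tm_opp by auto. apply gequiv_sm; [now apply Tm_uhp, HX|now apply Lp].
Qed.

(** * Lifts of loops and homotopies *)

Definition circle (t : R) : C := (1 - cos t, - sin t).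

Lemma ctat_pair (D : R -> Prop) (f g : R -> R) (t : R) :
  continuous f t -> continuous g t -> ctat dR D (fun t => (f t, g t)) t.
Proof.
  intros F G. apply (ctat_subset dR (fun _ => True)); [|easy].
  apply ctat_ext with (f := fun t => (RtoC (f t) + RtoC (g t) * Ci)%C).
  - intros. Ceq.
  - easy.
  - apply ctat_plus; [now apply ctat_RtoC|]. apply ctat_mult; [now apply ctat_RtoC|apply ctat_const].
Qed.

Ltac cont_1 := apply (ex_derive_continuous (K := R_AbsRing) (V := R_NormedModule)); auto_derive; easy.

Lemma circle_pcont (a b : R) : pcont a b circle.
Proof. intros t Ht. apply ctat_pair; cont_1. Qed.

Lemma circle_X (t : R) : Xdom (circle t).
Proof.
  apply Xdom_intro. unfold circle. simpl. pose proof (sin2_cos2 t) as S. unfold Rsqr in S.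
  destruct (Req_dec (sin t) 0) as [E|E]; [right|left; lra]. rewrite E in S.
  pose proof (COS_bound t). split; intros F; nra.
Qed.

Lemma Ci_tau1 : gequiv (Tm (RtoC 0)) Ci.
Proof. rewrite Tm_tau1, tau1_0 by (right; simpl; lra). apply gequiv_refl. Qed.

(** The loop enters the lower half-plane, crosses (1, infinity) and returns through the upper one.
    Between the angles 2 PI / 3 and 4 PI / 3 its real part is at least 3/2, and the lift is [sig2]
    there; before, it is [tau1], and after, [tau1] + 2. *)
Lemma circle_once (L : R -> C) : plift 0 (2 * PI) circle L -> L 0 = Ci -> L (2 * PI) = (Ci + RtoC 2)%C.
Proof.
  intros HL L0. pose proof PI_RGT_0 as HP.
  assert (c0 : circle 0 = RtoC 0) by (unfold circle; rewrite cos_0, sin_0; Ceq).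
  assert (c1 : circle (2 * PI) = RtoC 0) by (unfold circle; rewrite cos_2PI, sin_2PI; Ceq).
  set (u := 2 * (PI / 3)). set (v := 2 * PI - 2 * (PI / 3)).
  assert (su : 0 < sin u).
  { unfold u. rewrite sin_2PI3. apply Rdiv_lt_0_compat; [apply sqrt_lt_R0|]; lra. }
  assert (cu : cos u = - (1 / 2)) by (unfold u; rewrite cos_2PI3; lra).
  assert (sv : sin v < 0).
  { unfold v. rewrite sin_minus, sin_2PI, cos_2PI. fold u. lra. }
  assert (cv : cos v = - (1 / 2)).
  { unfold v. rewrite cos_minus, sin_2PI, cos_2PI. fold u. lra. }
  assert (Huv : 0 < u < v /\ v < 2 * PI) by (unfold u, v; lra).
  assert (A1 : forall t, seg 0 u t -> L t = tau1 (circle t)).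
  { apply (plift_unique 0 u circle L (fun t => tau1 (circle t)) 0).
    - intros; apply circle_X.
    - apply (plift_restrict 0 (2 * PI)); auto; lra.
    - apply plift_tau1; [apply circle_pcont|]. intros t [T0 T1].
      destruct (Req_dec t 0) as [->|N]; [right; rewrite c0; simpl; lra|left].
      unfold circle. simpl. assert (0 < sin t) by (apply sin_gt_0; unfold u in T1; lra). lra.
    - split; lra.
    - now rewrite c0, tau1_0, L0. }
  assert (F : forall t, seg u v t -> 1 < fst (circle t)).
  { intros t [T0 T1]. unfold circle. simpl. assert (cos t <= - (1 / 2)); [|lra].
    destruct (Rle_dec t PI).
    - rewrite <- cu. apply cos_decr_1; unfold u in *; lra.
    - rewrite <- cv. apply cos_incr_1; unfold v in *; lra. }
  assert (A2 : forall t, seg u v t -> L t = sig2 (circle t)).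
  { apply (plift_unique u v circle L (fun t => sig2 (circle t)) u).
    - intros; apply circle_X.
    - apply (plift_restrict 0 (2 * PI)); auto; lra.
    - split.
      + intros t Ht. apply (ctat_comp_T dR (seg u v) circle sig2); [now apply circle_pcont|].
        apply hol_ct. now apply sig2_spec, F.
      + intros t Ht. destruct (sig2_spec (circle t) (F t Ht)) as (U & _ & E1 & E2 & E3).
        destruct (Rtotal_order (snd (circle t)) 0) as [N|[N|N]].
        * rewrite Tm_tau1, E2 by lra. apply gequiv_refl.
        * rewrite E1 by easy. apply gequiv_refl.
        * rewrite Tm_tau1, E3 by lra. exists (Mat 1 (2 * 1) 0 1). split; [apply Gam_shift|].
          rewrite mob_shift. unfold ZtoC. Ceq.
    - split; lra.
    - rewrite A1 by (split; lra). apply sig2_spec; [apply F; split; lra|]. unfold circle. simpl. lra. }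
  assert (Lv : L v = (tau1 (circle v) + RtoC 2)%C).
  { rewrite A2 by (split; lra). apply sig2_spec; [apply F; split; lra|]. unfold circle. simpl. lra. }
  rewrite (plift_unique v (2 * PI) circle L (fun t => mob (Mat 1 (2 * 1) 0 1) (tau1 (circle t))) v).
  - rewrite mob_shift, c1, tau1_0. unfold ZtoC. Ceq.
  - intros; apply circle_X.
  - apply (plift_restrict 0 (2 * PI)); auto; lra.
  - apply plift_mob; [apply Gam_shift|intros; apply circle_X|]. apply plift_tau1; [apply circle_pcont|].
    intros t [T0 T1]. destruct (Req_dec t (2 * PI)) as [->|N]; [right; rewrite c1; simpl; lra|left].
    unfold circle. simpl. assert (sin t < 0) by (apply sin_lt_0; unfold v in T0; lra). lra.
  - split; lra.
  - rewrite mob_shift, Lv. unfold ZtoC. Ceq.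
  - split; lra.
Qed.

Lemma pcont_affine (a b a' b' k l : R) (g : R -> C) :
  (forall t, seg a b t -> seg a' b' (k * t + l)) -> pcont a' b' g -> pcont a b (fun t => g (k * t + l)).
Proof.
  intros H Hg t Ht. apply (ctat_pre dR dR (seg a b) (seg a' b') (fun t => k * t + l) g t (Rabs k + 1)).
  - pose proof (Rabs_pos k). lra.
  - intros y _. unfold dR. replace (k * y + l - (k * t + l)) with (k * (y - t)) by ring.
    rewrite Rabs_mult. pose proof (Rabs_pos (y - t)). nra.
  - auto.
  - apply Hg. auto.
Qed.

Lemma plift_affine (a b a' b' k l : R) (g phi : R -> C) :
  (forall t, seg a b t -> seg a' b' (k * t + l)) -> plift a' b' g phi ->
  plift a b (fun t => g (k * t + l)) (fun t => phi (k * t + l)).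
Proof.
  intros H [Cp Lp]. split; [now apply (pcont_affine a b a' b')|]. intros t Ht. apply Lp. auto.
Qed.

Lemma plift_ext (a b : R) (g g' phi : R -> C) : (forall t, seg a b t -> g t = g' t) -> plift a b g phi -> plift a b g' phi.
Proof. intros E [Cp Lp]. split; [easy|]. intros t Ht. rewrite <- E; auto. Qed.

Lemma circle_periodic (t : R) : circle (t + 2 * PI) = circle t.
Proof. unfold circle. rewrite cos_plus, sin_plus, cos_2PI, sin_2PI. Ceq. Qed.

(** One lift over N turns in both directions serves all exponents up to N. A full turn adds 2 to it,
    by uniqueness and [circle_once]. *)
Lemma circle_lift (N : nat) : exists L, plift (- (2 * PI * INR N)) (2 * PI * INR N) circle L /\ L 0 = Ci /\
  forall n : Z, (Z.abs n <= Z.of_nat N)%Z -> L (2 * PI * IZR n) = (Ci + RtoC 2 * ZtoC n)%C.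
Proof.
  pose proof PI_RGT_0 as HP. pose proof (pos_INR N) as HN. set (T := 2 * PI * INR N).
  assert (HT : 0 <= T) by (unfold T; nra).
  assert (c0 : circle 0 = RtoC 0) by (unfold circle; rewrite cos_0, sin_0; Ceq).
  destruct (plift_exists (- T) T circle 0 Ci) as (L & HL & L0).
  - lra.
  - apply circle_pcont.
  - intros; apply circle_X.
  - split; lra.
  - rewrite c0. apply Ci_tau1.
  - exists L. split; [easy|]. split; [easy|].
    assert (Hsh : forall t, - T <= t -> t + 2 * PI <= T -> L (t + 2 * PI) = (L t + RtoC 2)%C).
    { intros t Ht1 Ht2.
      assert (H1N : 1 <= INR N).
      { destruct N; [unfold T in *; simpl in *; lra|]. rewrite S_INR. pose proof (pos_INR N). lra. }
      assert (HT2 : 2 * PI <= T) by (unfold T; nra).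
      assert (E := plift_unique (- T) (T - 2 * PI) circle (fun t => L (1 * t + 2 * PI)) (fun t => mob (Mat 1 (2 * 1) 0 1) (L t)) 0).
      assert (E' : L (1 * t + 2 * PI) = mob (Mat 1 (2 * 1) 0 1) (L t)).
      { apply E.
        - intros; apply circle_X.
        - apply (plift_ext _ _ (fun t => circle (1 * t + 2 * PI))).
          + intros s _. rewrite Rmult_1_l. apply circle_periodic.
          + apply (plift_affine _ _ (- T) T); [|easy]. intros s [S1 S2]. split; lra.
        - apply plift_mob; [apply Gam_shift|intros; apply circle_X|]. apply (plift_restrict (- T) T); auto; lra.
        - split; lra.
        - rewrite mob_shift, L0. replace (1 * 0 + 2 * PI) with (2 * PI) by ring.
          rewrite (circle_once L); [unfold ZtoC; Ceq| |easy]. apply (plift_restrict (- T) T); auto; lra.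
        - split; lra. }
      rewrite Rmult_1_l in E'. rewrite E', mob_shift. unfold ZtoC. Ceq. }
    assert (Hpos : forall k : nat, (k <= N)%nat -> L (2 * PI * INR k) = (Ci + RtoC (2 * INR k))%C /\
      L (- (2 * PI * INR k)) = (Ci - RtoC (2 * INR k))%C).
    { induction k as [|k IH]; intros Hk.
      - simpl. rewrite !Rmult_0_r, Ropp_0, L0. split; Ceq.
      - destruct IH as [I1 I2]; [lia|]. apply le_INR in Hk. rewrite S_INR in *. pose proof (pos_INR k).
        split.
        + replace (2 * PI * (INR k + 1)) with (2 * PI * INR k + 2 * PI) by ring.
          rewrite Hsh; [rewrite I1; Ceq|unfold T; nra|unfold T; nra].
        + assert (E := Hsh (- (2 * PI * (INR k + 1)))).
          replace (- (2 * PI * (INR k + 1)) + 2 * PI) with (- (2 * PI * INR k)) in E by ring.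
          assert (E' := E ltac:(unfold T; nra) ltac:(unfold T; nra)). rewrite I2 in E'.
          transitivity (L (- (2 * PI * (INR k + 1)))%R + RtoC 2 - RtoC 2)%C; [ring|]. rewrite <- E'. Ceq. }
    intros n Hn. unfold ZtoC. destruct (Z_le_gt_dec 0 n).
    + destruct (Hpos (Z.to_nat n)) as [E _]; [lia|]. rewrite INR_IZR_INZ, Z2Nat.id in E by lia.
      rewrite E, RtoC_mult. easy.
    + destruct (Hpos (Z.to_nat (- n))) as [_ E]; [lia|]. rewrite INR_IZR_INZ, Z2Nat.id, opp_IZR in E by lia.
      replace (- (2 * PI * - IZR n)) with (2 * PI * IZR n) in E by ring. rewrite E. Ceq.
Qed.

(** The deck transformations of the generators: a2^n acts as h + 2 n. The loop a1^n is the negative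
    of a2^n, so it acts as the conjugate by S, which is h / (1 - 2 n h). *)
Definition tmat (t : bool * Z) : mat := if fst t then Mat 1 (2 * snd t) 0 1 else Mat 1 0 (2 * - snd t) 1.
Fixpoint wmat (w : word) : mat := match w with [] => mid | t :: r => mmul (tmat t) (wmat r) end.

Lemma Gam_tmat (t : bool * Z) : Gam (tmat t).
Proof.
  destruct t as [[] n]; unfold tmat; cbn [fst snd]; [apply Gam_shift|].
  split; [unfold SL2; cbv [mp mq mr ms]; ring|].
  split; [now exists 0%Z|split; [now exists 0%Z|split; [now exists (- n)%Z|now exists 0%Z]]].
Qed.

Lemma Gam_wmat (w : word) : Gam (wmat w).
Proof. induction w; simpl; [apply Gam_id|apply Gam_mul; [apply Gam_tmat|easy]]. Qed.

Lemma term_loop_true (n : Z) (s : R) : term_loop (true, n) s = circle (2 * PI * IZR n * s).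
Proof. reflexivity. Qed.

Lemma term_loop_false (n : Z) (s : R) : term_loop (false, n) s = (- term_loop (true, n) s)%C.
Proof. unfold term_loop. simpl. Ceq. Qed.

Lemma Ci_uhp : uhp Ci.
Proof. unfold uhp. simpl. lra. Qed.

Lemma tmat_false_Ci (n : Z) : mob (tmat (false, n)) Ci = sm (Ci + RtoC 2 * ZtoC n).
Proof.
  assert (U : uhp (Ci + RtoC 2 * ZtoC n)%C) by (unfold uhp; simpl; lra).
  apply uhp_neq_0 in U. assert (D := mob_den (tmat (false, n)) Ci (Gam_SL2 _ (Gam_tmat _)) Ci_uhp).
  unfold mob, sm, tmat in *. cbn [fst snd mp mq mr ms] in *.
  rewrite ZtoC_mult, ZtoC_opp in *. unfold ZtoC in *.
  assert (CC1 : (Ci * Ci = - RtoC 1)%C) by Ceq.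
  set (m := RtoC (IZR n)) in *.
  assert (E : (RtoC 2 * - m * Ci + RtoC 1 = - Ci * (Ci + RtoC 2 * m))%C).
  { transitivity (- (Ci * Ci) - RtoC 2 * m * Ci)%C; [rewrite CC1|]; ring. }
  rewrite E in *. field. repeat split; auto. 
  - intros X. apply (f_equal snd) in X. simpl in X. lra.
Qed.

Lemma term_lift (t : bool * Z) : exists phi, plift 0 1 (term_loop t) phi /\ phi 0 = Ci /\ phi 1 = mob (tmat t) Ci.
Proof.
  assert (Ht : forall n, exists phi, plift 0 1 (term_loop (true, n)) phi /\ phi 0 = Ci /\ phi 1 = (Ci + RtoC 2 * ZtoC n)%C).
  { intros n. destruct (circle_lift (Z.abs_nat n)) as (L & HL & L0 & Ln).
    exists (fun s => L (2 * PI * IZR n * s + 0)). split; [|split].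
    - apply (plift_ext _ _ (fun s => circle (2 * PI * IZR n * s + 0))).
      + intros s _. rewrite Rplus_0_r. reflexivity.
      + apply (plift_affine 0 1 (- (2 * PI * INR (Z.abs_nat n))) (2 * PI * INR (Z.abs_nat n))); [|easy].
        intros s [S1 S2]. rewrite INR_IZR_INZ, Zabs2Nat.id_abs, abs_IZR.
        pose proof PI_RGT_0. rewrite Rplus_0_r, <- Rmult_opp_opp.
        assert (B : Rabs (2 * PI * IZR n * s) <= 2 * PI * Rabs (IZR n)).
        { rewrite !Rabs_mult, (Rabs_right 2), (Rabs_right PI), (Rabs_right s) by lra.
          pose proof (Rabs_pos (IZR n)). assert (0 <= 2 * PI * Rabs (IZR n)) by (apply Rmult_le_pos; lra). nra. }
        apply Rabs_le_between in B. unfold seg. rewrite Rmult_opp_opp. lra.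
    - rewrite Rmult_0_r, Rplus_0_r. easy.
    - rewrite Rmult_1_r, Rplus_0_r. apply Ln. lia. }
  destruct t as [[] n].
  - destruct (Ht n) as (phi & H1 & H2 & H3). exists phi. split; [easy|]. split; [easy|].
    rewrite H3. unfold tmat. cbn [fst snd]. now rewrite mob_shift.
  - destruct (Ht n) as (phi & H1 & H2 & H3). exists (fun s => sm (phi s)). split; [|split].
    + apply (plift_ext _ _ (fun s => - term_loop (true, n) s)%C).
      * intros s _. now rewrite term_loop_false.
      * apply plift_sm; [|easy]. intros s _. apply circle_X.
    + rewrite H2. unfold sm. rewrite Ci_inv. ring.
    + rewrite H3. symmetry. apply tmat_false_Ci.
Qed.

Lemma term_loop_X (t : bool * Z) (s : R) : Xdom (term_loop t s).
Proof.
  destruct t as [[] n]; [apply circle_X|]. rewrite term_loop_false, term_loop_true.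
  destruct (circle_X (2 * PI * IZR n * s)) as [H1 H2].
  set (c := circle (2 * PI * IZR n * s)) in *.
  split; intros E; [apply H2|apply H1]; transitivity (- - c)%C; try ring; rewrite E; Ceq.
Qed.

Lemma pcont_glue (f1 f2 : R -> C) : pcont 0 1 f1 -> pcont 0 1 f2 -> f1 1 = f2 0 ->
  pcont 0 1 (fun s => if Rle_dec s (/ 2) then f1 (2 * s) else f2 (2 * s - 1)).
Proof.
  intros C1 C2 E.
  assert (C1' : pcont 0 (/ 2) (fun s => f1 (2 * s + 0))) by (apply (pcont_affine 0 (/ 2) 0 1); [unfold seg; intros; lra|easy]).
  assert (C2' : pcont (/ 2) 1 (fun s => f2 (2 * s + -1))) by (apply (pcont_affine (/ 2) 1 0 1); [unfold seg; intros; lra|easy]).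
  assert (G := cont_glue (rect 0 1 0 0) fst (/ 2) (fun z => f1 (2 * fst z + 0)) (fun z => f2 (2 * fst z + -1))
    (fun z w => fst_le_Cmod (z - w))).
  assert (G' := G
    ltac:(apply (cont_on_subset (rect 0 (/ 2) 0 0)); [unfold rect; intros; lra|exact (pcont_cont_on 0 (/ 2) _ C1')])
    ltac:(apply (cont_on_subset (rect (/ 2) 1 0 0)); [unfold rect; intros; lra|exact (pcont_cont_on (/ 2) 1 _ C2')])
    ltac:(intros z _ Hz; cbv beta; rewrite Hz; replace (2 * / 2 + 0) with 1 by field; replace (2 * / 2 + -1) with 0 by field; easy)).
  clear G. apply (cont_on_hor (rect 0 1 0 0) 0 1 0) in G'.
  - intros t Ht. apply ctat_ext with (3 := G' t Ht); [|easy]. intros s _. simpl.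
    destruct (Rle_dec s (/ 2)); f_equal; ring.
  - intros t Ht. split; simpl; [easy|lra].
Qed.

Lemma word_loop_0 (w : word) : word_loop w 0 = RtoC 0.
Proof.
  destruct w as [|t r]; [easy|]. simpl. destruct (Rle_dec 0 (/ 2)); [|lra].
  rewrite Rmult_0_r. destruct t as [[] n]; [|rewrite term_loop_false]; rewrite term_loop_true, Rmult_0_r;
    unfold circle; rewrite cos_0, sin_0; Ceq.
Qed.

Lemma word_loop_1 (w : word) : word_loop w 1 = RtoC 0.
Proof.
  induction w as [|t r IH]; [easy|]. simpl. destruct (Rle_dec 1 (/ 2)); [lra|].
  now replace (2 * 1 - 1) with 1 by ring.
Qed.

Lemma word_loop_X (w : word) (s : R) : Xdom (word_loop w s).
Proof.
  revert s. induction w as [|t r IH]; intros s; simpl.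
  - split; intros E; apply (f_equal fst) in E; simpl in E; lra.
  - destruct (Rle_dec s (/ 2)); [apply term_loop_X|apply IH].
Qed.

(** After the loop of the first term the lift continues as the translate by its matrix of the lift
    of the remaining word; hence the product in reading order. *)
Lemma word_lift (w : word) : exists psi, plift 0 1 (word_loop w) psi /\ psi 0 = Ci /\ psi 1 = mob (wmat w) Ci.
Proof.
  induction w as [|t r (psi & [Cp Lp] & P0 & P1)].
  - exists (fun _ => Ci). simpl. rewrite mob_id. repeat split.
    + intros s _. apply ctat_const.
    + intros s _. apply Ci_tau1.
  - destruct (term_lift t) as (phi & [Cq Lq] & Q0 & Q1).
    assert (GM := Gam_tmat t). assert (SM := Gam_SL2 _ GM).
    assert (HL : plift 0 1 (word_loop r) (fun s => mob (tmat t) (psi s))).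
    { apply plift_mob; [easy|intros; apply word_loop_X|easy]. }
    exists (fun s => if Rle_dec s (/ 2) then phi (2 * s) else mob (tmat t) (psi (2 * s - 1))). split; [split|split].
    + apply (pcont_glue phi (fun s => mob (tmat t) (psi s))); [easy|apply HL|]. now rewrite Q1, P0.
    + intros s [S0 S1]. simpl. destruct (Rle_dec s (/ 2)).
      * apply Lq. split; lra.
      * apply HL. split; lra.
    + destruct (Rle_dec 0 (/ 2)); [|lra]. now rewrite Rmult_0_r.
    + destruct (Rle_dec 1 (/ 2)); [lra|]. replace (2 * 1 - 1) with 1 by ring. rewrite P1. simpl.
      rewrite mob_mul; auto using Ci_uhp. apply Gam_SL2, Gam_wmat.
Qed.

(** The domain of [tau1]. It contains both (-1, 1) and the imaginary axis, so on each horizontal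
    side the lift is [tau1] or a translate of it. *)
Definition Om (z : C) : Prop := snd z <> 0 \/ -1 < fst z < 1.

Lemma Om_X (z : C) : Om z -> Xdom z.
Proof. intros H. apply Xdom_intro. unfold Om in H. lra. Qed.

(** The homotopy is lifted to its square. The edges on which the endpoints move stay in [Om], where
    the lift is a translate of [tau1]; the edge carrying the word loop contributes the matrix, and
    the opposite edge is the lift of [g]. *)
Lemma homotopy_lift (E1 E2 : C -> Prop) (g phi : R -> C) (w : word) :
  (forall z, E1 z -> Om z) -> (forall z, E2 z -> Om z) ->
  homotopic_rel E1 E2 g (word_loop w) -> plift 0 1 g phi -> phi 0 = tau1 (g 0) ->
  phi 1 = mob (wmat w) (tau1 (g 1)).
Proof.
  intros H1 H2 (H & CH & XH & EH & BH) Lphi P0.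
  assert (CH' : cont_on (rect 0 1 0 1) H) by exact CH.
  destruct (EH 0 ltac:(lra)) as [E00 E10]. destruct (EH 1 ltac:(lra)) as [E01 E11].
  rewrite word_loop_0 in E10. rewrite word_loop_1 in E11.
  destruct (lift_exists H 0 1 0 1 ltac:(lra) ltac:(lra) CH' XH (0, 0) (phi 0)) as (K & [CK LK] & K0).
  { split; simpl; lra. }
  { rewrite E00. apply (proj2 Lphi). split; lra. }
  assert (Kb : forall t, seg 0 1 t -> K (t, 0) = tau1 (H (t, 0))).
  { apply (plift_unique 0 1 (fun t => H (t, 0)) _ (fun t => tau1 (H (t, 0))) 0).
    - intros t Ht. apply Om_X, H1. now apply BH.
    - split; [apply (cont_on_hor (rect 0 1 0 1)); [|easy]; intros; split; simpl; [easy|lra]|].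
      intros t Ht. apply LK. split; simpl; [easy|lra].
    - apply (plift_tau1 0 1 (fun t => H (t, 0))).
      + apply (cont_on_hor (rect 0 1 0 1)); [|easy]; intros; split; simpl; [easy|lra].
      + intros t Ht. apply H1. now apply BH.
    - split; lra.
    - now rewrite K0, P0, E00. }
  destruct (word_lift w) as (psi & Lpsi & S0 & S1).
  assert (Kr : forall s, seg 0 1 s -> K (1, s) = psi s).
  { apply (plift_unique 0 1 (word_loop w) (fun s => K (1, s)) psi 0).
    - intros; apply word_loop_X.
    - split; [apply (cont_on_ver (rect 0 1 0 1)); [|easy]; intros; split; simpl; [lra|easy]|].
      intros s Hs. destruct (EH s Hs) as [_ <-]. apply LK. split; simpl; [lra|easy].
    - easy.
    - split; lra.
    - rewrite Kb by (split; lra). rewrite E10, tau1_0. easy. }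
  assert (Kt : forall t, seg 0 1 t -> K (t, 1) = mob (wmat w) (tau1 (H (t, 1)))).
  { assert (HL : plift 0 1 (fun t => H (t, 1)) (fun t => tau1 (H (t, 1)))).
    { apply (plift_tau1 0 1 (fun t => H (t, 1))).
      - apply (cont_on_hor (rect 0 1 0 1)); [|easy]; intros; split; simpl; [easy|lra].
      - intros t Ht. apply H2. now apply BH. }
    assert (XL : forall t, seg 0 1 t -> Xdom (H (t, 1))) by (intros t Ht; apply Om_X, H2; now apply BH).
    apply (plift_unique 0 1 (fun t => H (t, 1)) _ (fun t => mob (wmat w) (tau1 (H (t, 1)))) 1).
    - easy.
    - split; [apply (cont_on_hor (rect 0 1 0 1)); [|easy]; intros; split; simpl; [easy|lra]|].
      intros t Ht. apply LK. split; simpl; [easy|lra].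
    - apply (plift_mob 0 1 _ (fun t => tau1 (H (t, 1)))); [apply Gam_wmat|easy|easy].
    - split; lra.
    - rewrite Kr by (split; lra). rewrite E11, tau1_0. easy. }
  assert (Kl : forall s, seg 0 1 s -> K (0, s) = phi s).
  { apply (plift_unique 0 1 g (fun s => K (0, s)) phi 0).
    - intros s Hs. destruct (EH s Hs) as [<- _]. apply XH. split; simpl; [lra|easy].
    - split; [apply (cont_on_ver (rect 0 1 0 1)); [|easy]; intros; split; simpl; [lra|easy]|].
      intros s Hs. destruct (EH s Hs) as [<- _]. apply LK. split; simpl; [lra|easy].
    - easy.
    - split; lra.
    - easy. }
  rewrite <- (Kl 1), (Kt 0), E01 by (split; lra). easy.
Qed.

Lemma E_tr_Om (z : C) : E_tr z -> Om z.
Proof. intros [H _]. now right. Qed.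
Lemma E_pb_Om (z : C) : E_pb z -> Om z.
Proof. unfold E_pb. intros H. right. lra. Qed.

(** The interval [a, b] lies strictly inside because the horizontal sides and the vertical segments
    are constrained over the open interval only; on the outer vertical sides the map may run into -1
    or 1. The homotopy class is used on the segment over [a] and then carried along the upper side
    by uniqueness. *)
Theorem rectangle_lift (E1 E2 : C -> Prop) (w : word) (x0 x1 y0 y1 : R) (f : C -> C) (a b : R) :
  (forall z, E1 z -> Om z) -> (forall z, E2 z -> Om z) -> x0 < a -> a <= b -> b < x1 -> y0 < y1 ->
  holo_represents (HClass E1 E2 (word_loop w)) x0 x1 y0 y1 f ->
  exists F, cont_on (rect a b y0 y1) F /\ (forall z, rect a b y0 y1 z -> uhp (F z)) /\
    (forall z, a < fst z < b -> y0 < snd z < y1 -> hol F z) /\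
    (forall x, a <= x <= b -> F (x, y0) = tau1 (f (x, y0))) /\
    (forall x, a <= x <= b -> F (x, y1) = mob (wmat w) (tau1 (f (x, y1)))).
Proof.
  intros H1 H2 Ha Hab Hb Hy (Hh & HX & HC & HB & HT & HR). simpl hc_E1 in *. simpl hc_E2 in *.
  assert (XF : forall z, rect a b y0 y1 z -> Xdom (f z)).
  { intros [x y] [Z1 Z2]. simpl in Z1, Z2. destruct (Req_dec y y0) as [->|N0].
    - apply Om_X, H1, HB. lra.
    - destruct (Req_dec y y1) as [->|N1]; [apply Om_X, H2, HT; lra|]. apply HX. simpl. lra. }
  assert (CF : cont_on (rect a b y0 y1) f).
  { apply (cont_on_subset (fun z : C => x0 <= fst z <= x1 /\ y0 <= snd z <= y1)); [|exact HC].
    unfold rect. intros; lra. }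
  assert (Ra : rect a b y0 y1 (a, y0)) by (split; simpl; lra).
  assert (Oa : Om (f (a, y0))) by (apply H1, HB; lra).
  destruct (lift_exists f a b y0 y1 Hab (Rlt_le _ _ Hy) CF XF (a, y0) (tau1 (f (a, y0))) Ra)
    as (F & [CFt LF] & F0).
  { rewrite Tm_tau1 by exact Oa. apply gequiv_refl. }
  assert (LB : forall y E, (forall z, E z -> Om z) -> y0 <= y <= y1 -> (forall x, a <= x <= b -> E (f (x, y))) ->
    plift a b (fun x => f (x, y)) (fun x => F (x, y)) /\ plift a b (fun x => f (x, y)) (fun x => tau1 (f (x, y))) /\
    (forall x, seg a b x -> Xdom (f (x, y)))).
  { intros y E HE Hyy HEf. split; [|split].
    - split; [apply (cont_on_hor (rect a b y0 y1)); [|easy]; intros; split; simpl; [easy|lra]|].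
      intros x Hx. apply LF. split; simpl; [easy|lra].
    - apply (plift_tau1 a b (fun x => f (x, y))).
      + apply (cont_on_hor (rect a b y0 y1)); [|easy]; intros; split; simpl; [easy|lra].
      + intros x Hx. apply (HE _ (HEf x Hx)).
    - intros x Hx. apply Om_X, HE, HEf, Hx. }
  destruct (LB y0 E1 H1 ltac:(lra) ltac:(intros; apply HB; lra)) as (B1 & B2 & B3).
  destruct (LB y1 E2 H2 ltac:(lra) ltac:(intros; apply HT; lra)) as (T1 & T2 & T3).
  assert (Corner : F (a, y1) = mob (wmat w) (tau1 (f (a, y1)))).
  { assert (Hom := HR a ltac:(lra)). unfold in_class in Hom. simpl in Hom.
    assert (HL := homotopy_lift E1 E2 _ (fun s => F (a, (y1 - y0) * s + y0)) w H1 H2 Hom).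
    cbv beta in HL. replace (y0 + 1 * (y1 - y0)) with y1 in HL by ring. replace ((y1 - y0) * 1 + y0) with y1 in HL by ring.
    apply HL.
    - apply (plift_ext _ _ (fun s => f (a, (y1 - y0) * s + y0))).
      + intros s _. do 2 f_equal. ring.
      + apply (plift_affine 0 1 y0 y1 (y1 - y0) y0 (fun t => f (a, t)) (fun t => F (a, t))).
        * intros s [S0 S1]. split; nra.
        * split; [apply (cont_on_ver (rect a b y0 y1)); [|easy]; intros; split; simpl; [lra|easy]|].
          intros t Ht. apply LF. split; simpl; [lra|easy].
    - rewrite Rmult_0_r, Rplus_0_l, F0. do 3 f_equal. ring. }
  exists F. split; [easy|]. split; [|split; [|split]].
  - intros z Rz. apply (gequiv_uhp (Tm (f z))); [now apply Tm_uhp, XF|now apply LF].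
  - intros [x y] Z1 Z2. simpl in Z1, Z2.
    set (rho := Rmin (Rmin (x - a) (b - x)) (Rmin (y - y0) (y1 - y))).
    apply (lift_hol (rect a b y0 y1) f F (x, y) rho); auto.
    + unfold rho. repeat apply Rmin_glb_lt; lra.
    + intros [u v] Hw. pose proof (fst_le_Cmod ((u, v) - (x, y))) as Q1. pose proof (snd_le_Cmod ((u, v) - (x, y))) as Q2.
      simpl in Q1, Q2. apply Rabs_le_between in Q1, Q2. unfold rho in Hw.
      pose proof (Rmin_l (Rmin (x - a) (b - x)) (Rmin (y - y0) (y1 - y))).
      pose proof (Rmin_r (Rmin (x - a) (b - x)) (Rmin (y - y0) (y1 - y))).
      pose proof (Rmin_l (x - a) (b - x)). pose proof (Rmin_r (x - a) (b - x)).
      pose proof (Rmin_l (y - y0) (y1 - y)). pose proof (Rmin_r (y - y0) (y1 - y)).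
      split; simpl; lra.
    + split; easy.
    + apply hol_iff, Hh. simpl. lra.
  - apply (plift_unique a b (fun x => f (x, y0)) _ _ a B3 B1 B2); [split; lra|easy].
  - apply (plift_unique a b (fun x => f (x, y1)) _ (fun x => mob (wmat w) (tau1 (f (x, y1)))) a T3 T1).
    + apply plift_mob; auto. apply Gam_wmat.
    + split; lra.
    + easy.
Qed.

(** * The common perpendicular *)

(** With the argument expressed through x / y, one formula is valid on the whole half-plane and
    gives values in (0, PI). *)
Definition clog (u : C) : C := (ln (Cmod u), PI / 2 - atan (fst u / snd u)).

Lemma clog_im (u : C) : 0 < snd (clog u) < PI.
Proof. simpl. pose proof (atan_bound (fst u / snd u)). lra. Qed.

Lemma cexp_clog (u : C) : uhp u -> cexp (clog u) = u.
Proof.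
  intros H. unfold uhp in H. destruct u as [x y]. simpl in H. unfold clog, cexp.
  assert (Hm : 0 < Cmod (x, y)) by (apply Cmod_gt_0; intros E; apply (f_equal snd) in E; simpl in E; lra).
  cbn [fst snd]. rewrite exp_ln by easy. rewrite cos_shift, sin_shift, sin_atan, cos_atan.
  assert (E : Cmod (x, y) = y * sqrt (1 + (x / y)²)).
  { rewrite <- (sqrt_square y) at 2 by lra. rewrite <- sqrt_mult by (try apply Rle_0_sqr; nra || (pose proof (Rle_0_sqr (x / y)); lra)).
    unfold Cmod. simpl fst. simpl snd. f_equal. unfold Rsqr. field. lra. }
  assert (S : 0 < sqrt (1 + (x / y)²)) by (apply sqrt_lt_R0; pose proof (Rle_0_sqr (x / y)); lra).
  rewrite E. apply injective_projections; simpl; field; lra.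
Qed.

Lemma ctat_clog (u : C) : uhp u -> ctat dC (fun _ => True) clog u.
Proof.
  intros H. unfold uhp in H. destruct u as [x y]. simpl in H.
  assert (Hm : 0 < Cmod (x, y)) by (apply Cmod_gt_0; intros E; apply (f_equal snd) in E; simpl in E; lra).
  assert (C1 : continuous ln (Cmod (x, y))).
  { apply (ex_derive_continuous (K := R_AbsRing) (V := R_NormedModule)). auto_derive. easy. }
  assert (C2 : continuous atan (x / y)) by cont_1.
  intros e He.
  apply filterlim_locally with (eps := mkposreal (e / 2) ltac:(lra)) in C1.
  apply filterlim_locally with (eps := mkposreal (e / 2) ltac:(lra)) in C2.
  destruct C1 as [d1 D1]. destruct C2 as [d2 D2].
  assert (Q : ctat dC (fun _ => True) (fun z : C => (RtoC (fst z) / RtoC (snd z))%C) (x, y)).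
  { assert (Pf : forall pr : C -> R, (forall z w, Rabs (pr z - pr w) <= dC z w) ->
      ctat dC (fun _ => True) (fun z => RtoC (pr z)) (x, y)).
    { intros pr Hpr e' He'. exists e'. split; [easy|]. intros z _ L.
      rewrite <- RtoC_minus, Cmod_R. eapply Rle_lt_trans; [apply Hpr|easy]. }
    apply ctat_div.
    - apply Pf. intros z w. apply (fst_le_Cmod (z - w)).
    - apply Pf. intros z w. apply (snd_le_Cmod (z - w)).
    - intros E. apply RtoC_inj in E. simpl in E. lra. }
  destruct (Q d2 (cond_pos d2)) as (d3 & P3 & Q3).
  exists (Rmin (Rmin d1 d3) (y / 2)). split; [repeat apply Rmin_glb_lt; try lra; apply cond_pos|].
  intros [a b] _ L. unfold dC in L.
  pose proof (Rmin_l (Rmin d1 d3) (y / 2)). pose proof (Rmin_r (Rmin d1 d3) (y / 2)).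
  pose proof (Rmin_l d1 d3). pose proof (Rmin_r d1 d3).
  pose proof (snd_le_Cmod ((a, b) - (x, y))) as B. simpl in B. apply Rabs_le_between in B.
  assert (Hb : 0 < b) by lra.
  eapply Rle_lt_trans; [apply Cmod_le_abs|]. unfold clog. cbn [fst snd Cminus Cplus Copp].
  assert (K1 : Rabs (ln (Cmod (a, b)) - ln (Cmod (x, y))) < e / 2).
  { apply (D1 (Cmod (a, b))). change (Rabs (Cmod (a, b) - Cmod (x, y)) < d1).
    eapply Rle_lt_trans; [|apply (Rlt_le_trans _ _ _ L)]; [|lra].
    pose proof (Cmod_rev (a, b) (x, y)) as R1. pose proof (Cmod_rev (x, y) (a, b)) as R2.
    rewrite (Cmod_swap (x, y)) in R2. apply Rabs_le. lra. }
  assert (K2 : Rabs (atan (a / b) - atan (x / y)) < e / 2).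
  { apply (D2 (a / b)). change (Rabs (a / b - x / y) < d2).
    assert (Z := Q3 (a, b) I ltac:(unfold dC; lra)). simpl fst in Z. simpl snd in Z.
    rewrite <- !RtoC_div, <- RtoC_minus, Cmod_R in Z by lra. exact Z. }
  unfold Rminus in K1, K2. replace (PI / 2 - atan (a / b) + - (PI / 2 - atan (x / y))) with
    (- (atan (a / b) + - atan (x / y))) by ring. rewrite Rabs_Ropp. lra.
Qed.

Lemma cexp_slope_neq_0 (w0 : C) (phi : C -> C) (r : R) : 0 < r -> ctat dC (fun _ => True) phi w0 ->
  (forall w, Cmod (w - w0) < r -> (cexp w - cexp w0 = phi w * (w - w0))%C) -> phi w0 <> RtoC 0.
Proof.
  intros Hr Hc H E. set (m := Cmod (cexp w0)). assert (Hm : 0 < m) by (apply Cmod_gt_0, cexp_neq_0).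
  destruct (Hc (m / 4) ltac:(lra)) as (dl & Hd & Hb).
  set (k := Rmin (Rmin r dl) (/ 16) / 2). 
  assert (Hk : 0 < Rmin (Rmin r dl) (/ 16)) by (repeat apply Rmin_glb_lt; lra).
  pose proof (Rmin_l (Rmin r dl) (/ 16)). pose proof (Rmin_r (Rmin r dl) (/ 16)).
  pose proof (Rmin_l r dl). pose proof (Rmin_r r dl).
  set (w := (w0 + RtoC k)%C). assert (Ew : (w - w0 = RtoC k)%C) by (unfold w; ring).
  assert (Mk : Cmod (RtoC k) = k) by (rewrite Cmod_R; apply Rabs_right; unfold k; lra).
  specialize (H w ltac:(rewrite Ew, Mk; unfold k; lra)). specialize (Hb w I ltac:(unfold dC; rewrite Ew, Mk; unfold k; lra)).
  rewrite E in Hb. replace (phi w - RtoC 0)%C with (phi w) in Hb by ring.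
  assert (Eq : (cexp w - cexp w0 = cexp w0 * (cexp (RtoC k) - RtoC 1))%C) by (unfold w; rewrite cexp_plus; ring).
  apply (f_equal Cmod) in H. rewrite Eq, Ew, !Cmod_mult, Mk in H. fold m in H.
  assert (Q := cexp_quad (RtoC k) ltac:(rewrite Mk; unfold k; lra)). rewrite Mk in Q.
  assert (L : k / 2 <= Cmod (cexp (RtoC k) - RtoC 1)).
  { pose proof (Cmod_rev (RtoC k) (- (cexp (RtoC k) - RtoC 1 - RtoC k))) as Rv. rewrite Cmod_opp, Mk in Rv.
    replace (RtoC k - - (cexp (RtoC k) - RtoC 1 - RtoC k))%C with (cexp (RtoC k) - RtoC 1)%C in Rv by ring.
    assert (8 * (k * k) <= k / 2) by (unfold k in *; nra). lra. }
  assert (0 < k) by (unfold k; lra). nra.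
Qed.

(** Inversion in Caratheodory form: the slope of the logarithm is the reciprocal of the slope of
    [cexp] taken at [clog v], and that slope does not vanish. *)
Lemma hol_clog (u : C) : uhp u -> hol clog u.
Proof.
  intros H. destruct (hol_cexp (clog u)) as (phi & r & Hr & Hc & He).
  assert (N := cexp_slope_neq_0 (clog u) phi r Hr Hc He). assert (CL := ctat_clog u H).
  assert (Cphi : ctat dC (fun _ => True) (fun v => phi (clog v)) u) by now apply ctat_comp_T.
  destruct (ctat_nonzero _ _ _ _ Cphi N) as (d1 & P1 & N1).
  destruct (CL r Hr) as (d2 & P2 & N2).
  exists (fun v => / phi (clog v))%C, (Rmin (Rmin d1 d2) (snd u)).
  split; [repeat apply Rmin_glb_lt; easy|]. split; [now apply ctat_inv|].
  intros v L. pose proof (Rmin_l (Rmin d1 d2) (snd u)). pose proof (Rmin_r (Rmin d1 d2) (snd u)).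
  pose proof (Rmin_l d1 d2). pose proof (Rmin_r d1 d2).
  assert (Uv : uhp v).
  { pose proof (snd_le_Cmod (v - u)) as B. simpl in B. apply Rabs_le_between in B. unfold uhp. lra. }
  specialize (He (clog v) ltac:(apply N2; [easy|unfold dC; lra])). rewrite !cexp_clog in He by easy.
  assert (Nv : phi (clog v) <> RtoC 0).
  { apply Cmod_gt_0. specialize (N1 v I ltac:(unfold dC; lra)). pose proof (Cmod_ge_0 (phi (clog u))). lra. }
  rewrite He. field. easy.
Qed.

(** Uniform continuity near a horizontal side; [s] is 1 for moving up from the lower side and -1 for
    moving down from the upper one. *)
Lemma edge_approx (G : C -> C) (a b y0 y1 y : R) (s : R) (eta : R) : a <= b -> y0 < y1 -> 0 < eta -> Rabs s = 1 ->
  cont_on (rect a b y0 y1) G -> y0 <= y <= y1 ->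
  exists e0, 0 < e0 /\ forall x e, a <= x <= b -> 0 <= e < e0 -> y0 <= y + s * e <= y1 ->
    Cmod (G (x, (y + s * e)%R) - G (x, y)) < eta.
Proof.
  intros Hab Hy He Hs HG Hyy.
  apply (nested_rectangles (fun a' b' _ _ => exists e0, 0 < e0 /\ forall x e, a' <= x <= b' -> 0 <= e < e0 ->
    y0 <= y + s * e <= y1 -> Cmod (G (x, (y + s * e)%R) - G (x, y)) < eta) a b 0 0); [lra|lra| |].
  - intros a' b' c' d' _ _ _ _ _ _ (e1 & P1 & Q1) (e2 & P2 & Q2) _ _.
    exists (Rmin e1 e2). split; [now apply Rmin_glb_lt|]. intros x e Hx Hee Hr.
    pose proof (Rmin_l e1 e2). pose proof (Rmin_r e1 e2).
    destruct (Rle_dec x ((a' + b') / 2)); [apply Q1|apply Q2]; auto; lra.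
  - intros x0 y' Hx0 _. destruct (HG (x0, y)) with (eps := eta / 2) as (dl & Hd & Hb); [split; simpl; lra|lra|].
    exists (dl / 2). split; [lra|]. intros a' b' c' d' Ha Hb' _ _ L _. exists (dl / 2). split; [lra|].
    intros x e Hx Hee Hr.
    assert (N : forall e', 0 <= e' < dl / 2 -> y0 <= y + s * e' <= y1 -> Cmod (G (x, (y + s * e')%R) - G (x0, y)) < eta / 2).
    { intros e' He' Hr'. apply Hb; [split; simpl; lra|]. eapply Rle_lt_trans; [apply Cmod_le_abs|]. simpl.
      assert (Rabs (x + - x0) < dl / 2) by (apply Rabs_def1; lra).
      replace (y + s * e' + - y) with (s * e') by ring. rewrite Rabs_mult, Hs, (Rabs_right e') by lra. lra. }
    assert (N1 := N e Hee Hr). assert (N0 := N 0 ltac:(lra) ltac:(rewrite Rmult_0_r, Rplus_0_r; lra)).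
    rewrite Rmult_0_r, Rplus_0_r, Cmod_swap in N0.
    eapply Rle_lt_trans; [apply (Cmod_tri _ (G (x0, y)))|]. lra.
Qed.

(** The real part of Cauchy's theorem replaces a length-area argument: the horizontal sides
    contribute (u1 - u0) (b - a), and the vertical ones contribute integrals of Im G, which varies
    by at most PI. *)
Theorem strip_flux (G : C -> C) (a b y0 y1 u0 u1 : R) : a < b -> y0 < y1 ->
  cont_on (rect a b y0 y1) G ->
  (forall z : C, a <= fst z <= b -> y0 < snd z < y1 -> hol G z) ->
  (forall z : C, rect a b y0 y1 z -> 0 <= snd (G z) <= PI) ->
  (forall x, a <= x <= b -> fst (G (x, y0)) = u0) -> (forall x, a <= x <= b -> fst (G (x, y1)) = u1) ->
  Rabs (u1 - u0) * (b - a) <= PI * (y1 - y0).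
Proof.
  intros Hab Hy CG HG HV HB HT.
  apply Rnot_lt_le. intros N.
  set (gap := Rabs (u1 - u0) * (b - a) - PI * (y1 - y0)). assert (Hgap : 0 < gap) by (unfold gap; lra).
  set (eta := gap / (4 * (b - a))). assert (Heta : 0 < eta) by (apply Rdiv_lt_0_compat; lra).
  destruct (edge_approx G a b y0 y1 y0 1 eta ltac:(lra) Hy Heta (Rabs_R1) CG ltac:(lra)) as (e1 & P1 & Q1).
  destruct (edge_approx G a b y0 y1 y1 (-1) eta ltac:(lra) Hy Heta ltac:(rewrite Rabs_left; lra) CG ltac:(lra)) as (e2 & P2 & Q2).
  set (e := Rmin (Rmin e1 e2) (y1 - y0) / 3).
  assert (He : 0 < Rmin (Rmin e1 e2) (y1 - y0)) by (repeat apply Rmin_glb_lt; lra).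
  pose proof (Rmin_l (Rmin e1 e2) (y1 - y0)). pose proof (Rmin_r (Rmin e1 e2) (y1 - y0)).
  pose proof (Rmin_l e1 e2). pose proof (Rmin_r e1 e2).
  (* Holomorphy holds in the open height interval only, so the rectangle is shrunk by [e] at both
     ends; the factors 1 and -1 match the directions in [edge_approx]. *)
  set (c := y0 + 1 * e). set (d := y1 + -1 * e).
  assert (Hcd : y0 < c /\ c < d /\ d < y1) by (unfold c, d, e in *; lra).
  assert (Hh : forall z : C, a <= fst z <= b -> c <= snd z <= d -> hol G z) by (intros; apply HG; lra).
  assert (Z := goursat G a b c d ltac:(lra) ltac:(lra) Hh). unfold circ in Z.
  assert (Kc : forall u (l m : R) K (g : R -> R), l < m -> (forall x, l <= x <= m -> continuous g x) ->
    (forall x, l <= x <= m -> Rabs (g x - u) <= K) -> Rabs (RInt g l m - u * (m - l)) <= K * (m - l)).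
  { intros u l m K g Hlm Cg Hg. replace (u * (m - l)) with (RInt (fun _ => u) l m)
      by (rewrite RInt_const; unfold scal; simpl; unfold mult; simpl; ring).
    apply RInt_close; [lra|apply ex_RInt_cont; [lra|easy]|apply ex_RInt_const|easy]. }
  assert (B1 := Kc u0 a b eta (fun x => fst (G (x, c))) Hab).
  assert (B2 := Kc u1 a b eta (fun x => fst (G (x, d))) Hab).
  (* Both vertical integrands are compared with PI / 2, so each integral errs by PI / 2 times the
     height and their difference by PI times the height. *)
  assert (V1 := Kc (PI / 2) c d (PI / 2) (fun y => snd (G (b, y))) ltac:(lra)).
  assert (V2 := Kc (PI / 2) c d (PI / 2) (fun y => snd (G (a, y))) ltac:(lra)).
  assert (W1 := B1 ltac:(intros x Hx; apply ctat_continuous_fst, (ctat_hor G x c), hol_ct, Hh; simpl; lra)).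
  assert (W2 := B2 ltac:(intros x Hx; apply ctat_continuous_fst, (ctat_hor G x d), hol_ct, Hh; simpl; lra)).
  assert (W3 := V1 ltac:(intros y Hyy; apply ctat_continuous_snd, (ctat_ver G b y), hol_ct, Hh; simpl; lra)).
  assert (W4 := V2 ltac:(intros y Hyy; apply ctat_continuous_snd, (ctat_ver G a y), hol_ct, Hh; simpl; lra)).
  clear B1 B2 V1 V2.
  assert (W1' := W1 ltac:(intros x Hx; rewrite <- (HB x Hx); left; eapply Rle_lt_trans;
    [apply (fst_le_Cmod (G (x, c) - G (x, y0)))|apply Q1; unfold c, e in *; lra])).
  assert (W2' := W2 ltac:(intros x Hx; rewrite <- (HT x Hx); left; eapply Rle_lt_trans;
    [apply (fst_le_Cmod (G (x, d) - G (x, y1)))|apply Q2; unfold d, e in *; lra])).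
  assert (W3' := W3 ltac:(intros y Hyy; apply Rabs_le; assert (T := HV (b, y) ltac:(split; simpl; lra)); lra)).
  assert (W4' := W4 ltac:(intros y Hyy; apply Rabs_le; assert (T := HV (a, y) ltac:(split; simpl; lra)); lra)).
  clear W1 W2 W3 W4.
  apply Rabs_le_between in W1', W2', W3', W4'.
  assert (Ee : eta * (b - a) = gap / 4) by (unfold eta; field; lra).
  pose proof PI_RGT_0 as HP.
  assert (PI * (d - c) <= PI * (y1 - y0)) by (apply Rmult_le_compat_l; lra).
  assert (Rabs (u1 - u0) * (b - a) <= PI * (d - c) + gap / 2).
  { unfold Rabs. destruct (Rcase_abs (u1 - u0)); lra. }
  unfold gap in *. lra.
Qed.

(* In the half-plane model the geodesics [I] (the positive imaginary axis) and [V J]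
   (the image of the unit semicircle) have the common perpendicular |h| = rho; the map
   [ucoord] sends it to the imaginary axis. *)
Section Perp.
Variable V : mat.
Hypothesis HV : SL2 V.
(** [alpha], [Nst] and [beta] are the coefficients of the equation alpha |h|^2 - 2 Nst Re h + beta =
    0 of [V J]; its discriminant Nst^2 - alpha beta is 1. *)
Definition Nst : R := IZR (mq V) * IZR (ms V) - IZR (mp V) * IZR (mr V).
Definition alpha : R := IZR (ms V) * IZR (ms V) - IZR (mr V) * IZR (mr V).
Definition beta : R := IZR (mq V) * IZR (mq V) - IZR (mp V) * IZR (mp V).
Hypothesis HN : 2 <= Rabs Nst.

Definition rho : R := sqrt (beta / alpha).
(** The constant value of |ucoord|^2 on [V J]. Half its logarithm is the distance from [I] with a
    sign, which tells on which side of [I] the geodesic lies. *)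
Definition kap : R := (Nst / alpha - rho) / (Nst / alpha + rho).
Definition gdist : R := ln kap / 2.
Definition ucoord (h : C) : C := ((h - RtoC rho) / (h + RtoC rho))%C.

Lemma alpha_beta : alpha * beta = Nst * Nst - 1.
Proof.
  assert (D := SL2_R V HV). unfold alpha, beta, Nst.
  set (p := IZR (mp V)) in *. set (q := IZR (mq V)) in *. set (r := IZR (mr V)) in *. set (s := IZR (ms V)) in *.
  replace 1 with ((p * s - q * r) * (p * s - q * r)) by (rewrite D; ring). ring.
Qed.

Lemma Nst_sq : 4 <= Nst * Nst.
Proof. pose proof (Rsqr_abs Nst) as E. unfold Rsqr in E. nra. Qed.

Lemma alpha_neq_0 : alpha <> 0.
Proof. intros E. assert (A := alpha_beta). rewrite E in A. pose proof Nst_sq. lra. Qed.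

Lemma rho_sq : rho * rho = beta / alpha /\ 0 < rho.
Proof.
  assert (A := alpha_beta). assert (NA := alpha_neq_0). pose proof Nst_sq.
  assert (P : 0 < beta / alpha).
  { replace (beta / alpha) with ((alpha * beta) / (alpha * alpha)) by (field; easy).
    apply Rdiv_lt_0_compat; [lra|]. pose proof (Rsqr_pos_lt alpha NA) as Q. exact Q. }
  split; [apply sqrt_sqrt; lra|now apply sqrt_lt_R0].
Qed.

Lemma kap_alt : 0 < kap /\ (kap = / ((Rabs Nst + Rabs alpha * rho) * (Rabs Nst + Rabs alpha * rho)) \/
  kap = (Rabs Nst + Rabs alpha * rho) * (Rabs Nst + Rabs alpha * rho)).
Proof.
  destruct rho_sq as [R1 R2]. assert (NA := alpha_neq_0). assert (A := alpha_beta). pose proof Nst_sq as N4.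
  assert (AR : Rabs alpha * rho * (Rabs alpha * rho) = Nst * Nst - 1).
  { pose proof (Rsqr_abs alpha) as E. unfold Rsqr in E.
    replace (Rabs alpha * rho * (Rabs alpha * rho)) with (Rabs alpha * Rabs alpha * (rho * rho)) by ring.
    rewrite <- E, R1, <- A. field. easy. }
  assert (AA : 0 < Rabs alpha) by now apply Rabs_pos_lt.
  set (t := Rabs alpha * rho) in *. assert (Ht : 0 < t) by (unfold t; nra).
  assert (EN : Rabs Nst * Rabs Nst = Nst * Nst) by (pose proof (Rsqr_abs Nst) as E; unfold Rsqr in E; lra).
  set (n := Rabs Nst) in *.
  assert (One : (n + t) * (n - t) = 1) by nra.
  assert (Hnt : 0 < n - t) by nra.
  assert (Cases : (Nst / alpha = n / Rabs alpha /\ kap = (n - t) / (n + t)) \/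
                  (Nst / alpha = - (n / Rabs alpha) /\ kap = (n + t) / (n - t))).
  { assert (rho = t / Rabs alpha) by (unfold t; field; lra).
    assert (S : Nst / alpha = n / Rabs alpha \/ Nst / alpha = - (n / Rabs alpha)).
    { unfold n, Rabs. destruct (Rcase_abs Nst); destruct (Rcase_abs alpha);
        [left|right|right|left]; field; lra. }
    destruct S as [S|S]; [left|right]; (split; [easy|]); unfold kap; rewrite S, H; field; repeat split; lra. }
  destruct Cases as [[_ E]|[_ E]].
  - assert (E2 : kap = / ((n + t) * (n + t))).
    { rewrite E. apply Rmult_eq_reg_r with ((n + t) * (n + t)); [|nra]. rewrite Rinv_l by nra.
      transitivity ((n + t) * (n - t)); [field; lra|easy]. }
    split; [|now left]. rewrite E2. apply Rinv_0_lt_compat. nra.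
  - assert (E2 : kap = (n + t) * (n + t)).
    { rewrite E. transitivity ((n + t) * ((n + t) * (n - t)) / (n - t)); [rewrite One|]; field; lra. }
    split; [|now right]. rewrite E2. nra.
Qed.

(** |gdist| is ln (n + sqrt (n^2 - 1)), that is arccosh n, and the root lies between 0 and n. *)
Lemma gdist_bounds : ln (Rabs Nst) <= Rabs gdist <= ln (2 * Rabs Nst).
Proof.
  destruct rho_sq as [R1 R2]. assert (NA := alpha_neq_0). assert (A := alpha_beta).
  assert (AR : Rabs alpha * rho * (Rabs alpha * rho) = Rabs Nst * Rabs Nst - 1).
  { pose proof (Rsqr_abs alpha) as E. pose proof (Rsqr_abs Nst) as E'. unfold Rsqr in E, E'.
    replace (Rabs alpha * rho * (Rabs alpha * rho)) with (Rabs alpha * Rabs alpha * (rho * rho)) by ring.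
    rewrite <- E, R1, <- E', <- A. field. easy. }
  assert (AA : 0 < Rabs alpha) by now apply Rabs_pos_lt.
  assert (Ht : 0 < Rabs alpha * rho) by nra.
  destruct kap_alt as [K0 K]. set (t := Rabs alpha * rho) in *. set (n := Rabs Nst) in *.
  assert (L : Rabs gdist = ln (n + t)).
  { assert (E2 : ln ((n + t) * (n + t)) = 2 * ln (n + t)) by (rewrite ln_mult; lra).
    assert (P : 0 <= ln (n + t)) by (rewrite <- ln_1; apply Rlt_le, ln_increasing; lra).
    unfold gdist. destruct K as [-> | ->].
    - rewrite ln_Rinv, E2 by nra. rewrite Rabs_left1; lra.
    - rewrite E2. rewrite Rabs_right; lra. }
  rewrite L. assert (t < n) by nra. split.
  - apply Rlt_le, ln_increasing; lra.
  - apply Rlt_le, ln_increasing; lra.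
Qed.

Lemma ucoord_den (h : C) : uhp h -> (h + RtoC rho <> RtoC 0)%C.
Proof. intros H E. apply (f_equal snd) in E. unfold uhp in H. simpl in E. lra. Qed.

Lemma ucoord_uhp (h : C) : uhp h -> uhp (ucoord h).
Proof.
  intros H. destruct rho_sq as [_ R2]. assert (D := ucoord_den h H). unfold uhp in *. unfold ucoord.
  destruct h as [x y]. simpl in H |- *.
  pose proof (Rle_0_sqr (x + rho)) as P0. unfold Rsqr in P0. assert (P : 0 < (x + rho) * (x + rho) + y * y) by nra.
  match goal with |- 0 < ?X => replace X with (2 * rho * y / ((x + rho) * (x + rho) + y * y)) by (field; nra) end.
  apply Rdiv_lt_0_compat; nra.
Qed.

Lemma hol_ucoord (h : C) : uhp h -> hol ucoord h.
Proof.
  intros H. unfold ucoord. apply hol_div.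
  - apply hol_minus; [apply hol_id|apply hol_const].
  - apply hol_plus; [apply hol_id|apply hol_const].
  - now apply ucoord_den.
Qed.

Lemma ucoord_sq (h : C) : uhp h -> Cmod (ucoord h) * Cmod (ucoord h) =
  (fst h * fst h + snd h * snd h + rho * rho - 2 * rho * fst h) /
  (fst h * fst h + snd h * snd h + rho * rho + 2 * rho * fst h).
Proof.
  intros H. assert (D := ucoord_den h H). unfold ucoord. rewrite Cmod_div by easy.
  assert (Dp := proj1 (Cmod_gt_0 _) D).
  transitivity (Cmod (h - RtoC rho) * Cmod (h - RtoC rho) / (Cmod (h + RtoC rho) * Cmod (h + RtoC rho))).
  - field. lra.
  - rewrite !Cmod_sq. simpl. f_equal; ring.
Qed.

Lemma ucoord_I (h : C) : uhp h -> fst h = 0 -> fst (clog (ucoord h)) = 0.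
Proof.
  intros H E. assert (S := ucoord_sq h H). rewrite E in S. destruct rho_sq as [_ R2].
  assert (D : 0 < 0 * 0 + snd h * snd h + rho * rho) by nra.
  replace (0 * 0 + snd h * snd h + rho * rho - 2 * rho * 0) with (0 * 0 + snd h * snd h + rho * rho) in S by ring.
  replace (0 * 0 + snd h * snd h + rho * rho + 2 * rho * 0) with (0 * 0 + snd h * snd h + rho * rho) in S by ring.
  unfold Rdiv in S. rewrite Rinv_r in S by lra.
  pose proof (Cmod_ge_0 (ucoord h)). assert (E1 : Cmod (ucoord h) = 1) by nra.
  simpl. rewrite E1. apply ln_1.
Qed.

Lemma VJ_circle (h : C) : uhp h -> (Cmod (mob (minv V) h) = 1 <->
  alpha * (fst h * fst h + snd h * snd h) - 2 * Nst * fst h + beta = 0).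
Proof.
  intros H. assert (HI := SL2_inv V HV). assert (D := mob_den (minv V) h HI H).
  assert (Dp := proj1 (Cmod_gt_0 _) D). unfold mob. rewrite Cmod_div by easy.
  set (nu := (ZtoC (mp (minv V)) * h + ZtoC (mq (minv V)))%C) in *.
  set (de := (ZtoC (mr (minv V)) * h + ZtoC (ms (minv V)))%C) in *.
  assert (Key : Cmod nu * Cmod nu - Cmod de * Cmod de =
     alpha * (fst h * fst h + snd h * snd h) - 2 * Nst * fst h + beta).
  { rewrite !Cmod_sq. unfold nu, de, minv, alpha, beta, Nst, ZtoC. cbn [mp mq mr ms].
    rewrite !opp_IZR. destruct h as [x y]. simpl. ring. }
  rewrite <- Key. pose proof (Cmod_ge_0 nu). split; intros E.
  - assert (Cmod nu = Cmod de); [|nra]. apply (Rmult_eq_compat_r (Cmod de)) in E. 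
    unfold Rdiv in E. rewrite Rmult_assoc, Rinv_l in E by lra. lra.
  - assert (Cmod nu = Cmod de) by nra. rewrite H1. field. lra.
Qed.

(** On [V J] the equation of the circle expresses |h|^2 + rho^2 as a constant multiple of Re h, so
    Re h cancels from the quotient in [ucoord_sq]. *)
Lemma ucoord_VJ (h : C) : uhp h -> Cmod (mob (minv V) h) = 1 -> fst (clog (ucoord h)) = gdist.
Proof.
  intros H E. apply VJ_circle in E; [|easy]. assert (S := ucoord_sq h H).
  destruct rho_sq as [R1 R2]. assert (NA := alpha_neq_0). pose proof Nst_sq as N4.
  assert (Hy : 0 < snd h * snd h) by (unfold uhp in H; nra).
  assert (EQ : fst h * fst h + snd h * snd h + rho * rho = 2 * (Nst / alpha) * fst h).
  { rewrite R1. apply Rmult_eq_reg_l with alpha; [|easy]. 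
    transitivity (alpha * (fst h * fst h + snd h * snd h) + beta); [field; easy|].
    transitivity (2 * Nst * fst h); [lra|field; easy]. }
  assert (NX : fst h <> 0).
  { intros X. rewrite X in EQ. nra. }
  assert (NK : Nst / alpha + rho <> 0).
  { intros X. assert (P := proj1 kap_alt). unfold kap in P. rewrite X in P. unfold Rdiv in P.
    rewrite Rinv_0, Rmult_0_r in P. lra. }
  rewrite EQ in S.
  assert (S' : Cmod (ucoord h) * Cmod (ucoord h) = kap).
  { rewrite S. unfold kap. field. repeat split; auto.
    - intros X. apply NK. apply Rmult_eq_reg_l with alpha; [|easy]. rewrite Rmult_0_r. 
      rewrite <- X. field. easy.
    - intros X. apply NK. assert (X2 : 2 * fst h * (Nst + rho * alpha) = 0) by lra.
      apply Rmult_integral in X2. destruct X2 as [X2|X2]; [lra|].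
      apply Rmult_eq_reg_l with alpha; [|easy]. rewrite Rmult_0_r. rewrite <- X2. field. easy. }
  assert (U := uhp_neq_0 _ (ucoord_uhp h H)). apply Cmod_gt_0 in U.
  simpl. unfold gdist. rewrite <- S', ln_mult by easy. lra.
Qed.
End Perp.

(** * Syllables and matrices *)

Lemma rect_subset (a b c d a' b' c' d' : R) (z : C) : a <= a' -> b' <= b -> c <= c' -> d' <= d ->
  rect a' b' c' d' z -> rect a b c d z.
Proof. unfold rect. intros. lra. Qed.

(** * Extremal length and hyperbolic distance *)

Lemma lower_core (V : mat) (F : C -> C) (a b y0 y1 : R) (u0 u1 : R) :
  SL2 V -> 2 <= Rabs (Nst V) -> a < b -> y0 < y1 ->
  cont_on (rect a b y0 y1) F -> (forall z, rect a b y0 y1 z -> uhp (F z)) ->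
  (forall z : C, a <= fst z <= b -> y0 < snd z < y1 -> hol F z) ->
  (forall x, a <= x <= b -> fst (clog (ucoord V (F (x, y0)))) = u0) ->
  (forall x, a <= x <= b -> fst (clog (ucoord V (F (x, y1)))) = u1) ->
  Rabs (u1 - u0) * (b - a) <= PI * (y1 - y0).
Proof.
  intros HV HN Hab Hy CF UF HF HB HT.
  apply (strip_flux (fun z => clog (ucoord V (F z))) a b y0 y1 u0 u1); auto.
  - intros z Rz. assert (U := UF z Rz). assert (U2 := ucoord_uhp V HV HN _ U).
    apply (ctat_comp_T dC _ (fun z => ucoord V (F z)) clog); [|now apply ctat_clog].
    apply (ctat_comp_T dC _ F (ucoord V)); [now apply cont_at|]. now apply hol_ct, hol_ucoord.
  - intros z H1 H2. assert (U : uhp (F z)) by (apply UF; split; lra).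
    apply (hol_comp (fun z => ucoord V (F z)) clog).
    + apply (hol_comp F (ucoord V)); [now apply HF|now apply hol_ucoord].
    + now apply hol_clog, ucoord_uhp.
  - intros z _. pose proof (clog_im (ucoord V (F z))). lra.
Qed.

(** Passage to the limit from closed subintervals to the full horizontal side. *)
Lemma shrink (d P x0 x1 : R) : 0 <= d -> x0 < x1 ->
  (forall a b, x0 < a -> a < b -> b < x1 -> d * (b - a) <= P) -> d * (x1 - x0) <= P.
Proof.
  intros Hd Hx H. apply Rnot_lt_le. intros N.
  assert (Hdp : 0 < d).
  { destruct (Req_dec d 0) as [->|]; [|lra]. specialize (H (x0 + (x1 - x0) / 3) (x1 - (x1 - x0) / 3)).
    assert (0 * (x1 - (x1 - x0) / 3 - (x0 + (x1 - x0) / 3)) <= P) by (apply H; lra). lra. }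
  set (e := Rmin ((x1 - x0) / 3) ((d * (x1 - x0) - P) / (4 * d))).
  assert (He : 0 < e) by (apply Rmin_glb_lt; [lra|apply Rdiv_lt_0_compat; lra]).
  pose proof (Rmin_l ((x1 - x0) / 3) ((d * (x1 - x0) - P) / (4 * d))) as M1. fold e in M1.
  pose proof (Rmin_r ((x1 - x0) / 3) ((d * (x1 - x0) - P) / (4 * d))) as M2. fold e in M2.
  specialize (H (x0 + e) (x1 - e) ltac:(lra) ltac:(lra) ltac:(lra)).
  apply (Rmult_le_compat_l (4 * d)) in M2; [|lra].
  replace (4 * d * ((d * (x1 - x0) - P) / (4 * d))) with (d * (x1 - x0) - P) in M2 by (field; lra). lra.
Qed.

Theorem lower_tr_pb (w : word) (x0 x1 y0 y1 : R) (f : C -> C) :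
  2 <= Rabs (Nst (wmat w)) -> x0 < x1 -> y0 < y1 -> holo_represents (tr_pb w) x0 x1 y0 y1 f ->
  ln (Rabs (Nst (wmat w))) * (x1 - x0) <= PI * (y1 - y0).
Proof.
  intros HN Hx Hy HR. set (V := wmat w) in *. assert (HV : SL2 V) by apply Gam_SL2, Gam_wmat.
  eapply Rle_trans; [apply Rmult_le_compat_r; [lra|apply (gdist_bounds V HV HN)]|].
  apply shrink; [apply Rabs_pos|easy|]. intros a b Ha Hab Hb.
  (* The lift is taken over a slightly wider rectangle, since it is holomorphic in the interior
     while [lower_core] asks for holomorphy up to the vertical sides. *)
  destruct (rectangle_lift E_tr E_pb w x0 x1 y0 y1 f ((x0 + a) / 2) ((x1 + b) / 2) E_tr_Om E_pb_Om)
    as (F & CF & UF & HF & FB & FT); try lra; try exact HR.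
  destruct HR as (_ & _ & _ & HB & HT & _). simpl in HB, HT.
  replace (gdist V) with (gdist V - 0) by ring.
  apply (lower_core V F a b y0 y1 0 (gdist V)); auto.
  - apply (cont_on_subset (rect ((x0 + a) / 2) ((x1 + b) / 2) y0 y1)); [|easy]. intros z. apply rect_subset; lra.
  - intros z Rz. apply UF. apply (rect_subset _ _ _ _ a b y0 y1); auto; lra.
  - intros z H1 H2. apply HF; lra.
  - intros x Hxx. apply ucoord_I; auto.
    + apply UF. split; simpl; lra.
    + rewrite FB by lra. destruct (HB x ltac:(lra)) as [T1 T2]. now apply tau1_real.
  - intros x Hxx. apply ucoord_VJ; auto.
    + apply UF. split; simpl; lra.
    + rewrite FT by lra. rewrite mob_inv_l; [|easy|].
      * apply tau1_imag, HT. lra.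
      * apply tau1_uhp. right. rewrite (HT x ltac:(lra)). lra.
Qed.

(** The lift leads from J to W I. Applying V = W^(-1) turns it into a map from [V J] to I, the
    configuration of [lower_tr_pb] run backwards. *)
Theorem lower_pb_tr (w : word) (x0 x1 y0 y1 : R) (f : C -> C) :
  2 <= Rabs (Nst (minv (wmat w))) -> x0 < x1 -> y0 < y1 -> holo_represents (pb_tr w) x0 x1 y0 y1 f ->
  ln (Rabs (Nst (minv (wmat w)))) * (x1 - x0) <= PI * (y1 - y0).
Proof.
  intros HN Hx Hy HR. set (W := wmat w) in *. assert (HW : SL2 W) by apply Gam_SL2, Gam_wmat.
  set (V := minv W) in *. assert (HV : SL2 V) by now apply SL2_inv.
  assert (EV : minv V = W) by (unfold V, minv; destruct W; simpl; f_equal; lia).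
  eapply Rle_trans; [apply Rmult_le_compat_r; [lra|apply (gdist_bounds V HV HN)]|].
  apply shrink; [apply Rabs_pos|easy|]. intros a b Ha Hab Hb.
  destruct (rectangle_lift E_pb E_tr w x0 x1 y0 y1 f ((x0 + a) / 2) ((x1 + b) / 2) E_pb_Om E_tr_Om)
    as (F & CF & UF & HF & FB & FT); try lra; try exact HR.
  destruct HR as (_ & _ & _ & HB & HT & _). simpl in HB, HT.
  rewrite <- Rabs_Ropp. replace (- gdist V) with (0 - gdist V) by ring.
  apply (lower_core V (fun z => mob V (F z)) a b y0 y1 (gdist V) 0); auto.
  - intros z Rz. assert (Rz' : rect ((x0 + a) / 2) ((x1 + b) / 2) y0 y1 z)
      by (apply (rect_subset _ _ _ _ a b y0 y1); auto; lra).
    apply (ctat_comp_T dC _ F (mob V)); [|now apply hol_ct, hol_mob, UF].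
    apply (ctat_subset dC (rect ((x0 + a) / 2) ((x1 + b) / 2) y0 y1)); [now apply cont_at|].
    intros v. apply rect_subset; lra.
  - intros z Rz. apply mob_uhp; [easy|]. apply UF. apply (rect_subset _ _ _ _ a b y0 y1); auto; lra.
  - intros z H1 H2. apply (hol_comp F (mob V)); [apply HF; lra|]. apply hol_mob; [easy|].
    apply UF. split; lra.
  - intros x Hxx. assert (U : uhp (F (x, y0))) by (apply UF; split; simpl; lra).
    apply ucoord_VJ; auto; [now apply mob_uhp|]. rewrite mob_inv_l by easy.
    rewrite FB by lra. apply tau1_imag, HB. lra.
  - intros x Hxx. assert (U : uhp (F (x, y1))) by (apply UF; split; simpl; lra).
    apply ucoord_I; auto; [now apply mob_uhp|]. rewrite FT by lra.
    destruct (HT x ltac:(lra)) as [T1 T2]. unfold V. rewrite mob_inv_l; [now apply tau1_real|easy|].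
    apply tau1_uhp. now right.
Qed.

(** * Growth of the quadratic form along a word *)

Local Open Scope Z_scope.

Definition NZ (M : mat) : Z := mq M * ms M - mp M * mr M.
Definition aZ (M : mat) : Z := ms M * ms M - mr M * mr M.
Definition bZ (M : mat) : Z := mq M * mq M - mp M * mp M.

Lemma Nst_NZ (M : mat) : Nst M = IZR (NZ M).
Proof. unfold Nst, NZ. rewrite minus_IZR, !mult_IZR. reflexivity. Qed.

(* Up to sign and exchange of the outer entries, the state of a list of exponents is the
   integral quadratic form of the geodesic [V J]; as the generators alternate, only the
   exponents matter. *)
Fixpoint st (l : list Z) : Z * Z * Z :=
  match l with
  | [] => (1, 0, -1)
  | n :: r => let '(x, N, y) := st r in (y - 4 * n * N + 4 * n * n * x, 2 * n * x - N, x)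
  end.

Definition form_state (b : bool) (M : mat) (s : Z * Z * Z) : Prop :=
  exists e, (e = 1 \/ e = -1) /\ let '(x, N, y) := s in
    if b then aZ M = e * y /\ NZ M = e * N /\ bZ M = e * x
    else aZ M = e * x /\ NZ M = - (e * N) /\ bZ M = e * y.

(** A translation by 2 n on the left fixes [aZ], adds 2 n [aZ] to [NZ] and changes [bZ]
    quadratically; the other generator does the same with the outer coefficients exchanged. As
    generators alternate, the coefficient changed by one term is the one that the next term to its
    left keeps. *)
Lemma form_state_word (w : word) : alternating w ->
  forall b, (forall t r, w = t :: r -> fst t = b) -> form_state b (wmat w) (st (map snd w)).
Proof.
  induction w as [|[g n] r IH]; intros Ha b Hb.
  - exists (if b then -1 else 1). split; [destruct b; auto|]. destruct b; simpl; auto.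
  - assert (g = b) by exact (Hb (g, n) r eq_refl). subst g.
    assert (Ar : alternating r) by (destruct r as [|[g' n'] r']; [exact I|now destruct Ha]).
    destruct (IH Ar (negb b)) as (e & He & HS).
    { intros [g' n'] r' E. subst r. destruct Ha as [Hn _]. simpl. destruct b, g'; easy. }
    change (st (map snd ((b, n) :: r))) with (let '(x, N, y) := st (map snd r) in
      (y - 4 * n * N + 4 * n * n * x, 2 * n * x - N, x)).
    destruct (st (map snd r)) as [[x N] y]. exists e. split; [easy|].
    unfold aZ, bZ, NZ in *. simpl wmat. unfold mmul, tmat. 
    destruct b; cbn [negb fst snd mp mq mr ms] in *; destruct HS as (H1 & H2 & H3);
      set (p := mp (wmat r)) in *; set (q := mq (wmat r)) in *; set (rr := mr (wmat r)) in *; set (s := ms (wmat r)) in *.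
    + repeat split.
      * transitivity (s * s - rr * rr); [ring|]. rewrite H1. ring.
      * transitivity ((q * s - p * rr) + 2 * n * (s * s - rr * rr)); [ring|]. rewrite H1, H2. ring.
      * transitivity ((q * q - p * p) + 4 * n * (q * s - p * rr) + 4 * n * n * (s * s - rr * rr)); [ring|].
        rewrite H1, H2, H3. ring.
    + repeat split.
      * transitivity ((s * s - rr * rr) - 4 * n * (q * s - p * rr) + 4 * n * n * (q * q - p * p)); [ring|].
        rewrite H1, H2, H3. ring.
      * transitivity ((q * s - p * rr) - 2 * n * (q * q - p * p)); [ring|]. rewrite H2, H3. ring.
      * transitivity (q * q - p * p); [ring|]. rewrite H3. ring.
Qed.

(** The exponential of [run_contribution]; the growth estimates thus become inequalities between
    integers. *)
Definition pc (p : Z * nat) : Z :=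
  let (n, k) := p in if 2 <=? Z.abs n then (4 * Z.abs n - 1) ^ Z.of_nat k else 4 * Z.of_nat k - 1.
Definition prodc (l : list (Z * nat)) : Z := fold_right (fun p acc => pc p * acc) 1 l.

(** Invariant of the recursion: [m] is the first exponent, [k] the length of its run, [Q] the
    product over the later runs. While exponents of equal sign and modulus 1 repeat, the step is
    parabolic: [x + y - 2 * nu] is constant, [x - nu] grows at most linearly in [k] and [nu] at most
    quadratically. [B] and [E] control these rates from below and above. This polynomial growth is
    why such a run counts as one syllable. For |m| >= 2 the inequality [3 * nu <= x] prepares the
    start of a run. *)
Definition good (m x nu y : Z) (k : nat) (Q : Z) : Prop :=
  m <> 0 /\ 0 < nu /\ 0 < y <= x /\ nu < x /\ 2 * nu <= x + y /\ 1 <= Q /\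
  (2 <= Z.abs m -> 3 * nu <= x) /\
  (Z.abs m = 1 -> exists B E, 0 <= B /\ Q <= B * B /\ 2 * Z.of_nat k * B <= nu /\ B <= x - nu /\
     0 <= E <= 10 * Q ^ 4 /\ x + y - 2 * nu <= E /\ x - nu <= Z.of_nat k * E /\ nu <= Z.of_nat k * Z.of_nat k * E).

(** Here [a] is the modulus of the new exponent and [d] the product of its sign with that of the
    preceding one. For d = -1 all terms add up; for d = 1 the cancellation is controlled by [nu < x]
    and [2 * nu <= x + y]. *)
Lemma step_bounds (a x nu y : Z) (d : Z) : 1 <= a -> 0 <= nu -> 0 < y <= x -> nu < x -> 2 * nu <= x + y -> d = 1 \/ d = -1 ->
  let x' := y - 4 * a * (d * nu) + 4 * a * a * x in let nu' := 2 * a * x - d * nu in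
  0 < nu' /\ 0 < x <= x' /\ nu' < x' /\ 2 * nu' <= x' + x /\ (2 * a - 1) * nu' <= x' /\ (2 * a - 1) * nu <= nu' /\
  x' <= (2 * a + 1) * (2 * a + 1) * x.
Proof.
  intros Ha Hn Hy Hx HD Hd x' nu'.
  assert (E1 : x' - (2 * a - 1) * nu' = y + 2 * a * x - (2 * a + 1) * (d * nu)) by (unfold x', nu'; ring).
  assert (E2 : x' + x - 2 * nu' = y + (2 * a - 1) * (2 * a - 1) * x - 2 * (2 * a - 1) * (d * nu)) by (unfold x', nu'; ring).
  assert (E3 : x' - nu' = y + (4 * a * a - 2 * a) * x - (4 * a - 1) * (d * nu)) by (unfold x', nu'; ring).
  assert (M1 : 0 <= (a - 1) * (x - nu)) by nia. assert (M2 : 0 <= (a - 1) * nu) by nia.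
  assert (M3 : 0 <= (a - 1) * (a - 1) * x) by nia. assert (M4 : 0 <= (a - 1) * x) by nia.
  destruct Hd as [-> | ->]; rewrite ?Z.mul_1_l in *; repeat split; unfold x', nu' in *; nia.
Qed.

Lemma square_growth (a nu nu' P : Z) : 2 <= a -> 0 < nu -> 0 <= P -> P <= nu * nu -> (2 * a - 1) * nu <= nu' ->
  (4 * a - 1) * P <= nu' * nu'.
Proof.
  intros Ha Hn HP HPn H.
  assert (A : 4 * a - 1 <= (2 * a - 1) * (2 * a - 1)) by nia.
  assert (B : (2 * a - 1) * nu * ((2 * a - 1) * nu) <= nu' * nu') by (apply Z.mul_le_mono_nonneg; nia).
  assert (D : (4 * a - 1) * P <= (2 * a - 1) * (2 * a - 1) * (nu * nu)) by (apply Z.mul_le_mono_nonneg; nia).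
  lia.
Qed.

Lemma fourth_growth (a x x' P : Z) : 2 <= a -> 0 <= x -> x <= P ^ 4 -> x' <= (2 * a + 1) * (2 * a + 1) * x ->
  x' <= ((4 * a - 1) * P) ^ 4.
Proof.
  intros Ha Hx H1 H2. rewrite Z.pow_mul_l.
  assert (A : (2 * a + 1) * (2 * a + 1) <= (4 * a - 1) ^ 4).
  { replace ((4 * a - 1) ^ 4) with ((4 * a - 1) * (4 * a - 1) * ((4 * a - 1) * (4 * a - 1))) by ring.
    assert ((2 * a + 1) * (2 * a + 1) <= (4 * a - 1) * (4 * a - 1)) by nia. nia. }
  assert (B : (2 * a + 1) * (2 * a + 1) * x <= (4 * a - 1) ^ 4 * P ^ 4) by (apply Z.mul_le_mono_nonneg; nia).
  lia.
Qed.

(** The comparisons behind the two bounds are 4 K - 1 <= 4 K^2 and 20 K^2 <= (4 K - 1)^4; the factor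
    20 is the 10 in the bound for [E] times the 2 from K^2 + K <= 2 K^2. *)
Lemma run_bounds (x nu K B E Q y : Z) : 1 <= K -> nu < x -> 1 <= Q -> 0 <= B -> Q <= B * B -> 2 * K * B <= nu ->
  0 <= E <= 10 * Q ^ 4 -> x - nu <= K * E -> nu <= K * K * E ->
  (4 * K - 1) * Q <= nu * nu /\ x <= ((4 * K - 1) * Q) ^ 4 /\ 3 <= (4 * K - 1) * Q.
Proof.
  intros HK Hx HQ HB HQB HnB HE HgE HnE. split; [|split].
  - assert (H0 : 0 <= 2 * K * B) by nia.
    assert (H1 : (2 * K * B) * (2 * K * B) <= nu * nu) by (apply Z.mul_le_mono_nonneg; lia).
    assert (H2 : (4 * K - 1) * Q <= 4 * (K * K) * (B * B)) by (apply Z.mul_le_mono_nonneg; nia). lia.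
  - rewrite Z.pow_mul_l.
    assert (H20 : 20 * (K * K) <= (4 * K - 1) ^ 4).
    { replace ((4 * K - 1) ^ 4) with ((4 * K - 1) * (4 * K - 1) * ((4 * K - 1) * (4 * K - 1))) by ring.
      assert (9 * (K * K) <= (4 * K - 1) * (4 * K - 1)) by nia. nia. }
    assert (HP : 0 < Q ^ 4) by (apply Z.pow_pos_nonneg; lia).
    assert (H1 : (K * K + K) * E <= (2 * (K * K)) * (10 * Q ^ 4)) by (apply Z.mul_le_mono_nonneg; nia).
    assert (H2 : 20 * (K * K) * Q ^ 4 <= (4 * K - 1) ^ 4 * Q ^ 4) by (apply Z.mul_le_mono_nonneg_r; lia). lia.
  - nia.
Qed.

(** The new [nu] is nu + 2 (x - nu), and the new difference is x - nu plus the constant x + y - 2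
    nu; so the lower bound gains 2 B, and k^2 + 2 k <= (k + 1)^2 gives the upper one. *)
Lemma run_step (x nu y K B E : Z) : 1 <= K -> 0 <= B -> 0 <= E -> 2 * nu <= x + y -> 2 * K * B <= nu -> B <= x - nu ->
  x + y - 2 * nu <= E -> x - nu <= K * E -> nu <= K * K * E ->
  let x' := y - 4 * 1 * (1 * nu) + 4 * 1 * 1 * x in let nu' := 2 * 1 * x - 1 * nu in
  2 * Z.succ K * B <= nu' /\ B <= x' - nu' /\ x' + x - 2 * nu' <= E /\ x' - nu' <= Z.succ K * E /\
  nu' <= Z.succ K * Z.succ K * E.
Proof. intros HK HB HE HD H1 H2 H3 H4 H5 x' nu'. unfold x', nu'. repeat split; nia. Qed.

(** A new run of exponents of modulus 1 begins either with a change of sign or after an exponent of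
    modulus at least 2, where [3 * nu <= x] is available. The new rates are [B] = nu and [E] = 10
    x. *)
Lemma run_start (x nu y d : Z) : 0 < nu -> 0 < y <= x -> nu < x -> d = -1 \/ (d = 1 /\ 3 * nu <= x) ->
  let x' := y - 4 * 1 * (d * nu) + 4 * 1 * 1 * x in let nu' := 2 * 1 * x - d * nu in
  2 * 1 * nu <= nu' /\ nu <= x' - nu' /\ x' + x - 2 * nu' <= 10 * x /\ x' - nu' <= 1 * (10 * x) /\
  nu' <= 1 * 1 * (10 * x).
Proof. intros Hn Hy Hx Hd x' nu'. unfold x', nu'. destruct Hd as [-> |[-> H]]; lia. Qed.

(** For exponents of modulus at least 2 the factor 4 a - 1 is at most (2 a - 1)^2, the square of the
    growth of [nu]. For runs of modulus 1 the syllable factor changes with each new term, so the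
    bounds are recomputed from [Q] by [run_bounds]. *)
Lemma runs_spec (l : list Z) : (forall n, In n l -> n <> 0) -> l <> [] ->
  exists m k rs x nu y, runs l = (m, k) :: rs /\ (1 <= k)%nat /\ (exists r, l = m :: r) /\
    st l = (x, Z.sgn m * nu, y) /\ good m x nu y k (prodc rs) /\
    prodc (runs l) <= nu * nu /\ x <= prodc (runs l) ^ 4 /\ 3 <= prodc (runs l).
Proof.
  assert (Fin : forall m x nu y k Q, (1 <= k)%nat -> Z.abs m = 1 -> good m x nu y k Q ->
    (4 * Z.of_nat k - 1) * Q <= nu * nu /\ x <= ((4 * Z.of_nat k - 1) * Q) ^ 4 /\ 3 <= (4 * Z.of_nat k - 1) * Q).
  { intros m x nu y k Q Hk Hm (_ & Hn & Hy & Hx & HD & HQ & _ & G). destruct (G Hm) as (B & E & HB & HQB & HnB & HxB & HE & HDE & HgE & HnE).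
    apply (run_bounds x nu (Z.of_nat k) B E Q y); auto. lia. }
  induction l as [|n l IH]; intros Hnz Hne; [easy|clear Hne].
  assert (Hn : n <> 0) by (apply Hnz; now left).
  set (a := Z.abs n). assert (Ha : 1 <= a) by (unfold a; lia).
  assert (En : n = Z.sgn n * a) by (unfold a; rewrite Z.mul_comm, Z.abs_sgn; easy).
  assert (Esn : Z.sgn n = 1 \/ Z.sgn n = -1) by lia.
  destruct l as [|n2 l2].
  - exists n, 1%nat, [], (4 * a * a - 1), (2 * a), 1. 
    assert (Est : st [n] = (4 * a * a - 1, Z.sgn n * (2 * a), 1)).
    { change (st [n]) with (-1 - 4 * n * 0 + 4 * n * n * 1, 2 * n * 1 - 0, 1).
      apply (f_equal2 pair); [apply (f_equal2 pair)|easy].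
      - unfold a. nia.
      - rewrite En at 1. ring. }
    assert (Hg : good n (4 * a * a - 1) (2 * a) 1 1 1).
    (* A last exponent of modulus 1 gives x = 3, nu = 2 and y = 1, hence these values of [B] and
       [E]. *)
    { repeat split; try nia. intros H1. exists 1, 3. unfold a in *. rewrite H1. simpl. lia. }
    split; [reflexivity|]. split; [lia|]. split; [now exists []|]. split; [easy|]. split; [easy|].
    change (prodc (runs [n])) with (pc (n, 1%nat) * 1). unfold pc. fold a.
    destruct (2 <=? a) eqn:E2.
    + apply Z.leb_le in E2. change (Z.of_nat 1) with 1. rewrite Z.pow_1_r, Z.mul_1_r.
      replace ((4 * a - 1) ^ 4) with ((4 * a - 1) * (4 * a - 1) * ((4 * a - 1) * (4 * a - 1))) by ring.
      assert (4 * a * a - 1 <= (4 * a - 1) * (4 * a - 1)) by nia. repeat split; nia.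
    + apply Z.leb_gt in E2. change (Z.of_nat 1) with 1. assert (a = 1) by lia. rewrite H. simpl. lia.
  - destruct IH as (m & k & rs & x & nu & y & Er & Hk & (r & El) & Est & G & P1 & P2 & P3).
    { intros j Hj. apply Hnz. now right. } { easy. }
    assert (Gm := G). destruct G as (Hm & Gn & Gy & Gx & GD & GQ & G2 & G1).
    set (P := prodc (runs (n2 :: l2))) in *.
    assert (Esm : Z.sgn m = 1 \/ Z.sgn m = -1) by lia.
    set (d := Z.sgn n * Z.sgn m). assert (Hd : d = 1 \/ d = -1) by (unfold d; nia).
    set (x' := y - 4 * a * (d * nu) + 4 * a * a * x). set (nu' := 2 * a * x - d * nu).
    destruct (step_bounds a x nu y d Ha ltac:(lia) Gy Gx GD Hd) as (S1 & S2 & S3 & S4 & S5 & S6 & S7).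
    fold x' nu' in S1, S2, S3, S4, S5, S6, S7.
    assert (Est' : st (n :: n2 :: l2) = (x', Z.sgn n * nu', x)).
    { change (st (n :: n2 :: l2)) with (let '(x, N, y) := st (n2 :: l2) in (y - 4 * n * N + 4 * n * n * x, 2 * n * x - N, x)).
      rewrite Est. unfold x', nu', d. apply (f_equal2 pair); [apply (f_equal2 pair)|easy].
      - rewrite En at 1 2 3. destruct Esn as [E|E]; rewrite E; ring.
      - rewrite En at 1. destruct Esn as [E|E]; rewrite E; ring. }
    assert (Eruns : runs (n :: n2 :: l2) = if n =? m then (m, S k) :: rs else (n, 1%nat) :: (m, k) :: rs).
    { change (runs (n :: n2 :: l2)) with (match runs (n2 :: l2) with
        | (m, k) :: rs => if Z.eqb n m then (m, S k) :: rs else (n, 1%nat) :: (m, k) :: rs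
        | [] => [(n, 1%nat)] end). now rewrite Er. }
    assert (EP : P = pc (m, k) * prodc rs) by (unfold P; rewrite Er; reflexivity).
    destruct (2 <=? a) eqn:E2.
    + apply Z.leb_le in E2.
      assert (GN : forall k' Q', 1 <= Q' -> good n x' nu' x k' Q').
      { intros k' Q' HQ'. repeat split; auto; try lia; try nia. }
      assert (PP : prodc (runs (n :: n2 :: l2)) = (4 * a - 1) * P).
      { rewrite Eruns. destruct (n =? m) eqn:Enm.
        - apply Z.eqb_eq in Enm. subst m. rewrite EP.
          change (prodc ((n, S k) :: rs)) with (pc (n, S k) * prodc rs). unfold pc. fold a.
          assert (T : 2 <=? a = true) by now apply Z.leb_le. rewrite T.
          rewrite Nat2Z.inj_succ, Z.pow_succ_r by lia. ring.
        - change (prodc ((n, 1%nat) :: (m, k) :: rs)) with (pc (n, 1%nat) * (pc (m, k) * prodc rs)).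
          rewrite <- EP. unfold pc. fold a. assert (T : 2 <=? a = true) by now apply Z.leb_le. rewrite T.
          change (Z.of_nat 1) with 1. now rewrite Z.pow_1_r. }
      assert (Q1 : (4 * a - 1) * P <= nu' * nu').
      { apply (square_growth a nu nu' P); auto; lia. }
      assert (Q2 : x' <= ((4 * a - 1) * P) ^ 4).
      { apply (fourth_growth a x x' P); auto; lia. }
      assert (Q3 : 3 <= (4 * a - 1) * P) by (clear -E2 P3; nia).
      destruct (n =? m) eqn:Enm.
      * apply Z.eqb_eq in Enm. subst m. exists n, (S k), rs, x', nu', x. rewrite PP, Eruns.
        split; [easy|]. split; [lia|]. split; [now exists (n2 :: l2)|]. auto.
      * exists n, 1%nat, ((m, k) :: rs), x', nu', x. rewrite PP, Eruns.
        split; [easy|]. split; [lia|]. split; [now exists (n2 :: l2)|]. split; [easy|].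
        change (prodc ((m, k) :: rs)) with (pc (m, k) * prodc rs). rewrite <- EP. split; [apply GN; lia|auto].
    + apply Z.leb_gt in E2. assert (a1 : a = 1) by lia. assert (Han : Z.abs n = 1) by (unfold a in a1; easy).
      destruct (n =? m) eqn:Enm.
      * apply Z.eqb_eq in Enm. subst m. assert (d1 : d = 1) by (unfold d; destruct Esn as [E|E]; rewrite E; ring).
        rewrite a1, d1 in *.
        assert (GN : good n x' nu' x (S k) (prodc rs)).
        { repeat split; auto; try lia. intros _.
          destruct (G1 Han) as (B & E & HB & HQB & HnB & HxB & HE & HDE & HgE & HnE).
          exists B, E. rewrite Nat2Z.inj_succ.
          destruct (run_step x nu y (Z.of_nat k) B E ltac:(lia) HB (proj1 HE) GD HnB HxB HDE HgE HnE) as (R1 & R2 & R3 & R4 & R5).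
          repeat split; auto; lia. }
        assert (PP : prodc (runs (n :: n2 :: l2)) = (4 * Z.of_nat (S k) - 1) * prodc rs).
        { rewrite Eruns. change (prodc ((n, S k) :: rs)) with (pc (n, S k) * prodc rs).
          unfold pc. rewrite Han. reflexivity. }
        destruct (Fin n x' nu' x (S k) (prodc rs) ltac:(lia) Han GN) as (Q1 & Q2 & Q3).
        exists n, (S k), rs, x', nu', x. rewrite PP, Eruns.
        split; [easy|]. split; [lia|]. split; [now exists (n2 :: l2)|]. auto.
      * apply Z.eqb_neq in Enm. rewrite a1 in *.
        assert (GN : good n x' nu' x 1 P).
        (* The finished part becomes [Q] = P, and the induction hypotheses P <= nu^2 and x <= P^4
           are what the new [B] and [E] require. *)
        { repeat split; auto; try lia. intros _. exists nu, (10 * x). change (Z.of_nat 1) with 1.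
          assert (Hcase : d = -1 \/ (d = 1 /\ 3 * nu <= x)).
          { destruct Hd as [Hd|Hd]; [right|now left]. split; [easy|]. apply G2. unfold d in Hd.
            assert (Z.abs m <> 1); [|lia]. intros Hm1. apply Enm. lia. }
          destruct (run_start x nu y d Gn Gy Gx Hcase) as (R1 & R2 & R3 & R4 & R5).
          repeat split; auto; lia. }
        assert (PP : prodc (runs (n :: n2 :: l2)) = (4 * Z.of_nat 1 - 1) * P).
        { rewrite Eruns, EP. change (prodc ((n, 1%nat) :: (m, k) :: rs)) with (pc (n, 1%nat) * (pc (m, k) * prodc rs)).
          unfold pc at 1. rewrite Han. reflexivity. }
        destruct (Fin n x' nu' x 1%nat P ltac:(lia) Han GN) as (Q1 & Q2 & Q3).
        exists n, 1%nat, ((m, k) :: rs), x', nu', x. rewrite PP, Eruns.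
        split; [easy|]. split; [lia|]. split; [now exists (n2 :: l2)|]. split; [easy|].
        change (prodc ((m, k) :: rs)) with (pc (m, k) * prodc rs). rewrite <- EP. auto.
Qed.

Lemma prodc_pos (l : list Z) : 1 <= prodc (runs l) /\ (forall p, In p (runs l) -> 3 <= pc p).
Proof.
  assert (Hp : forall p, In p (runs l) -> fst p <> 0 \/ True -> (1 <= snd p)%nat).
  { induction l as [|n l IH]; [easy|]. simpl. destruct (runs l) as [|[m k] rs].
    - intros p [<-|[]] _. simpl. lia.
    - destruct (n =? m); intros p Hp _; destruct Hp as [<-|Hp]; simpl; try lia.
      + apply IH; [now right|auto].
      + apply IH; [easy|auto]. }
  assert (H3 : forall p, In p (runs l) -> 3 <= pc p).
  { intros [n k] Hin. specialize (Hp _ Hin (or_intror I)). simpl in Hp. unfold pc.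
    destruct (2 <=? Z.abs n) eqn:E; [|lia]. apply Z.leb_le in E.
    assert ((4 * Z.abs n - 1) ^ 1 <= (4 * Z.abs n - 1) ^ Z.of_nat k) by (apply Z.pow_le_mono_r; lia).
    rewrite Z.pow_1_r in H. lia. }
  split; [|easy]. clear Hp. revert H3. induction (runs l) as [|p rs IH]; intros H3; simpl; [lia|].
  assert (3 <= pc p) by (apply H3; now left). assert (1 <= prodc rs) by (apply IH; intros; apply H3; now right).
  unfold prodc in *. nia.
Qed.

Local Open Scope R_scope.

Lemma run_contribution_pc (p : Z * nat) : (3 <= pc p)%Z -> run_contribution p = ln (IZR (pc p)).
Proof.
  destruct p as [n k]. unfold run_contribution, pc. intros H. destruct (2 <=? Z.abs n)%Z eqn:E.
  - apply Z.leb_le in E. rewrite <- pow_IZR, ln_pow, minus_IZR, mult_IZR; [easy|].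
    apply (IZR_lt 0). lia.
  - rewrite minus_IZR, mult_IZR, <- INR_IZR_INZ. easy.
Qed.

Definition Lsum (l : list Z) : R := fold_right Rplus 0 (map run_contribution (runs l)).

Lemma Lsum_prodc (l : list Z) : Lsum l = ln (IZR (prodc (runs l))).
Proof.
  unfold Lsum. destruct (prodc_pos l) as [_ H]. revert H. induction (runs l) as [|p rs IH]; intros H.
  - simpl. now rewrite ln_1.
  - change (fold_right Rplus 0 (map run_contribution (p :: rs))) with
      (run_contribution p + fold_right Rplus 0 (map run_contribution rs)).
    assert (H3 : (3 <= pc p)%Z) by (apply H; now left).
    rewrite IH by (intros; apply H; now right). rewrite run_contribution_pc by easy.
    change (prodc (p :: rs)) with (pc p * prodc rs)%Z. rewrite mult_IZR, ln_mult; [easy| |].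
    + apply (IZR_lt 0). lia.
    + assert (1 <= prodc rs)%Z; [|apply (IZR_lt 0); lia].
      clear -H. induction rs as [|p' rs IH]; simpl; [lia|].
      assert (3 <= pc p')%Z by (apply H; right; now left).
      assert (1 <= prodc rs)%Z by (apply IH; intros q [->|Hq]; apply H; [now left|right; now right]).
      unfold prodc in *. nia.
Qed.

(** With P = exp L the recursion gives P <= nu^2 and nu < x <= P^4; since P >= 3, also 2 nu < P^5.
    Hence the constants 2 and 5. *)
Theorem word_bounds (w : word) : reduced w -> w <> [] ->
  2 <= Rabs (Nst (wmat w)) /\ Lw w <= 2 * ln (Rabs (Nst (wmat w))) /\ ln (2 * Rabs (Nst (wmat w))) <= 5 * Lw w.
Proof.
  intros [Hnz Ha] Hne. set (l := map snd w).
  assert (Hl : forall n, In n l -> n <> 0%Z).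
  { intros n Hn. apply in_map_iff in Hn. destruct Hn as (t & <- & Ht). now apply Hnz. }
  assert (Hln : l <> []) by (unfold l; destruct w; easy).
  destruct (runs_spec l Hl Hln) as (m & k & rs & x & nu & y & Er & Hk & (r & El) & Est & G & P1 & P2 & P3).
  destruct w as [|t0 w0]; [easy|].
  destruct (form_state_word (t0 :: w0) Ha (fst t0)) as (e & He & HS).
  { intros t r' E. now inversion E. }
  fold l in HS. rewrite Est in HS.
  destruct G as (Hm & Gn & Gy & Gx & _).
  assert (Habs : Z.abs (NZ (wmat (t0 :: w0))) = nu).
  { destruct (fst t0); destruct HS as (_ & -> & _); destruct He as [-> | ->]; nia. }
  set (M := wmat (t0 :: w0)) in *.
  assert (EN : Rabs (Nst M) = IZR nu) by (rewrite Nst_NZ, <- abs_IZR, Habs; easy).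
  rewrite EN. change (Lw (t0 :: w0)) with (Lsum l). rewrite Lsum_prodc. set (P := prodc (runs l)) in *.
  assert (H2 : (2 <= nu)%Z) by nia.
  assert (R2 : 2 <= IZR nu) by now apply IZR_le.
  assert (RP : 0 < IZR P) by (apply (IZR_lt 0); lia).
  split; [easy|]. split.
  - replace (2 * ln (IZR nu)) with (ln (IZR nu * IZR nu)) by (rewrite ln_mult; lra).
    rewrite <- mult_IZR. apply IZR_le in P1. destruct (Req_dec (IZR P) (IZR (nu * nu))) as [->|]; [lra|].
    apply Rlt_le, ln_increasing; lra.
  - replace (5 * ln (IZR P)) with (ln (IZR P ^ 5)) by (rewrite ln_pow by easy; simpl; ring).
    rewrite (pow_IZR P 5), <- mult_IZR. assert (H5 : (2 * nu < P ^ 5)%Z).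
    { replace (P ^ 5)%Z with (P * P ^ 4)%Z by ring. nia. }
    apply IZR_lt in H5. apply Rlt_le, ln_increasing; [|exact H5]. apply (IZR_lt 0). lia.
Qed.

(** * The lower bound *)

Definition rcons (n : Z) (rs : list (Z * nat)) : list (Z * nat) :=
  match rs with
  | (m, k) :: r => if Z.eqb n m then (m, S k) :: r else (n, 1%nat) :: (m, k) :: r
  | [] => [(n, 1%nat)]
  end.

(** Extension at the right end, the mirror image of the way in which [runs] grows. Comparing the two
    shows that reversal of a word reverses its runs, so that a word and its inverse have the same
    L. *)
Fixpoint rsnoc (rs : list (Z * nat)) (n : Z) : list (Z * nat) :=
  match rs with
  | [] => [(n, 1%nat)]
  | p :: [] => if Z.eqb (fst p) n then [(fst p, S (snd p))] else [p; (n, 1%nat)]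
  | p :: r => p :: rsnoc r n
  end.

Lemma runs_cons (n : Z) (l : list Z) : runs (n :: l) = rcons n (runs l).
Proof. simpl. destruct (runs l) as [|[m k] r]; reflexivity. Qed.

Lemma rcons_rsnoc (a n : Z) (rs : list (Z * nat)) : rcons a (rsnoc rs n) = rsnoc (rcons a rs) n.
Proof.
  destruct rs as [|[m k] [|q r]].
  - simpl. destruct (Z.eqb_spec a n); [now subst|easy].
  - simpl. destruct (Z.eqb_spec m n); destruct (Z.eqb_spec a m); simpl; subst;
      repeat (rewrite ?Z.eqb_refl; simpl);
      repeat match goal with |- context [Z.eqb ?x ?y] => destruct (Z.eqb_spec x y); subst; try easy; simpl end; easy.
  - simpl. destruct (Z.eqb_spec a m); reflexivity.
Qed.

Lemma runs_snoc (l : list Z) (n : Z) : runs (l ++ [n]) = rsnoc (runs l) n.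
Proof.
  induction l as [|a l IH]; [easy|].
  change ((a :: l) ++ [n]) with (a :: (l ++ [n])). now rewrite !runs_cons, IH, rcons_rsnoc.
Qed.

Lemma rsnoc_app (ys : list (Z * nat)) (m n : Z) (k : nat) :
  rsnoc (ys ++ [(m, k)]) n = if Z.eqb m n then ys ++ [(m, S k)] else ys ++ [(m, k); (n, 1%nat)].
Proof.
  induction ys as [|y ys IH]; [easy|]. simpl app. destruct (ys ++ [(m, k)]) as [|z zs] eqn:E.
  - destruct ys; easy.
  - change (rsnoc (y :: z :: zs) n) with (y :: rsnoc (z :: zs) n). rewrite IH. destruct (m =? n)%Z; easy.
Qed.

Lemma runs_rev (l : list Z) : runs (rev l) = rev (runs l).
Proof.
  induction l as [|n l IH]; [easy|]. rewrite runs_cons. change (rev (n :: l)) with (rev l ++ [n]). rewrite runs_snoc, IH.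
  destruct (runs l) as [|[m k] rs]; [easy|]. simpl rev. rewrite rsnoc_app. unfold rcons.
  rewrite (Z.eqb_sym n m). destruct (m =? n)%Z; simpl; [easy|]. now rewrite <- app_assoc.
Qed.

Lemma runs_opp (l : list Z) : runs (map Z.opp l) = map (fun p => (- fst p, snd p)%Z) (runs l).
Proof.
  induction l as [|n l IH]; [easy|]. change (map Z.opp (n :: l)) with (Z.opp n :: map Z.opp l). rewrite !runs_cons, IH.
  destruct (runs l) as [|[m k] rs]; [easy|]. simpl.
  replace (- n =? - m)%Z with (n =? m)%Z; [destruct (n =? m)%Z; easy|].
  destruct (Z.eqb_spec n m); destruct (Z.eqb_spec (- n) (- m)); lia.
Qed.

Lemma fold_Rplus_app (l1 l2 : list R) : fold_right Rplus 0 (l1 ++ l2) = fold_right Rplus 0 l1 + fold_right Rplus 0 l2.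
Proof. induction l1; simpl; [ring|]. rewrite IHl1. ring. Qed.

Lemma fold_Rplus_rev (l : list R) : fold_right Rplus 0 (rev l) = fold_right Rplus 0 l.
Proof. induction l; simpl; [easy|]. rewrite fold_Rplus_app, IHl. simpl. ring. Qed.

Definition winv (w : word) : word := rev (map (fun t => (fst t, (- snd t)%Z)) w).

Lemma Lw_winv (w : word) : Lw (winv w) = Lw w.
Proof.
  unfold Lw, winv. rewrite map_rev, map_map, runs_rev, map_rev, fold_Rplus_rev.
  change (map (fun x : bool * Z => snd (fst x, (- snd x)%Z)) w) with (map (fun x : bool * Z => Z.opp (snd x)) w).
  rewrite <- (map_map snd Z.opp), runs_opp, map_map. f_equal. apply map_ext. intros [n k].
  unfold run_contribution. simpl. now rewrite Z.abs_opp.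
Qed.

Lemma alternating_snoc (l : word) (t : bool * Z) : alternating l ->
  (forall l' t', l = l' ++ [t'] -> fst t' <> fst t) -> alternating (l ++ [t]).
Proof.
  induction l as [|[g n] l IH]; intros H1 H2.
  - destruct t. easy.
  - destruct l as [|[g' n'] l'].
    + destruct t as [gt nt]. simpl. split; [|easy]. apply (H2 [] (g, n) eq_refl).
    + destruct H1 as [Hg H1]. change (((g, n) :: (g', n') :: l') ++ [t]) with ((g, n) :: (((g', n') :: l') ++ [t])).
      simpl. split; [easy|]. apply IH; [easy|]. intros l2 t2 E. apply (H2 ((g, n) :: l2) t2). now rewrite E.
Qed.

Lemma alternating_rev (l : word) : alternating l -> alternating (rev l).
Proof.
  induction l as [|[g n] l IH]; intros H; [easy|]. simpl rev. apply alternating_snoc.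
  - apply IH. destruct l as [|[g' n'] l']; [easy|now destruct H].
  - intros l' t' E. destruct l as [|[g2 n2] l2]; [destruct l'; easy|].
    simpl rev in E. apply app_inj_tail in E. destruct E as [_ <-]. destruct H as [Hg _]. simpl. congruence.
Qed.

Lemma reduced_winv (w : word) : reduced w -> reduced (winv w).
Proof.
  intros [H1 H2]. split.
  - intros t Ht. unfold winv in Ht. apply in_rev, in_map_iff in Ht. destruct Ht as (u & <- & Hu).
    specialize (H1 u Hu). simpl. lia.
  - apply alternating_rev. clear H1. induction w as [|[g n] w IH]; [easy|]. destruct w as [|[g' n'] w']; [easy|].
    destruct H2 as [Hg H2]. specialize (IH H2). split; easy.
Qed.

Lemma mmul_assoc (M N P : mat) : mmul M (mmul N P) = mmul (mmul M N) P.
Proof. unfold mmul. cbn [mp mq mr ms]. f_equal; ring. Qed.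

Lemma mmul_id_l (M : mat) : mmul mid M = M.
Proof. unfold mmul, mid. destruct M as [p q r s]. cbn [mp mq mr ms]. f_equal; ring. Qed.

Lemma mmul_id_r (M : mat) : mmul M mid = M.
Proof. unfold mmul, mid. destruct M as [p q r s]. cbn [mp mq mr ms]. f_equal; ring. Qed.

Lemma minv_mul (M N : mat) : minv (mmul M N) = mmul (minv N) (minv M).
Proof. unfold mmul, minv. cbn [mp mq mr ms]. f_equal; ring. Qed.

Lemma wmat_app (w1 w2 : word) : wmat (w1 ++ w2) = mmul (wmat w1) (wmat w2).
Proof. induction w1; simpl; [now rewrite mmul_id_l|]. now rewrite IHw1, mmul_assoc. Qed.

Lemma wmat_winv (w : word) : wmat (winv w) = minv (wmat w).
Proof.
  induction w as [|[b n] w IH]; [easy|]. unfold winv in *. simpl map. simpl rev. rewrite wmat_app, IH.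
  simpl wmat. rewrite mmul_id_r, minv_mul. f_equal.
  unfold tmat, minv. destruct b; cbn [fst snd mp mq mr ms]; f_equal; ring.
Qed.

Lemma winv_nil (w : word) : w <> [] -> winv w <> [].
Proof. intros H E. apply H. unfold winv in E. apply (f_equal (@length _)) in E. rewrite length_rev, length_map in E. now destruct w. Qed.

Lemma lower_from_ln (L N x0 x1 y0 y1 : R) : x0 < x1 -> L <= 2 * ln N -> ln N * (x1 - x0) <= PI * (y1 - y0) ->
  L / (2 * PI) <= (y1 - y0) / (x1 - x0).
Proof.
  intros Hx HL H. pose proof PI_RGT_0. apply Rle_div_l; [lra|].
  apply Rmult_le_reg_r with (x1 - x0); [lra|].
  replace ((y1 - y0) / (x1 - x0) * (2 * PI) * (x1 - x0)) with (2 * (PI * (y1 - y0))) by (field; lra). nra.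
Qed.

Theorem lower_bound (w : word) : reduced w ->
  Rbar_le (Finite (Lw w / (2 * PI))) (Lambda (tr_pb w)) /\ Rbar_le (Finite (Lw w / (2 * PI))) (Lambda (pb_tr w)).
Proof.
  intros Hw. pose proof PI_RGT_0 as HP.
  assert (Nil : forall x0 x1 y0 y1, x0 < x1 -> y0 < y1 -> Lw [] / (2 * PI) <= (y1 - y0) / (x1 - x0)).
  { intros. unfold Lw. simpl. unfold Rdiv at 1. rewrite Rmult_0_l. left. apply Rdiv_lt_0_compat; lra. }
  unfold Lambda. split; apply (proj2 (Glb_Rbar_correct _)); intros l (x0 & x1 & y0 & y1 & f & Hx & Hy & HR & ->); simpl.
  - destruct w as [|t r]; [now apply Nil|]. destruct (word_bounds (t :: r) Hw ltac:(easy)) as (B1 & B2 & _).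
    apply (lower_from_ln _ (Rabs (Nst (wmat (t :: r))))); auto. now apply (lower_tr_pb _ _ _ _ _ f).
  - destruct w as [|t r]; [now apply Nil|].
    destruct (word_bounds (winv (t :: r)) (reduced_winv (t :: r) Hw) (winv_nil (t :: r) ltac:(easy))) as (B1 & B2 & _).
    rewrite Lw_winv, wmat_winv in *. 
    apply (lower_from_ln _ (Rabs (Nst (minv (wmat (t :: r)))))); auto. now apply (lower_pb_tr _ _ _ _ _ f).
Qed.

(** * Partial fractions *)

Definition climseq (u : nat -> C) (l : C) : Prop :=
  forall eps, 0 < eps -> exists N, forall n, (N <= n)%nat -> Cmod (u n - l) < eps.

Lemma climseq_unique (u : nat -> C) (l l' : C) : climseq u l -> climseq u l' -> l = l'.
Proof.
  intros H H'. apply Ceq_minus, Cmod_eq_0. apply Rle_antisym; [|apply Cmod_ge_0].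
  apply Rnot_lt_le. intros N. destruct (H (Cmod (l - l') / 2) ltac:(lra)) as (N1 & H1).
  destruct (H' (Cmod (l - l') / 2) ltac:(lra)) as (N2 & H2).
  specialize (H1 (max N1 N2) ltac:(lia)). specialize (H2 (max N1 N2) ltac:(lia)).
  pose proof (Cmod_tri l (u (max N1 N2)) l') as T. rewrite (Cmod_swap l (u _)) in T. lra.
Qed.

Lemma climseq_ext (u v : nat -> C) (l : C) : (forall n, u n = v n) -> climseq u l -> climseq v l.
Proof. intros E H e He. destruct (H e He) as (N & HN). exists N. intros n Hn. rewrite <- E. auto. Qed.

Lemma climseq_const (c : C) : climseq (fun _ => c) c.
Proof. intros e He. exists 0%nat. intros n _. unfold Cminus. now rewrite Cplus_opp_r, Cmod_0. Qed.

Lemma climseq_plus (u v : nat -> C) (l m : C) : climseq u l -> climseq v m -> climseq (fun n => u n + v n)%C (l + m)%C.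
Proof.
  intros H H' e He. destruct (H (e / 2) ltac:(lra)) as (N1 & H1). destruct (H' (e / 2) ltac:(lra)) as (N2 & H2).
  exists (max N1 N2). intros n Hn. specialize (H1 n ltac:(lia)). specialize (H2 n ltac:(lia)).
  replace (u n + v n - (l + m))%C with ((u n - l) + (v n - m))%C by ring.
  pose proof (Cmod_triangle (u n - l) (v n - m)). lra.
Qed.

Lemma climseq_scal (c : C) (u : nat -> C) (l : C) : climseq u l -> climseq (fun n => c * u n)%C (c * l)%C.
Proof.
  intros H e He. pose proof (Cmod_ge_0 c).
  destruct (H (e / (Cmod c + 1))) as (N & HN); [apply Rdiv_lt_0_compat; lra|].
  exists N. intros n Hn. specialize (HN n Hn). apply Rlt_div_r in HN; [|lra].
  replace (c * u n - c * l)%C with (c * (u n - l))%C by ring. rewrite Cmod_mult.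
  pose proof (Cmod_ge_0 (u n - l)). nra.
Qed.

Lemma climseq_minus (u v : nat -> C) (l m : C) : climseq u l -> climseq v m -> climseq (fun n => u n - v n)%C (l - m)%C.
Proof.
  intros H H'. apply (climseq_ext (fun n => u n + (- RtoC 1) * v n)%C); [intros; ring|].
  replace (l - m)%C with (l + (- RtoC 1) * m)%C by ring. apply climseq_plus; [easy|now apply climseq_scal].
Qed.

Lemma climseq_sub (u : nat -> C) (l : C) (f : nat -> nat) : (forall n, (n <= f n)%nat) -> climseq u l -> climseq (fun n => u (f n)) l.
Proof. intros Hf H e He. destruct (H e He) as (N & HN). exists N. intros n Hn. apply HN. specialize (Hf n). lia. Qed.

Lemma climseq_bound (u : nat -> C) (l c : C) (K : R) : climseq u l -> (forall n, Cmod (u n - c) <= K) -> Cmod (l - c) <= K.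
Proof.
  intros H HK. apply Rnot_lt_le. intros N. destruct (H (Cmod (l - c) - K) ltac:(lra)) as (n & Hn).
  specialize (Hn n ltac:(lia)). specialize (HK n). pose proof (Cmod_tri l (u n) c) as T. rewrite (Cmod_swap l (u n)) in T. lra.
Qed.

Fixpoint csm (u : nat -> C) (n : nat) : C := match n with O => RtoC 0 | S k => (csm u k + u k)%C end.
Fixpoint rsm (u : nat -> R) (n : nat) : R := match n with O => 0 | S k => rsm u k + u k end.

Lemma csm_ext (u v : nat -> C) (n : nat) : (forall k, (k < n)%nat -> u k = v k) -> csm u n = csm v n.
Proof. intros H. induction n as [|n IH]; [easy|]. simpl. rewrite IH, H; auto. Qed.

Lemma csm_plus (u v : nat -> C) (n : nat) : csm (fun k => u k + v k)%C n = (csm u n + csm v n)%C.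
Proof. induction n as [|n IH]; simpl; [ring|]. rewrite IH. ring. Qed.

Lemma csm_scal (c : C) (u : nat -> C) (n : nat) : csm (fun k => c * u k)%C n = (c * csm u n)%C.
Proof. induction n as [|n IH]; simpl; [ring|]. rewrite IH. ring. Qed.

Lemma csm_minus (u v : nat -> C) (n : nat) : csm (fun k => u k - v k)%C n = (csm u n - csm v n)%C.
Proof. induction n as [|n IH]; simpl; [ring|]. rewrite IH. ring. Qed.

Lemma csm_swap (u : nat -> nat -> C) (n m : nat) :
  csm (fun i => csm (fun j => u i j) m) n = csm (fun j => csm (fun i => u i j) n) m.
Proof.
  induction n as [|n IH]; simpl.
  - induction m as [|m IHm]; simpl; [easy|]. rewrite <- IHm. ring.
  - rewrite IH. now rewrite <- csm_plus.
Qed.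

Lemma csm_app (u : nat -> C) (n m : nat) : csm u (n + m) = (csm u n + csm (fun k => u (n + k)%nat) m)%C.
Proof. induction m as [|m IH]; simpl; [rewrite Nat.add_0_r; ring|]. rewrite Nat.add_succ_r. simpl. rewrite IH. ring. Qed.

Lemma csm_first (u : nat -> C) (n : nat) : csm u (S n) = (u 0%nat + csm (fun k => u (S k)) n)%C.
Proof. induction n as [|n IH]; [simpl; ring|]. change (csm u (S (S n))) with (csm u (S n) + u (S n))%C. rewrite IH. simpl. ring. Qed.

Lemma csm_rev (u : nat -> C) (n : nat) : csm u n = csm (fun k => u (n - 1 - k)%nat) n.
Proof.
  revert u. induction n as [|n IH]; intros u; [easy|]. rewrite csm_first.
  rewrite (IH (fun k => u (S k))). simpl csm at 2. rewrite (Nat.sub_0_r n), Nat.sub_diag.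
  rewrite Cplus_comm. f_equal. apply csm_ext. intros k Hk. f_equal. lia.
Qed.

Lemma csm_bound (u : nat -> C) (v : nat -> R) (n : nat) :
  (forall k, (k < n)%nat -> Cmod (u k) <= v k) -> Cmod (csm u n) <= rsm v n.
Proof.
  intros H. induction n as [|n IH]; simpl; [rewrite Cmod_0; lra|].
  eapply Rle_trans; [apply Cmod_triangle|]. apply Rplus_le_compat; auto.
Qed.

Lemma rsm_scal (c : R) (u : nat -> R) (n : nat) : rsm (fun k => c * u k) n = c * rsm u n.
Proof. induction n as [|n IH]; simpl; [ring|]. rewrite IH. ring. Qed.

Lemma rsm_le (u v : nat -> R) (n : nat) : (forall k, (k < n)%nat -> u k <= v k) -> rsm u n <= rsm v n.
Proof. intros H. induction n as [|n IH]; simpl; [lra|]. apply Rplus_le_compat; auto. Qed.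

Lemma rsm_geom (r : R) (n : nat) : 0 <= r < 1 -> rsm (fun k => r ^ k) n <= / (1 - r).
Proof.
  intros Hr. assert (E : rsm (fun k => r ^ k) n = (1 - r ^ n) / (1 - r)).
  { induction n as [|n IH]; simpl; [field; lra|]. rewrite IH. field. lra. }
  rewrite E. unfold Rdiv. rewrite <- (Rmult_1_l (/ (1 - r))) at 2. apply Rmult_le_compat_r.
  - left. apply Rinv_0_lt_compat. lra.
  - pose proof (pow_le r n ltac:(lra)). lra.
Qed.

Definition csum (u : nat -> C) : C := (Series (fun k => fst (u k)), Series (fun k => snd (u k))).

Lemma csum_lim (u : nat -> C) (A r : R) : 0 <= r < 1 -> (forall k, Cmod (u k) <= A * r ^ k) -> climseq (csm u) (csum u).
Proof.
  intros Hr H.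
  assert (G : ex_series (fun k => A * r ^ k)).
  { apply (ex_series_scal (K := R_AbsRing) (V := R_NormedModule) A). apply ex_series_geom. rewrite Rabs_right; lra. }
  assert (K : forall pr : C -> R, (forall z, Rabs (pr z) <= Cmod z) ->
    (forall n, sum_n (fun k => pr (u k)) n = pr (csm u (S n))) -> is_lim_seq (fun n => pr (csm u (S n))) (Series (fun k => pr (u k)))).
  { intros pr Hpr E. assert (X : ex_series (fun k => pr (u k))).
    { apply (ex_series_le (V := R_CompleteNormedModule) _ (fun k => A * r ^ k)); [|easy]. intros k.
      eapply Rle_trans; [apply Hpr|apply H]. }
    apply Series_correct in X. apply (is_lim_seq_ext (sum_n (fun k => pr (u k)))); [exact E|exact X]. }
  assert (K1 := K fst fst_le_Cmod). assert (K2 := K snd snd_le_Cmod).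
  assert (E1 : forall n, sum_n (fun k => fst (u k)) n = fst (csm u (S n))).
  { induction n as [|n IH]; [rewrite sum_O; simpl; ring|]. rewrite sum_Sn, IH. reflexivity. }
  assert (E2 : forall n, sum_n (fun k => snd (u k)) n = snd (csm u (S n))).
  { induction n as [|n IH]; [rewrite sum_O; simpl; ring|]. rewrite sum_Sn, IH. reflexivity. }
  specialize (K1 E1). specialize (K2 E2). apply is_lim_seq_spec in K1, K2.
  intros e He. destruct (K1 (mkposreal (e / 2) ltac:(lra))) as (N1 & H1).
  destruct (K2 (mkposreal (e / 2) ltac:(lra))) as (N2 & H2).
  exists (S (max N1 N2)). intros n Hn. destruct n as [|n]; [lia|].
  specialize (H1 n ltac:(lia)). specialize (H2 n ltac:(lia)). cbn [pos] in H1, H2.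
  eapply Rle_lt_trans; [apply Cmod_le_abs|]. unfold csum. cbn [fst snd Cminus Cplus Copp].
  unfold Rminus in H1, H2. lra.
Qed.

Lemma csum_bound (u : nat -> C) (A r : R) : 0 <= r < 1 -> (forall k, Cmod (u k) <= A * r ^ k) -> Cmod (csum u) <= A / (1 - r).
Proof.
  intros Hr H. assert (L := csum_lim u A r Hr H).
  assert (HA : 0 <= A) by (specialize (H 0%nat); simpl in H; pose proof (Cmod_ge_0 (u 0%nat)); lra).
  replace (csum u) with (csum u - RtoC 0)%C by ring. apply (climseq_bound (csm u)); [easy|].
  intros n. replace (csm u n - RtoC 0)%C with (csm u n) by ring.
  eapply Rle_trans; [apply (csm_bound u (fun k => A * r ^ k)); auto|]. rewrite rsm_scal.
  unfold Rdiv. apply Rmult_le_compat_l; [easy|]. now apply rsm_geom.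
Qed.

(** * The complex sine and powers of its inverse *)

Definition sn (w : C) : C := ((cexp (Ci * w) - cexp (- (Ci * w))) / (RtoC 2 * Ci))%C.
Definition cs (w : C) : C := ((cexp (Ci * w) + cexp (- (Ci * w))) / RtoC 2)%C.

Lemma Ci_neq_0 : Ci <> RtoC 0.
Proof. intros E. apply (f_equal snd) in E. simpl in E. lra. Qed.

Lemma CiCi : (Ci * Ci = - RtoC 1)%C.
Proof. Ceq. Qed.

Lemma sn_eq (u v : R) : sn (u, v) = (sin u * ((exp v + exp (- v)) / 2), cos u * ((exp v - exp (- v)) / 2)).
Proof.
  unfold sn, cexp. simpl.
  replace (0 * u - 1 * v) with (- v) by ring. replace (0 * v + 1 * u) with u by ring.
  rewrite Ropp_involutive, cos_neg, sin_neg. apply injective_projections; simpl; field.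
Qed.

Lemma sn_sq (u v : R) : Cmod (sn (u, v)) * Cmod (sn (u, v)) = sin u * sin u + (exp v - exp (- v)) / 2 * ((exp v - exp (- v)) / 2).
Proof.
  rewrite Cmod_sq, sn_eq. cbn [fst snd]. pose proof (sin2_cos2 u) as S. unfold Rsqr in S.
  assert (E : exp v * exp (- v) = 1) by (rewrite <- exp_plus, Rplus_opp_r; apply exp_0).
  replace (cos u * ((exp v - exp (- v)) / 2) * (cos u * ((exp v - exp (- v)) / 2))) with
    (cos u * cos u * ((exp v - exp (- v)) / 2 * ((exp v - exp (- v)) / 2))) by ring.
  replace (cos u * cos u) with (1 - sin u * sin u) by lra.
  replace (sin u * ((exp v + exp (- v)) / 2) * (sin u * ((exp v + exp (- v)) / 2))) with
    (sin u * sin u * ((exp v - exp (- v)) / 2 * ((exp v - exp (- v)) / 2) + exp v * exp (- v))) by field.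
  rewrite E. ring.
Qed.

Lemma sinh_lower (v : R) : v * v / 4 <= (exp v - exp (- v)) / 2 * ((exp v - exp (- v)) / 2).
Proof.
  assert (P : forall v, 0 <= v -> v <= exp v - exp (- v)).
  { intros t Ht. pose proof (exp_ineq1_le t). assert (exp (- t) <= 1); [|lra].
    rewrite <- exp_0. destruct (Req_dec t 0) as [->|]; [right; f_equal; lra|]. left. apply exp_increasing. lra. }
  destruct (Rle_dec 0 v) as [H|H].
  - specialize (P v H). nra.
  - specialize (P (- v) ltac:(lra)). rewrite Ropp_involutive in P. nra.
Qed.

Lemma sn_neq_0 (w : C) : snd w <> 0 \/ 0 < Rabs (fst w) < PI -> sn w <> RtoC 0.
Proof.
  intros H. apply Cmod_gt_0. destruct w as [u v]. simpl in H.
  pose proof (sn_sq u v) as E. pose proof (sinh_lower v) as L. pose proof (Cmod_ge_0 (sn (u, v))).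
  assert (0 < Cmod (sn (u, v)) * Cmod (sn (u, v))); [|nra]. rewrite E.
  assert (0 <= sin u * sin u) by apply Rle_0_sqr. destruct H as [H|[U1 U2]].
  - assert (0 < v * v) by nra. lra.
  - assert (U3 : sin u <> 0).
    { unfold Rabs in *. destruct (Rcase_abs u).
      - assert (sin u < 0); [|lra]. rewrite <- (Ropp_involutive u), sin_neg. assert (0 < sin (- u)) by (apply sin_gt_0; lra). lra.
      - assert (0 < sin u) by (apply sin_gt_0; lra). lra. }
    assert (0 < sin u * sin u) by (pose proof (Rsqr_pos_lt _ U3) as Q; exact Q).
    assert (0 <= v * v) by apply Rle_0_sqr. lra.
Qed.

(** The range 3 PI / 4 exceeds PI / 2 because the arguments occurring in [even_sum_lim] pass PI / 2
    by a bounded shift. *)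
Lemma sin_lower (u : R) : Rabs u <= 3 * (PI / 4) -> u * u / 36 <= sin u * sin u.
Proof.
  assert (Main : forall u, 0 <= u <= 3 * (PI / 4) -> u / 6 <= sin u).
  { intros t [H0 H1]. pose proof PI_4 as P4. pose proof PI2_3_2 as P3.
    assert (Small : forall s, 0 <= s <= 1 -> s / 2 <= sin s).
    { intros s Hs. destruct (MVT_gen sin 0 s cos) as (c & Hc & E).
      - intros. apply is_derive_sin.
      - intros. apply continuity_sin.
      - rewrite sin_0 in E. rewrite Rmin_left, Rmax_right in Hc by lra. pose proof (one_minus_cos c).
        assert (c * c <= 1) by nra. assert (1 / 2 <= cos c) by lra. rewrite !Rminus_0_r in E. nra. }
    destruct (Rle_dec t 1); [specialize (Small t ltac:(lra)); lra|].
    assert (1 / 2 <= sin t); [|lra].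
    destruct (Rle_dec t (PI / 2)).
    - assert (sin 1 <= sin t) by (apply sin_incr_1; lra). specialize (Small 1 ltac:(lra)). lra.
    - assert (sin (3 * (PI / 4)) <= sin t) by (apply sin_decr_1; lra).
      rewrite sin_3PI4 in H. assert (1 / 2 <= 1 / sqrt 2); [|lra].
      apply Rmult_le_compat_l; [lra|]. apply Rinv_le_contravar; [apply sqrt_lt_R0; lra|].
      rewrite <- (sqrt_square 2) at 2 by lra. apply sqrt_le_1_alt. lra. }
  intros H. destruct (Rle_dec 0 u).
  - rewrite Rabs_right in H by lra. specialize (Main u ltac:(lra)). nra.
  - rewrite Rabs_left in H by lra. specialize (Main (- u) ltac:(lra)). rewrite sin_neg in Main. nra.
Qed.

Lemma sn_lower (w : C) : Rabs (fst w) <= 3 * (PI / 4) -> Cmod w / 6 <= Cmod (sn w).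
Proof.
  destruct w as [u v]. simpl. intros H. pose proof (sin_lower u H). pose proof (sinh_lower v).
  pose proof (sn_sq u v) as E. pose proof (Cmod_sq (u, v)) as E2. cbn [fst snd] in E2.
  pose proof (Cmod_ge_0 (sn (u, v))). pose proof (Cmod_ge_0 (u, v)).
  assert (0 <= v * v) by apply Rle_0_sqr.
  apply Rnot_lt_le. intros N. nra.
Qed.

Lemma sn_approx (w : C) : Rabs (fst w) <= 3 * (PI / 4) -> Rabs (snd w) <= 1 -> Cmod (sn w - w) <= 20 * (Cmod w * Cmod w).
Proof.
  intros H1 H2. pose proof Cmod_Ci as CM.
  pose proof (Cmod_ge_0 w) as W0.
  assert (Half : forall X, Cmod (X / (RtoC 2 * Ci)) = Cmod X / 2).
  { intros X. rewrite Cmod_div.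
    - rewrite Cmod_mult, CM, Cmod_R, Rabs_right by lra. lra.
    - apply Cmult_neq_0; [intros E; apply RtoC_inj in E; lra|apply Ci_neq_0]. }
  destruct (Rle_dec (Cmod w) (/ 2)) as [L|L].
  - assert (E : (sn w - w = ((cexp (Ci * w) - RtoC 1 - Ci * w) - (cexp (- (Ci * w)) - RtoC 1 - - (Ci * w))) / (RtoC 2 * Ci))%C).
    { unfold sn. field. apply Ci_neq_0. }
    assert (M : Cmod (Ci * w) = Cmod w) by (rewrite Cmod_mult, CM; ring).
    assert (Q1 := cexp_quad (Ci * w)%C ltac:(lra)).
    assert (Q2 := cexp_quad (- (Ci * w))%C ltac:(rewrite Cmod_opp; lra)). rewrite Cmod_opp in Q2. rewrite M in *.
    rewrite E, Half.
    pose proof (Cmod_minus_le (cexp (Ci * w) - RtoC 1 - Ci * w) (cexp (- (Ci * w)) - RtoC 1 - - (Ci * w))). nra.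
  - assert (B : Cmod (sn w) <= 3).
    { unfold sn. rewrite Half. pose proof (Cmod_minus_le (cexp (Ci * w)) (cexp (- (Ci * w)))) as T.
      rewrite !Cmod_cexp in T. apply Rabs_le_between in H2.
      assert (X : forall t, t <= 1 -> exp t <= 3).
      { intros t Ht. apply Rle_trans with (exp 1); [|apply exp_le_3].
        destruct (Req_dec t 1) as [->|]; [lra|left; apply exp_increasing; lra]. }
      assert (X1 := X (fst (Ci * w)%C) ltac:(simpl; lra)). assert (X2 := X (fst (- (Ci * w))%C) ltac:(simpl; lra)). lra. }
    pose proof (Cmod_minus_le (sn w) w). nra.
Qed.

Definition gg (w : C) : C := (/ (sn w * sn w))%C.

Lemma gg_approx (w : C) : w <> RtoC 0 -> Rabs (fst w) <= 3 * (PI / 4) -> Rabs (snd w) <= 1 ->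
  Cmod (gg w - / (w * w)) <= 74000 / Cmod w.
Proof.
  intros N H1 H2. assert (A := sn_approx w H1 H2). assert (L := sn_lower w H1).
  assert (Wp := proj1 (Cmod_gt_0 w) N).
  assert (Ns : sn w <> RtoC 0) by (apply Cmod_gt_0; lra). assert (Sp := proj1 (Cmod_gt_0 _) Ns).
  assert (W4 : Cmod w <= 5).
  { eapply Rle_trans; [apply Cmod_le_abs|]. pose proof PI_4. lra. }
  unfold gg. replace (/ (sn w * sn w) - / (w * w))%C with (- (sn w - w) * (w + sn w) / (w * w * (sn w * sn w)))%C
    by (field; auto).
  rewrite Cmod_div by (apply Cmult_neq_0; apply Cmult_neq_0; auto). rewrite !Cmod_mult, Cmod_opp.
  set (m := Cmod w) in *. set (s := Cmod (sn w)) in *. set (d := Cmod (sn w - w)) in *.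
  assert (Hsum : Cmod (w + sn w) <= 102 * m).
  { replace (w + sn w)%C with ((sn w - w) + RtoC 2 * w)%C by ring.
    eapply Rle_trans; [apply Cmod_triangle|]. rewrite Cmod_RtoC_mult, Rabs_right by lra. fold m d. nra. }
  assert (Hs2 : m * m / 36 <= s * s) by nra.
  apply Rle_div_l; [repeat apply Rmult_lt_0_compat; lra|].
  replace (74000 / m * (m * m * (s * s))) with (74000 * m * (s * s)) by (field; lra).
  pose proof (Cmod_ge_0 (w + sn w)). assert (0 <= d) by apply Cmod_ge_0.
  assert (d * Cmod (w + sn w) <= 20 * (m * m) * (102 * m)) by (apply Rmult_le_compat; lra).
  assert (74000 * m * (m * m / 36) <= 74000 * m * (s * s)) by (apply Rmult_le_compat_l; lra).
  assert (0 < m * m * m) by (repeat apply Rmult_lt_0_compat; lra). nra.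
Qed.

Lemma sn_double (w : C) : sn (RtoC 2 * w) = (RtoC 2 * sn w * cs w)%C.
Proof.
  unfold sn, cs. replace (Ci * (RtoC 2 * w))%C with (Ci * w + Ci * w)%C by ring.
  replace (- (Ci * w + Ci * w))%C with (- (Ci * w) + - (Ci * w))%C by ring. rewrite !cexp_plus. field.
  apply Ci_neq_0.
Qed.

Lemma sn_cs (w : C) : (sn w * sn w + cs w * cs w = RtoC 1)%C.
Proof.
  assert (E : (cexp (Ci * w) * cexp (- (Ci * w)) = RtoC 1)%C).
  { rewrite <- cexp_plus, Cplus_opp_r. apply cexp_0. }
  unfold sn, cs. set (a := cexp (Ci * w)) in *. set (b := cexp (- (Ci * w))) in *.
  transitivity ((a - b) * (a - b) / (RtoC 4 * (Ci * Ci)) + (a + b) * (a + b) / RtoC 4)%C; [field; apply Ci_neq_0|].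
  rewrite CiCi. transitivity (a * b)%C; [field|easy].
Qed.

Lemma sn_shift (w : C) (s : R) : s = 1 \/ s = -1 -> sn (w + RtoC (s * (PI / 2))) = (RtoC s * cs w)%C.
Proof.
  intros Hs. unfold sn, cs. rewrite !Cmult_plus_distr_l.
  replace (- (Ci * w + Ci * RtoC (s * (PI / 2))))%C with (- (Ci * w) + - (Ci * RtoC (s * (PI / 2))))%C by ring.
  rewrite !cexp_plus.
  assert (E1 : cexp (Ci * RtoC (s * (PI / 2))) = (RtoC s * Ci)%C).
  { unfold cexp. simpl. replace (0 * (s * (PI / 2)) - 1 * 0) with 0 by ring.
    replace (0 * 0 + 1 * (s * (PI / 2))) with (s * (PI / 2)) by ring. rewrite exp_0.
    destruct Hs as [-> | ->]; rewrite ?Rmult_1_l, ?cos_PI2, ?sin_PI2; [Ceq|].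
    replace (-1 * (PI / 2)) with (- (PI / 2)) by ring. rewrite cos_neg, sin_neg, cos_PI2, sin_PI2. Ceq. }
  assert (SS : (RtoC s * RtoC s = RtoC 1)%C) by (rewrite <- RtoC_mult; f_equal; destruct Hs as [-> | ->]; ring).
  assert (E2 : cexp (- (Ci * RtoC (s * (PI / 2)))) = (- (RtoC s * Ci))%C).
  { rewrite cexp_opp, E1. assert (NS : RtoC s <> RtoC 0) by (intros E; apply RtoC_inj in E; destruct Hs; lra).
    assert (I1 : (- (RtoC s * Ci) * (RtoC s * Ci) = RtoC 1)%C).
    { transitivity (- ((RtoC s * RtoC s) * (Ci * Ci)))%C; [ring|]. rewrite SS, CiCi. ring. }
    transitivity ((- (RtoC s * Ci) * (RtoC s * Ci)) * / (RtoC s * Ci))%C; [rewrite I1; ring|].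
    field. split; [apply Ci_neq_0|easy]. }
  rewrite E1, E2. field. apply Ci_neq_0.
Qed.

(* The combination of powers of 1/sin that equals the sum of (w + k PI)^(-4) over all integers k. *)
Definition g4 (w : C) : C := (gg w * gg w - RtoC (2 / 3) * gg w)%C.

Lemma RtoC_div_2_3 : RtoC (2 / 3) = (RtoC 2 / RtoC 3)%C.
Proof. rewrite RtoC_div; [easy|lra]. Qed.

(** The formula mirrors the separation of the poles k PI into even and odd k; with sin^2 + cos^2 = 1
    it is a rational identity. Iteration expresses [g4] through its values at 2^j arguments shrunk
    by 2^(-j), where it is close to w^(-4). *)
Lemma g4_dup (w : C) (s : R) : s = 1 \/ s = -1 -> sn (RtoC 2 * w) <> RtoC 0 ->
  (RtoC 16 * g4 (RtoC 2 * w) = g4 w + g4 (w + RtoC (s * (PI / 2))))%C.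
Proof.
  intros Hs N. rewrite sn_double in N.
  assert (N1 : sn w <> RtoC 0) by (intros E; apply N; rewrite E; ring).
  assert (N2 : cs w <> RtoC 0) by (intros E; apply N; rewrite E; ring).
  assert (SS : (RtoC s * RtoC s = RtoC 1)%C) by (rewrite <- RtoC_mult; f_equal; destruct Hs as [-> | ->]; ring).
  unfold g4, gg. rewrite sn_double, (sn_shift w s Hs).
  replace (RtoC s * cs w * (RtoC s * cs w))%C with (RtoC s * RtoC s * (cs w * cs w))%C by ring. rewrite SS.
  pose proof (sn_cs w) as P. set (x := sn w) in *. set (y := cs w) in *. rewrite RtoC_div_2_3.
  assert (NX : (x * x)%C <> RtoC 0) by (apply Cmult_neq_0; auto).
  assert (NY : (y * y)%C <> RtoC 0) by (apply Cmult_neq_0; auto).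
  replace (RtoC 2 * x * y * (RtoC 2 * x * y))%C with (RtoC 4 * ((x * x) * (y * y)))%C by ring.
  set (X := (x * x)%C) in *. set (Y := (y * y)%C) in *. clearbody X Y.
  replace X with (RtoC 1 - Y)%C in * by (rewrite <- P; ring). field. auto.
Qed.

(** An error of order |w|^(-3) suffices: at the arguments of size k / N, after division by N^4, the
    errors sum up to O(1 / N). *)
Lemma g4_approx (w : C) : w <> RtoC 0 -> Rabs (fst w) <= 3 * (PI / 4) -> Rabs (snd w) <= 1 ->
  Cmod (g4 w - / (w * w * (w * w))) <= 3000000 / (Cmod w * Cmod w * Cmod w).
Proof.
  intros N H1 H2. assert (A := gg_approx w N H1 H2). assert (L := sn_lower w H1).
  assert (Wp := proj1 (Cmod_gt_0 w) N).
  assert (Ns : sn w <> RtoC 0) by (apply Cmod_gt_0; lra).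
  assert (W4 : Cmod w <= 5).
  { eapply Rle_trans; [apply Cmod_le_abs|]. pose proof PI_4. lra. }
  replace (g4 w - / (w * w * (w * w)))%C with ((gg w - / (w * w)) * (gg w + / (w * w)) - RtoC (2 / 3) * gg w)%C
    by (unfold g4; field; auto).
  assert (I : Cmod (/ (w * w)) = / (Cmod w * Cmod w)).
  { rewrite Cmod_inv by (apply Cmult_neq_0; auto). now rewrite Cmod_mult. }
  assert (G : Cmod (gg w) <= 36 * / (Cmod w * Cmod w)).
  { unfold gg. rewrite Cmod_inv by (apply Cmult_neq_0; auto). rewrite Cmod_mult.
    replace (36 * / (Cmod w * Cmod w)) with (/ (Cmod w / 6 * (Cmod w / 6))) by (field; lra).
    apply Rinv_le_contravar; [nra|]. apply Rmult_le_compat; lra. }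
  assert (S : Cmod (gg w + / (w * w)) <= 37 * / (Cmod w * Cmod w)).
  { eapply Rle_trans; [apply Cmod_triangle|]. lra. }
  eapply Rle_trans; [apply Cmod_minus_le|]. rewrite Cmod_mult, Cmod_RtoC_mult, Rabs_right by lra.
  set (m := Cmod w) in *. set (t := / m). assert (Ht : 0 < t) by (apply Rinv_0_lt_compat; lra).
  replace (/ (m * m)) with (t * t) in * by (unfold t; field; lra).
  replace (74000 / m) with (74000 * t) in A by (unfold t; field; lra).
  replace (3000000 / (m * m * m)) with (3000000 * (t * t * t)) by (unfold t; field; lra).
  assert (M1 : Cmod (gg w - / (w * w)) * Cmod (gg w + / (w * w)) <= 74000 * t * (37 * (t * t))).
  { apply Rmult_le_compat; try apply Cmod_ge_0; lra. }
  assert (T1 : 1 <= 5 * t). { unfold t. apply Rmult_le_reg_r with m; [lra|]. rewrite Rmult_assoc, Rinv_l by lra. lra. }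
  assert (T2 : 0 < t * t) by nra. nra.
Qed.

Lemma cexp_PI_Ci : cexp (RtoC PI * Ci) = (- RtoC 1)%C.
Proof.
  unfold cexp. simpl. replace (PI * 0 - 0 * 1) with 0 by ring. replace (PI * 1 + 0 * 0) with PI by ring.
  rewrite exp_0, cos_PI, sin_PI. Ceq.
Qed.

Lemma sn_PI (w : C) : sn (w + RtoC PI) = (- sn w)%C.
Proof.
  assert (C1 : cexp (Ci * RtoC PI) = (- RtoC 1)%C) by (rewrite Cmult_comm; apply cexp_PI_Ci).
  assert (C2 : cexp (- (Ci * RtoC PI)) = (- RtoC 1)%C).
  { rewrite cexp_opp, C1. field. }
  unfold sn. rewrite Cmult_plus_distr_l.
  replace (- (Ci * w + Ci * RtoC PI))%C with (- (Ci * w) + - (Ci * RtoC PI))%C by ring.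
  rewrite !cexp_plus, C1, C2. field. apply Ci_neq_0.
Qed.

Lemma g4_PI (w : C) : g4 (w - RtoC PI) = g4 w.
Proof.
  replace w with (w - RtoC PI + RtoC PI)%C at 2 by ring. unfold g4, gg. rewrite sn_PI.
  replace (- sn (w - RtoC PI) * - sn (w - RtoC PI))%C with (sn (w - RtoC PI) * sn (w - RtoC PI))%C by ring. easy.
Qed.

Lemma climseq_rate (u : nat -> C) (l : C) (K : R) (J : nat) :
  (forall j, (J <= j)%nat -> Cmod (u j - l) <= K / INR (2 ^ j)) -> climseq u l.
Proof.
  intros H e He. destruct (archimed_cor1 (e / (Rabs K + 1))) as (N & HN & HN0).
  { apply Rdiv_lt_0_compat; [easy|]. pose proof (Rabs_pos K). lra. }
  exists (max N J). intros j Hj. eapply Rle_lt_trans; [apply H; lia|].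
  assert (P : INR N <= INR (2 ^ j)). { apply le_INR. pose proof (Nat.pow_gt_lin_r 2 j ltac:(lia)). lia. }
  assert (P0 : 0 < INR N) by (apply lt_0_INR; lia).
  pose proof (Rle_abs K). pose proof (Rabs_pos K).
  apply Rlt_div_r in HN; [|lra].
  apply Rle_lt_trans with ((Rabs K + 1) / INR N).
  - apply Rle_div_l; [lra|]. unfold Rdiv.
    apply Rle_trans with ((Rabs K + 1) * / INR N * INR N); [rewrite Rmult_assoc, Rinv_l by lra; lra|].
    apply Rmult_le_compat_l; [|easy]. apply Rmult_le_pos; [lra|]. left. now apply Rinv_0_lt_compat.
  - unfold Rdiv. rewrite Rmult_comm. lra.
Qed.

Definition iv4 (w : C) : C := (/ (w * w * (w * w)))%C.

Lemma iv4_bound (w : C) (m : R) : 0 < m -> m <= Cmod w -> Cmod (iv4 w) <= / (m * m * (m * m)).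
Proof.
  intros Hm H. assert (N : w <> RtoC 0) by (apply Cmod_gt_0; lra).
  unfold iv4. rewrite Cmod_inv by (apply Cmult_neq_0; apply Cmult_neq_0; auto). rewrite !Cmod_mult.
  apply Rinv_le_contravar; [repeat apply Rmult_lt_0_compat; lra|].
  assert (m * m <= Cmod w * Cmod w) by (apply Rmult_le_compat; lra).
  apply Rmult_le_compat; nra.
Qed.

Lemma iv4_scal (c w : C) : c <> RtoC 0 -> w <> RtoC 0 -> iv4 (w / c) = (c * c * (c * c) * iv4 w)%C.
Proof. intros. unfold iv4. field. auto. Qed.

(** The translates by even integers from -2 M to 2 M - 2. The range is lopsided because it comes
    from 2 M consecutive translates, of which the upper half is moved back by a period. *)
Definition even_sum (M : nat) (z : C) : C :=
  csm (fun k => iv4 (z + RtoC (2 * INR k)) + iv4 (z - RtoC (2 * INR k + 2)))%C M.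

(** The second alternative admits the one real row that occurs, the odd integers. *)
Definition off_poles (x : C) : Prop := snd x <> 0 \/ x = RtoC (PI / 2).

Lemma sn_off_poles (x : C) (k N : nat) : off_poles x -> (k < N)%nat ->
  sn ((x + RtoC (INR k * PI)) / RtoC (INR N)) <> RtoC 0.
Proof.
  intros G H. assert (P : 0 < INR N) by (apply lt_0_INR; lia). apply sn_neq_0.
  assert (E : ((x + RtoC (INR k * PI)) / RtoC (INR N))%C = ((fst x + INR k * PI) / INR N, snd x / INR N)).
  { apply injective_projections; simpl; field; lra. }
  rewrite E. cbn [fst snd]. destruct G as [G|G].
  - left. intros Z. apply G. apply (Rmult_eq_reg_r (/ INR N)); [|apply Rinv_neq_0_compat; lra]. rewrite Rmult_0_l. exact Z.
  - right. subst x. simpl. pose proof PI_RGT_0. pose proof (pos_INR k).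
    assert (INR k + 1 <= INR N) by (rewrite <- S_INR; apply le_INR; lia).
    assert (0 < (PI / 2 + INR k * PI) / INR N) by (apply Rdiv_lt_0_compat; nra).
    rewrite Rabs_right by lra. split; [easy|]. apply Rlt_div_l; nra.
Qed.

Lemma RtoC_neq_0 (r : R) : r <> 0 -> RtoC r <> RtoC 0.
Proof. intros H E. apply RtoC_inj in E. lra. Qed.

Lemma g4_iter (x : C) (j : nat) : off_poles x ->
  (RtoC (INR (2 ^ j) ^ 4) * g4 x)%C = csm (fun k => g4 ((x + RtoC (INR k * PI)) / RtoC (INR (2 ^ j))))%C (2 ^ j).
Proof.
  intros G. induction j as [|j IH].
  - simpl. replace ((x + RtoC (0 * PI)) / RtoC 1)%C with x; [|rewrite Rmult_0_l; field].
    rewrite !Rmult_1_r. ring.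
  - replace (2 ^ S j)%nat with (2 ^ j + 2 ^ j)%nat by (simpl; lia).
    assert (P : (0 < 2 ^ j)%nat) by (apply Nat.neq_0_lt_0, Nat.pow_nonzero; lia).
    set (N := (2 ^ j)%nat) in *. assert (PN : 0 < INR N) by (apply lt_0_INR; lia).
    rewrite csm_app, plus_INR, <- csm_plus.
    replace (RtoC ((INR N + INR N) ^ 4) * g4 x)%C with (RtoC 16 * (RtoC (INR N ^ 4) * g4 x))%C.
    2:{ rewrite Cmult_assoc, <- RtoC_mult. f_equal. f_equal. ring. }
    rewrite IH, <- csm_scal. apply csm_ext. intros k Hk.
    set (w := ((x + RtoC (INR k * PI)) / RtoC (INR N + INR N))%C).
    assert (NN : RtoC (INR N) <> RtoC 0) by (apply RtoC_neq_0; lra).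
    assert (E2 : RtoC (INR N + INR N) = (RtoC 2 * RtoC (INR N))%C) by (rewrite <- RtoC_mult; f_equal; ring).
    assert (E : ((x + RtoC (INR k * PI)) / RtoC (INR N))%C = (RtoC 2 * w)%C) by (unfold w; rewrite E2; field; auto).
    rewrite E. rewrite (g4_dup w 1); [|now left|rewrite <- E; now apply sn_off_poles].
    f_equal. f_equal. unfold w. rewrite E2, plus_INR, Rmult_plus_distr_r, RtoC_plus.
    replace (RtoC (1 * (PI / 2))) with (RtoC (INR N * PI) / (RtoC 2 * RtoC (INR N)))%C.
    2:{ rewrite <- RtoC_mult, <- RtoC_div by lra. f_equal. field. lra. }
    field. auto.
Qed.

Lemma rsm_sq (n m : nat) : (0 < m)%nat -> rsm (fun k => / ((INR (m + k) + 1) * (INR (m + k) + 1))) n <= / INR m.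
Proof.
  intros Hm. assert (P : 0 < INR m) by (apply lt_0_INR; lia).
  assert (H : rsm (fun k => / ((INR (m + k) + 1) * (INR (m + k) + 1))) n <= / INR m - / INR (m + n)).
  { induction n as [|n IH]; simpl rsm; [rewrite Nat.add_0_r; lra|].
    assert (Q : 0 < INR (m + n)) by (apply lt_0_INR; lia).
    rewrite Nat.add_succ_r, S_INR. set (t := INR (m + n)) in *.
    assert (/ ((t + 1) * (t + 1)) <= / t - / (t + 1)); [|lra].
    replace (/ t - / (t + 1)) with (/ (t * (t + 1))) by (field; lra).
    apply Rinv_le_contravar; nra. }
  assert (0 < / INR (m + n)); [apply Rinv_0_lt_compat, lt_0_INR; lia|lra].
Qed.

Lemma rsm_cube (n : nat) : rsm (fun k => / ((INR k + 1) * (INR k + 1) * (INR k + 1))) n <= 2.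
Proof.
  destruct n as [|n]; [simpl; lra|].
  assert (F : forall u m, rsm u (S m) = u 0%nat + rsm (fun k => u (S k)) m).
  { intros u m. induction m as [|m IH]; [simpl; ring|]. change (rsm u (S (S m))) with (rsm u (S m) + u (S m)).
    rewrite IH. simpl. ring. }
  rewrite F. simpl (INR 0). replace (/ ((0 + 1) * (0 + 1) * (0 + 1))) with 1 by field.
  assert (H := rsm_sq n 1 ltac:(lia)). simpl (INR 1) in H. rewrite Rinv_1 in H.
  assert (L : rsm (fun k => / ((INR (S k) + 1) * (INR (S k) + 1) * (INR (S k) + 1))) n <= rsm (fun k => / ((INR (1 + k) + 1) * (INR (1 + k) + 1))) n).
  { apply rsm_le. intros k _. replace (1 + k)%nat with (S k) by lia. rewrite S_INR. pose proof (pos_INR k).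
    apply Rinv_le_contravar; nra. }
  lra.
Qed.

Section Row.
Variables (z : C) (c : R).
Hypothesis Hz : off_poles (RtoC (PI / 2) * z).
Hypothesis Hc : 0 < c.
Hypothesis Hl : forall k : nat, c * (INR k + 1) <= Cmod (z + RtoC (2 * INR k)) /\ c * (INR k + 1) <= Cmod (z - RtoC (2 * INR k + 2)).

Lemma even_sum_pos (k : nat) : 0 < c * (INR k + 1).
Proof. pose proof (pos_INR k). nra. Qed.

Lemma even_sum_term (k : nat) :
  Cmod (iv4 (z + RtoC (2 * INR k)) + iv4 (z - RtoC (2 * INR k + 2)))%C <= 2 / (c * c * (c * c)) * / ((INR k + 1) * (INR k + 1) * ((INR k + 1) * (INR k + 1))).
Proof.
  destruct (Hl k) as [H1 H2]. pose proof (even_sum_pos k) as P. pose proof (pos_INR k).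
  eapply Rle_trans; [apply Cmod_triangle|].
  pose proof (iv4_bound _ _ P H1). pose proof (iv4_bound _ _ P H2).
  replace (2 / (c * c * (c * c)) * / ((INR k + 1) * (INR k + 1) * ((INR k + 1) * (INR k + 1)))) with
    (2 * / (c * (INR k + 1) * (c * (INR k + 1)) * (c * (INR k + 1) * (c * (INR k + 1))))) by (field; lra).
  lra.
Qed.

Lemma even_sum_tail (M n : nat) : (0 < M)%nat ->
  Cmod (even_sum (M + n) z - even_sum M z) <= 2 / (c * c * (c * c)) / (INR M * INR M * INR M).
Proof.
  intros HM. assert (PM : 0 < INR M) by (apply lt_0_INR; lia). unfold even_sum. rewrite csm_app.
  match goal with |- Cmod (?a + ?b - ?a)%C <= _ => replace (a + b - a)%C with b by ring end.
  assert (C0 : 0 < 2 / (c * c * (c * c))) by (apply Rdiv_lt_0_compat; [lra|]; repeat apply Rmult_lt_0_compat; lra).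
  eapply Rle_trans.
  { apply (csm_bound _ (fun k => 2 / (c * c * (c * c)) * / (INR M * INR M) * / ((INR (M + k) + 1) * (INR (M + k) + 1)))).
    intros k _. eapply Rle_trans; [apply even_sum_term|].
    rewrite (Rmult_assoc (2 / (c * c * (c * c)))). apply Rmult_le_compat_l; [lra|].
    rewrite <- Rinv_mult. rewrite plus_INR. pose proof (pos_INR k).
    apply Rinv_le_contravar; [repeat apply Rmult_lt_0_compat; lra|].
    apply Rmult_le_compat_r; [nra|]. apply Rmult_le_compat; lra. }
  rewrite rsm_scal. replace (2 / (c * c * (c * c)) / (INR M * INR M * INR M)) with (2 / (c * c * (c * c)) * / (INR M * INR M) * / INR M) by (field; lra).
  apply Rmult_le_compat_l; [|now apply rsm_sq].
  apply Rmult_le_pos; [lra|]. left. apply Rinv_0_lt_compat. nra.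
Qed.

Lemma even_sum_lim : climseq (fun j => even_sum (2 ^ j) z) (RtoC ((PI / 2) ^ 4) * g4 (RtoC (PI / 2) * z)).
Proof.
  pose proof PI_RGT_0 as P0. pose proof PI2_3_2 as P3. pose proof PI_4 as P4.
  (* From this index on, M >= 8 (|z| + 1), which keeps all arguments in the region where [g4_approx]
     holds. *)
  destruct (archimed_cor1 (/ (8 * (Cmod z + 1)))) as (J & HJ & HJ0).
  { apply Rinv_0_lt_compat. pose proof (Cmod_ge_0 z). lra. }
  set (x := (RtoC (PI / 2) * z)%C) in *.
  apply (climseq_rate _ _ (4 * (3000000 / (c * c * c)) * (PI / 2) ^ 4) J). intros j Hj.
  assert (I := g4_iter x (S j) Hz). 
  replace (2 ^ S j)%nat with (2 ^ j + 2 ^ j)%nat in I by (simpl; lia).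
  assert (HMJ : (J <= 2 ^ j)%nat) by (pose proof (Nat.pow_gt_lin_r 2 j ltac:(lia)); lia).
  set (M := (2 ^ j)%nat) in *. assert (PM : 0 < INR M) by (apply lt_0_INR; lia).
  assert (HM : 8 * (Cmod z + 1) <= INR M).
  { apply Rle_trans with (INR J); [|apply le_INR; lia]. pose proof (Cmod_ge_0 z).
    assert (0 < INR J) by (apply lt_0_INR; lia).
    apply Rnot_lt_le. intros L. apply Rinv_lt_contravar in L; [lra|]. apply Rmult_lt_0_compat; lra. }
  (* The upper half of the sum is reversed and moved back by the period PI, which pairs the
     translates as in [even_sum]. *)
  rewrite csm_app, plus_INR in I. rewrite (csm_rev (fun k => g4 ((x + RtoC (INR (M + k) * PI)) / RtoC (INR M + INR M)))%C) in I.
  rewrite <- csm_plus in I.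
  set (N := INR M + INR M) in *. assert (PN : 0 < N) by (unfold N; lra).
  assert (NN : RtoC N <> RtoC 0) by (apply RtoC_neq_0; lra).
  assert (I2 : (RtoC (N ^ 4) * g4 x)%C = csm (fun k => g4 (x / RtoC N + RtoC (INR k * PI / N)) + g4 (x / RtoC N - RtoC ((INR k + 1) * PI / N)))%C M).
  { rewrite I. apply csm_ext. intros k Hk. f_equal.
    - f_equal. rewrite RtoC_div by lra. field. auto.
    - rewrite <- g4_PI. f_equal. rewrite RtoC_div by lra.
      replace (INR (M + (M - 1 - k))) with (N - (INR k + 1)).
      2:{ rewrite plus_INR, !minus_INR by lia. unfold N. simpl. ring. }
      rewrite Rmult_minus_distr_r, RtoC_minus, (RtoC_mult N). field. auto. }
  assert (W : forall y : R, Rabs y <= INR M -> (c * (c * c) > 0) -> forall m, 0 < m -> m <= Cmod (z + RtoC (2 * y)) ->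
    Cmod (g4 (x / RtoC N + RtoC (y * PI / N)) - RtoC (N ^ 4) * / RtoC ((PI / 2) ^ 4) * iv4 (z + RtoC (2 * y)))%C <= 3000000 * (N * N * N) / (m * m * m)).
  { intros y Hy _ m Hm Hzy. set (v := (x / RtoC N + RtoC (y * PI / N))%C).
    assert (Ev : v = (RtoC (PI / 2 / N) * (z + RtoC (2 * y)))%C).
    { unfold v, x. rewrite !RtoC_div, !RtoC_mult by lra. field. repeat split; first [easy | apply RtoC_neq_0; lra]. }
    assert (Mv : Cmod v = PI / 2 / N * Cmod (z + RtoC (2 * y))).
    { rewrite Ev, Cmod_RtoC_mult, Rabs_right; [easy|]. apply Rle_ge, Rlt_le. apply Rdiv_lt_0_compat; lra. }
    assert (Nz : (z + RtoC (2 * y))%C <> RtoC 0) by (apply Cmod_gt_0; lra).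
    assert (PN2 : 0 < PI / 2 / N) by (apply Rdiv_lt_0_compat; lra).
    assert (Nv : v <> RtoC 0) by (apply Cmod_gt_0; rewrite Mv; apply Rmult_lt_0_compat; lra).
    assert (B1 : Rabs (fst v) <= 3 * (PI / 4)).
    { assert (F1 : fst v = PI / 2 / N * (fst z + 2 * y)) by (rewrite Ev; simpl; ring). rewrite F1, Rabs_mult, (Rabs_right (PI / 2 / N)) by lra.
      pose proof (fst_le_Cmod z). pose proof (Rabs_triang (fst z) (2 * y)). rewrite Rabs_mult, (Rabs_right 2) in H0 by lra.
      replace (3 * (PI / 4)) with (PI / 2 / N * (3 / 2 * N)) by (field; lra).
      apply Rmult_le_compat_l; [lra|]. unfold N. lra. }
    assert (B2 : Rabs (snd v) <= 1).
    { assert (F1 : snd v = PI / 2 / N * snd z) by (rewrite Ev; simpl; ring). rewrite F1, Rabs_mult, (Rabs_right (PI / 2 / N)) by lra.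
      pose proof (snd_le_Cmod z). assert (Rabs (snd z) <= N / 16) by (unfold N; lra).
      apply Rle_trans with (PI / 2 / N * (N / 16)); [apply Rmult_le_compat_l; lra|].
      replace (PI / 2 / N * (N / 16)) with (PI / 32) by (field; lra). lra. }
    assert (A := g4_approx v Nv B1 B2).
    replace (RtoC (N ^ 4) * / RtoC ((PI / 2) ^ 4) * iv4 (z + RtoC (2 * y)))%C with (/ (v * v * (v * v)))%C.
    2:{ rewrite Ev. unfold iv4. rewrite !RtoC_div by lra. simpl pow. rewrite !RtoC_mult, RtoC_div by lra.
        field. repeat split; first [easy | apply RtoC_neq_0; lra | rewrite <- RtoC_mult; exact Nz]. }
    eapply Rle_trans; [exact A|]. rewrite Mv.
    unfold Rdiv. rewrite (Rmult_assoc 3000000). apply Rmult_le_compat_l; [lra|].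
    set (Z := Cmod (z + RtoC (2 * y))) in *.
    apply Rle_trans with (/ (1 * (m * / N) * (m * / N) * (m * / N))); [|right; field; lra].
    apply Rinv_le_contravar; [repeat apply Rmult_lt_0_compat; try lra; apply Rinv_0_lt_compat; lra|].
    rewrite Rmult_1_l.
    assert (IN : 0 < / N) by (apply Rinv_0_lt_compat; lra).
    assert (0 < m * / N) by nra. assert (0 <= m * / N <= PI * / 2 * / N * Z).
    { split; [lra|]. apply Rle_trans with (Z * / N); [apply Rmult_le_compat_r; lra|].
      assert (0 <= Z * / N) by (apply Rmult_le_pos; lra). nra. }
    apply Rmult_le_compat; [apply Rmult_le_pos; lra|lra|apply Rmult_le_compat; lra|lra]. }
  assert (PP : 0 < (PI / 2) ^ 4) by (apply pow_lt; lra). assert (PN4 : 0 < N ^ 4) by (apply pow_lt; lra).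
  assert (C3 : 0 < c * c * c) by (repeat apply Rmult_lt_0_compat; lra).
  assert (D : Cmod (RtoC (N ^ 4) * g4 x - RtoC (N ^ 4) * / RtoC ((PI / 2) ^ 4) * even_sum M z)%C <= 4 * (3000000 / (c * c * c)) * (N * N * N)).
  { rewrite I2. unfold even_sum. rewrite <- csm_scal, <- csm_minus.
    eapply Rle_trans.
    { apply (csm_bound _ (fun k => 2 * (3000000 / (c * c * c)) * (N * N * N) * / ((INR k + 1) * (INR k + 1) * (INR k + 1)))).
      intros k Hk. destruct (Hl k) as [L1 L2]. pose proof (even_sum_pos k) as Pk. pose proof (pos_INR k) as P5.
      assert (Hk1 : INR k + 1 <= INR M) by (rewrite <- S_INR; apply le_INR; lia).
      assert (W1 := W (INR k) ltac:(rewrite Rabs_right; lra) ltac:(nra) _ Pk L1).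
      assert (E : (z - RtoC (2 * INR k + 2) = z + RtoC (2 * - (INR k + 1)))%C).
      { unfold Cminus. rewrite <- RtoC_opp. f_equal. f_equal. ring. }
      rewrite E in *.
      assert (W2 := W (- (INR k + 1)) ltac:(rewrite Rabs_Ropp, Rabs_right; lra) ltac:(nra) _ Pk L2).
      replace (x / RtoC N + RtoC (- (INR k + 1) * PI / N))%C with (x / RtoC N - RtoC ((INR k + 1) * PI / N))%C in W2.
      2:{ unfold Cminus. rewrite <- RtoC_opp. f_equal. f_equal. field. lra. }
      match goal with |- Cmod (?a + ?b - ?s * (?d + ?e))%C <= _ => replace (a + b - s * (d + e))%C with ((a - s * d) + (b - s * e))%C by ring end.
      eapply Rle_trans; [apply Cmod_triangle|].
      replace (2 * (3000000 / (c * c * c)) * (N * N * N) * / ((INR k + 1) * (INR k + 1) * (INR k + 1))) with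
        (2 * (3000000 * (N * N * N) / (c * (INR k + 1) * (c * (INR k + 1)) * (c * (INR k + 1))))) by (field; lra).
      lra. }
    rewrite rsm_scal. pose proof (rsm_cube M) as RC.
    assert (0 < 3000000 / (c * c * c)) by (apply Rdiv_lt_0_compat; lra).
    assert (0 < N * N * N) by (repeat apply Rmult_lt_0_compat; lra).
    assert (0 < 3000000 / (c * c * c) * (N * N * N)) by (apply Rmult_lt_0_compat; lra). nra. }
  assert (E : (even_sum M z - RtoC ((PI / 2) ^ 4) * g4 x = RtoC (- ((PI / 2) ^ 4 / N ^ 4)) * (RtoC (N ^ 4) * g4 x - RtoC (N ^ 4) * / RtoC ((PI / 2) ^ 4) * even_sum M z))%C).
  { rewrite RtoC_opp, RtoC_div by lra. field. split; apply RtoC_neq_0; lra. }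
  rewrite E, Cmod_RtoC_mult, Rabs_Ropp, Rabs_right.
  2:{ apply Rle_ge, Rlt_le, Rdiv_lt_0_compat; lra. }
  apply Rle_trans with ((PI / 2) ^ 4 / N ^ 4 * (4 * (3000000 / (c * c * c)) * (N * N * N))).
  { apply Rmult_le_compat_l; [|easy]. apply Rlt_le, Rdiv_lt_0_compat; lra. }
  set (K := 3000000 / (c * c * c)) in *. assert (0 < K) by (apply Rdiv_lt_0_compat; lra).
  replace ((PI / 2) ^ 4 / N ^ 4 * (4 * K * (N * N * N))) with (4 * K * (PI / 2) ^ 4 * / N) by (field; lra).
  apply Rmult_le_compat_l.
  - apply Rmult_le_pos; lra.
  - apply Rinv_le_contravar; [easy|]. unfold N. lra.
Qed.
End Row.

(** * Eisenstein series of weight 4 *)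

Lemma rsm_const (K : R) (n : nat) : rsm (fun _ => K) n = INR n * K.
Proof. induction n as [|n IH]; [simpl; ring|]. rewrite S_INR. simpl. rewrite IH. ring. Qed.

(** Rows and columns are truncated at the same M = 2^j: each row misses a tail of order M^(-3), so
    the M rows together err by O(M^(-2)). *)
Lemma rows_lim (z : nat -> C) (c A r : R) : 0 < c -> 0 <= r < 1 ->
  (forall a, off_poles (RtoC (PI / 2) * z a)) ->
  (forall a k : nat, c * (INR k + 1) <= Cmod (z a + RtoC (2 * INR k)) /\ c * (INR k + 1) <= Cmod (z a - RtoC (2 * INR k + 2))) ->
  (forall a, Cmod (g4 (RtoC (PI / 2) * z a)) <= A * r ^ a) ->
  climseq (fun j => csm (fun a => even_sum (2 ^ j) (z a)) (2 ^ j)) (RtoC ((PI / 2) ^ 4) * csum (fun a => g4 (RtoC (PI / 2) * z a))).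
Proof.
  intros Hc Hr Hz Hl HA. set (P4 := RtoC ((PI / 2) ^ 4)).
  assert (L2 := csum_lim _ A r Hr HA).
  assert (L3 := climseq_scal P4 _ _ (climseq_sub _ _ (fun j => 2 ^ j)%nat (fun n => Nat.lt_le_incl _ _ (Nat.pow_gt_lin_r 2 n ltac:(lia))) L2)).
  set (G := csum (fun a => g4 (RtoC (PI / 2) * z a))%C) in *.
  assert (L1 : climseq (fun j => csm (fun a => even_sum (2 ^ j) (z a) - P4 * g4 (RtoC (PI / 2) * z a))%C (2 ^ j)) (RtoC 0)).
  { apply (climseq_rate _ _ (2 / (c * c * (c * c))) 0). intros j _.
    assert (HM : (0 < 2 ^ j)%nat) by (pose proof (Nat.pow_gt_lin_r 2 j ltac:(lia)); lia).
    assert (PM : 1 <= INR (2 ^ j)) by (apply (le_INR 1); lia).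
    set (K := 2 / (c * c * (c * c))). 
    assert (C0 : 0 < K) by (apply Rdiv_lt_0_compat; [lra|]; repeat apply Rmult_lt_0_compat; lra).
    unfold Cminus at 1. rewrite Copp_0, Cplus_0_r.
    eapply Rle_trans.
    { apply (csm_bound _ (fun _ => K / (INR (2 ^ j) * INR (2 ^ j) * INR (2 ^ j)))). intros a _.
      rewrite Cmod_swap.
      apply (climseq_bound (fun i => even_sum (2 ^ (j + i)) (z a))).
      - apply (climseq_sub (fun i => even_sum (2 ^ i) (z a)) _ (fun i => (j + i)%nat)); [intros; lia|].
        apply (even_sum_lim (z a) c (Hz a) Hc (Hl a)).
      - intros i. replace (2 ^ (j + i))%nat with (2 ^ j + (2 ^ (j + i) - 2 ^ j))%nat.
        + now apply even_sum_tail.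
        + assert (2 ^ j <= 2 ^ (j + i))%nat by (apply Nat.pow_le_mono_r; lia). lia. }
    rewrite rsm_const. set (M := INR (2 ^ j)) in *.
    replace (M * (K / (M * M * M))) with (K * / (M * M)) by (field; lra).
    apply Rmult_le_compat_l; [lra|]. apply Rinv_le_contravar; nra. }
  replace (P4 * G)%C with (RtoC 0 + P4 * G)%C by ring.
  apply (climseq_ext (fun j => csm (fun a => even_sum (2 ^ j) (z a) - P4 * g4 (RtoC (PI / 2) * z a))%C (2 ^ j) + P4 * csm (fun a => g4 (RtoC (PI / 2) * z a))%C (2 ^ j))%C).
  - intros j. rewrite csm_minus, csm_scal. ring.
  - now apply climseq_plus.
Qed.

Lemma lattice_lower (t : C) : uhp t -> exists c, 0 < c /\ forall a b : R,
  c * Rabs a <= Cmod (RtoC a * t + RtoC b) /\ c * Rabs b <= Cmod (RtoC a * t + RtoC b).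
Proof.
  unfold uhp. intros H. pose proof (Cmod_ge_0 t).
  assert (Q : 0 < snd t / (snd t + Cmod t) <= 1).
  { split; [apply Rdiv_lt_0_compat; lra|]. apply Rle_div_l; lra. }
  assert (S : forall a b : R, snd t * Rabs a <= Cmod (RtoC a * t + RtoC b)).
  { intros a b. eapply Rle_trans; [|apply snd_le_Cmod]. simpl. replace (a * snd t + 0 * fst t + 0) with (snd t * a) by ring.
    rewrite Rabs_mult, (Rabs_right (snd t)) by lra. lra. }
  exists (Rmin (snd t) (snd t / (snd t + Cmod t))).
  split; [apply Rmin_glb_lt; lra|]. intros a b. specialize (S a b).
  pose proof (Rabs_pos a). pose proof (Rabs_pos b). split.
  - eapply Rle_trans; [|apply S]. apply Rmult_le_compat_r; [easy|]. apply Rmin_l.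
  - apply Rle_trans with (snd t / (snd t + Cmod t) * Rabs b); [apply Rmult_le_compat_r; [easy|]; apply Rmin_r|].
    set (m := Cmod (RtoC a * t + RtoC b)) in *.
    assert (T : Rabs b <= m + Rabs a * Cmod t).
    { replace (Rabs b) with (Cmod ((RtoC a * t + RtoC b) - RtoC a * t)%C).
      - eapply Rle_trans; [apply Cmod_minus_le|]. rewrite Cmod_RtoC_mult. unfold m. lra.
      - replace ((RtoC a * t + RtoC b) - RtoC a * t)%C with (RtoC b) by ring. apply Cmod_R. }
    replace (snd t / (snd t + Cmod t) * Rabs b) with (snd t * Rabs b / (snd t + Cmod t)) by (field; lra).
    apply Rle_div_l; [lra|]. nra.
Qed.

(** The generating function of the cubes, the sum of n^3 w^n over n >= 1. Through it a row sum of
    fourth inverse powers becomes a power series in the nome. *)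
Definition phi (w : C) : C := (w * (RtoC 1 + RtoC 4 * w + w * w) / ((RtoC 1 - w) * (RtoC 1 - w) * ((RtoC 1 - w) * (RtoC 1 - w))))%C.

Lemma one_minus_neq_0 (w : C) : Cmod w < 1 -> (RtoC 1 - w)%C <> RtoC 0.
Proof.
  intros H E. apply Ceq_minus in E. rewrite <- E, Cmod_R, Rabs_R1 in H. lra.
Qed.

Lemma Cmod_one_minus (w : C) : 1 - Cmod w <= Cmod (RtoC 1 - w).
Proof. pose proof (Cmod_rev (RtoC 1) w) as R. rewrite Cmod_R, Rabs_R1 in R. lra. Qed.

Lemma phi_bound (w : C) (r : R) : Cmod w <= r -> r < 1 -> Cmod (phi w) <= 6 / ((1 - r) * (1 - r) * ((1 - r) * (1 - r))) * Cmod w.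
Proof.
  intros H Hr. pose proof (Cmod_one_minus w) as L. pose proof (Cmod_ge_0 w).
  assert (N := one_minus_neq_0 w ltac:(lra)). unfold phi.
  rewrite Cmod_div by (apply Cmult_neq_0; apply Cmult_neq_0; auto). rewrite !Cmod_mult.
  assert (B : Cmod (RtoC 1 + RtoC 4 * w + w * w) <= 6).
  { eapply Rle_trans; [apply Cmod_triangle|]. pose proof (Cmod_triangle (RtoC 1) (RtoC 4 * w)) as T.
    rewrite Cmod_RtoC_mult, Cmod_R, Rabs_R1, Rabs_right in T by lra. rewrite Cmod_mult. nra. }
  set (d := Cmod (RtoC 1 - w)) in *. unfold Rdiv.
  replace (6 * / ((1 - r) * (1 - r) * ((1 - r) * (1 - r))) * Cmod w) with (Cmod w * 6 * / ((1 - r) * (1 - r) * ((1 - r) * (1 - r)))) by ring.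
  assert (D2 : (1 - r) * (1 - r) <= d * d) by (apply Rmult_le_compat; lra).
  apply Rmult_le_compat.
  - apply Rmult_le_pos; [lra|apply Cmod_ge_0].
  - left. apply Rinv_0_lt_compat. repeat apply Rmult_lt_0_compat; lra.
  - apply Rmult_le_compat_l; lra.
  - apply Rinv_le_contravar; [repeat apply Rmult_lt_0_compat; lra|]. apply Rmult_le_compat; nra.
Qed.

Lemma g4_phi (w : C) : sn w <> RtoC 0 -> g4 w = (RtoC (8 / 3) * phi (cexp (RtoC 2 * (Ci * w))))%C.
Proof.
  intros N. pose proof Ci_neq_0 as NC.
  assert (EI : cexp (- (Ci * w)) = (/ cexp (Ci * w))%C) by apply cexp_opp.
  replace (RtoC 2 * (Ci * w))%C with (Ci * w + Ci * w)%C by ring. rewrite cexp_plus.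
  assert (NE := cexp_neq_0 (Ci * w)). unfold g4, gg. unfold sn in *. rewrite EI in *.
  set (e := cexp (Ci * w)) in *. clearbody e.
  assert (ND : (RtoC 1 - e * e)%C <> RtoC 0).
  { intros E. apply N. replace ((e - / e) / (RtoC 2 * Ci))%C with (- (RtoC 1 - e * e) / (e * (RtoC 2 * Ci)))%C by (field; auto).
    rewrite E. field. auto. }
  assert (ND' : (e * e - RtoC 1)%C <> RtoC 0).
  { intros E. apply ND. replace (RtoC 1 - e * e)%C with (- (e * e - RtoC 1))%C by ring. rewrite E. ring. }
  replace ((e - / e) / (RtoC 2 * Ci) * ((e - / e) / (RtoC 2 * Ci)))%C with ((RtoC 1 - e * e) * (RtoC 1 - e * e) / (RtoC 4 * (e * e) * (Ci * Ci)))%C by (field; auto).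
  rewrite CiCi. unfold phi. rewrite (RtoC_div 2 3), (RtoC_div 8 3) by lra. field. auto.
Qed.

Lemma cexp_pow (x : C) (n : nat) : cexp (RtoC (INR n) * x) = (cexp x ^ n)%C.
Proof.
  induction n as [|n IH]; [simpl; rewrite Cmult_0_l; apply cexp_0|].
  rewrite S_INR, RtoC_plus, Cmult_plus_distr_r, cexp_plus, IH, Cpow_S.
  replace (RtoC 1 * x)%C with x by ring. ring.
Qed.

Definition nome (t : C) : C := cexp (RtoC PI * (Ci * t)).

Lemma Cmod_nome (t : C) : Cmod (nome t) = exp (- (PI * snd t)).
Proof. unfold nome. rewrite Cmod_cexp. f_equal. simpl. ring. Qed.

Lemma Cmod_nome_lt (t : C) : uhp t -> 0 < Cmod (nome t) < 1.
Proof.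
  unfold uhp. intros H. rewrite Cmod_nome. split; [apply exp_pos|]. rewrite <- exp_0. apply exp_increasing.
  pose proof PI_RGT_0. nra.
Qed.

(* Eisenstein series of weight 4, whose lattice sums converge absolutely. In terms of theta
   constants, 16 h10 = (theta_2 theta_3)^4 and 16 h01 = (theta_3 theta_4)^4. *)
Definition h10 (q : C) : C := csum (fun k => phi (q ^ (2 * k + 1))%C).
Definition h01 (q : C) : C := (RtoC (1 / 16) + csum (fun k => phi (- q ^ (2 * k + 2))%C))%C.

Lemma phi_pow_bound (q w : C) (k m : nat) : Cmod q < 1 -> Cmod w = Cmod (q ^ (2 * k + S m))%C ->
  Cmod (phi w) <= 6 / ((1 - Cmod q) * (1 - Cmod q) * ((1 - Cmod q) * (1 - Cmod q))) * (Cmod q * Cmod q) ^ k.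
Proof.
  intros H E. pose proof (Cmod_ge_0 q). rewrite Cmod_pow in E.
  assert (E2 : Cmod w = Cmod q ^ (S m) * (Cmod q * Cmod q) ^ k).
  { rewrite E, pow_add, pow_mult, Rmult_comm. f_equal. f_equal. simpl. ring. }
  assert (P1 : 0 <= Cmod q ^ S m <= Cmod q).
  { split; [apply pow_le; lra|]. simpl. assert (Cmod q ^ m <= 1) by (rewrite <- (pow1 m); apply pow_incr; lra).
    pose proof (pow_le _ m H0). nra. }
  assert (P2 : 0 <= (Cmod q * Cmod q) ^ k <= 1).
  { split; [apply pow_le; nra|]. rewrite <- (pow1 k). apply pow_incr. nra. }
  eapply Rle_trans; [apply (phi_bound w (Cmod q)); [nra|easy]|].
  apply Rmult_le_compat_l; [|nra].
  apply Rlt_le, Rdiv_lt_0_compat; [lra|]. repeat apply Rmult_lt_0_compat; lra.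
Qed.

Lemma csum_unique (u : nat -> C) (A r : R) (l : C) : 0 <= r < 1 -> (forall k, Cmod (u k) <= A * r ^ k) -> climseq (csm u) l -> csum u = l.
Proof. intros Hr H L. exact (climseq_unique _ _ _ (csum_lim u A r Hr H) L). Qed.

Lemma csum_ext (u v : nat -> C) : (forall k, u k = v k) -> csum u = csum v.
Proof. intros H. unfold csum. f_equal; apply Series_ext; intros n; now rewrite H. Qed.

Lemma csum_scal (u : nat -> C) (A r : R) (c : C) : 0 <= r < 1 -> (forall k, Cmod (u k) <= A * r ^ k) -> csum (fun k => c * u k)%C = (c * csum u)%C.
Proof.
  intros Hr H. apply (csum_unique _ (Cmod c * A) r).
  - easy.
  - intros k. rewrite Cmod_mult, Rmult_assoc. apply Rmult_le_compat_l; [apply Cmod_ge_0|easy].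
  - apply (climseq_ext (fun n => c * csm u n)%C); [intros; now rewrite csm_scal|]. apply climseq_scal. now apply (csum_lim u A r).
Qed.

Lemma snd_mult_pos (a : R) (t : C) : 0 < a -> uhp t -> snd (RtoC (PI / 2) * (RtoC a * t))%C <> 0.
Proof.
  unfold uhp. intros Ha H. simpl. pose proof PI_RGT_0.
  assert (0 < PI / 2 * (a * snd t)) by (apply Rmult_lt_0_compat; [lra|nra]). lra.
Qed.

Lemma g4_row (n : nat) (t : C) : (0 < n)%nat -> uhp t ->
  g4 (RtoC (PI / 2) * (RtoC (INR n) * t)) = (RtoC (8 / 3) * phi (nome t ^ n))%C /\
  g4 (RtoC (PI / 2) * (RtoC (INR n) * t + RtoC 1)) = (RtoC (8 / 3) * phi (- nome t ^ n))%C.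
Proof.
  intros Hn Ht. assert (P : 0 < INR n) by now apply lt_0_INR.
  assert (P2 : RtoC (PI / 2) = (RtoC PI / RtoC 2)%C) by (rewrite RtoC_div; [easy|lra]).
  split; rewrite g4_phi.
  - f_equal. f_equal. unfold nome. rewrite <- cexp_pow. f_equal. rewrite P2. field.
  - apply sn_neq_0. left. now apply snd_mult_pos.
  - f_equal. f_equal. unfold nome. rewrite <- cexp_pow.
    replace (RtoC 2 * (Ci * (RtoC (PI / 2) * (RtoC (INR n) * t + RtoC 1))))%C with (RtoC (INR n) * (RtoC PI * (Ci * t)) + RtoC PI * Ci)%C by (rewrite P2; field).
    rewrite cexp_plus, cexp_PI_Ci. ring.
  - apply sn_neq_0. left. pose proof (snd_mult_pos _ t P Ht) as Q. intros E. apply Q. rewrite <- E. simpl. ring.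
Qed.

Lemma g4_PI2 : g4 (RtoC (PI / 2) * RtoC 1) = RtoC (1 / 3).
Proof.
  rewrite Cmult_1_r. assert (E : sn (RtoC (PI / 2)) = RtoC 1).
  { unfold RtoC. rewrite sn_eq, sin_PI2, cos_PI2, Ropp_0, exp_0. apply injective_projections; simpl; field. }
  unfold g4, gg. rewrite E, !RtoC_div by lra. field.
Qed.

Lemma disc_bounds (q : C) : Cmod q < 1 -> 0 <= Cmod q * Cmod q < 1.
Proof. intros H. pose proof (Cmod_ge_0 q). nra. Qed.

Lemma h10_term (q : C) (k : nat) : Cmod q < 1 ->
  Cmod (phi (q ^ (2 * k + 1))%C) <= 6 / ((1 - Cmod q) * (1 - Cmod q) * ((1 - Cmod q) * (1 - Cmod q))) * (Cmod q * Cmod q) ^ k.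
Proof. intros H. now apply (phi_pow_bound q _ k 0). Qed.

Lemma h01_term (q : C) (k : nat) : Cmod q < 1 ->
  Cmod (phi (- q ^ (2 * k + 2))%C) <= 6 / ((1 - Cmod q) * (1 - Cmod q) * ((1 - Cmod q) * (1 - Cmod q))) * (Cmod q * Cmod q) ^ k.
Proof. intros H. apply (phi_pow_bound q _ k 1); [easy|]. now rewrite Cmod_opp. Qed.

Lemma h10_rows (t : C) : uhp t ->
  climseq (fun j => csm (fun a => even_sum (2 ^ j) (RtoC (2 * INR a + 1) * t)) (2 ^ j))%C
    (RtoC ((PI / 2) ^ 4 * (8 / 3)) * h10 (nome t)).
Proof.
  intros Ht. destruct (lattice_lower t Ht) as (c & Hc & Hl).
  assert (HQ := proj2 (Cmod_nome_lt t Ht)).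
  assert (E : forall a, g4 (RtoC (PI / 2) * (RtoC (2 * INR a + 1) * t)) = (RtoC (8 / 3) * phi (nome t ^ (2 * a + 1)))%C).
  { intros a. destruct (g4_row (2 * a + 1) t ltac:(lia) Ht) as [E _]. rewrite <- E. rewrite plus_INR, mult_INR. reflexivity. }
  set (B := 6 / ((1 - Cmod (nome t)) * (1 - Cmod (nome t)) * ((1 - Cmod (nome t)) * (1 - Cmod (nome t))))).
  assert (L := rows_lim (fun a => RtoC (2 * INR a + 1) * t)%C c (8 / 3 * B) (Cmod (nome t) * Cmod (nome t)) Hc (disc_bounds _ HQ)).
  rewrite RtoC_mult, <- Cmult_assoc.
  replace (RtoC (8 / 3) * h10 (nome t))%C with (csum (fun a => g4 (RtoC (PI / 2) * (RtoC (2 * INR a + 1) * t)))%C).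
  - apply L.
    + intros a. left. apply snd_mult_pos; [pose proof (pos_INR a); lra|easy].
    + intros a k. destruct (Hl (2 * INR a + 1) (2 * INR k)) as [L1 L2].
      destruct (Hl (2 * INR a + 1) (- (2 * INR k + 2))) as [L3 L4].
      pose proof (pos_INR a). pose proof (pos_INR k).
      rewrite (Rabs_right (2 * INR a + 1)) in L1 by lra. rewrite (Rabs_right (2 * INR k)) in L2 by lra.
      rewrite Rabs_Ropp, (Rabs_right (2 * INR k + 2)) in L4 by lra. split.
      * destruct k as [|k]; [simpl INR in *; nra|]. rewrite S_INR in *. pose proof (pos_INR k). nra.
      * unfold Cminus. rewrite <- RtoC_opp. nra.
    + intros a. rewrite E, Cmod_RtoC_mult, Rabs_right, Rmult_assoc by lra. apply Rmult_le_compat_l; [lra|].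
      now apply h10_term.
  - rewrite (csum_ext _ _ E). apply (csum_scal _ B (Cmod (nome t) * Cmod (nome t))); [now apply disc_bounds|].
    intros k. now apply h10_term.
Qed.

(** One half of the lattice sum over even multiples of t plus odd integers: opposite rows agree, so
    the positive rows are taken once and the row 0 with weight 1/2, which produces the constant 1/16
    in [h01]. *)
Lemma h01_rows (t : C) : uhp t ->
  climseq (fun j => RtoC (1 / 2) * even_sum (2 ^ j) (RtoC 1) + csm (fun b => even_sum (2 ^ j) (RtoC (2 * INR b + 2) * t + RtoC 1)) (2 ^ j))%C
    (RtoC ((PI / 2) ^ 4 * (8 / 3)) * h01 (nome t)).
Proof.
  intros Ht. destruct (lattice_lower t Ht) as (c & Hc & Hl).
  assert (HQ := proj2 (Cmod_nome_lt t Ht)).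
  assert (E : forall a, g4 (RtoC (PI / 2) * (RtoC (2 * INR a + 2) * t + RtoC 1)) = (RtoC (8 / 3) * phi (- nome t ^ (2 * a + 2)))%C).
  { intros a. destruct (g4_row (2 * a + 2) t ltac:(lia) Ht) as [_ E]. rewrite <- E. rewrite plus_INR, mult_INR. reflexivity. }
  set (B := 6 / ((1 - Cmod (nome t)) * (1 - Cmod (nome t)) * ((1 - Cmod (nome t)) * (1 - Cmod (nome t))))).
  assert (L := rows_lim (fun a => RtoC (2 * INR a + 2) * t + RtoC 1)%C c (8 / 3 * B) (Cmod (nome t) * Cmod (nome t)) Hc (disc_bounds _ HQ)).
  assert (S : csum (fun a => g4 (RtoC (PI / 2) * (RtoC (2 * INR a + 2) * t + RtoC 1)))%C = (RtoC (8 / 3) * csum (fun k => phi (- nome t ^ (2 * k + 2))))%C).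
  { rewrite (csum_ext _ _ E). apply (csum_scal _ B (Cmod (nome t) * Cmod (nome t))); [now apply disc_bounds|].
    intros k. now apply h01_term. }
  cbv beta in L. rewrite S in L.
  assert (L1 : climseq (fun j => even_sum (2 ^ j) (RtoC 1)) (RtoC ((PI / 2) ^ 4) * RtoC (1 / 3))).
  { rewrite <- g4_PI2. apply (even_sum_lim (RtoC 1) 1).
    - right. now rewrite Cmult_1_r.
    - lra.
    - intros k. pose proof (pos_INR k). rewrite <- RtoC_plus, <- RtoC_minus, !Cmod_R.
      rewrite Rabs_right by lra. rewrite Rabs_left by lra. lra. }
  unfold h01.
  replace (RtoC ((PI / 2) ^ 4 * (8 / 3)) * (RtoC (1 / 16) + csum (fun k => phi (- nome t ^ (2 * k + 2))%C)))%C with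
    (RtoC (1 / 2) * (RtoC ((PI / 2) ^ 4) * RtoC (1 / 3)) + RtoC ((PI / 2) ^ 4) * (RtoC (8 / 3) * csum (fun k => phi (- nome t ^ (2 * k + 2))%C)))%C.
  2:{ set (P4 := (PI / 2) ^ 4). rewrite (RtoC_mult P4), !RtoC_div by lra. field. }
  apply climseq_plus; [now apply climseq_scal|]. apply L.
  - intros a. left. simpl. pose proof PI_RGT_0. unfold uhp in Ht. pose proof (pos_INR a).
    assert (0 < PI / 2 * ((2 * INR a + 2) * snd t)) by (apply Rmult_lt_0_compat; [lra|nra]). lra.
  - intros a k. destruct (Hl (2 * INR a + 2) (2 * INR k + 1)) as [L2 L3].
    destruct (Hl (2 * INR a + 2) (- (2 * INR k + 1))) as [L4 L5].
    pose proof (pos_INR a). pose proof (pos_INR k).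
    rewrite (Rabs_right (2 * INR k + 1)) in L3 by lra.
    rewrite Rabs_Ropp, (Rabs_right (2 * INR k + 1)) in L5 by lra. split.
    + rewrite <- Cplus_assoc, <- RtoC_plus. replace (1 + 2 * INR k) with (2 * INR k + 1) by ring. nra.
    + unfold Cminus. rewrite <- Cplus_assoc, <- RtoC_opp, <- RtoC_plus.
      replace (1 + - (2 * INR k + 2)) with (- (2 * INR k + 1)) by ring. nra.
  - intros a. rewrite E, Cmod_RtoC_mult, Rabs_right, Rmult_assoc by lra. apply Rmult_le_compat_l; [lra|].
    now apply h01_term.
Qed.

Lemma even_sum_split (z : C) (M : nat) :
  even_sum M z = (csm (fun k => iv4 (z + RtoC (2 * INR k))) M + csm (fun k => iv4 (z - RtoC (2 * INR k + 2))) M)%C.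
Proof. unfold even_sum. now rewrite csm_plus. Qed.

(* Interchanging the two summations in the lattice sum over (odd, even) pairs. *)
Lemma h01_S (t : C) : uhp t -> h01 (nome (sm t)) = (t * t * (t * t) * h10 (nome t))%C.
Proof.
  intros Ht. assert (Hs := sm_uhp t Ht). assert (Nt := uhp_neq_0 t Ht).
  destruct (lattice_lower t Ht) as (c & Hc & Hl).
  set (t4 := (t * t * (t * t))%C).
  assert (L1 := climseq_scal t4 _ _ (h10_rows t Ht)). assert (L2 := h01_rows _ Hs).
  (* The lopsided range of [even_sum] lacks one translate in each row when the order of summation
     changes. These M terms are of order M^(-4) each. *)
  assert (Z : climseq (fun j => t4 * csm (fun a => iv4 (RtoC (2 * INR a + 1) * t + RtoC (2 * INR (2 ^ j)))) (2 ^ j))%C (t4 * RtoC 0)).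
  { apply climseq_scal. apply (climseq_rate _ _ (/ (c * c * (c * c))) 0). intros j _.
    assert (PM : 1 <= INR (2 ^ j)).
    { apply (le_INR 1). pose proof (Nat.pow_gt_lin_r 2 j ltac:(lia)). lia. }
    unfold Cminus. rewrite Copp_0, Cplus_0_r. set (M := INR (2 ^ j)) in *.
    eapply Rle_trans.
    { apply (csm_bound _ (fun _ => / (c * M * (c * M) * (c * M * (c * M))))). intros a _.
      apply iv4_bound; [nra|]. destruct (Hl (2 * INR a + 1) (2 * M)) as [_ L]. rewrite Rabs_right in L by lra. nra. }
    rewrite rsm_const. fold M. replace (M * / (c * M * (c * M) * (c * M * (c * M)))) with (/ (c * c * (c * c)) * / (M * M * M)) by (field; lra).
    apply Rmult_le_compat_l.
    - left. apply Rinv_0_lt_compat. repeat apply Rmult_lt_0_compat; lra.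
    - apply Rinv_le_contravar; [lra|]. assert (1 <= M * M) by nra. nra. }
  assert (L3 := climseq_plus _ _ _ _ L1 Z).
  assert (U := fun H => climseq_unique _ _ _ L2 (climseq_ext _ _ _ H L3)).
  match type of U with ?A -> _ => assert (HA : A) end.
  2:{ specialize (U HA). set (P4 := RtoC ((PI / 2) ^ 4 * (8 / 3))) in *.
    assert (NP : P4 <> RtoC 0).
    { apply RtoC_neq_0. pose proof PI_RGT_0. assert (0 < (PI / 2) ^ 4) by (apply pow_lt; lra). lra. }
    transitivity (/ P4 * (P4 * h01 (nome (sm t))))%C; [field; easy|]. rewrite U. field. easy. }
  intros j. set (M := (2 ^ j)%nat). clear - Nt Ht Hl Hc.
  assert (NZ : forall a b : R, a <> 0 -> (RtoC a * t + RtoC b)%C <> RtoC 0).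
  { intros a b Ha. apply Cmod_gt_0. destruct (Hl a b) as [L _]. pose proof (Rabs_pos_lt a Ha). nra. }
  set (z := fun a : nat => (RtoC (2 * INR a + 1) * t)%C).
  assert (P : forall a : nat, 2 * INR a + 1 <> 0) by (intros a; pose proof (pos_INR a); lra).
  assert (E1 : (RtoC (1 / 2) * even_sum M (RtoC 1) = t4 * csm (fun a => iv4 (z a)) M)%C).
  { unfold even_sum. rewrite <- !csm_scal. apply csm_ext. intros a _. unfold z, iv4, t4.
    assert (N1 : RtoC (2 * INR a + 1) <> RtoC 0) by now apply RtoC_neq_0.
    rewrite RtoC_div by lra.
    replace (RtoC 1 + RtoC (2 * INR a))%C with (RtoC (2 * INR a + 1)) by (rewrite <- RtoC_plus; f_equal; ring).
    replace (RtoC 1 - RtoC (2 * INR a + 2))%C with (- RtoC (2 * INR a + 1))%C.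
    2:{ rewrite <- RtoC_opp, <- RtoC_minus. f_equal. ring. }
    field. auto. }
  assert (E2 : forall b, even_sum M (RtoC (2 * INR b + 2) * sm t + RtoC 1) =
    csm (fun a => t4 * (iv4 (z a - RtoC (2 * INR b + 2)) + iv4 (z a + RtoC (2 * INR b + 2))))%C M).
  { intros b. unfold even_sum. apply csm_ext. intros a _.
    assert (N1 := NZ _ (- (2 * INR b + 2)) (P a)). assert (N2 := NZ _ (2 * INR b + 2) (P a)).
    rewrite RtoC_opp in N1.
    replace (RtoC (2 * INR b + 2) * sm t + RtoC 1 + RtoC (2 * INR a))%C with ((z a - RtoC (2 * INR b + 2)) / t)%C.
    2:{ unfold z, sm. rewrite (RtoC_plus (2 * INR a)). field. easy. }
    replace (RtoC (2 * INR b + 2) * sm t + RtoC 1 - RtoC (2 * INR a + 2))%C with ((- (z a + RtoC (2 * INR b + 2))) / t)%C.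
    2:{ unfold z, sm. rewrite (RtoC_plus (2 * INR a)), (RtoC_plus (2 * INR a) 2). 
        replace (RtoC 2) with (RtoC 1 + RtoC 1)%C at 2 by (rewrite <- RtoC_plus; f_equal; ring). field. easy. }
    rewrite !iv4_scal; try easy.
    - unfold t4, iv4, z. field. repeat split; first [exact N1 | exact N2 | easy].
    - intros E. apply N2. transitivity (- - (z a + RtoC (2 * INR b + 2)))%C; [unfold z; ring|]. rewrite E. ring. }
  rewrite E1.
  rewrite (csm_ext (fun b => even_sum M (RtoC (2 * INR b + 2) * sm t + RtoC 1))%C (fun b => csm (fun a => t4 * (iv4 (z a - RtoC (2 * INR b + 2)) + iv4 (z a + RtoC (2 * INR b + 2))))%C M)) by (intros b _; apply E2).
  rewrite csm_swap. rewrite <- !csm_scal, <- !csm_plus. apply csm_ext. intros a _.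
  rewrite csm_scal, even_sum_split.
  assert (T : (csm (fun k => iv4 (z a + RtoC (2 * INR k))) M + iv4 (z a + RtoC (2 * INR M)) = iv4 (z a) + csm (fun k => iv4 (z a + RtoC (2 * INR k + 2))) M)%C).
  { change (csm (fun k => iv4 (z a + RtoC (2 * INR k))) M + iv4 (z a + RtoC (2 * INR M)))%C with (csm (fun k => iv4 (z a + RtoC (2 * INR k)))%C (S M)).
    rewrite csm_first. f_equal.
    - f_equal. simpl. rewrite Rmult_0_r. ring.
    - apply csm_ext. intros k _. f_equal. f_equal. f_equal. rewrite S_INR. ring. }
  fold (z a). transitivity (t4 * ((iv4 (z a) + csm (fun k => iv4 (z a + RtoC (2 * INR k + 2))) M) + csm (fun k => iv4 (z a - RtoC (2 * INR k + 2))) M))%C; [rewrite <- T; ring|].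
  rewrite csm_plus. ring.
Qed.

(** * Transformation laws under the modular group *)

(** The indices are the parities of a and b in the lattice points a t + b; replacing t by t + 1
    turns (odd, even) into (odd, odd). *)
Definition s10 (t : C) : C := h10 (nome t).
Definition s01 (t : C) : C := h01 (nome t).
Definition s11 (t : C) : C := s10 (t + RtoC 1).

Lemma nome_1 (t : C) : nome (t + RtoC 1) = (- nome t)%C.
Proof.
  unfold nome. replace (RtoC PI * (Ci * (t + RtoC 1)))%C with (RtoC PI * (Ci * t) + RtoC PI * Ci)%C by ring.
  rewrite cexp_plus, cexp_PI_Ci. ring.
Qed.

Lemma uhp_1 (t : C) : uhp t -> uhp (t + RtoC 1).
Proof. unfold uhp. simpl. lra. Qed.

Lemma uhp_m1 (t : C) : uhp t -> uhp (t - RtoC 1).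
Proof. unfold uhp. simpl. lra. Qed.

Lemma Cpow_opp_even (q : C) (k : nat) : ((- q) ^ (2 * k))%C = (q ^ (2 * k))%C.
Proof. rewrite !Cpow_mult_r. f_equal. cbn [Cpow]. ring. Qed.

Lemma Cpow_opp_odd (q : C) (k : nat) : ((- q) ^ (2 * k + 1))%C = (- q ^ (2 * k + 1))%C.
Proof. rewrite !Cpow_add_r, Cpow_opp_even, !Cpow_1_r. ring. Qed.

Lemma s01_1 (t : C) : s01 (t + RtoC 1) = s01 t.
Proof.
  unfold s01, h01. rewrite nome_1. f_equal. apply csum_ext. intros k. do 2 f_equal.
  replace (2 * k + 2)%nat with (2 * (k + 1))%nat by lia. apply Cpow_opp_even.
Qed.

Lemma s11_1 (t : C) : s11 (t + RtoC 1) = s10 t.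
Proof. unfold s11, s10. rewrite !nome_1. f_equal. ring. Qed.

Lemma s01_S (t : C) : uhp t -> s01 (sm t) = (t * t * (t * t) * s10 t)%C.
Proof. apply h01_S. Qed.

Lemma s10_S (t : C) : uhp t -> s10 (sm t) = (t * t * (t * t) * s01 t)%C.
Proof.
  intros H. pose proof (uhp_neq_0 t H). assert (E := s01_S (sm t) (sm_uhp t H)). rewrite sm_sm in E by easy.
  rewrite E. unfold sm. field. easy.
Qed.

Lemma s11_S (t : C) : uhp t -> s11 (sm t) = (t * t * (t * t) * s11 t)%C.
Proof.
  intros H. pose proof (uhp_neq_0 t H) as N.
  set (v := (t - RtoC 1)%C). assert (Hv : uhp v) by now apply uhp_m1. pose proof (uhp_neq_0 v Hv) as Nv.
  assert (Hx := uhp_1 _ (sm_uhp v Hv)). set (x := (sm v + RtoC 1)%C) in *.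
  assert (Nx := uhp_neq_0 x Hx).
  assert (Ex : x = ((v - RtoC 1) / v)%C) by (unfold x, sm; field; easy).
  assert (Hy := uhp_1 _ (sm_uhp t H)).
  (* 1 - 1/t = -1/x' with x' = -1 - 1/(t - 1) *)
  set (x' := (sm v - RtoC 1)%C). assert (Hx' : uhp x') by now apply uhp_m1, sm_uhp.
  assert (E1 : (sm t + RtoC 1)%C = sm x').
  { assert (Ex' : x' = (- t / v)%C).
    { unfold x', sm. replace t with (v + RtoC 1)%C by (unfold v; ring). field. easy. }
    rewrite Ex'. unfold sm. transitivity (v / t)%C; [unfold v; field; easy|field; auto]. }
  unfold s11 at 1. rewrite E1, s10_S by easy.
  assert (E2 : s01 x' = s01 (sm v)).
  { rewrite <- s01_1. f_equal. unfold x'. ring. }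
  rewrite E2, s01_S by easy.
  assert (E3 : s10 v = s11 t).
  { rewrite <- s11_1. f_equal. unfold v. ring. }
  rewrite E3. unfold x', sm, v in *. field. easy.
Qed.

(** The even part of the generating function of cubes: (2 n)^3 = 8 n^3, taken twice. *)
Lemma phi_even (w : C) : Cmod w < 1 -> (phi w + phi (- w) = RtoC 16 * phi (w * w))%C.
Proof.
  intros H. assert (N1 := one_minus_neq_0 w H).
  assert (N2 : (RtoC 1 - - w)%C <> RtoC 0) by (apply one_minus_neq_0; now rewrite Cmod_opp).
  assert (N3 : (RtoC 1 - w * w)%C <> RtoC 0).
  { replace (RtoC 1 - w * w)%C with ((RtoC 1 - w) * (RtoC 1 - - w))%C by ring. now apply Cmult_neq_0. }
  unfold phi. field. auto.
Qed.

Lemma Cmod_pow_lt (q : C) (n : nat) : Cmod q < 1 -> Cmod (q ^ S n)%C < 1.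
Proof.
  intros H. pose proof (Cmod_ge_0 q) as P. rewrite Cmod_pow. simpl. 
  assert (Cmod q ^ n <= 1) by (rewrite <- (pow1 n); apply pow_incr; lra). pose proof (pow_le _ n P). nra.
Qed.

Lemma h10_even (q : C) : Cmod q < 1 -> (h10 q + h10 (- q) = RtoC 16 * h10 (q * q))%C.
Proof.
  intros H. pose proof (Cmod_ge_0 q).
  assert (H2 : Cmod (q * q)%C < 1) by (rewrite Cmod_mult; nra).
  assert (Hm : Cmod (- q)%C < 1) by now rewrite Cmod_opp.
  assert (L := csum_lim _ _ _ (disc_bounds q H) (fun k => h10_term q k H)).
  assert (Lm := csum_lim _ _ _ (disc_bounds _ Hm) (fun k => h10_term _ k Hm)).
  assert (L2 := climseq_scal (RtoC 16) _ _ (csum_lim _ _ _ (disc_bounds _ H2) (fun k => h10_term _ k H2))).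
  apply (climseq_unique _ _ _ (climseq_plus _ _ _ _ L Lm)).
  refine (climseq_ext _ _ _ _ L2). intros n. rewrite <- csm_scal, <- csm_plus. apply csm_ext. intros k _.
  rewrite Cpow_opp_odd, Cpow_mult_l. symmetry. apply phi_even.
  replace (2 * k + 1)%nat with (S (2 * k)) by lia. now apply Cmod_pow_lt.
Qed.

(** This reduces the non-vanishing of the sum to that of [s10] at twice the height. *)
Lemma s10_s11 (t : C) : uhp t -> (s10 t + s11 t = RtoC 16 * s10 (RtoC 2 * t))%C.
Proof.
  intros H. unfold s11, s10. rewrite nome_1, h10_even by now apply Cmod_nome_lt.
  do 2 f_equal. unfold nome. rewrite <- cexp_plus. f_equal. ring.
Qed.

(** * Non-vanishing of the Eisenstein series and of their sums *)

Lemma Cmod_affine (a : R) (w b : C) (r B : R) : Cmod w <= r -> Cmod b <= B -> Cmod (RtoC a + w * b) <= Rabs a + r * B.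
Proof.
  intros Hw Hb. eapply Rle_trans; [apply Cmod_triangle|]. rewrite Cmod_R, Cmod_mult.
  apply Rplus_le_compat_l. apply Rmult_le_compat; try apply Cmod_ge_0; easy.
Qed.

Lemma one_minus_pow4 (w : C) : Cmod w <= 1 / 12 -> 0.7 <= Cmod ((RtoC 1 - w) * (RtoC 1 - w) * ((RtoC 1 - w) * (RtoC 1 - w)))%C.
Proof.
  intros H. pose proof (Cmod_one_minus w) as L. rewrite !Cmod_mult. set (d := Cmod (RtoC 1 - w)) in *.
  assert (0.84 <= d * d) by nra. nra.
Qed.

(** The remainder after w + 8 w^2 is an exact rational function with denominator (1 - w)^4. The
    radius 1/12 is the bound for the nome at heights above 5/6. *)
Lemma phi_taylor2 (w : C) : Cmod w <= 1 / 12 -> Cmod (phi w - (w + RtoC 8 * (w * w))) <= 45 * (Cmod w * Cmod w * Cmod w).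
Proof.
  intros H. assert (N := one_minus_neq_0 w ltac:(lra)). assert (D := one_minus_pow4 w H). pose proof (Cmod_ge_0 w).
  set (d := ((RtoC 1 - w) * (RtoC 1 - w) * ((RtoC 1 - w) * (RtoC 1 - w)))%C) in *.
  replace (phi w - (w + RtoC 8 * (w * w)))%C with (w * w * w * (RtoC 27 + w * (RtoC (-44) + w * (RtoC 31 + w * RtoC (-8)))) / d)%C.
  2:{ unfold phi, d. replace (RtoC (-8)) with (- RtoC 8)%C by (rewrite <- RtoC_opp; f_equal; ring).
    replace (RtoC (-44)) with (- RtoC 44)%C by (rewrite <- RtoC_opp; f_equal; ring). field. easy. }
  rewrite Cmod_div by (intros E; rewrite E, Cmod_0 in D; lra). rewrite !Cmod_mult.
  assert (B : Cmod (RtoC 27 + w * (RtoC (-44) + w * (RtoC 31 + w * RtoC (-8)))) <= 31).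
  { assert (B1 := Cmod_affine 31 w (RtoC (-8)) (1/12) 8 H ltac:(rewrite Cmod_R, Rabs_left; lra)).
    assert (B2 := Cmod_affine (-44) w _ (1/12) _ H B1). assert (B3 := Cmod_affine 27 w _ (1/12) _ H B2).
    eapply Rle_trans; [exact B3|]. rewrite (Rabs_left (-44)) by lra. rewrite !Rabs_right by lra. lra. }
  assert (0 <= Cmod w * Cmod w * Cmod w) by (repeat apply Rmult_le_pos; lra).
  apply Rle_div_l; [lra|]. nra.
Qed.

Lemma phi_taylor3 (w : C) : Cmod w <= 1 / 12 -> Cmod (phi w - (w + RtoC 8 * (w * w) + RtoC 27 * (w * w * w))) <= 109 * (Cmod w * Cmod w * (Cmod w * Cmod w)).
Proof.
  intros H. assert (N := one_minus_neq_0 w ltac:(lra)). assert (D := one_minus_pow4 w H). pose proof (Cmod_ge_0 w).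
  set (d := ((RtoC 1 - w) * (RtoC 1 - w) * ((RtoC 1 - w) * (RtoC 1 - w)))%C) in *.
  replace (phi w - (w + RtoC 8 * (w * w) + RtoC 27 * (w * w * w)))%C with (w * w * (w * w) * (RtoC 64 + w * (RtoC (-131) + w * (RtoC 100 + w * RtoC (-27)))) / d)%C.
  2:{ unfold phi, d. replace (RtoC (-27)) with (- RtoC 27)%C by (rewrite <- RtoC_opp; f_equal; ring).
    replace (RtoC (-131)) with (- RtoC 131)%C by (rewrite <- RtoC_opp; f_equal; ring). field. easy. }
  rewrite Cmod_div by (intros E; rewrite E, Cmod_0 in D; lra). rewrite !Cmod_mult.
  assert (B : Cmod (RtoC 64 + w * (RtoC (-131) + w * (RtoC 100 + w * RtoC (-27)))) <= 76).
  { assert (B1 := Cmod_affine 100 w (RtoC (-27)) (1/12) 27 H ltac:(rewrite Cmod_R, Rabs_left; lra)).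
    assert (B2 := Cmod_affine (-131) w _ (1/12) _ H B1). assert (B3 := Cmod_affine 64 w _ (1/12) _ H B2).
    eapply Rle_trans; [exact B3|]. rewrite (Rabs_left (-131)) by lra. rewrite !Rabs_right by lra. lra. }
  assert (0 <= Cmod w * Cmod w * (Cmod w * Cmod w)) by (repeat apply Rmult_le_pos; lra).
  apply Rle_div_l; [lra|]. nra.
Qed.

Lemma phi_small (w : C) : Cmod w <= 1 / 100 -> Cmod (phi w) <= 2 * Cmod w.
Proof.
  intros H. pose proof (phi_taylor2 w ltac:(lra)) as T. pose proof (Cmod_ge_0 w).
  pose proof (Cmod_triangle (phi w - (w + RtoC 8 * (w * w))) (w + RtoC 8 * (w * w))) as T1.
  replace (phi w - (w + RtoC 8 * (w * w)) + (w + RtoC 8 * (w * w)))%C with (phi w) in T1 by ring.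
  pose proof (Cmod_triangle w (RtoC 8 * (w * w))) as T2. rewrite Cmod_RtoC_mult, Cmod_mult, Rabs_right in T2 by lra.
  nra.
Qed.

Lemma phi_tail (q : C) (s : C) (m : nat) : Cmod q <= 1 / 12 -> Cmod s = 1 ->
  Cmod (csum (fun k => phi (s * q ^ (2 * k + S (S m)))%C)) <= 2.1 * (Cmod q * Cmod q * Cmod q ^ m).
Proof.
  intros H Hs. pose proof (Cmod_ge_0 q) as P. set (r := Cmod q) in *.
  assert (B : forall k, Cmod (phi (s * q ^ (2 * k + S (S m)))%C) <= 2 * (r * r * r ^ m) * (r * r) ^ k).
  { intros k. assert (E : Cmod (s * q ^ (2 * k + S (S m)))%C = r * r * r ^ m * (r * r) ^ k).
    { rewrite Cmod_mult, Hs, Cmod_pow. fold r. rewrite pow_add, pow_mult. simpl. ring_simplify (r * (r * 1)). replace (r ^ 2) with (r * r) by ring. ring. }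
    rewrite Rmult_assoc, <- E. apply phi_small. rewrite E.
    assert (0 <= r ^ m <= 1) by (split; [apply pow_le; lra|rewrite <- (pow1 m); apply pow_incr; lra]).
    assert (0 <= (r * r) ^ k <= 1) by (split; [apply pow_le; nra|rewrite <- (pow1 k); apply pow_incr; nra]).
    assert (0 <= r * r <= 1 / 144) by nra.
    assert (0 <= r ^ m * (r * r) ^ k <= 1) by nra. nra. }
  eapply Rle_trans; [apply (csum_bound _ _ (r * r) ltac:(nra) B)|].
  apply Rle_div_l; [nra|].
  assert (A0 : 0 <= r * r * r ^ m) by (apply Rmult_le_pos; [nra|apply pow_le; lra]).
  set (A := r * r * r ^ m) in *. assert (R2 : r * r <= 1 / 144) by nra. set (x := r * r) in *.
  clear - A0 R2. nra.
Qed.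

Lemma csum_first (u : nat -> C) (A r : R) : 0 <= r < 1 -> (forall k, Cmod (u k) <= A * r ^ k) -> csum u = (u 0%nat + csum (fun k => u (S k)))%C.
Proof.
  intros Hr H. assert (H2 : forall k, Cmod (u (S k)) <= (A * r) * r ^ k).
  { intros k. eapply Rle_trans; [apply H|]. simpl. right. ring. }
  apply (csum_unique u A r _ Hr H).
  assert (L := climseq_plus _ _ _ _ (climseq_const (u 0%nat)) (csum_lim _ _ _ Hr H2)).
  intros e He. destruct (L e He) as (N & HN). exists (S N). intros n Hn. destruct n as [|n]; [lia|].
  rewrite csm_first. apply HN. lia.
Qed.

Lemma h10_split (q : C) : Cmod q < 1 -> h10 q = (phi q + csum (fun k => phi (RtoC 1 * q ^ (2 * k + 3))))%C.
Proof.
  intros H. unfold h10. rewrite (csum_first _ _ _ (disc_bounds q H) (fun k => h10_term q k H)). f_equal.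
  - f_equal. simpl. ring.
  - apply csum_ext. intros k. f_equal. rewrite Cmult_1_l. f_equal. lia.
Qed.

Lemma h01_split (q : C) : Cmod q < 1 -> h01 q = (RtoC (1 / 16) + (phi (- (q * q)) + csum (fun k => phi (- RtoC 1 * q ^ (2 * k + 4)))))%C.
Proof.
  intros H. unfold h01. rewrite (csum_first _ _ _ (disc_bounds q H) (fun k => h01_term q k H)). do 2 f_equal.
  - f_equal. simpl. ring.
  - apply csum_ext. intros k. f_equal. replace (2 * S k + 2)%nat with (2 * k + 4)%nat by lia. ring.
Qed.

Lemma Cmod_m1 : Cmod (- RtoC 1)%C = 1.
Proof. rewrite Cmod_opp, Cmod_R. apply Rabs_R1. Qed.

Lemma h10_approx (q : C) : Cmod q <= 1 / 12 -> Cmod (h10 q - q) <= 11.95 * (Cmod q * Cmod q).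
Proof.
  intros H. pose proof (Cmod_ge_0 q). rewrite h10_split by lra.
  pose proof (phi_tail q (RtoC 1) 1 H ltac:(rewrite Cmod_R; apply Rabs_R1)) as T. pose proof (phi_taylor2 q H) as T2.
  set (S := csum (fun k => phi (RtoC 1 * q ^ (2 * k + 3)))%C) in *.
  replace (phi q + S - q)%C with ((phi q - (q + RtoC 8 * (q * q))) + (RtoC 8 * (q * q) + S))%C by ring.
  pose proof (Cmod_triangle (phi q - (q + RtoC 8 * (q * q))) (RtoC 8 * (q * q) + S)).
  pose proof (Cmod_triangle (RtoC 8 * (q * q)) S) as T4. rewrite Cmod_RtoC_mult, Cmod_mult, Rabs_right in T4 by lra.
  rewrite pow_1 in T. fold S in T. 
  assert (Cmod q * Cmod q * Cmod q <= 1 / 12 * (Cmod q * Cmod q)) by nra. 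
  assert (0 <= Cmod q * Cmod q) by nra. lra.
Qed.

Lemma h10_neq_0 (q : C) : 0 < Cmod q <= 1 / 12 -> h10 q <> RtoC 0.
Proof.
  intros H E. pose proof (h10_approx q ltac:(lra)) as T. rewrite E in T.
  replace (RtoC 0 - q)%C with (- q)%C in T by ring. rewrite Cmod_opp in T. nra.
Qed.

Lemma h01_approx (q : C) : Cmod q <= 1 / 12 -> Cmod (h01 q - RtoC (1 / 16)) <= 5 * (Cmod q * Cmod q).
Proof.
  intros H. pose proof (Cmod_ge_0 q). rewrite h01_split by lra.
  pose proof (phi_tail q _ 2 H Cmod_m1) as T.
  assert (M2 : Cmod (- (q * q)) = Cmod q * Cmod q) by now rewrite Cmod_opp, Cmod_mult.
  pose proof (phi_small (- (q * q))%C ltac:(rewrite M2; nra)) as T2. rewrite M2 in T2.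
  set (S := csum (fun k => phi (- RtoC 1 * q ^ (2 * k + 4)))%C) in *.
  replace (RtoC (1 / 16) + (phi (- (q * q)) + S) - RtoC (1 / 16))%C with (phi (- (q * q)) + S)%C by ring.
  pose proof (Cmod_triangle (phi (- (q * q))) S).
  assert (P : 0 <= Cmod q ^ 2 <= 1) by (simpl; nra).
  assert (0 <= Cmod q * Cmod q) by nra.
  assert (2.1 * (Cmod q * Cmod q * Cmod q ^ 2) <= 2.1 * (Cmod q * Cmod q)) by nra. 
  fold S in T. lra.
Qed.

Lemma h01_neq_0 (q : C) : Cmod q <= 1 / 12 -> h01 q <> RtoC 0.
Proof.
  intros H E. pose proof (h01_approx q H) as T. rewrite E in T. pose proof (Cmod_ge_0 q).
  replace (RtoC 0 - RtoC (1 / 16))%C with (- RtoC (1 / 16))%C in T by ring.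
  rewrite Cmod_opp, Cmod_R, Rabs_right in T by lra. nra.
Qed.

(* 16 (h01 + h10) is the eighth power of the theta constant 1 + 2q + 2q^4 + ..., hence close to (1 + 2q)^8. *)
Lemma h01_h10_neq_0 (q : C) : Cmod q <= 1 / 12 -> (h01 q + h10 q)%C <> RtoC 0.
Proof.
  intros H E. pose proof (Cmod_ge_0 q) as P. rewrite h01_split, h10_split in E by lra.
  pose proof (phi_tail q _ 2 H Cmod_m1) as T1.
  pose proof (phi_tail q (RtoC 1) 1 H ltac:(rewrite Cmod_R; apply Rabs_R1)) as T2.
  assert (M2 : Cmod (- (q * q)) = Cmod q * Cmod q) by now rewrite Cmod_opp, Cmod_mult.
  assert (R2 : 0 <= Cmod q * Cmod q <= 1 / 144) by nra.
  assert (R3 : 0 <= Cmod q * Cmod q * Cmod q <= 1 / 1728) by nra.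
  assert (R4 : 0 <= Cmod q * Cmod q * (Cmod q * Cmod q) <= 1 / 20736) by nra.
  pose proof (phi_taylor2 (- (q * q))%C ltac:(rewrite M2; lra)) as T3. rewrite M2 in T3.
  pose proof (phi_taylor3 q H) as T4.
  set (S1 := csum (fun k => phi (- RtoC 1 * q ^ (2 * k + 4)))%C) in *.
  set (S2 := csum (fun k => phi (RtoC 1 * q ^ (2 * k + 3)))%C) in *. fold S1 in T1. fold S2 in T2.
  set (E3 := (phi (- (q * q)) - (- (q * q) + RtoC 8 * (- (q * q) * - (q * q))))%C) in *.
  set (E4 := (phi q - (q + RtoC 8 * (q * q) + RtoC 27 * (q * q * q)))%C) in *.
  set (X := (RtoC 1 + RtoC 2 * q)%C).
  assert (HX : 5 / 6 <= Cmod X).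
  { pose proof (Cmod_one_minus (- (RtoC 2 * q))%C) as L. rewrite Cmod_opp, Cmod_RtoC_mult, Rabs_right in L by lra.
    replace (RtoC 1 - - (RtoC 2 * q))%C with X in L by (unfold X; ring). lra. }
  set (q4 := (q * q * (q * q))%C).
  set (D := (RtoC 992 + q * (RtoC 1792 + q * (RtoC 1792 + q * (RtoC 1024 + q * RtoC 256))))%C).
  (* If the sum vanished, (1 + 2 q)^8 would equal its difference from 16 (h01 + h10). That
     difference starts with 16 q^3 and has modulus at most 0.2, while |1 + 2 q| >= 5/6 and (5/6)^8 >
     0.2. *)
  assert (Q : (X ^ 8 = q * q * q * RtoC 16 + (q4 * D - RtoC 16 * (E3 + E4 + S1 + S2)))%C).
  { assert (Z : (RtoC 16 * (RtoC (1 / 16) + (phi (- (q * q)) + S1) + (phi q + S2)) = RtoC 0)%C) by (rewrite E; ring).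
    transitivity (X ^ 8 - RtoC 16 * (RtoC (1 / 16) + (phi (- (q * q)) + S1) + (phi q + S2)))%C; [rewrite Z; ring|].
    rewrite RtoC_div by lra. unfold X, q4, D, E3, E4. cbn [Cpow]. field. }
  assert (MX : Cmod (X ^ 8)%C <= 0.2).
  { rewrite Q.
    assert (BD : Cmod D <= 1200).
    { assert (B0 := Cmod_affine 1024 q (RtoC 256) (1/12) 256 H ltac:(rewrite Cmod_R, Rabs_right; lra)).
      assert (B1 := Cmod_affine 1792 q _ (1/12) _ H B0). assert (B2 := Cmod_affine 1792 q _ (1/12) _ H B1). assert (B3 := Cmod_affine 992 q _ (1/12) _ H B2).
      eapply Rle_trans; [exact B3|]. rewrite !Rabs_right by lra. lra. }
    eapply Rle_trans; [apply Cmod_triangle|]. 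
    pose proof (Cmod_minus_le (q4 * D) (RtoC 16 * (E3 + E4 + S1 + S2))) as U1. rewrite (Cmod_RtoC_mult 16), Rabs_right in U1 by lra.
    pose proof (Cmod_triangle (E3 + E4 + S1) S2). pose proof (Cmod_triangle (E3 + E4) S1). pose proof (Cmod_triangle E3 E4).
    assert (U2 : Cmod (q * q * q * RtoC 16) = Cmod q * Cmod q * Cmod q * 16) by (rewrite !Cmod_mult, Cmod_R, Rabs_right by lra; ring).
    assert (U3 : Cmod (q4 * D) <= 1 / 20736 * 1200).
    { rewrite Cmod_mult. apply Rmult_le_compat; try apply Cmod_ge_0; [|easy]. unfold q4. rewrite !Cmod_mult. lra. }
    simpl pow in T1, T2. rewrite !Rmult_1_r in T1, T2.
    assert (Cmod q * Cmod q * (Cmod q * Cmod q) * (Cmod q * Cmod q) <= 1 / 20736 * (1 / 144)) by nra.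
    rewrite U2. lra. }
  rewrite Cmod_pow in MX.
  assert ((5 / 6) ^ 8 <= Cmod X ^ 8) by (apply pow_incr; lra). 
  assert (0.2 < (5 / 6) ^ 8) by (simpl; lra). lra.
Qed.

(** The translation t + 1 and the inversion permute the three series, up to the factor t^4. The six
    conditions together are stable under both, while the condition on s01 + s10 alone is not. *)
Definition nv (t : C) : Prop :=
  (s01 t <> RtoC 0 /\ s10 t <> RtoC 0 /\ s11 t <> RtoC 0) /\
  ((s01 t + s10 t)%C <> RtoC 0 /\ (s01 t + s11 t)%C <> RtoC 0 /\ (s10 t + s11 t)%C <> RtoC 0).

(** Eight squarings, starting from 1 + x <= exp x at x = 5/512. *)
Lemma exp_5_2 : 12 <= exp (5 / 2).
Proof.
  assert (E : exp (5 / 2) = exp (5 / 512) ^ 256).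
  { assert (X : forall n x, exp x ^ n = exp (INR n * x)).
    { intros n x. induction n as [|n IH]; [simpl; now rewrite Rmult_0_l, exp_0|].
      rewrite S_INR. simpl. rewrite IH, <- exp_plus. f_equal. ring. }
    rewrite X. f_equal. rewrite INR_IZR_INZ. simpl. field. }
  rewrite E. pose proof (exp_ineq1_le (5 / 512)) as L. set (x := exp (5 / 512)) in *.
  assert (A1 : 1.01962 <= x ^ 2) by nra. assert (A2 : 1.03962 <= (x ^ 2) ^ 2) by nra.
  rewrite <- (pow_mult x 2 2) in A2. assert (A3 : 1.0808 <= (x ^ (2 * 2)) ^ 2) by nra. rewrite <- pow_mult in A3.
  assert (A4 : 1.16812 <= (x ^ (2 * 2 * 2)) ^ 2) by nra. rewrite <- pow_mult in A4.
  assert (A5 : 1.3645 <= (x ^ (2 * 2 * 2 * 2)) ^ 2) by nra. rewrite <- pow_mult in A5.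
  assert (A6 : 1.8618 <= (x ^ (2 * 2 * 2 * 2 * 2)) ^ 2) by nra. rewrite <- pow_mult in A6.
  assert (A7 : 3.4662 <= (x ^ (2 * 2 * 2 * 2 * 2 * 2)) ^ 2) by nra. rewrite <- pow_mult in A7.
  assert (A8 : 12 <= (x ^ (2 * 2 * 2 * 2 * 2 * 2 * 2)) ^ 2) by nra. rewrite <- pow_mult in A8. exact A8.
Qed.

Lemma nome_small (t : C) : 5 / 6 <= snd t -> 0 < Cmod (nome t) <= 1 / 12.
Proof.
  intros H. rewrite Cmod_nome. split; [apply exp_pos|]. rewrite exp_Ropp. unfold Rdiv. rewrite Rmult_1_l.
  apply Rinv_le_contravar; [lra|]. eapply Rle_trans; [apply exp_5_2|].
  pose proof PI2_3_2. destruct (Req_dec (5 / 2) (PI * snd t)) as [->|]; [lra|]. left. apply exp_increasing. nra.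
Qed.

Lemma nv_high (t : C) : 5 / 6 <= snd t -> nv t.
Proof.
  intros H. assert (N := nome_small t H). assert (Ht : uhp t) by (unfold uhp; lra).
  assert (Nm : Cmod (- nome t)%C = Cmod (nome t)) by apply Cmod_opp.
  split; [split; [|split]|split; [|split]].
  - apply h01_neq_0. lra.
  - apply h10_neq_0. lra.
  - unfold s11, s10. rewrite nome_1. apply h10_neq_0. lra.
  - apply h01_h10_neq_0. lra.
  - rewrite <- s01_1. unfold s11, s01, s10. rewrite nome_1. apply h01_h10_neq_0. lra.
  - rewrite s10_s11 by easy. apply Cmult_neq_0; [apply RtoC_neq_0; lra|]. apply h10_neq_0.
    apply nome_small. simpl. lra.
Qed.

Lemma nv_1 (t : C) : nv t <-> nv (t + RtoC 1).
Proof.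
  unfold nv. rewrite s01_1, s11_1. fold (s11 t). rewrite (Cplus_comm (s11 t) (s10 t)). tauto.
Qed.

Lemma nv_shift (n : Z) (t : C) : nv (t + RtoC (IZR n)) <-> nv t.
Proof.
  assert (P : forall k (s : C), nv (s + RtoC (INR k)) <-> nv s).
  { induction k as [|k IH]; intros s; [simpl; now rewrite Cplus_0_r|].
    rewrite S_INR, RtoC_plus, Cplus_assoc. rewrite <- nv_1. apply IH. }
  destruct (Z_le_gt_dec 0 n) as [H|H].
  - rewrite <- (Z2Nat.id n H), <- INR_IZR_INZ. apply P.
  - rewrite <- (P (Z.to_nat (- n)) (t + RtoC (IZR n))%C). rewrite INR_IZR_INZ, Z2Nat.id by lia.
    rewrite opp_IZR, RtoC_opp. now replace (t + RtoC (IZR n) + - RtoC (IZR n))%C with t by ring.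
Qed.

Lemma nv_S (t : C) : uhp t -> nv (sm t) -> nv t.
Proof.
  intros H. unfold nv. rewrite s01_S, s10_S, s11_S by easy. set (c := (t * t * (t * t))%C).
  rewrite <- !Cmult_plus_distr_l. rewrite (Cplus_comm (s10 t) (s01 t)).
  assert (K : forall x, (c * x)%C <> RtoC 0 -> x <> RtoC 0) by (intros x Hx E; apply Hx; rewrite E; ring).
  intros ((A1 & A2 & A3) & (A4 & A5 & A6)). repeat split; now apply K.
Qed.

(** Reduction to heights above 5/6: after a translation |Re t| <= 1/2, and if Im t < 5/6 then |t|^2
    <= 1/4 + 25/36 < 20/21, so -1/t is higher by a factor of at least 1.05. Finitely many such steps
    suffice. *)
Lemma nonvanishing (t : C) : uhp t -> nv t.
Proof.
  intros H. assert (P : forall n s, uhp s -> 5 / 6 <= 1.05 ^ n * snd s -> nv s).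
  { induction n as [|n IH]; intros s Hs Hb; [apply nv_high; simpl in Hb; lra|].
    destruct (archimed (fst s - 1 / 2)) as [K1 K2]. set (k := up (fst s - 1 / 2)) in *.
    apply (proj1 (nv_shift (- k) s)). rewrite opp_IZR. set (v := (s + RtoC (- IZR k))%C).
    assert (Fv : fst v = fst s - IZR k) by (unfold v; cbn [fst snd Cplus RtoC]; ring).
    assert (Sv : snd v = snd s) by (unfold v; cbn [fst snd Cplus RtoC]; ring).
    clearbody v k.
    assert (Hv : uhp v) by (unfold uhp in *; lra).
    destruct (Rle_dec (5 / 6) (snd v)) as [L|L]; [now apply nv_high|].
    apply nv_S; [easy|]. apply IH; [now apply sm_uhp|].
    assert (E : snd (sm v) = snd v / (fst v * fst v + snd v * snd v)).
    { unfold sm. cbn [fst snd Copp Cinv]. field. unfold uhp in Hv. nra. }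
    rewrite E. unfold uhp in Hv. assert (D : 0 < fst v * fst v + snd v * snd v <= 20 / 21) by nra.
    simpl pow in Hb. rewrite <- Sv in Hb.
    assert (1.05 * snd v <= snd v / (fst v * fst v + snd v * snd v)).
    { set (D' := fst v * fst v + snd v * snd v) in *. apply (proj1 (Rle_div_r (1.05 * snd v) (snd v) D' ltac:(lra))).
      assert (0 <= snd v * (1 - 1.05 * D')) by (apply Rmult_le_pos; lra). lra. }
    set (D' := snd v / (fst v * fst v + snd v * snd v)) in *. clearbody D'.
    assert (0 < 1.05 ^ n) by (apply pow_lt; lra). nra. }
  unfold uhp in H. destruct (Pow_x_infinity 1.05 ltac:(rewrite Rabs_right; lra) (5 / 6 / snd t)) as (N & HN).
  specialize (HN N ltac:(lia)). apply (P N t H). rewrite Rabs_right in HN by (apply Rle_ge, pow_le; lra).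
  apply Rge_le in HN. apply Rle_div_l in HN; lra.
Qed.

(** * The modular function *)

(** First-order expansion with a quadratic remainder and one constant for a whole disc. The property
    is inherited by products, which gives it for [phi] and makes the series termwise
    differentiable. *)
Definition quad_on (p : R) (f : C -> C) : Prop := exists (d : C -> C) (K : R), 0 <= K /\ forall X Y : C, Cmod X <= p -> Cmod Y <= p ->
  Cmod (f X) <= K /\ Cmod (d X) <= K /\ Cmod (f Y - f X - d X * (Y - X)) <= K * (Cmod (Y - X) * Cmod (Y - X)).

Lemma quad_on_affine (p : R) (a b : C) : quad_on p (fun w => a + b * w)%C.
Proof.
  exists (fun _ => b), (Cmod a + Cmod b * (Rabs p + 1)). pose proof (Cmod_ge_0 a). pose proof (Cmod_ge_0 b). pose proof (Rabs_pos p).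
  split; [nra|]. intros X Y HX HY. split; [|split].
  - eapply Rle_trans; [apply Cmod_triangle|]. rewrite Cmod_mult. pose proof (Rle_abs p). nra.
  - nra.
  - replace (a + b * Y - (a + b * X) - b * (Y - X))%C with (RtoC 0) by ring. rewrite Cmod_0.
    apply Rmult_le_pos; [nra|]. apply Rmult_le_pos; apply Cmod_ge_0.
Qed.

Lemma quad_on_mult (p : R) (f g : C -> C) : p <= 1 -> quad_on p f -> quad_on p g -> quad_on p (fun w => f w * g w)%C.
Proof.
  intros Hp (d & K & HK & Hf) (e & L & HL & Hg).
  exists (fun w => f w * e w + d w * g w)%C, (5 * (K * L)). assert (KL : 0 <= K * L) by nra.
  split; [lra|]. intros X Y HX HY. destruct (Hf X Y HX HY) as (F1 & F2 & F3). destruct (Hg X Y HX HY) as (G1 & G2 & G3).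
  destruct (Hg Y X HY HX) as (G4 & _ & _).
  assert (B : forall a b, Cmod a <= K -> Cmod b <= L -> Cmod (a * b) <= K * L).
  { intros a b Ha Hb. rewrite Cmod_mult. apply Rmult_le_compat; try apply Cmod_ge_0; easy. }
  split; [|split].
  - pose proof (B _ _ F1 G1). lra.
  - eapply Rle_trans; [apply Cmod_triangle|]. pose proof (B _ _ F1 G2). pose proof (B _ _ F2 G1). lra.
  - set (h := (Y - X)%C) in *. assert (Hh : Cmod h <= 2) by (eapply Rle_trans; [apply Cmod_minus_le|lra]).
    pose proof (Cmod_ge_0 h).
    assert (GG : Cmod (g Y - g X) <= 3 * L * Cmod h).
    { replace (g Y - g X)%C with ((g Y - g X - e X * h) + e X * h)%C by ring.
      eapply Rle_trans; [apply Cmod_triangle|]. rewrite Cmod_mult.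
      assert (L * (Cmod h * Cmod h) <= L * (2 * Cmod h)) by (apply Rmult_le_compat_l; nra).
      assert (Cmod (e X) * Cmod h <= L * Cmod h) by now apply Rmult_le_compat_r. lra. }
    replace (f Y * g Y - f X * g X - (f X * e X + d X * g X) * h)%C with
      ((f Y - f X - d X * h) * g Y + (f X * (g Y - g X - e X * h) + d X * h * (g Y - g X)))%C by ring.
    eapply Rle_trans; [apply Cmod_triangle|].
    pose proof (Cmod_triangle (f X * (g Y - g X - e X * h)) (d X * h * (g Y - g X))) as T. rewrite !Cmod_mult in *.
    assert (A1 : Cmod (f Y - f X - d X * h) * Cmod (g Y) <= K * (Cmod h * Cmod h) * L) by (apply Rmult_le_compat; try apply Cmod_ge_0; easy).
    assert (A2 : Cmod (f X) * Cmod (g Y - g X - e X * h) <= K * (L * (Cmod h * Cmod h))) by (apply Rmult_le_compat; try apply Cmod_ge_0; easy).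
    assert (A3 : Cmod (d X) * Cmod h * Cmod (g Y - g X) <= K * Cmod h * (3 * L * Cmod h)).
    { apply Rmult_le_compat; try apply Cmod_ge_0; [apply Rmult_le_pos; apply Cmod_ge_0| |easy]. now apply Rmult_le_compat_r. }
    nra.
Qed.

Lemma quad_on_inv (p : R) : 0 <= p < 1 -> quad_on p (fun w => / (RtoC 1 - w))%C.
Proof.
  intros Hp. set (G := / (1 - p)). assert (HG : 1 <= G).
  { unfold G. rewrite <- Rinv_1. apply Rinv_le_contravar; lra. }
  exists (fun w => / (RtoC 1 - w) * / (RtoC 1 - w))%C, (G * G * G). split; [apply Rmult_le_pos; nra|]. intros X Y HX HY.
  assert (B : forall w, Cmod w <= p -> (RtoC 1 - w)%C <> RtoC 0 /\ Cmod (/ (RtoC 1 - w)) <= G).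
  { intros w Hw. assert (N := one_minus_neq_0 w ltac:(lra)). split; [easy|]. rewrite Cmod_inv by easy. pose proof (Cmod_one_minus w).
    apply Rinv_le_contravar; lra. }
  destruct (B X HX) as [NX BX]. destruct (B Y HY) as [NY BY].
  pose proof (Cmod_ge_0 (/ (RtoC 1 - X))). pose proof (Cmod_ge_0 (/ (RtoC 1 - Y))).
  set (x := Cmod (/ (RtoC 1 - X))) in *. set (y := Cmod (/ (RtoC 1 - Y))) in *.
  assert (G2 : G <= G * G) by nra. assert (G3 : G * G <= G * G * G) by nra. assert (x2 : x * x <= G * G) by nra.
  split; [lra|]. split; [rewrite Cmod_mult; fold x; lra|].
  replace (/ (RtoC 1 - Y) - / (RtoC 1 - X) - / (RtoC 1 - X) * / (RtoC 1 - X) * (Y - X))%C with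
    (/ (RtoC 1 - X) * / (RtoC 1 - X) * / (RtoC 1 - Y) * ((Y - X) * (Y - X)))%C by (field; auto).
  rewrite !Cmod_mult. fold x y. apply Rmult_le_compat_r; [apply Rmult_le_pos; apply Cmod_ge_0|].
  apply Rmult_le_compat; try lra. apply Rmult_le_pos; lra.
Qed.

Lemma quad_on_ext (p : R) (f g : C -> C) : (forall w, Cmod w <= p -> f w = g w) -> quad_on p f -> quad_on p g.
Proof.
  intros E (d & K & HK & H). exists d, K. split; [easy|]. intros X Y HX HY. rewrite <- !E by easy. auto.
Qed.

Lemma quad_on_phi (p : R) : 0 <= p < 1 -> quad_on p phi.
Proof.
  intros Hp. assert (I := quad_on_inv p Hp). assert (Hp1 : p <= 1) by lra.
  assert (W := quad_on_affine p (RtoC 0) (RtoC 1)).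
  assert (P1 := quad_on_mult p _ _ Hp1 I I). assert (P2 := quad_on_mult p _ _ Hp1 P1 P1).
  assert (V : quad_on p (fun w => RtoC 1 + RtoC 4 * w + w * w)%C).
  { clear I P1 P2. destruct (quad_on_mult p _ _ Hp1 W W) as (d & K & HK & H). destruct (quad_on_affine p (RtoC 1) (RtoC 4)) as (e & L & HL & H').
    exists (fun w => e w + d w)%C, (L + K). split; [lra|]. intros X Y HX HY.
    destruct (H X Y HX HY) as (A1 & A2 & A3). destruct (H' X Y HX HY) as (B1 & B2 & B3). split; [|split].
    - eapply Rle_trans; [apply Cmod_triangle|]. replace (X * X)%C with ((RtoC 0 + RtoC 1 * X) * (RtoC 0 + RtoC 1 * X))%C by ring. lra.
    - eapply Rle_trans; [apply Cmod_triangle|]. lra.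
    - replace (RtoC 1 + RtoC 4 * Y + Y * Y - (RtoC 1 + RtoC 4 * X + X * X) - (e X + d X) * (Y - X))%C with
        ((RtoC 1 + RtoC 4 * Y - (RtoC 1 + RtoC 4 * X) - e X * (Y - X)) + ((RtoC 0 + RtoC 1 * Y) * (RtoC 0 + RtoC 1 * Y) - (RtoC 0 + RtoC 1 * X) * (RtoC 0 + RtoC 1 * X) - d X * (Y - X)))%C by ring.
      eapply Rle_trans; [apply Cmod_triangle|]. lra. }
  assert (Q := quad_on_mult p _ _ Hp1 (quad_on_mult p _ _ Hp1 W V) P2).
  refine (quad_on_ext _ _ _ _ Q). intros w Hw. unfold phi. pose proof (one_minus_neq_0 w ltac:(lra)). field. easy.
Qed.

Lemma pow_diff (p : R) (X Y : C) (j : nat) : Cmod X <= p -> Cmod Y <= p ->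
  Cmod (Y ^ S j - X ^ S j) <= (INR j + 1) * p ^ j * Cmod (Y - X).
Proof.
  intros HX HY. pose proof (Cmod_ge_0 X). pose proof (Cmod_ge_0 (Y - X)). induction j as [|j IH].
  - cbn [Cpow]. replace (Y * RtoC 1 - X * RtoC 1)%C with (Y - X)%C by ring. simpl. lra.
  - replace (Y ^ S (S j) - X ^ S (S j))%C with (Y * (Y ^ S j - X ^ S j) + X ^ S j * (Y - X))%C by (rewrite !(Cpow_S _ (S j)); ring).
    eapply Rle_trans; [apply Cmod_triangle|]. rewrite !Cmod_mult, Cmod_pow, S_INR.
    assert (Cmod X ^ S j <= p ^ S j) by (apply pow_incr; lra).
    assert (Cmod Y * Cmod (Y ^ S j - X ^ S j) <= p * ((INR j + 1) * p ^ j * Cmod (Y - X))).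
    { apply Rmult_le_compat; try apply Cmod_ge_0; easy. }
    assert (Cmod X ^ S j * Cmod (Y - X) <= p ^ S j * Cmod (Y - X)) by now apply Rmult_le_compat_r.
    replace ((INR j + 1 + 1) * p ^ S j * Cmod (Y - X)) with (p * ((INR j + 1) * p ^ j * Cmod (Y - X)) + p ^ S j * Cmod (Y - X)) by (simpl; ring).
    lra.
Qed.

(** The factor [p] on the left avoids the exponent j - 1, so that no case distinction at j = 0
    arises. *)
Lemma pow_quad (p : R) (X Y : C) (j : nat) : Cmod X <= p -> Cmod Y <= p ->
  p * Cmod (Y ^ S j - X ^ S j - RtoC (INR j + 1) * X ^ j * (Y - X)) <= (INR j + 1) * (INR j + 1) * p ^ j * (Cmod (Y - X) * Cmod (Y - X)).
Proof.
  intros HX HY. pose proof (Cmod_ge_0 X). set (h := (Y - X)%C). pose proof (Cmod_ge_0 h).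
  induction j as [|j IH].
  - cbn [Cpow]. replace (Y * RtoC 1 - X * RtoC 1 - RtoC (INR 0 + 1) * RtoC 1 * h)%C with (RtoC 0).
    + rewrite Cmod_0, Rmult_0_r. simpl. nra.
    + simpl INR. rewrite Rplus_0_l. unfold h. ring.
  - set (D := (Y ^ S j - X ^ S j - RtoC (INR j + 1) * X ^ j * h)%C) in *.
    replace (Y ^ S (S j) - X ^ S (S j) - RtoC (INR (S j) + 1) * X ^ S j * h)%C with (Y * D + RtoC (INR j + 1) * X ^ j * (h * h))%C.
    2:{ unfold D, h. rewrite S_INR, (RtoC_plus (INR j + 1)), !(Cpow_S _ (S j)), !(Cpow_S _ j). ring. }
    pose proof (pos_INR j). assert (0 <= p) by lra.
    assert (T : Cmod (Y * D + RtoC (INR j + 1) * X ^ j * (h * h)) <= p * Cmod D + (INR j + 1) * p ^ j * (Cmod h * Cmod h)).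
    { eapply Rle_trans; [apply Cmod_triangle|]. rewrite !Cmod_mult, Cmod_pow, Cmod_R, (Rabs_right (INR j + 1)) by lra.
      apply Rplus_le_compat; [apply Rmult_le_compat_r; [apply Cmod_ge_0|easy]|].
      apply Rmult_le_compat_r; [nra|]. apply Rmult_le_compat_l; [lra|]. apply pow_incr. lra. }
    apply Rle_trans with (p * (p * Cmod D + (INR j + 1) * p ^ j * (Cmod h * Cmod h))); [now apply Rmult_le_compat_l|].
    rewrite S_INR. replace (p ^ S j) with (p * p ^ j) by (simpl; ring).
    pose proof (pow_le p j H2). set (N := INR j) in *. set (H' := Cmod h * Cmod h) in *. assert (0 <= H') by (unfold H'; nra).
    assert (0 <= p * p ^ j * H') by (repeat apply Rmult_le_pos; easy). nra.
Qed.

(** With y = p^(1/4), Bernoulli's inequality bounds (j + 1) y^j, and p^j is the square of y^j times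
    (sqrt p)^j. *)
Lemma poly_geom (p : R) : 0 < p < 1 -> exists A, 0 <= A /\ forall j, (INR j + 1) * (INR j + 1) * p ^ j <= A * sqrt p ^ j.
Proof.
  intros Hp. set (y := sqrt (sqrt p)).
  assert (S1 : 0 < sqrt p) by (apply sqrt_lt_R0; lra). assert (S2 : 0 < y) by (apply sqrt_lt_R0; lra).
  assert (E1 : sqrt p * sqrt p = p) by (apply sqrt_sqrt; lra). assert (E2 : y * y = sqrt p) by (apply sqrt_sqrt; lra).
  assert (L1 : sqrt p < 1) by nra. assert (L2 : y < 1) by nra.
  set (d := / y - 1). assert (Hd : 0 < d).
  { unfold d. assert (1 < / y); [|lra]. rewrite <- Rinv_1. apply Rinv_lt_contravar; lra. }
  set (B := 1 + / d). assert (HB : 0 < / d) by now apply Rinv_0_lt_compat.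
  assert (K : forall j, (INR j + 1) * y ^ j <= B).
  { intros j. assert (Q := poly j d Hd). replace (1 + d) with (/ y) in Q by (unfold d; ring). rewrite pow_inv in Q.
    pose proof (pow_lt y j S2). pose proof (pos_INR j).
    assert (Q2 : (1 + INR j * d) * y ^ j <= 1).
    { apply Rmult_le_reg_r with (/ y ^ j); [now apply Rinv_0_lt_compat|]. rewrite Rmult_assoc, Rinv_r by lra. lra. }
    assert (y ^ j <= 1) by (rewrite <- (pow1 j); apply pow_incr; lra).
    assert (INR j * y ^ j <= / d).
    { apply Rmult_le_reg_r with d; [easy|]. rewrite Rinv_l by lra. nra. }
    unfold B. lra. }
  exists (B * B). split; [unfold B; nra|]. intros j. specialize (K j).
  assert (E3 : p ^ j = y ^ j * y ^ j * sqrt p ^ j).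
  { rewrite <- !Rpow_mult_distr. f_equal. rewrite E2. easy. }
  rewrite E3. pose proof (pow_lt y j S2). pose proof (pow_lt _ j S1). pose proof (pos_INR j).
  replace ((INR j + 1) * (INR j + 1) * (y ^ j * y ^ j * sqrt p ^ j)) with ((INR j + 1) * y ^ j * ((INR j + 1) * y ^ j) * sqrt p ^ j) by ring.
  apply Rmult_le_compat_r; [lra|]. assert (0 <= (INR j + 1) * y ^ j) by nra. apply Rmult_le_compat; lra.
Qed.

(** Termwise differentiation: the linear coefficients and the quadratic remainders have geometric
    bounds, so the remainders add up to a quadratic one. *)
Lemma hol_csum (p A r : R) (u du : nat -> C -> C) (X : C) : Cmod X < p -> 0 <= r < 1 ->
  (forall Y, Cmod Y < p -> climseq (csm (fun k => u k Y)) (csum (fun k => u k Y))) ->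
  (forall k, Cmod (du k X) <= A * r ^ k) ->
  (forall k Y, Cmod Y < p -> Cmod (u k Y - u k X - du k X * (Y - X)) <= A * r ^ k * (Cmod (Y - X) * Cmod (Y - X))) ->
  hol (fun q => csum (fun k => u k q)) X.
Proof.
  intros HX Hr Hu Hd Hq. 
  assert (HA : 0 <= A) by (specialize (Hd 0%nat); pose proof (Cmod_ge_0 (du 0%nat X)); simpl in Hd; lra).
  apply (hol_quad _ X (csum (fun k => du k X)) (p - Cmod X) (A / (1 - r))); [lra|]. intros Y HY.
  assert (HY2 : Cmod Y < p).
  { replace Y with (X + (Y - X))%C by ring. eapply Rle_lt_trans; [apply Cmod_triangle|]. lra. }
  set (h := (Y - X)%C) in *.
  assert (L := climseq_minus _ _ _ _ (climseq_minus _ _ _ _ (Hu Y HY2) (Hu X HX)) (climseq_scal h _ _ (csum_lim _ _ _ Hr Hd))).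
  replace (csum (fun k => u k Y) - csum (fun k => u k X) - csum (fun k => du k X) * h)%C with
    (csum (fun k => u k Y) - csum (fun k => u k X) - h * csum (fun k => du k X) - RtoC 0)%C by ring.
  apply (climseq_bound _ _ _ _ L). intros n. rewrite <- csm_scal, <- !csm_minus.
  unfold Cminus at 1. rewrite Copp_0, Cplus_0_r.
  eapply Rle_trans.
  { apply (csm_bound _ (fun k => A * (Cmod h * Cmod h) * r ^ k)). intros k _.
    replace (h * du k X)%C with (du k X * h)%C by ring. eapply Rle_trans; [apply Hq; easy|]. right. unfold h. ring. }
  rewrite rsm_scal. pose proof (rsm_geom r n Hr). pose proof (Cmod_ge_0 h).
  replace (A / (1 - r) * (Cmod h * Cmod h)) with (A * (Cmod h * Cmod h) * / (1 - r)) by (field; lra).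
  apply Rmult_le_compat_l; [|easy]. apply Rmult_le_pos; [easy|nra].
Qed.

(** One statement for [h10] (s = 1, m = 0) and for the series in [h01] (s = -1, m = 1). The radius p
    lies halfway between |X| and 1, and the polynomial factors from differentiating powers are
    absorbed by [poly_geom]. *)
Lemma hol_phi_series (s : C) (m : nat) (X : C) : Cmod s = 1 -> Cmod X < 1 ->
  (forall q, Cmod q < 1 -> climseq (csm (fun k => phi (s * q ^ S (2 * k + m)))%C) (csum (fun k => phi (s * q ^ S (2 * k + m)))%C)) ->
  hol (fun q => csum (fun k => phi (s * q ^ S (2 * k + m)))%C) X.
Proof.
  intros Hs HX Hc. pose proof (Cmod_ge_0 X). set (p := (1 + Cmod X) / 2). assert (Hp : 0 < p < 1) by (unfold p; lra).
  destruct (quad_on_phi p ltac:(lra)) as (d & K & HK & HQ). destruct (poly_geom p Hp) as (A & HA & HP).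
  assert (HXp : Cmod X < p) by (unfold p; lra).
  assert (S1 : 0 < sqrt p) by (apply sqrt_lt_R0; lra).
  assert (E1 : sqrt p * sqrt p = p) by (apply sqrt_sqrt; lra). assert (L1 : sqrt p < 1) by nra.
  assert (PB : forall k, (INR (2 * k + m) + 1) * (INR (2 * k + m) + 1) * p ^ (2 * k + m) <= A * p ^ k).
  { intros k. eapply Rle_trans; [apply HP|]. apply Rmult_le_compat_l; [easy|].
    rewrite pow_add, pow_mult. simpl (sqrt p ^ 2). rewrite Rmult_1_r, E1.
    assert (0 <= sqrt p ^ m <= 1) by (split; [apply pow_le; lra|rewrite <- (pow1 m); apply pow_incr; lra]).
    assert (0 <= p ^ k) by (apply pow_le; lra). nra. }
  assert (PW : forall (Z : C) j, Cmod Z <= p -> Cmod (s * Z ^ S j) <= p).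
  { intros Z j HZ. rewrite Cmod_mult, Hs, Cmod_pow, Rmult_1_l. pose proof (Cmod_ge_0 Z). simpl.
    assert (0 <= Cmod Z ^ j <= 1) by (split; [apply pow_le; lra|rewrite <- (pow1 j); apply pow_incr; lra]). nra. }
  apply (hol_csum p (K * (1 + / p) * A) p _ (fun k q => d (s * q ^ S (2 * k + m)) * (s * (RtoC (INR (2 * k + m) + 1) * q ^ (2 * k + m))))%C).
  - easy.
  - lra.
  - intros Y HY. apply Hc. lra.
  - intros k. specialize (PB k). set (j := (2 * k + m)%nat) in *. pose proof (pos_INR j).
    destruct (HQ (s * X ^ S j)%C (s * X ^ S j)%C (PW X j ltac:(lra)) (PW X j ltac:(lra))) as (_ & D & _).
    rewrite !Cmod_mult, Hs, Cmod_R, Cmod_pow, Rabs_right by lra.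
    assert (I : 0 < / p) by (apply Rinv_0_lt_compat; lra).
    assert (Q : 0 <= Cmod X ^ j <= p ^ j) by (split; [now apply pow_le|apply pow_incr; lra]).
    assert (Q2 : (INR j + 1) * Cmod X ^ j <= A * p ^ k) by nra.
    assert (0 <= (INR j + 1) * Cmod X ^ j) by nra. assert (0 <= K * / p * (A * p ^ k)) by (repeat apply Rmult_le_pos; try lra; apply pow_le; lra).
    assert (Cmod (d (s * X ^ S j)%C) * (1 * ((INR j + 1) * Cmod X ^ j)) <= K * (A * p ^ k)).
    { rewrite Rmult_1_l. apply Rmult_le_compat; try lra; apply Cmod_ge_0. }
    nra.
  - intros k Y HY. specialize (PB k). set (j := (2 * k + m)%nat) in *. pose proof (pos_INR j).
    destruct (HQ (s * X ^ S j)%C (s * Y ^ S j)%C (PW X j ltac:(lra)) (PW Y j ltac:(lra))) as (_ & D1 & D2).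
    assert (G1 := pow_diff p X Y j ltac:(lra) ltac:(lra)). assert (G2 := pow_quad p X Y j ltac:(lra) ltac:(lra)).
    set (h := (Y - X)%C) in *. set (x := (s * X ^ S j)%C) in *. set (y := (s * Y ^ S j)%C) in *.
    set (E := (Y ^ S j - X ^ S j - RtoC (INR j + 1) * X ^ j * h)%C) in *.
    replace (phi y - phi x - d x * (s * (RtoC (INR j + 1) * X ^ j)) * h)%C with ((phi y - phi x - d x * (y - x)) + d x * (s * E))%C.
    2:{ unfold E, x, y. ring. }
    assert (Eyx : Cmod (y - x) = Cmod (Y ^ S j - X ^ S j)).
    { replace (y - x)%C with (s * (Y ^ S j - X ^ S j))%C by (unfold x, y; ring). rewrite Cmod_mult, Hs. ring. }
    rewrite Eyx in D2. eapply Rle_trans; [apply Cmod_triangle|]. rewrite !Cmod_mult, Hs, Rmult_1_l.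
    pose proof (Cmod_ge_0 h) as Ph. pose proof (pow_lt p j ltac:(lra)) as Pj.
    assert (Pj1 : p ^ j <= 1) by (rewrite <- (pow1 j); apply pow_incr; lra).
    set (N := INR j + 1) in *. set (H2 := Cmod h * Cmod h) in *. assert (0 <= H2) by (unfold H2; nra).
    set (W := A * p ^ k) in *. 
    assert (B1 : Cmod (Y ^ S j - X ^ S j) * Cmod (Y ^ S j - X ^ S j) <= W * H2).
    { apply Rle_trans with (N * p ^ j * Cmod h * (N * p ^ j * Cmod h)); [apply Rmult_le_compat; try apply Cmod_ge_0; easy|].
      replace (N * p ^ j * Cmod h * (N * p ^ j * Cmod h)) with (N * N * p ^ j * p ^ j * H2) by (unfold H2; ring).
      apply Rmult_le_compat_r; [easy|]. assert (0 <= N * N * p ^ j) by nra. nra. }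
    assert (B2 : Cmod E <= / p * (W * H2)).
    { apply Rmult_le_reg_l with p; [lra|]. rewrite <- Rmult_assoc, Rinv_r, Rmult_1_l by lra.
      eapply Rle_trans; [exact G2|]. now apply Rmult_le_compat_r. }
    assert (B3 : Cmod (d x) * Cmod E <= K * (/ p * (W * H2))) by (apply Rmult_le_compat; try apply Cmod_ge_0; easy).
    assert (B4 : K * (Cmod (Y ^ S j - X ^ S j) * Cmod (Y ^ S j - X ^ S j)) <= K * (W * H2)) by now apply Rmult_le_compat_l.
    replace (K * (1 + / p) * A * p ^ k * H2) with (K * (W * H2) + K * (/ p * (W * H2))) by (unfold W; ring). lra.
Qed.

Lemma h10_lim (q : C) : Cmod q < 1 -> climseq (csm (fun k => phi (q ^ (2 * k + 1))%C)) (h10 q).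
Proof. intros H. exact (csum_lim _ _ _ (disc_bounds q H) (fun k => h10_term q k H)). Qed.

Lemma h01_lim (q : C) : Cmod q < 1 ->
  climseq (csm (fun k => phi (- q ^ (2 * k + 2))%C)) (csum (fun k => phi (- q ^ (2 * k + 2))%C)).
Proof. intros H. exact (csum_lim _ _ _ (disc_bounds q H) (fun k => h01_term q k H)). Qed.

Lemma h10_hol (q : C) : Cmod q < 1 -> hol h10 q.
Proof.
  intros H. assert (E : forall p, csum (fun k => phi (RtoC 1 * p ^ S (2 * k + 0))%C) = h10 p).
  { intros p. apply csum_ext. intros k. f_equal. rewrite Cmult_1_l. f_equal. lia. }
  apply (hol_ext (fun p => csum (fun k => phi (RtoC 1 * p ^ S (2 * k + 0))%C)) _ q 1); [lra|intros; apply E|].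
  apply hol_phi_series; [rewrite Cmod_R; apply Rabs_R1|easy|]. intros p Hp. rewrite E. unfold h10.
  apply (climseq_ext (csm (fun k => phi (p ^ (2 * k + 1))%C))).
  - intros n. apply csm_ext. intros k _. f_equal. rewrite Cmult_1_l. f_equal. lia.
  - now apply h10_lim.
Qed.

Lemma h01_hol (q : C) : Cmod q < 1 -> hol h01 q.
Proof.
  intros H. unfold h01. apply hol_plus; [apply hol_const|].
  assert (E : forall p, csum (fun k => phi (- RtoC 1 * p ^ S (2 * k + 1))%C) = csum (fun k => phi (- p ^ (2 * k + 2))%C)).
  { intros p. apply csum_ext. intros k. f_equal. replace (2 * k + 2)%nat with (S (2 * k + 1)) by lia. ring. }
  apply (hol_ext (fun p => csum (fun k => phi (- RtoC 1 * p ^ S (2 * k + 1))%C)) _ q 1); [lra|intros; apply E|].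
  apply hol_phi_series; [apply Cmod_m1|easy|]. intros p Hp. rewrite E.
  apply (climseq_ext (csm (fun k => phi (- p ^ (2 * k + 2))%C))).
  - intros n. apply csm_ext. intros k _. f_equal. replace (2 * k + 2)%nat with (S (2 * k + 1)) by lia. ring.
  - now apply h01_lim.
Qed.

Lemma nome_hol (t : C) : hol nome t.
Proof.
  apply (hol_comp (fun t => RtoC PI * (Ci * t))%C cexp); [|apply hol_cexp].
  apply hol_mult; [apply hol_const|]. apply hol_mult; [apply hol_const|apply hol_id].
Qed.

(* This is 1 - 2 lambda, where lambda is the modular function (theta_2 / theta_3)^4. *)
Definition modF (t : C) : C := ((s01 t - s10 t) / (s01 t + s10 t))%C.

Lemma modF_hol (t : C) : uhp t -> hol modF t.
Proof.
  intros H. assert (Q := proj2 (Cmod_nome_lt t H)). destruct (nonvanishing t H) as (_ & N & _).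
  assert (A : hol s01 t) by (apply (hol_comp nome h01); [apply nome_hol|now apply h01_hol]).
  assert (B : hol s10 t) by (apply (hol_comp nome h10); [apply nome_hol|now apply h10_hol]).
  unfold modF. apply hol_div; [now apply hol_minus|now apply hol_plus|easy].
Qed.

Lemma modF_1 (t : C) : uhp t -> (RtoC 1 - modF t = RtoC 2 * s10 t / (s01 t + s10 t))%C.
Proof. intros H. destruct (nonvanishing t H) as (_ & N & _). unfold modF. field. easy. Qed.

Lemma modF_Xdom (t : C) : uhp t -> Xdom (modF t).
Proof.
  intros H. destruct (nonvanishing t H) as ((N1 & N2 & _) & N & _).
  assert (N3 : RtoC 2 <> RtoC 0) by (apply RtoC_neq_0; lra). split; intros E.
  - assert (Z : (modF t + RtoC 1 = RtoC 0)%C) by (rewrite E; Ceq).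
    assert (Z2 : (modF t + RtoC 1 = RtoC 2 * s01 t / (s01 t + s10 t))%C) by (unfold modF; field; easy).
    apply (Cmult_neq_0 _ _ N3 N1). transitivity ((RtoC 2 * s01 t / (s01 t + s10 t)) * (s01 t + s10 t))%C; [field; easy|].
    rewrite <- Z2, Z. ring.
  - assert (Z : (RtoC 1 - modF t = RtoC 0)%C) by (rewrite E; Ceq).
    apply (Cmult_neq_0 _ _ N3 N2). transitivity ((RtoC 2 * s10 t / (s01 t + s10 t)) * (s01 t + s10 t))%C; [field; easy|].
    rewrite <- modF_1, Z by easy. ring.
Qed.

Lemma nome_shift (n : Z) (t : C) : nome (t + RtoC 2 * ZtoC n) = nome t.
Proof.
  unfold nome. replace (RtoC PI * (Ci * (t + RtoC 2 * ZtoC n)))%C with (RtoC PI * (Ci * t) + RtoC (2 * IZR n * PI) * Ci)%C.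
  2:{ unfold ZtoC. rewrite !RtoC_mult. ring. }
  rewrite cexp_plus. assert (E : cexp (RtoC (2 * IZR n * PI) * Ci) = RtoC 1).
  { unfold cexp. simpl. replace (2 * IZR n * PI * 0 - 0 * 1) with 0 by ring. rewrite exp_0.
    replace (2 * IZR n * PI * 1 + 0 * 0) with (2 * (IZR n * PI)) by ring.
    rewrite cos_2a_sin, sin_2a. rewrite (sin_eq_0_1 (IZR n * PI)); [Ceq|now exists n]. }
  rewrite E. ring.
Qed.

Lemma modF_shift (n : Z) (t : C) : modF (t + RtoC 2 * ZtoC n) = modF t.
Proof. unfold modF, s01, s10. now rewrite nome_shift. Qed.

Lemma modF_S (t : C) : uhp t -> modF (sm t) = (- modF t)%C.
Proof.
  intros H. destruct (nonvanishing t H) as (_ & N & _). pose proof (uhp_neq_0 t H).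
  unfold modF. rewrite s01_S, s10_S by easy. field. repeat split; auto.
  rewrite <- Cmult_plus_distr_l, Cplus_comm. repeat apply Cmult_neq_0; auto.
Qed.

Lemma uhp_shift (n : Z) (t : C) : uhp t -> uhp (t + RtoC 2 * ZtoC n).
Proof. unfold uhp, ZtoC. simpl. intros H. replace (snd t + (2 * 0 + 0 * IZR n)) with (snd t) by ring. easy. Qed.

Lemma mob_tmat_false (n : Z) (t : C) : uhp t -> mob (tmat (false, n)) t = sm (sm t + RtoC 2 * ZtoC n).
Proof.
  intros H. assert (U := uhp_shift n _ (sm_uhp t H)). apply uhp_neq_0 in U.
  assert (D := mob_den (tmat (false, n)) t (Gam_SL2 _ (Gam_tmat _)) H). pose proof (uhp_neq_0 t H) as Nt.
  unfold mob, sm, tmat in *. cbn [fst snd mp mq mr ms] in *.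
  replace (ZtoC (2 * - n)) with (- (RtoC 2 * ZtoC n))%C in * by (unfold ZtoC; rewrite mult_IZR, opp_IZR, RtoC_mult, RtoC_opp; ring).
  replace (ZtoC 1) with (RtoC 1) in * by easy. replace (ZtoC 0) with (RtoC 0) in * by easy.
  set (m := (RtoC 2 * ZtoC n)%C) in *. 
  replace (- / t + m)%C with (- (- m * t + RtoC 1) / t)%C by (field; easy).
  field. repeat split; auto; intros E; apply D; transitivity (- - (- m * t + RtoC 1))%C; try ring; rewrite <- E; try ring.
Qed.

Lemma modF_tmat (t : bool * Z) (h : C) : uhp h -> modF (mob (tmat t) h) = modF h.
Proof.
  intros H. destruct t as [[] n].
  - unfold tmat. cbn [fst snd]. rewrite mob_shift. apply modF_shift.
  - rewrite mob_tmat_false by easy. rewrite modF_S by now apply uhp_shift, sm_uhp.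
    rewrite modF_shift, modF_S by easy. ring.
Qed.

Lemma modF_wmat (w : word) (h : C) : uhp h -> modF (mob (wmat w) h) = modF h.
Proof.
  revert h. induction w as [|t w IH]; intros h H; simpl.
  - now rewrite mob_id.
  - rewrite mob_mul by (try apply Gam_SL2; auto using Gam_tmat, Gam_wmat).
    rewrite modF_tmat; [now apply IH|]. apply mob_uhp; [apply Gam_SL2, Gam_wmat|easy].
Qed.

Lemma phi_conj (w : C) : Cmod w < 1 -> Cconj (phi w) = phi (Cconj w).
Proof.
  intros H. assert (N := one_minus_neq_0 w H). unfold phi.
  rewrite Cdiv_conj by (apply Cmult_neq_0; apply Cmult_neq_0; auto).
  rewrite !Cmult_conj, !Cplus_conj, !Cmult_conj, !Cminus_conj.
  assert (R : forall r, Cconj (RtoC r) = RtoC r) by (intros; Ceq). now rewrite !R.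
Qed.

Lemma csum_conj (u : nat -> C) : Cconj (csum u) = csum (fun k => Cconj (u k)).
Proof.
  unfold csum, Cconj. cbn [fst snd]. f_equal. rewrite <- Series_opp. apply Series_ext. easy.
Qed.

Lemma nome_conj (t : C) : nome (- Cconj t) = Cconj (nome t).
Proof.
  unfold nome, cexp, Cconj. cbn [fst snd Cmult RtoC Ci Copp].
  match goal with |- (exp ?a * cos ?b, exp ?a * sin ?b) = (exp ?c * cos ?d, - (exp ?c * sin ?d)) =>
    replace a with c by ring; replace b with (- d) by ring end.
  rewrite cos_neg, sin_neg. f_equal. ring.
Qed.

Lemma h10_conj (q : C) : Cmod q < 1 -> Cconj (h10 q) = h10 (Cconj q).
Proof.
  intros H. unfold h10. rewrite csum_conj. apply csum_ext. intros k.
  rewrite phi_conj, Cpow_conj; [easy|]. replace (2 * k + 1)%nat with (S (2 * k)) by lia. now apply Cmod_pow_lt.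
Qed.

Lemma h01_conj (q : C) : Cmod q < 1 -> Cconj (h01 q) = h01 (Cconj q).
Proof.
  intros H. unfold h01. rewrite Cplus_conj, csum_conj. f_equal; [Ceq|]. apply csum_ext. intros k.
  rewrite phi_conj, Copp_conj, Cpow_conj; [easy|]. rewrite Cmod_opp. replace (2 * k + 2)%nat with (S (2 * k + 1)) by lia. now apply Cmod_pow_lt.
Qed.

Lemma modF_conj (t : C) : uhp t -> modF (- Cconj t) = Cconj (modF t).
Proof.
  intros H. assert (Q := proj2 (Cmod_nome_lt t H)). destruct (nonvanishing t H) as (_ & N & _).
  unfold modF. rewrite Cdiv_conj by easy. rewrite Cminus_conj, Cplus_conj. unfold s01, s10.
  now rewrite h01_conj, h10_conj, nome_conj.
Qed.

Lemma sm_unit (t : C) : Cmod t = 1 -> sm t = (- Cconj t)%C.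
Proof.
  intros H. assert (E : (t * Cconj t = RtoC 1)%C) by (rewrite <- Cmod2_conj, H; Ceq).
  assert (N : t <> RtoC 0) by (apply Cmod_gt_0; lra).
  unfold sm. f_equal. transitivity (/ t * (t * Cconj t))%C; [rewrite E; ring|]. field. easy.
Qed.

(** On the unit semicircle -1/t is the reflection of t in the imaginary axis. Oddness under S and
    the reflection symmetry give -F = conj F. *)
Lemma modF_unit (t : C) : uhp t -> Cmod t = 1 -> E_pb (modF t).
Proof.
  intros H H1. assert (E := modF_S t H). rewrite sm_unit, modF_conj in E by easy.
  apply (f_equal fst) in E. unfold Cconj, Copp in E. cbn [fst] in E. unfold E_pb. lra.
Qed.

Definition rpos (z : C) : Prop := snd z = 0 /\ 0 < fst z.

Lemma rpos_eq (z : C) : rpos z -> z = RtoC (fst z).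
Proof. destruct z as [x y]. intros [E _]. simpl in *. now rewrite E. Qed.

Lemma rpos_RtoC (r : R) : 0 < r -> rpos (RtoC r).
Proof. split; simpl; lra. Qed.

Lemma phi_rpos (r : R) : 0 < r < 1 -> rpos (phi (RtoC r)).
Proof.
  intros H. unfold phi.
  replace (RtoC r * (RtoC 1 + RtoC 4 * RtoC r + RtoC r * RtoC r) / ((RtoC 1 - RtoC r) * (RtoC 1 - RtoC r) * ((RtoC 1 - RtoC r) * (RtoC 1 - RtoC r))))%C
    with (RtoC (r * (1 + 4 * r + r * r) / ((1 - r) * (1 - r) * ((1 - r) * (1 - r))))).
  - apply rpos_RtoC. apply Rdiv_lt_0_compat; [apply Rmult_lt_0_compat; nra|]. repeat apply Rmult_lt_0_compat; lra.
  - rewrite RtoC_div by (apply Rgt_not_eq; repeat apply Rmult_lt_0_compat; lra).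
    rewrite !RtoC_mult, !RtoC_minus, !RtoC_plus, !RtoC_mult. easy.
Qed.

Lemma nome_I (t : C) : fst t = 0 -> nome t = RtoC (Cmod (nome t)).
Proof.
  intros H0. rewrite Cmod_nome. unfold nome, cexp. simpl. rewrite H0.
  replace (PI * (0 * snd t + 1 * 0) + 0 * (0 * 0 - 1 * snd t)) with 0 by ring. rewrite cos_0, sin_0.
  replace (PI * (0 * 0 - 1 * snd t) - 0 * (0 * snd t + 1 * 0)) with (- (PI * snd t)) by ring. Ceq.
Qed.

Lemma s10_rpos (t : C) : uhp t -> fst t = 0 -> rpos (s10 t).
Proof.
  intros H H0. assert (Q := Cmod_nome_lt t H).
  assert (E := nome_I t H0).
  unfold s10. set (r := Cmod (nome t)) in *. rewrite E.
  assert (Hr : Cmod (RtoC r) < 1) by (rewrite Cmod_R, Rabs_right; lra).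
  assert (L : climseq (csm (fun k => phi (RtoC r ^ (2 * k + 1))%C)) (h10 (RtoC r))).
  { now apply h10_lim. }
  assert (P : forall k, rpos (phi (RtoC r ^ (2 * k + 1))%C)).
  { intros k. rewrite <- RtoC_pow. apply phi_rpos. split; [apply pow_lt; lra|].
    rewrite Nat.add_1_r. simpl. assert (r ^ (k + (k + 0)) <= 1) by (rewrite <- (pow1 (k + (k + 0))); apply pow_incr; lra).
    pose proof (pow_lt r (k + (k + 0)) ltac:(lra)). nra. }
  set (u := fun k => phi (RtoC r ^ (2 * k + 1))%C) in *.
  assert (B : forall n, snd (csm u (S n)) = 0 /\ fst (u 0%nat) <= fst (csm u (S n))).
  { induction n as [|n IH].
    { change (csm u 1) with (RtoC 0 + u 0%nat)%C. cbn [Cplus fst snd RtoC].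
      destruct (P 0%nat) as [P1 P2]. fold (u 0%nat) in P1, P2. lra. }
    change (csm u (S (S n))) with (csm u (S n) + u (S n))%C. cbn [Cplus fst snd].
    destruct (P (S n)) as [P1 P2]. fold (u (S n)) in P1, P2. lra. }
  destruct (P 0%nat) as [_ P0]. fold (u 0%nat) in P0. split.
  - destruct (Req_dec (snd (h10 (RtoC r))) 0) as [|N]; [easy|].
    destruct (L (Rabs (snd (h10 (RtoC r))))) as (n & Hn); [now apply Rabs_pos_lt|].
    specialize (Hn (S n) ltac:(lia)). destruct (B n) as [B1 _].
    pose proof (snd_le_Cmod (csm u (S n) - h10 (RtoC r))) as S1. cbn [Cminus Cplus Copp snd] in S1. rewrite B1 in S1.
    rewrite Rplus_0_l, Rabs_Ropp in S1. lra.
  - apply Rnot_le_lt. intros N. destruct (L (fst (u 0%nat)) P0) as (n & Hn).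
    specialize (Hn (S n) ltac:(lia)). destruct (B n) as [_ B1].
    pose proof (fst_le_Cmod (csm u (S n) - h10 (RtoC r))) as S1. cbn [Cminus Cplus Copp fst] in S1.
    pose proof (Rle_abs (fst (csm u (S n)) + - fst (h10 (RtoC r)))). lra.
Qed.

(** The terms of [h01] have no constant sign, so positivity is transferred from [s10] by S; on the
    imaginary axis the factor t^4 is positive. *)
Lemma s01_rpos (t : C) : uhp t -> fst t = 0 -> rpos (s01 t).
Proof.
  intros H H0. assert (Nt := uhp_neq_0 t H). assert (E : t = (0, snd t)) by (destruct t; simpl in *; now rewrite H0).
  assert (Es : sm t = (0, / snd t)).
  { unfold uhp in H. unfold sm. rewrite E. apply injective_projections; simpl; field; nra. }
  assert (P : rpos (s10 (sm t))) by (apply s10_rpos; [now apply sm_uhp|now rewrite Es]).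
  assert (X := s01_S (sm t) (sm_uhp t H)). rewrite sm_sm in X by easy.
  rewrite (rpos_eq _ P), Es in X. destruct P as [_ P]. unfold uhp in H.
  assert (I : 0 < / snd t) by now apply Rinv_0_lt_compat.
  rewrite X. rewrite Es in P. set (c := fst (s10 (0, / snd t))) in *. set (y := / snd t) in *.
  replace ((0, y) * (0, y) * ((0, y) * (0, y)) * RtoC c)%C with (RtoC (y * y * (y * y) * c)) by Ceq.
  apply rpos_RtoC. repeat apply Rmult_lt_0_compat; easy.
Qed.

Lemma modF_I (t : C) : uhp t -> fst t = 0 -> E_tr (modF t).
Proof.
  intros H H0. assert (A := s01_rpos t H H0). assert (B := s10_rpos t H H0).
  unfold modF. rewrite (rpos_eq _ A), (rpos_eq _ B). destruct A as [_ A]. destruct B as [_ B].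
  set (a := fst (s01 t)) in *. set (b := fst (s10 t)) in *.
  rewrite <- RtoC_minus, <- RtoC_plus, <- RtoC_div by lra. split; [|easy]. simpl. split.
  - apply Rlt_div_r; lra.
  - apply Rlt_div_l; lra.
Qed.

Lemma modF_Ci : modF Ci = RtoC 0.
Proof.
  assert (A := modF_I Ci Ci_uhp eq_refl). assert (B := modF_unit Ci Ci_uhp Cmod_Ci).
  destruct A as [_ A]. unfold E_pb in B. destruct (modF Ci) as [x y]. simpl in *. now rewrite A, B.
Qed.

(** * Homotopies *)

Lemma cont_on_affine (a b c d : R) (D D' : C -> Prop) (f : C -> C) :
  (forall z, D z -> D' (a * fst z + b, c * snd z + d)) -> cont_on D' f ->
  cont_on D (fun z => f (a * fst z + b, c * snd z + d)).
Proof.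
  intros H Hf z Dz.
  apply (ctat_pre dC dC D D' (fun z : C => (a * fst z + b, c * snd z + d)) f z (Rabs a + Rabs c + 1)).
  - pose proof (Rabs_pos a). pose proof (Rabs_pos c). lra.
  - intros y _. unfold dC. eapply Rle_trans; [apply Cmod_le_abs|]. cbn [fst snd Cminus Cplus Copp].
    replace (a * fst y + b + - (a * fst z + b)) with (a * (fst y + - fst z)) by ring.
    replace (c * snd y + d + - (c * snd z + d)) with (c * (snd y + - snd z)) by ring. rewrite !Rabs_mult.
    pose proof (fst_le_Cmod (y - z)) as A. pose proof (snd_le_Cmod (y - z)) as B. cbn [fst snd Cminus Cplus Copp] in A, B.
    pose proof (Rabs_pos a). pose proof (Rabs_pos c). pose proof (Cmod_ge_0 (y - z)). nra.
  - easy.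
  - exact (Hf _ (H z Dz)).
Qed.

Lemma fst_lip (z w : C) : Rabs (fst z - fst w) <= dC z w.
Proof. apply (fst_le_Cmod (z - w)). Qed.

Lemma snd_lip (z w : C) : Rabs (snd z - snd w) <= dC z w.
Proof. apply (snd_le_Cmod (z - w)). Qed.

Lemma hom_ext (E1 E2 : C -> Prop) (g1 g1' g2 g2' : R -> C) : (forall s, 0 <= s <= 1 -> g1 s = g1' s) ->
  (forall s, 0 <= s <= 1 -> g2 s = g2' s) -> homotopic_rel E1 E2 g1 g2 -> homotopic_rel E1 E2 g1' g2'.
Proof.
  intros A B (H & C1 & X & S & U). exists H. split; [easy|]. split; [easy|]. split; [|easy].
  intros s Hs. rewrite <- A, <- B by easy. now apply S.
Qed.

Lemma hom_weaken (E1 E2 E1' E2' : C -> Prop) (g1 g2 : R -> C) : (forall z, E1 z -> E1' z) -> (forall z, E2 z -> E2' z) ->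
  homotopic_rel E1 E2 g1 g2 -> homotopic_rel E1' E2' g1 g2.
Proof.
  intros A B (H & C1 & X & S & U). exists H. split; [easy|]. split; [easy|]. split; [easy|].
  intros u Hu. destruct (U u Hu). auto.
Qed.

Lemma hom_trans (E1 E2 : C -> Prop) (g1 g2 g3 : R -> C) :
  homotopic_rel E1 E2 g1 g2 -> homotopic_rel E1 E2 g2 g3 -> homotopic_rel E1 E2 g1 g3.
Proof.
  intros (H & C1 & X1 & S1 & U1) (K & C2 & X2 & S2 & U2).
  exists (fun p : C => if Rle_dec (fst p) (/ 2) then H (2 * fst p + 0, 1 * snd p + 0) else K (2 * fst p + -1, 1 * snd p + 0)).
  assert (Q1 : forall p : C, unit_square p -> fst p <= / 2 -> unit_square (2 * fst p + 0, 1 * snd p + 0)).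
  { intros p [A B] L. split; simpl; lra. }
  assert (Q2 : forall p : C, unit_square p -> / 2 <= fst p -> unit_square (2 * fst p + -1, 1 * snd p + 0)).
  { intros p [A B] L. split; simpl; lra. }
  split; [|split; [|split]].
  - apply (cont_glue unit_square fst (/ 2) (fun p : C => H (2 * fst p + 0, 1 * snd p + 0)) (fun p : C => K (2 * fst p + -1, 1 * snd p + 0)) fst_lip).
    + apply (cont_on_affine 2 0 1 0 _ unit_square); [|easy]. intros z [Dz L]. now apply Q1.
    + apply (cont_on_affine 2 (-1) 1 0 _ unit_square); [|easy]. intros z [Dz L]. now apply Q2.
    + intros z [Dz1 Dz2] E. rewrite E.
      replace (2 * / 2 + 0) with 1 by field. replace (2 * / 2 + -1) with 0 by field.
      replace (1 * snd z + 0) with (snd z) by ring. now rewrite (proj2 (S1 _ Dz2)), (proj1 (S2 _ Dz2)).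
  - intros p Hp. destruct Rle_dec; [apply X1, Q1|apply X2, Q2]; auto; lra.
  - intros s Hs. cbn [fst snd]. destruct (Rle_dec 0 (/ 2)); [|lra]. destruct (Rle_dec 1 (/ 2)); [lra|].
    replace (2 * 0 + 0) with 0 by ring. replace (2 * 1 + -1) with 1 by ring. replace (1 * s + 0) with s by ring.
    split; [now apply S1|now apply S2].
  - intros u Hu. cbn [fst snd]. replace (1 * 0 + 0) with 0 by ring. replace (1 * 1 + 0) with 1 by ring.
    destruct Rle_dec; [apply U1|apply U2]; lra.
Qed.

(** Homotopies with both endpoints fixed at 0 can be concatenated; the conditions are weakened to
    (-1, 1) and the imaginary axis only at the end. *)
Definition at_0 (z : C) : Prop := z = RtoC 0.

Lemma hom_concat (f1 f2 g1 g2 : R -> C) : homotopic_rel at_0 at_0 f1 g1 -> homotopic_rel at_0 at_0 f2 g2 ->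
  homotopic_rel at_0 at_0 (fun s => if Rle_dec s (/ 2) then f1 (2 * s) else f2 (2 * s - 1))
    (fun s => if Rle_dec s (/ 2) then g1 (2 * s) else g2 (2 * s - 1)).
Proof.
  intros (H & C1 & X1 & S1 & U1) (K & C2 & X2 & S2 & U2).
  exists (fun p : C => if Rle_dec (snd p) (/ 2) then H (1 * fst p + 0, 2 * snd p + 0) else K (1 * fst p + 0, 2 * snd p + -1)).
  assert (Q1 : forall p : C, unit_square p -> snd p <= / 2 -> unit_square (1 * fst p + 0, 2 * snd p + 0)).
  { intros p [A B] L. split; simpl; lra. }
  assert (Q2 : forall p : C, unit_square p -> / 2 <= snd p -> unit_square (1 * fst p + 0, 2 * snd p + -1)).
  { intros p [A B] L. split; simpl; lra. }
  split; [|split; [|split]].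
  - apply (cont_glue unit_square snd (/ 2) (fun p : C => H (1 * fst p + 0, 2 * snd p + 0)) (fun p : C => K (1 * fst p + 0, 2 * snd p + -1)) snd_lip).
    + apply (cont_on_affine 1 0 2 0 _ unit_square); [|easy]. intros z [Dz L]. now apply Q1.
    + apply (cont_on_affine 1 0 2 (-1) _ unit_square); [|easy]. intros z [Dz L]. now apply Q2.
    + intros z [Dz1 Dz2] E. rewrite E.
      replace (2 * / 2 + 0) with 1 by field. replace (2 * / 2 + -1) with 0 by field.
      replace (1 * fst z + 0) with (fst z) by ring. rewrite (proj2 (U1 _ Dz1)). symmetry. apply (proj1 (U2 _ Dz1)).
  - intros p Hp. destruct Rle_dec; [apply X1, Q1|apply X2, Q2]; auto; lra.
  - intros s Hs. cbn [fst snd]. replace (1 * 0 + 0) with 0 by ring. replace (1 * 1 + 0) with 1 by ring.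
    destruct (Rle_dec s (/ 2)).
    + replace (2 * s + 0) with (2 * s) by ring. apply S1. lra.
    + replace (2 * s + -1) with (2 * s - 1) by ring. apply S2. lra.
  - intros u Hu. cbn [fst snd]. replace (1 * u + 0) with u by ring.
    destruct (Rle_dec 0 (/ 2)); [|lra]. destruct (Rle_dec 1 (/ 2)); [lra|].
    replace (2 * 0 + 0) with 0 by ring. replace (2 * 1 + -1) with 1 by ring. split; [apply U1|apply U2]; easy.
Qed.

Lemma hom_opp (f g : R -> C) : homotopic_rel at_0 at_0 f g -> homotopic_rel at_0 at_0 (fun s => - f s)%C (fun s => - g s)%C.
Proof.
  intros (H & C1 & X & S & U). exists (fun p => - H p)%C. split; [|split; [|split]].
  - intros z Dz. exact (ctat_opp dC unit_square H z (C1 z Dz)).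
  - intros p Hp. destruct (X p Hp) as [A B]. split; intros E.
    + apply B. replace (H p) with (- - H p)%C by ring. rewrite E. Ceq.
    + apply A. replace (H p) with (- - H p)%C by ring. rewrite E. Ceq.
  - intros s Hs. destruct (S s Hs) as [-> ->]. easy.
  - intros u Hu. destruct (U u Hu) as [A B]. unfold at_0 in *. rewrite A, B. split; Ceq.
Qed.

Lemma ctat_fst (D : C -> Prop) (p : C) : ctat dC D (fun p => RtoC (fst p)) p.
Proof.
  intros e He. exists e. split; [easy|]. intros q _ L. rewrite <- RtoC_minus, Cmod_R.
  eapply Rle_lt_trans; [apply fst_lip|easy].
Qed.

Lemma ctat_snd (D : C -> Prop) (p : C) : ctat dC D (fun p => RtoC (snd p)) p.
Proof.
  intros e He. exists e. split; [easy|]. intros q _ L. rewrite <- RtoC_minus, Cmod_R.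
  eapply Rle_lt_trans; [apply snd_lip|easy].
Qed.

Lemma ctat_path (l : R -> C) (p : C) : pcont 0 1 l -> unit_square p -> ctat dC unit_square (fun p => l (snd p)) p.
Proof.
  intros H [Hp1 Hp2]. apply (ctat_pre dC dR unit_square (seg 0 1) (fun p : C => snd p) l p 1); [lra| | |].
  - intros y _. rewrite Rmult_1_l. apply snd_lip.
  - intros y [_ Hy]. exact Hy.
  - now apply H.
Qed.

(* The straight-line homotopy in the logarithmic coordinate [log (1 - z)] avoids 1, and also -1 because the real part stays below [ln 2]. *)
Lemma exp_homotopy (l : R -> C) (n : Z) : pcont 0 1 l -> l 0 = RtoC 0 -> l 1 = (RtoC (2 * PI * IZR n) * Ci)%C ->
  (forall s, seg 0 1 s -> fst (l s) < ln 2) ->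
  homotopic_rel at_0 at_0 (fun s => RtoC 1 - cexp (l s))%C (term_loop (true, n)).
Proof.
  intros Hl L0 L1 Hb. set (a := 2 * PI * IZR n).
  exists (fun p => RtoC 1 - cexp ((RtoC 1 - RtoC (fst p)) * l (snd p) + RtoC (fst p) * (RtoC a * RtoC (snd p) * Ci)))%C.
  split; [|split; [|split]].
  - intros p Hp. change (ctat dC unit_square (fun p => RtoC 1 - cexp ((RtoC 1 - RtoC (fst p)) * l (snd p) + RtoC (fst p) * (RtoC a * RtoC (snd p) * Ci)))%C p).
    apply ctat_minus; [apply ctat_const|].
    apply (ctat_comp_T dC unit_square _ cexp); [|apply hol_ct, hol_cexp].
    apply ctat_plus.
    + apply ctat_mult; [apply ctat_minus; [apply ctat_const|apply ctat_fst]|now apply ctat_path].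
    + apply ctat_mult; [apply ctat_fst|]. apply ctat_mult; [|apply ctat_const]. apply ctat_mult; [apply ctat_const|apply ctat_snd].
  - intros p [Hp1 Hp2]. specialize (Hb (snd p) Hp2).
    set (x := ((RtoC 1 - RtoC (fst p)) * l (snd p) + RtoC (fst p) * (RtoC a * RtoC (snd p) * Ci))%C).
    assert (Fx : fst x = (1 - fst p) * fst (l (snd p))) by (unfold x; simpl; ring).
    assert (L2 : 0 < ln 2) by (rewrite <- ln_1; apply ln_increasing; lra).
    assert (Hx : fst x < ln 2) by (rewrite Fx; destruct (Rle_dec 0 (fst (l (snd p)))); nra).
    split; intros E.
    + assert (E2 : cexp x = RtoC 2) by (transitivity (RtoC 1 - (RtoC 1 - cexp x))%C; [ring|rewrite E; Ceq]).
      apply (f_equal Cmod) in E2. rewrite Cmod_cexp, Cmod_R, Rabs_right in E2 by lra.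
      apply exp_increasing in Hx. rewrite exp_ln in Hx by lra. lra.
    + apply (cexp_neq_0 x). transitivity (RtoC 1 - (RtoC 1 - cexp x))%C; [ring|rewrite E; Ceq].
  - intros s Hs. cbn [fst snd]. split.
    + do 2 f_equal. ring.
    + rewrite term_loop_true. unfold circle. fold a.
      replace ((RtoC 1 - RtoC 1) * l s + RtoC 1 * (RtoC a * RtoC s * Ci))%C with (0, a * s) by Ceq.
      unfold cexp. cbn [fst snd]. rewrite exp_0. Ceq.
  - intros u Hu. cbn [fst snd]. rewrite L0, L1. fold a. unfold at_0. split.
    + replace ((RtoC 1 - RtoC u) * RtoC 0 + RtoC u * (RtoC a * RtoC 0 * Ci))%C with (RtoC 0) by ring. rewrite cexp_0. ring.
    + replace ((RtoC 1 - RtoC u) * (RtoC a * Ci) + RtoC u * (RtoC a * RtoC 1 * Ci))%C with (0, a) by Ceq.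
      unfold cexp. cbn [fst snd]. rewrite exp_0. replace a with (2 * (IZR n * PI)) by (unfold a; ring).
      rewrite cos_2a_sin, sin_2a, (sin_eq_0_1 (IZR n * PI)) by now exists n. Ceq.
Qed.

(** * A logarithm of 1 - F along paths in the half-plane *)

(** The factor of 1 - F that is left after the nome, whose logarithm PI i t is explicit. On the
    chosen paths it has positive real part, so its logarithm is unambiguous. *)
Definition kq (t : C) : C := ((RtoC 1 - modF t) / nome t)%C.

Lemma nome_neq_0 (t : C) : nome t <> RtoC 0.
Proof. apply cexp_neq_0. Qed.

Lemma kq_nome (t : C) : (nome t * kq t = RtoC 1 - modF t)%C.
Proof. unfold kq. field. apply nome_neq_0. Qed.

Lemma kq_shift (n : Z) (t : C) : kq (t + RtoC 2 * ZtoC n) = kq t.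
Proof. unfold kq. now rewrite modF_shift, nome_shift. Qed.

Lemma kq_hol (t : C) : uhp t -> hol kq t.
Proof.
  intros H. unfold kq. apply hol_div; [|apply nome_hol|apply nome_neq_0].
  apply hol_minus; [apply hol_const|now apply modF_hol].
Qed.

Lemma kq_I (t : C) : uhp t -> fst t = 0 -> rpos (kq t) /\ Cmod (RtoC 1 - modF t) < 2.
Proof.
  intros H H0. destruct (modF_I t H H0) as [A B]. assert (Q := Cmod_nome_lt t H).
  assert (E : (RtoC 1 - modF t)%C = RtoC (1 - fst (modF t))).
  { rewrite RtoC_minus. f_equal. destruct (modF t) as [x y]. simpl in *. now rewrite B. }
  split.
  - unfold kq. rewrite E, (nome_I t H0), <- RtoC_div by lra. apply rpos_RtoC. apply Rdiv_lt_0_compat; lra.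
  - rewrite E, Cmod_R, Rabs_right; lra.
Qed.

(** At this height |q| <= 1/144, [s10] is close to q and [s01] to 1/16, so 1 - F = 2 s10 / (s01 +
    s10) is close to 32 q and [kq] to 32. *)
Lemma kq_high (t : C) : snd t = 5 / 3 -> 0 < fst (kq t) /\ Cmod (RtoC 1 - modF t) < 2.
Proof.
  intros H. assert (Ht : uhp t) by (unfold uhp; lra).
  assert (Q : 0 < Cmod (nome t) <= 1 / 144).
  { assert (N := nome_small (0, 5 / 6) ltac:(simpl; lra)). rewrite Cmod_nome in *. cbn [snd] in N. rewrite H.
    replace (- (PI * (5 / 3))) with (- (PI * (5 / 6)) + - (PI * (5 / 6))) by field. rewrite exp_plus. 
    split; [apply Rmult_lt_0_compat; lra|nra]. }
  destruct (nonvanishing t Ht) as (_ & N & _). 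
  set (q := nome t) in *. set (r := Cmod q) in *. pose proof (nome_neq_0 t) as Nq. fold q in Nq.
  pose proof (h10_approx q ltac:(fold r; lra)) as A1. pose proof (h01_approx q ltac:(fold r; lra)) as A2. fold r in A1, A2.
  set (a := h10 q) in *. set (b := h01 q) in *.
  assert (Ma : Cmod a <= 1.1 * r).
  { pose proof (Cmod_triangle (a - q) q) as T. replace (a - q + q)%C with a in T by ring. fold r in T. nra. }
  set (e := (b - RtoC (1 / 16))%C) in *.
  assert (Mba : 0.05 <= Cmod (b + a)).
  { pose proof (Cmod_rev (RtoC (1 / 16)) (- (e + a))) as T. rewrite Cmod_opp, Cmod_R, Rabs_right in T by lra.
    replace (RtoC (1 / 16) - - (e + a))%C with (b + a)%C in T by (unfold e; ring).
    pose proof (Cmod_triangle e a). assert (5 * (r * r) <= 0.001) by nra. lra. }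
  assert (E1 : (RtoC 1 - modF t = RtoC 2 * a / (b + a))%C) by (apply modF_1; easy).
  split.
  - assert (Ek : (kq t = RtoC 32 * (RtoC 1 + ((a - q) / q - RtoC 16 * (e + a)) / (RtoC 16 * (b + a))))%C).
    { unfold kq. fold q. rewrite E1. unfold e. rewrite RtoC_div by lra. field. auto. }
    set (d := (((a - q) / q - RtoC 16 * (e + a)) / (RtoC 16 * (b + a)))%C) in *.
    assert (Md : Cmod d < 1).
    { unfold d. rewrite Cmod_div by (apply Cmult_neq_0; [apply RtoC_neq_0; lra|exact N]).
      rewrite (Cmod_RtoC_mult 16), Rabs_right by lra. apply Rlt_div_l; [lra|].
      eapply Rle_lt_trans; [apply Cmod_minus_le|]. rewrite (Cmod_RtoC_mult 16), Rabs_right, Cmod_div by (easy || lra). fold r.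
      assert (Cmod (a - q) / r <= 0.09) by (apply Rle_div_l; [lra|]; nra).
      pose proof (Cmod_triangle e a). assert (5 * (r * r) <= 0.001) by nra. lra. }
    rewrite Ek. pose proof (fst_le_Cmod d) as F. assert (Q1 := Rle_abs (- fst d)). rewrite Rabs_Ropp in Q1.
    cbn [fst snd Cmult Cplus RtoC]. nra.
  - rewrite E1, Cmod_div, Cmod_RtoC_mult, Rabs_right by (exact N || lra). apply Rlt_div_l; [lra|]. lra.
Qed.

(** The horizontal motion takes place for s between 1/3 and 2/3, exactly while [detour_y] stays at
    5/3; before and after, the real part is 0 or 2 n, where symmetry determines the sign of [kq]. *)
Definition detour_x (s : R) : R := Rmax 0 (Rmin 1 (3 * s - 1)).
Definition detour_y (s : R) : R := Rmin (5 / 3) (Rmin (1 + 2 * s) (3 - 2 * s)).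
(* A path from i to i + 2n through the height 5/3, where [nome] is small. *)
Definition detour (n : Z) (s : R) : C := (2 * IZR n * detour_x s, detour_y s).

Lemma detour_x_lip (s t : R) : Rabs (detour_x s - detour_x t) <= 3 * Rabs (s - t).
Proof.
  unfold detour_x, Rmax, Rmin. repeat destruct Rle_dec; unfold Rabs; repeat destruct Rcase_abs; lra.
Qed.

Lemma detour_y_lip (s t : R) : Rabs (detour_y s - detour_y t) <= 2 * Rabs (s - t).
Proof.
  unfold detour_y, Rmin. repeat destruct Rle_dec; unfold Rabs; repeat destruct Rcase_abs; lra.
Qed.

Lemma detour_pcont (n : Z) : pcont 0 1 (detour n).
Proof.
  intros s Hs e He. set (K := Rabs (2 * IZR n) * 3 + 2). pose proof (Rabs_pos (2 * IZR n)) as P.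
  exists (e / K). split; [apply Rdiv_lt_0_compat; unfold K; lra|]. intros t _ L. unfold dR in L.
  apply (Rlt_div_r (Rabs (t - s))) in L; [|unfold K; lra].
  eapply Rle_lt_trans; [apply Cmod_le_abs|]. unfold detour. cbn [fst snd Cminus Cplus Copp].
  pose proof (detour_x_lip t s). pose proof (detour_y_lip t s).
  replace (2 * IZR n * detour_x t + - (2 * IZR n * detour_x s)) with (2 * IZR n * (detour_x t - detour_x s)) by ring.
  rewrite Rabs_mult. unfold Rminus in *. unfold K in L. nra.
Qed.

Lemma detour_cases (s : R) : 0 <= s <= 1 -> 1 <= detour_y s /\ (detour_x s = 0 \/ detour_x s = 1 \/ detour_y s = 5 / 3).
Proof.
  intros Hs. unfold detour_x, detour_y, Rmax, Rmin. repeat destruct Rle_dec; (split; [lra|]).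
  all: first [left; lra | right; left; lra | right; right; lra].
Qed.

Lemma detour_uhp (n : Z) (s : R) : 0 <= s <= 1 -> uhp (detour n s).
Proof. intros Hs. destruct (detour_cases s Hs) as [H _]. unfold uhp, detour. simpl. lra. Qed.

Lemma detour_0 (n : Z) : detour n 0 = Ci.
Proof.
  unfold detour, detour_x, detour_y, Rmax, Rmin. repeat destruct Rle_dec; try lra. apply injective_projections; simpl; ring.
Qed.

Lemma detour_1 (n : Z) : detour n 1 = (Ci + RtoC 2 * ZtoC n)%C.
Proof.
  unfold detour, detour_x, detour_y, Rmax, Rmin. repeat destruct Rle_dec; try lra. apply injective_projections; simpl; ring.
Qed.

Lemma detour_kq (n : Z) (s : R) : 0 <= s <= 1 -> 0 < fst (kq (detour n s)) /\ Cmod (RtoC 1 - modF (detour n s)) < 2.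
Proof.
  intros Hs. destruct (detour_cases s Hs) as [H1 H].
  assert (V : forall m, (detour n s = (0, detour_y s) + RtoC 2 * ZtoC m)%C -> 0 < fst (kq (detour n s)) /\ Cmod (RtoC 1 - modF (detour n s)) < 2).
  { intros m ->. rewrite kq_shift, modF_shift. destruct (kq_I (0, detour_y s)) as [[_ A] B]; [unfold uhp; simpl; lra|easy|easy]. }
  destruct H as [H|[H|H]].
  - apply (V 0%Z). unfold detour. rewrite H. apply injective_projections; simpl; ring.
  - apply (V n). unfold detour. rewrite H. apply injective_projections; simpl; ring.
  - apply kq_high. simpl. now rewrite H.
Qed.

(** [clog] lives on the upper half-plane while [kq] lies in the right one; hence the factor i and
    the subtraction of i PI / 2. *)
Definition hlog (t : C) : C := (RtoC PI * (Ci * t) + (clog (Ci * kq t) - RtoC (PI / 2) * Ci))%C.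

Lemma Ci_mult_uhp (k : C) : 0 < fst k -> uhp (Ci * k).
Proof. unfold uhp. simpl. lra. Qed.

Lemma cexp_hlog (t : C) : 0 < fst (kq t) -> cexp (hlog t) = (RtoC 1 - modF t)%C.
Proof.
  intros H. unfold hlog, Cminus at 1. rewrite !cexp_plus, cexp_clog by now apply Ci_mult_uhp.
  rewrite cexp_opp. fold (nome t).
  assert (E : cexp (RtoC (PI / 2) * Ci) = Ci).
  { unfold cexp. simpl. replace (PI / 2 * 0 - 0 * 1) with 0 by ring. replace (PI / 2 * 1 + 0 * 0) with (PI / 2) by ring.
    rewrite exp_0, cos_PI2, sin_PI2. Ceq. }
  rewrite E, <- kq_nome. field. apply Ci_neq_0.
Qed.

Lemma hlog_hol (t : C) : uhp t -> 0 < fst (kq t) -> hol hlog t.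
Proof.
  intros H Hk. unfold hlog. apply hol_plus.
  - apply hol_mult; [apply hol_const|]. apply hol_mult; [apply hol_const|apply hol_id].
  - apply hol_minus; [|apply hol_const]. apply (hol_comp (fun t => Ci * kq t)%C clog); [|now apply hol_clog, Ci_mult_uhp].
    apply hol_mult; [apply hol_const|now apply kq_hol].
Qed.

Lemma hlog_shift (n : Z) (t : C) : hlog (t + RtoC 2 * ZtoC n) = (hlog t + RtoC (2 * PI * IZR n) * Ci)%C.
Proof. unfold hlog. rewrite kq_shift. unfold ZtoC. rewrite !RtoC_mult. ring. Qed.

Lemma hlog_Ci : hlog Ci = RtoC 0.
Proof.
  destruct (kq_I Ci Ci_uhp eq_refl) as [[K1 K2] _].
  assert (E := cexp_hlog Ci K2). rewrite modF_Ci in E.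
  assert (S : snd (hlog Ci) = 0).
  { unfold hlog, clog. cbn [fst snd Cmult Cplus Cminus Copp RtoC Ci]. rewrite K1.
    replace ((0 * fst (kq Ci) - 1 * 0) / (0 * 0 + 1 * fst (kq Ci))) with 0 by (field; lra). rewrite atan_0. ring. }
  apply (f_equal Cmod) in E. rewrite Cmod_cexp in E.
  replace (RtoC 1 - RtoC 0)%C with (RtoC 1) in E by ring. rewrite Cmod_R, Rabs_R1, <- exp_0 in E. apply exp_inv in E.
  destruct (hlog Ci) as [x y]. simpl in *. now rewrite E, S.
Qed.

Lemma pcont_comp (a b : R) (g : R -> C) (f : C -> C) : pcont a b g -> (forall s, seg a b s -> hol f (g s)) -> pcont a b (fun s => f (g s)).
Proof. intros H Hf s Hs. apply (ctat_comp_T dR _ g f); [now apply H|]. apply hol_ct. now apply Hf. Qed.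

(** The counterpart of [word_lift] for [modF]: the path in the half-plane is given, and its image is
    compared with the loop. *)
Definition base_path (M : mat) (lp : R -> C) (g : R -> C) : Prop :=
  pcont 0 1 g /\ (forall s, seg 0 1 s -> uhp (g s)) /\ g 0 = Ci /\ g 1 = mob M Ci /\
  homotopic_rel at_0 at_0 (fun s => modF (g s)) lp.

(** Along the detour |1 - F| < 2, so the real part of [hlog] is below ln 2 as [exp_homotopy]
    demands, while the imaginary part increases by 2 PI n in total. *)
Lemma term_path_true (n : Z) : base_path (tmat (true, n)) (term_loop (true, n)) (detour n).
Proof.
  split; [apply detour_pcont|]. split; [apply detour_uhp|]. split; [apply detour_0|]. split.
  { rewrite detour_1. unfold tmat. cbn [fst snd]. now rewrite mob_shift. }
  apply (hom_ext _ _ (fun s => RtoC 1 - cexp (hlog (detour n s)))%C _ (term_loop (true, n))).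
  - intros s Hs. rewrite cexp_hlog by now apply detour_kq. ring.
  - easy.
  - apply exp_homotopy.
    + apply (pcont_comp 0 1 (detour n) hlog); [apply detour_pcont|]. intros s Hs.
      apply hlog_hol; [now apply detour_uhp|now apply detour_kq].
    + rewrite detour_0. apply hlog_Ci.
    + rewrite detour_1, hlog_shift, hlog_Ci. ring.
    + intros s Hs. destruct (detour_kq n s Hs) as [A B]. rewrite <- (cexp_hlog _ A), Cmod_cexp in B.
      rewrite <- (ln_exp (fst (hlog (detour n s)))). apply ln_increasing; [apply exp_pos|easy].
Qed.

Lemma hol_sm (t : C) : uhp t -> hol sm t.
Proof. intros H. unfold sm. apply hol_opp, hol_inv; [apply hol_id|now apply uhp_neq_0]. Qed.

Lemma sm_Ci : sm Ci = Ci.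
Proof. unfold sm. apply injective_projections; simpl; field. Qed.

Lemma term_path (t : bool * Z) : exists g, base_path (tmat t) (term_loop t) g.
Proof.
  destruct t as [[] n]; [exists (detour n); apply term_path_true|].
  destruct (term_path_true n) as (A & B & C0 & C1 & D). exists (fun s => sm (detour n s)).
  split; [|split; [|split; [|split]]].
  - apply (pcont_comp 0 1 (detour n) sm); [easy|]. intros s Hs. now apply hol_sm, B.
  - intros s Hs. now apply sm_uhp, B.
  - rewrite C0. apply sm_Ci.
  - rewrite detour_1. symmetry. apply tmat_false_Ci.
  - apply (hom_ext _ _ (fun s => - modF (detour n s))%C _ (fun s => - term_loop (true, n) s)%C).
    + intros s Hs. now rewrite modF_S by now apply B.
    + intros s Hs. now rewrite term_loop_false.
    + now apply hom_opp.
Qed.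

(** The path of the remaining word is translated by the matrix of the first term; invariance of
    [modF] leaves its image unchanged. *)
Lemma word_path (w : word) : exists g, base_path (wmat w) (word_loop w) g.
Proof.
  induction w as [|t w (g2 & A2 & B2 & C2 & D2 & H2)].
  - exists (fun _ => Ci). split; [intros s Hs; apply ctat_const|]. split; [intros; apply Ci_uhp|]. split; [easy|].
    split; [symmetry; apply mob_id|].
    exists (fun _ => RtoC 0). split; [|split; [|split]].
    + intros z Dz. exact (ctat_const dC unit_square (RtoC 0) z).
    + intros p _. split; intros E; apply (f_equal fst) in E; simpl in E; lra.
    + intros s Hs. now rewrite modF_Ci.
    + intros u Hu. now split.
  - destruct (term_path t) as (g1 & A1 & B1 & C1 & D1 & H1).
    assert (GM := Gam_SL2 _ (Gam_tmat t)). assert (GW := Gam_SL2 _ (Gam_wmat w)).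
    exists (fun s => if Rle_dec s (/ 2) then g1 (2 * s) else mob (tmat t) (g2 (2 * s - 1))).
    split; [|split; [|split; [|split]]].
    + apply (pcont_glue g1 (fun s => mob (tmat t) (g2 s))); [easy| |now rewrite D1, C2].
      apply (pcont_comp 0 1 g2 (mob (tmat t))); [easy|]. intros s Hs. apply hol_mob; auto.
    + intros s Hs. unfold seg in *. destruct Rle_dec; [apply B1; unfold seg; lra|].
      apply mob_uhp; [easy|]. apply B2. unfold seg. lra.
    + destruct Rle_dec; [|lra]. now rewrite Rmult_0_r.
    + destruct Rle_dec; [lra|]. replace (2 * 1 - 1) with 1 by ring. rewrite D2. simpl wmat.
      now rewrite mob_mul by (easy || apply Ci_uhp).
    + apply (hom_ext _ _ (fun s => if Rle_dec s (/ 2) then modF (g1 (2 * s)) else modF (g2 (2 * s - 1))) _ (word_loop (t :: w))).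
      * intros s Hs. destruct Rle_dec; [easy|]. rewrite modF_tmat; [easy|]. apply B2. unfold seg. lra.
      * easy.
      * exact (hom_concat (fun s => modF (g1 s)) (fun s => modF (g2 s)) (term_loop t) (word_loop w) H1 H2).
Qed.

(** * The upper bound *)

Lemma clog_cexp (x : C) : 0 < snd x < PI -> uhp (cexp x) /\ clog (cexp x) = x.
Proof.
  intros H. assert (U : uhp (cexp x)).
  { unfold uhp, cexp. simpl. apply Rmult_lt_0_compat; [apply exp_pos|]. apply sin_gt_0; lra. }
  split; [easy|]. assert (E : fst (clog (cexp x)) = fst x) by (simpl fst; rewrite Cmod_cexp; apply ln_exp).
  assert (E2 := cexp_clog (cexp x) U). pose proof (clog_im (cexp x)) as I.
  set (y := clog (cexp x)) in *. apply injective_projections; [easy|].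
  unfold cexp in E2. rewrite E in E2. apply (f_equal fst) in E2. cbn [fst] in E2.
  apply Rmult_eq_reg_l in E2; [|apply Rgt_not_eq, exp_pos].
  destruct (Rtotal_order (snd y) (snd x)) as [L|[L|L]]; [|easy|].
  - assert (cos (snd x) < cos (snd y)) by (apply cos_decreasing_1; lra). lra.
  - assert (cos (snd y) < cos (snd x)) by (apply cos_decreasing_1; lra). lra.
Qed.

Section Strip.
Variable V : mat.
Hypothesis HV : SL2 V.
Hypothesis HN : 2 <= Rabs (Nst V).

Definition pcoord (h : C) : C := clog (ucoord V h).
(** The exponential followed by the inverse of the Moebius map u = (h - rho) / (h + rho). *)
Definition pcoord_inv (x : C) : C := (RtoC (rho V) * (RtoC 1 + cexp x) / (RtoC 1 - cexp x))%C.

Lemma uhp_one_minus (u : C) : uhp u -> (RtoC 1 - u)%C <> RtoC 0.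
Proof. unfold uhp. intros H E. apply (f_equal snd) in E. simpl in E. lra. Qed.

Lemma pcoord_inv_uhp (x : C) : 0 < snd x < PI -> uhp (pcoord_inv x).
Proof.
  intros H. destruct (clog_cexp x H) as [U _]. destruct (rho_sq V HV HN) as [_ R2]. unfold pcoord_inv.
  assert (N := uhp_one_minus _ U). unfold uhp in *. destruct (cexp x) as [a b]. cbn [snd] in U.
  assert (D : 0 < (1 - a) * (1 - a) + b * b).
  { pose proof (Rle_0_sqr (1 - a)) as P. unfold Rsqr in P. nra. }
  replace (RtoC (rho V) * (RtoC 1 + (a, b)) / (RtoC 1 - (a, b)))%C with
    (rho V * (1 - a * a - b * b) / ((1 - a) * (1 - a) + b * b), 2 * rho V * b / ((1 - a) * (1 - a) + b * b)).
  - cbn [snd]. apply Rdiv_lt_0_compat; [|easy]. repeat apply Rmult_lt_0_compat; lra.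
  - apply injective_projections; simpl; field; repeat split; nra.
Qed.

Lemma ucoord_inv (x : C) : 0 < snd x < PI -> ucoord V (pcoord_inv x) = cexp x.
Proof.
  intros H. destruct (clog_cexp x H) as [U _]. destruct (rho_sq V HV HN) as [_ R2]. assert (N := uhp_one_minus _ U).
  assert (Nr : RtoC (rho V) <> RtoC 0) by (apply RtoC_neq_0; lra).
  assert (N2 : RtoC 2 <> RtoC 0) by (apply RtoC_neq_0; lra).
  unfold ucoord, pcoord_inv. set (u := cexp x) in *.
  replace (RtoC (rho V) * (RtoC 1 + u) / (RtoC 1 - u) - RtoC (rho V))%C with (RtoC 2 * RtoC (rho V) * u / (RtoC 1 - u))%C by (field; auto).
  replace (RtoC (rho V) * (RtoC 1 + u) / (RtoC 1 - u) + RtoC (rho V))%C with (RtoC 2 * RtoC (rho V) / (RtoC 1 - u))%C by (field; auto).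
  field. auto.
Qed.

Lemma pcoord_inv_r (x : C) : 0 < snd x < PI -> pcoord (pcoord_inv x) = x.
Proof. intros H. unfold pcoord. rewrite ucoord_inv by easy. now apply clog_cexp. Qed.

Lemma pcoord_inv_l (h : C) : uhp h -> pcoord_inv (pcoord h) = h.
Proof.
  intros H. assert (U := ucoord_uhp V HV HN h H). unfold pcoord, pcoord_inv. rewrite cexp_clog by easy.
  assert (D := ucoord_den V h H). destruct (rho_sq V HV HN) as [_ R2].
  assert (Nr : RtoC (rho V) <> RtoC 0) by (apply RtoC_neq_0; lra).
  assert (N2 : RtoC 2 <> RtoC 0) by (apply RtoC_neq_0; lra).
  unfold ucoord. replace (RtoC 1 + (h - RtoC (rho V)) / (h + RtoC (rho V)))%C with (RtoC 2 * h / (h + RtoC (rho V)))%C by (field; auto).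
  replace (RtoC 1 - (h - RtoC (rho V)) / (h + RtoC (rho V)))%C with (RtoC 2 * RtoC (rho V) / (h + RtoC (rho V)))%C by (field; auto).
  field. auto.
Qed.

Lemma pcoord_inv_hol (x : C) : 0 < snd x < PI -> hol pcoord_inv x.
Proof.
  intros H. destruct (clog_cexp x H) as [U _]. unfold pcoord_inv. apply hol_div.
  - apply hol_mult; [apply hol_const|]. apply hol_plus; [apply hol_const|apply hol_cexp].
  - apply hol_minus; [apply hol_const|apply hol_cexp].
  - now apply uhp_one_minus.
Qed.

Lemma pcoord_hol (h : C) : uhp h -> hol pcoord h.
Proof.
  intros H. apply (hol_comp (ucoord V) clog); [now apply (hol_ucoord V)|]. now apply hol_clog, (ucoord_uhp V HV HN).
Qed.

Lemma ucoord_den_pos (h : C) : uhp h -> 0 < fst h * fst h + snd h * snd h + rho V * rho V + 2 * rho V * fst h.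
Proof. unfold uhp. intros H. assert (0 < snd h * snd h) by nra. assert (0 <= (fst h + rho V) * (fst h + rho V)) by apply Rle_0_sqr. nra. Qed.

Lemma Cmod_ucoord (h : C) : uhp h -> Cmod (ucoord V h) * Cmod (ucoord V h) = exp (2 * fst (pcoord h)).
Proof.
  intros H. assert (U := ucoord_uhp V HV HN h H). unfold pcoord.
  rewrite <- (cexp_clog _ U) at 1 2. rewrite !Cmod_cexp, <- exp_plus. f_equal. ring.
Qed.

Lemma pcoord_0 (h : C) : uhp h -> fst (pcoord h) = 0 -> fst h = 0.
Proof.
  intros H E. assert (S := ucoord_sq V h H). rewrite Cmod_ucoord, E, Rmult_0_r, exp_0 in S by easy.
  pose proof (ucoord_den_pos h H) as D. destruct (rho_sq V HV HN) as [_ R2].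
  set (A := fst h * fst h + snd h * snd h + rho V * rho V) in *.
  assert (S2 : A - 2 * rho V * fst h = A + 2 * rho V * fst h).
  { transitivity ((A - 2 * rho V * fst h) / (A + 2 * rho V * fst h) * (A + 2 * rho V * fst h)); [field; lra|]. rewrite <- S. ring. }
  assert (S3 : rho V * fst h = 0) by lra. destruct (Rmult_integral _ _ S3); lra.
Qed.

Lemma pcoord_gdist (h : C) : uhp h -> fst (pcoord h) = gdist V -> Cmod (mob (minv V) h) = 1.
Proof.
  intros H E. apply (VJ_circle V HV h H). assert (S := ucoord_sq V h H). rewrite Cmod_ucoord, E in S by easy.
  destruct (kap_alt V HV HN) as [K0 _]. assert (EK : exp (2 * gdist V) = kap V).
  { unfold gdist. replace (2 * (ln (kap V) / 2)) with (ln (kap V)) by field. now apply exp_ln. }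
  rewrite EK in S. pose proof (ucoord_den_pos h H) as D. destruct (rho_sq V HV HN) as [R1 R2]. assert (NA := alpha_neq_0 V HV HN).
  unfold kap in S, K0. set (A := fst h * fst h + snd h * snd h + rho V * rho V) in *. set (c := Nst V / alpha V) in *.
  assert (Nc : c + rho V <> 0).
  { intros Z. rewrite Z in K0. unfold Rdiv in K0. rewrite Rinv_0, Rmult_0_r in K0. lra. }
  assert (S2 : (c - rho V) * (A + 2 * rho V * fst h) = (A - 2 * rho V * fst h) * (c + rho V)).
  { apply (Rmult_eq_compat_r ((c + rho V) * (A + 2 * rho V * fst h))) in S.
    transitivity ((c - rho V) / (c + rho V) * ((c + rho V) * (A + 2 * rho V * fst h))); [field; easy|]. rewrite S. field. lra. }
  assert (S3 : rho V * (A - 2 * c * fst h) = 0) by lra. destruct (Rmult_integral _ _ S3) as [Z|Z]; [lra|].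
  unfold A in Z. rewrite R1 in Z.
  transitivity (alpha V * (fst h * fst h + snd h * snd h + beta V / alpha V - 2 * c * fst h)); [unfold c; field; easy|].
  rewrite Z. ring.
Qed.

(* Homotopies are straight lines in the coordinate [pcoord], whose range, a strip, is convex. *)
Lemma strip_rectangle (e0 e1 : R) (E0 E1 : C -> Prop) (w : word) (g : R -> C) : e0 <> e1 ->
  (forall h, uhp h -> fst (pcoord h) = e0 -> E0 (modF h)) -> (forall h, uhp h -> fst (pcoord h) = e1 -> E1 (modF h)) ->
  pcont 0 1 g -> (forall s, seg 0 1 s -> uhp (g s)) -> fst (pcoord (g 0)) = e0 -> fst (pcoord (g 1)) = e1 ->
  homotopic_rel E0 E1 (fun s => modF (g s)) (word_loop w) ->
  exists x0 x1 y0 y1 f, x0 < x1 /\ y0 < y1 /\ holo_represents (HClass E0 E1 (word_loop w)) x0 x1 y0 y1 f /\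
    (y1 - y0) / (x1 - x0) = Rabs (e1 - e0) / 2.
Proof.
  intros Ne HE0 HE1 Cg Ug G0 G1 Hom. assert (PD : 0 < Rabs (e1 - e0)) by (apply Rabs_pos_lt; lra).
  (* Half the width of the source rectangle, chosen so that its image under [zeta] has height 2. *)
  set (m := / Rabs (e1 - e0)). assert (Hm : 0 < m) by now apply Rinv_0_lt_compat.
  assert (Em : Rabs (e1 - e0) * m = 1) by (apply Rinv_r; lra).
  (* A quarter turn with a scaling by |e1 - e0|: the horizontal sides go to the vertical lines over
     e0 and e1, and the imaginary part stays within 1 < PI / 2 of the middle of the strip. *)
  set (zeta := fun z : C => (RtoC e0 + RtoC (PI / 2) * Ci - RtoC (e1 - e0) * Ci * z)%C).
  assert (Zf : forall z, fst (zeta z) = e0 + (e1 - e0) * snd z) by (intros z; unfold zeta; simpl; ring).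
  assert (Zs : forall z, snd (zeta z) = PI / 2 - (e1 - e0) * fst z) by (intros z; unfold zeta; simpl; ring).
  assert (ZS : forall z : C, - m <= fst z <= m -> 0 < snd (zeta z) < PI).
  { intros z Hz. rewrite Zs. pose proof PI2_3_2. assert (B : Rabs ((e1 - e0) * fst z) <= 1).
    { rewrite Rabs_mult, <- Em. apply Rmult_le_compat_l; [lra|]. apply Rabs_le. lra. }
    apply Rabs_le_between in B. lra. }
  assert (Zh : forall z, hol zeta z).
  { intros z. unfold zeta. apply hol_minus; [apply hol_const|]. apply hol_mult; [apply hol_const|apply hol_id]. }
  set (f := fun z => modF (pcoord_inv (zeta z))).
  assert (Hf : forall z : C, - m <= fst z <= m -> hol f z).
  { intros z Hz. apply (hol_comp (fun z => pcoord_inv (zeta z)) modF).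
    - apply (hol_comp zeta pcoord_inv); [apply Zh|]. now apply pcoord_inv_hol, ZS.
    - now apply modF_hol, pcoord_inv_uhp, ZS. }
  assert (Xf : forall z : C, - m <= fst z <= m -> Xdom (f z)) by (intros z Hz; now apply modF_Xdom, pcoord_inv_uhp, ZS).
  exists (- m), m, 0, 1, f. split; [lra|]. split; [lra|]. split.
  2:{ replace ((1 - 0) / (m - - m)) with (/ m / 2) by (field; lra). unfold m. now rewrite Rinv_inv. }
  assert (In : forall x y : R, - m < x < m -> 0 < snd (zeta (x, y)) < PI) by (intros x y Hx; apply ZS; simpl; lra).
  split; [|split; [|split; [|split; [|split]]]].
  - intros z [Hz _]. apply hol_iff. apply Hf. lra.
  - intros z [Hz _]. apply Xf. lra.
  - intros z [Hz _]. exact (ctat_subset dC _ _ f z (hol_ct f z (Hf z Hz)) (fun _ _ => I)).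
  - intros x Hx. apply HE0; [now apply pcoord_inv_uhp, In|]. rewrite pcoord_inv_r by now apply In. rewrite Zf. simpl. ring.
  - intros x Hx. apply HE1; [now apply pcoord_inv_uhp, In|]. rewrite pcoord_inv_r by now apply In. rewrite Zf. simpl. ring.
  - intros x Hx. unfold in_class. cbn [hc_E1 hc_E2 hc_ref]. apply (hom_trans _ _ _ (fun s => modF (g s))); [|easy].
    set (l := fun s => pcoord (g s)).
    assert (Ls : forall s, 0 < snd (l s) < PI) by (intros s; apply clog_im).
    (* Both curves have their endpoints on the lines over e0 and e1, so the linear interpolation
       keeps them there. *)
    set (K := fun p : C => ((RtoC 1 - RtoC (fst p)) * zeta (RtoC x + Ci * RtoC (snd p)) + RtoC (fst p) * l (snd p))%C).
    assert (Zx : forall s : R, (RtoC x + Ci * RtoC s)%C = (x, s)) by (intros s; Ceq).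
    assert (KS : forall p, unit_square p -> 0 < snd (K p) < PI).
    { intros p [Hp _]. unfold K. rewrite Zx. specialize (In x (snd p) Hx). specialize (Ls (snd p)).
      cbn [fst snd Cmult Cplus Cminus Copp RtoC]. 
      replace ((1 + - fst p) * snd (zeta (x, snd p)) + (0 + - 0) * fst (zeta (x, snd p)) + (fst p * snd (l (snd p)) + 0 * fst (l (snd p))))
        with ((1 - fst p) * snd (zeta (x, snd p)) + fst p * snd (l (snd p))) by ring.
      set (A := snd (zeta (x, snd p))) in *. set (B := snd (l (snd p))) in *. 
      assert (0 <= (1 - fst p) * A) by (apply Rmult_le_pos; lra). assert (0 <= fst p * B) by (apply Rmult_le_pos; lra).
      assert (0 <= (1 - fst p) * (PI - A)) by (apply Rmult_le_pos; lra). assert (0 <= fst p * (PI - B)) by (apply Rmult_le_pos; lra).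
      destruct (Rle_dec (fst p) (/ 2)); split; nra. }
    assert (K0 : forall u, 0 <= u <= 1 -> fst (K (u, 0)) = e0).
    { intros u Hu. unfold K. rewrite Zx. cbn [fst snd Cmult Cplus Cminus Copp RtoC]. rewrite Zf. unfold l. rewrite G0. cbn [snd]. ring. }
    assert (K1 : forall u, 0 <= u <= 1 -> fst (K (u, 1)) = e1).
    { intros u Hu. unfold K. rewrite Zx. cbn [fst snd Cmult Cplus Cminus Copp RtoC]. rewrite Zf. unfold l. rewrite G1. cbn [snd]. ring. }
    exists (fun p => modF (pcoord_inv (K p))). split; [|split; [|split]].
    + intros p Hp. 
      assert (CK : ctat dC unit_square K p).
      { unfold K. apply ctat_plus.
        - apply ctat_mult; [apply ctat_minus; [apply ctat_const|apply ctat_fst]|].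
          apply (ctat_comp_T dC unit_square (fun p => RtoC x + Ci * RtoC (snd p))%C zeta); [|apply hol_ct, Zh].
          apply ctat_plus; [apply ctat_const|]. apply ctat_mult; [apply ctat_const|apply ctat_snd].
        - apply ctat_mult; [apply ctat_fst|]. apply (ctat_path l); [|easy].
          apply (pcont_comp 0 1 g pcoord); [easy|]. intros s Hs. now apply pcoord_hol, Ug. }
      apply (ctat_comp_T dC unit_square (fun p => pcoord_inv (K p)) modF).
      * apply (ctat_comp_T dC unit_square K pcoord_inv); [easy|]. now apply hol_ct, pcoord_inv_hol, KS.
      * now apply hol_ct, modF_hol, pcoord_inv_uhp, KS.
    + intros p Hp. now apply modF_Xdom, pcoord_inv_uhp, KS.
    + intros s Hs. split.
      * unfold f. do 2 f_equal. unfold K. rewrite Zx. cbn [fst snd].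
        replace (0 + s * (1 - 0)) with s by ring. ring.
      * f_equal. unfold K. cbn [fst snd]. rewrite <- (pcoord_inv_l (g s)) at 1 by now apply Ug. f_equal. fold (l s). ring.
    + intros u Hu. assert (P0 : unit_square (u, 0)) by (split; simpl; lra). assert (P1 : unit_square (u, 1)) by (split; simpl; lra).
      split; [apply HE0|apply HE1]; try (now apply pcoord_inv_uhp, KS); (rewrite pcoord_inv_r by now apply KS); auto.
Qed.
End Strip.

Lemma Lambda_le (h : hclass) (x0 x1 y0 y1 : R) (f : C -> C) : x0 < x1 -> y0 < y1 -> holo_represents h x0 x1 y0 y1 f ->
  Rbar_le (Lambda h) (Finite ((y1 - y0) / (x1 - x0))).
Proof.
  intros Hx Hy H. unfold Lambda. apply (proj1 (Glb_Rbar_correct _)). exists x0, x1, y0, y1, f. auto.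
Qed.

Lemma at_0_tr (z : C) : at_0 z -> E_tr z.
Proof. intros ->. split; simpl; lra. Qed.

Lemma at_0_pb (z : C) : at_0 z -> E_pb z.
Proof. now intros ->. Qed.

(** For the empty word L = 0, and the constant map 0 is admissible on arbitrarily flat
    rectangles. *)
Lemma Lambda_constant (E1 E2 : C -> Prop) : E1 (RtoC 0) -> E2 (RtoC 0) ->
  Rbar_le (Lambda (HClass E1 E2 (word_loop []))) (Finite (300 * Lw [])).
Proof.
  intros H1 H2. replace (300 * Lw []) with 0 by (unfold Lw; simpl; ring).
  assert (X0 : Xdom (RtoC 0)) by (split; intros E; apply (f_equal fst) in E; simpl in E; lra).
  assert (P : forall e, 0 < e -> Rbar_le (Lambda (HClass E1 E2 (word_loop []))) (Finite e)).
  { intros e He. replace e with ((e - 0) / (1 - 0)) by field.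
    apply (Lambda_le _ 0 1 0 e (fun _ => RtoC 0)); [lra|easy|].
    split; [|split; [|split; [|split; [|split]]]]; try easy.
    - intros z _. apply hol_iff, hol_const.
    - intros z Dz. exact (ctat_const dC (fun z : C => 0 <= fst z <= 1 /\ 0 <= snd z <= e) (RtoC 0) z).
    - intros x Hx. exists (fun _ => RtoC 0). split; [|split; [|split]]; try easy.
      intros z Dz. exact (ctat_const dC unit_square (RtoC 0) z). }
  destruct (Lambda (HClass E1 E2 (word_loop []))) as [r| |]; simpl in *.
  - apply Rnot_lt_le. intros N. specialize (P (r / 2) ltac:(lra)). lra.
  - apply (P 1). lra.
  - easy.
Qed.

Lemma mob_minv_r (M : mat) (h : C) : SL2 M -> uhp h -> mob M (mob (minv M) h) = h.
Proof.
  intros H Hh. assert (E := mob_inv_l (minv M) h (SL2_inv M H) Hh).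
  replace (minv (minv M)) with M in E; [easy|]. unfold minv. destruct M as [p q r s]. cbn [mp mq mr ms]. f_equal; ring.
Qed.

Lemma gdist_neq_0 (V : mat) : SL2 V -> 2 <= Rabs (Nst V) -> gdist V <> 0.
Proof.
  intros HV HN E. destruct (gdist_bounds V HV HN) as [B _]. rewrite E, Rabs_R0 in B.
  assert (0 < ln (Rabs (Nst V))); [|lra]. rewrite <- ln_1. apply ln_increasing; lra.
Qed.

Section Core.
Variable v : word.
Hypothesis HN : 2 <= Rabs (Nst (wmat v)).
Let V := wmat v.
Let HV : SL2 V := Gam_SL2 _ (Gam_wmat v).

Lemma pcoord_tr (h : C) : uhp h -> fst (pcoord V h) = 0 -> E_tr (modF h).
Proof. intros H E. apply modF_I; [easy|]. now apply (pcoord_0 V HV HN). Qed.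

Lemma pcoord_pb (h : C) : uhp h -> fst (pcoord V h) = gdist V -> E_pb (modF h).
Proof.
  intros H E. rewrite <- (mob_minv_r V h HV H). unfold V. 
  assert (U : uhp (mob (minv V) h)) by (apply mob_uhp; [now apply SL2_inv|easy]).
  rewrite modF_wmat by easy. apply modF_unit; [easy|]. now apply (pcoord_gdist V HV HN).
Qed.

Lemma pcoord_Ci : fst (pcoord V Ci) = 0.
Proof. now apply (ucoord_I V HV HN Ci Ci_uhp). Qed.

Lemma pcoord_V_Ci : fst (pcoord V (mob V Ci)) = gdist V.
Proof.
  apply (ucoord_VJ V HV HN).
  - apply mob_uhp; [apply HV|apply Ci_uhp].
  - rewrite mob_inv_l by (apply HV || apply Ci_uhp). apply Cmod_Ci.
Qed.
End Core.

(** Half the distance is at most ln (2 |N|) / 2, hence at most 5 L / 2. *)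
Lemma upper_from_ln (V : mat) (L x : R) : SL2 V -> 2 <= Rabs (Nst V) -> ln (2 * Rabs (Nst V)) <= 5 * L -> x = Rabs (gdist V) / 2 -> x <= 300 * L.
Proof.
  intros HV HN HL ->. destruct (gdist_bounds V HV HN) as [_ B]. pose proof (Rabs_pos (gdist V)). lra.
Qed.

Lemma upper_tr_pb (w : word) : reduced w -> Rbar_le (Lambda (tr_pb w)) (Finite (300 * Lw w)).
Proof.
  intros Hw. destruct w as [|t r]; [apply Lambda_constant; [now apply at_0_tr|now apply at_0_pb]|].
  set (w := t :: r) in *. destruct (word_bounds w Hw ltac:(easy)) as (B1 & _ & B2).
  assert (HV : SL2 (wmat w)) by apply Gam_SL2, Gam_wmat.
  destruct (word_path w) as (g & A & B & C0 & C1 & D).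
  destruct (strip_rectangle (wmat w) HV B1 0 (gdist (wmat w)) E_tr E_pb w g) as (x0 & x1 & y0 & y1 & f & Hx & Hy & Hf & E).
  - apply not_eq_sym. now apply gdist_neq_0.
  - now apply pcoord_tr.
  - now apply pcoord_pb.
  - easy.
  - easy.
  - rewrite C0. now apply pcoord_Ci.
  - rewrite C1. now apply pcoord_V_Ci.
  - exact (hom_weaken at_0 at_0 E_tr E_pb _ _ at_0_tr at_0_pb D).
  - eapply Rbar_le_trans; [exact (Lambda_le _ x0 x1 y0 y1 f Hx Hy Hf)|]. simpl.
    apply (upper_from_ln (wmat w)); auto. rewrite E. now rewrite Rminus_0_r.
Qed.

(** The path from i to W i is moved by V = W^(-1), the matrix of the inverse word. It then leads
    from V i on [V J] to i on I, and its image under [modF] is unchanged. *)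
Lemma upper_pb_tr (w : word) : reduced w -> Rbar_le (Lambda (pb_tr w)) (Finite (300 * Lw w)).
Proof.
  intros Hw. destruct w as [|t r]; [apply Lambda_constant; [now apply at_0_pb|now apply at_0_tr]|].
  set (w := t :: r) in *. destruct (word_bounds (winv w) (reduced_winv w Hw) (winv_nil w ltac:(easy))) as (B1 & _ & B2).
  rewrite Lw_winv in B2. 
  assert (HV : SL2 (wmat (winv w))) by apply Gam_SL2, Gam_wmat. assert (HW : SL2 (wmat w)) by apply Gam_SL2, Gam_wmat.
  destruct (word_path w) as (g & A & B & C0 & C1 & D). set (V := wmat (winv w)) in *.
  destruct (strip_rectangle V HV B1 (gdist V) 0 E_pb E_tr w (fun s => mob V (g s))) as (x0 & x1 & y0 & y1 & f & Hx & Hy & Hf & E).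
  - now apply gdist_neq_0.
  - now apply pcoord_pb.
  - now apply pcoord_tr.
  - apply (pcont_comp 0 1 g (mob V)); [easy|]. intros s Hs. apply hol_mob; auto.
  - intros s Hs. apply mob_uhp; auto.
  - rewrite C0. now apply pcoord_V_Ci.
  - rewrite C1. unfold V. rewrite wmat_winv, mob_inv_l by (apply HW || apply Ci_uhp). rewrite <- wmat_winv. now apply pcoord_Ci.
  - apply (hom_ext _ _ (fun s => modF (g s)) _ (word_loop w)).
    + intros s Hs. symmetry. apply modF_wmat. now apply B.
    + easy.
    + exact (hom_weaken at_0 at_0 E_pb E_tr _ _ at_0_pb at_0_tr D).
  - eapply Rbar_le_trans; [exact (Lambda_le _ x0 x1 y0 y1 f Hx Hy Hf)|]. simpl.
    apply (upper_from_ln V); auto. rewrite E. rewrite Rminus_0_l, Rabs_Ropp. easy.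
Qed.

Theorem theorem1 (w : word) : reduced w ->
  Rbar_le (Finite (Lw w / (2 * PI))) (Lambda (tr_pb w)) /\
  Rbar_le (Lambda (tr_pb w)) (Finite (300 * Lw w)) /\
  Rbar_le (Finite (Lw w / (2 * PI))) (Lambda (pb_tr w)) /\
  Rbar_le (Lambda (pb_tr w)) (Finite (300 * Lw w)).
Proof.
  intros H. destruct (lower_bound w H) as [L1 L2].
  split; [easy|]. split; [now apply upper_tr_pb|]. split; [easy|now apply upper_pb_tr].
Qed.
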